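(* Let $1<p<\infty$, $p'=\frac p{p-1}$, $\omega\in\widehat{\mathcal{D}}$, and let $g\in H^\infty$ with $\widehat g(n)\ge0$ for all $n\in\mathbb N\cup\{0\}$. Then the following are equivalent: $T_g:D^p_\omega\to H^\infty$ is bounded; $T_g:D^p_\omega\to H^\infty$ is compact; $$\sum_{k=0}^\infty\frac{(k+1)^{-2}}{(\omega_k)^{p'-1}}\left(\sum_{n=0}^\infty\frac{(n+1)\widehat g(n+1)}{n+k+1}\right)^{p'}<\infty.$$ Moreover, $$\|T_g\|^{p'}_{D^p_\omega\to H^\infty}\asymp\sum_{k=0}^\infty\frac{(k+1)^{-2}}{(\omega_k)^{p'-1}}\left(\sum_{n=0}^\infty\frac{(n+1)\widehat g(n+1)}{n+k+1}\right)^{p'}.$$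
   Context: $\mathbb{D}$ is the open unit disc, $\mathcal{H}(\mathbb{D})$ the analytic functions on it, $dA(z)=\frac{dx\,dy}{\pi}$. A radial weight is a non-negative $\omega\in L^1([0,1))$ extended by $\omega(z)=\omega(|z|)$; always assume $\widehat\omega(r)=\int_r^1\omega(s)\,ds>0$ for all $0\le r<1$. $\omega\in\widehat{\mathcal{D}}$ means there is $C\ge1$ with $\widehat\omega(r)\le C\widehat\omega(\frac{1+r}{2})$ for all $0\le r<1$. Moments: $\omega_x=\int_0^1 r^x\omega(r)\,dr$. $D^p_\omega$ consists of $f\in\mathcal H(\mathbb D)$ with $\|f\|_{D^p_\omega}^p=\int_{\mathbb D}|f'|^p\omega\,dA+|f(0)|^p<\infty$. $g(z)=\sum_{n\ge0}\widehat g(n)z^n$. $T_g(f)(z)=\int_0^z f(\zeta)g'(\zeta)\,d\zeta$. $a\asymp b$ means comparability with constants independent of $g$. *)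

(* Defs.v *)
From HB Require Import structures.
From mathcomp Require Import all_boot all_order all_algebra.
From mathcomp Require Import all_classical all_reals all_analysis.
From mathcomp Require Import complex.
Set Implicit Arguments. Unset Strict Implicit. Unset Printing Implicit Defensive.
Import Order.TTheory GRing.Theory Num.Theory.
Import numFieldNormedType.Exports.
Local Open Scope classical_set_scope.
Local Open Scope ring_scope.

(* The complex plane, seen as a numClosedFieldType so that it carries its
   normed (module over itself) structure: derivability over CC R is complex
   differentiability. *)
Definition CC (R : realType) : numClosedFieldType := R[i].

Section Defs.
Variable R : realType.
Local Notation C := (CC R).

Definition cmod (z : C) : R := Num.sqrt (complex.Re z ^+ 2 + complex.Im z ^+ 2).

Definition disc : set C := [set z | cmod z < 1].

Definition holo (f : C -> C) : Prop := forall z, disc z -> derivable f z 1.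

Definition coef (g : C -> C) (n : nat) : C := derive1n n g 0 / (n`!)%:R.

Definition supnorm (h : C -> C) : \bar R :=
  ereal_sup [set (cmod (h z))%:E | z in disc].

Definition Hinf (h : C -> C) : Prop := holo h /\ (supnorm h < +oo)%E.

Definition leb := @lebesgue_measure R.
Definition area := (leb \x leb)%E.

Definition omega_hat (w : R -> R) (r : R) : \bar R :=
  (\int[leb]_(s in `[r, 1%R[) (w s)%:E)%E.

Definition radial_weight (w : R -> R) : Prop :=
  [/\ (forall r, 0 <= r < 1 -> 0 <= w r),
      leb.-integrable `[0%R, 1%R[ (fun s => (w s)%:E) &
      (forall r, 0 <= r < 1 -> (0 < omega_hat w r)%E)].

Definition Dhat (w : R -> R) : Prop :=
  exists C0 : R, 1 <= C0 /\
    forall r, 0 <= r < 1 -> (omega_hat w r <= C0%:E * omega_hat w ((1 + r) / 2))%E.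

Definition moment (w : R -> R) (k : nat) : \bar R :=
  (\int[leb]_(r in `[0%R, 1%R[) (r ^+ k * w r)%:E)%E.

(* ||f||_{D^p_omega}^p = int_D |f'|^p omega dA + |f(0)|^p,
   with dA = dx dy / pi, and omega(z) = omega(|z|) *)
Definition area_integrand (p : R) (w : R -> R) (f : C -> C) (xy : R * R) : R :=
  (cmod (derive1 f ((xy.1 +i* xy.2)%C : C))) `^ p
    * w (Num.sqrt (xy.1 ^+ 2 + xy.2 ^+ 2)).

Definition unit_disc2 : set (R * R) := [set xy | xy.1 ^+ 2 + xy.2 ^+ 2 < 1].

Definition Dnorm_p (p : R) (w : R -> R) (f : C -> C) : \bar R :=
  ((pi^-1)%:E * \int[area]_(xy in unit_disc2) (area_integrand p w f xy)%:E
   + ((cmod (f 0)) `^ p)%:E)%E.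

Definition Dnorm (p : R) (w : R -> R) (f : C -> C) : \bar R :=
  (Dnorm_p p w f `^ p^-1)%E.

Definition Dp (p : R) (w : R -> R) (f : C -> C) : Prop :=
  holo f /\ (Dnorm_p p w f < +oo)%E.

Definition cint01 (h : R -> C) : C :=
  ((Rintegral leb `[0%R, 1%R] (fun t => complex.Re (h t)))
   +i* (Rintegral leb `[0%R, 1%R] (fun t => complex.Im (h t))))%C.

(* T_g f (z) = int_0^z f(zeta) g'(zeta) d zeta, along the segment [0, z] *)
Definition Tg (g f : C -> C) (z : C) : C :=
  z * cint01 (fun t : R => f ((t%:C)%C * z) * derive1 g ((t%:C)%C * z)).

Definition Tg_bounded (p : R) (w : R -> R) (g : C -> C) : Prop :=
  (forall f, Dp p w f -> Hinf (Tg g f)) /\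
  exists K : R, forall f, Dp p w f -> (supnorm (Tg g f) <= K%:E * Dnorm p w f)%E.

Definition Tg_compact (p : R) (w : R -> R) (g : C -> C) : Prop :=
  (forall f, Dp p w f -> Hinf (Tg g f)) /\
  forall u : nat -> C -> C,
    (forall n, Dp p w (u n) /\ (Dnorm p w (u n) <= 1)%E) ->
    exists (phi : nat -> nat) (h : C -> C),
      (forall n, (phi n < phi n.+1)%N) /\ Hinf h /\
      (fun n => supnorm (fun z => Tg g (u (phi n)) z - h z)) @ \oo --> 0%E.

Definition Tg_norm (p : R) (w : R -> R) (g : C -> C) : \bar R :=
  ereal_sup [set supnorm (Tg g f) | f in [set f | Dp p w f /\ (Dnorm p w f <= 1)%E]].

Definition inner_sum (g : C -> C) (k : nat) : \bar R :=
  (\sum_(0 <= n <oo)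
     ((n.+1)%:R * complex.Re (coef g n.+1) / (n + k + 1)%:R)%:E)%E.

Definition Sg (p : R) (w : R -> R) (g : C -> C) : \bar R :=
  let p' := p / (p - 1) in
  (\sum_(0 <= k <oo)
     (((k.+1)%:R ^- 2 / (fine (moment w k)) `^ (p' - 1))%:E
        * (inner_sum g k) `^ p'))%E.

End Defs.

(* Main.v *)
(* Write I_k for the k-th inner sum, w_k for the k-th moment, and let hat w be the tail integral of w.
   The doubling condition makes w_k comparable both with hat w (1 - 1/(k+1)) and, for a large fixed M,
   with the integral of w(r) (1 + k (1 - r))^-M.

   Upper bound.  Integration by parts on the radius ending at z = r eta gives
     T_g f (z) = f(0) (g(z) - g(0)) + int_0^r f'(t eta) eta (g(r eta) - g(t eta)) dt.
   As the coefficients of g are nonnegative, |g(r eta) - g(t eta)| <= 2 I_k for t >= 1 - 1/(k+1).  Split the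
   integral at the points 1 - 1/(k+1) and apply Hoelder's inequality with the weight hat w; by Fubini and the
   Fejer-Riesz inequality on each circle, int_0^1 |f'(t eta)|^p hat w(t) dt is at most a constant times
   the norm of f to the power p.

   Lower bound.  Test on f(z) = sum_(k < N) a_k (1 + k (1 - z))^-M, where
   (k + 1)^2 a_k is proportional to w_k^(1-p') I_k^(p'-1).  On each circle |f'| is at most a Hilbert transform of
   a step function, which controls the norm of f; and T_g f at the points of [0, 1) near 1 is at least
   a constant times sum_(k < N) a_k I_k.

   Compactness.  In the upper bound, what comes from the radii beyond 1 - 1/(K+1) involves only the tail from K on of
   the series, and the rest is controlled by f(0) and by |f'| on the disc |z| <= 1 - 1/(K+1), where
   the unit ball is a normal family.

   Fejer-Riesz follows in turn from Hilbert's inequality and Cauchy's formula on the unit circle, which is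
   parametrised by the four arcs i^k (1 + i u) / sqrt(1 + u^2), -1 <= u <= 1. *)
Require Import Defs.
From HB Require Import structures.
From mathcomp Require Import all_boot all_order all_algebra.
From mathcomp Require Import all_classical all_reals all_analysis.
From mathcomp Require Import measurable_realfun complex.
From mathcomp Require Import ring lra.
Import Order.TTheory GRing.Theory Num.Theory.
Import numFieldNormedType.Exports.
Local Open Scope classical_set_scope.
Local Open Scope ring_scope.

(** Powers z^k would match the moments but not the norm: |z^k| is constant on circles. The bump (1 +
    k (1 - z))^-M also decays along the circle, where its derivative is controlled by k / (1 + k
    |u|); integrating the Hilbert kernel 1 / (v + |u|) against a step function in v yields such
    quotients. The exponent M has to beat the doubling constant for the radial decay to reproduce
    the moment. The tail hat w enters because Fejer-Riesz on the circle of radius s controls the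
    whole segment [0, s]; integration against w(s) ds then collects, at each t, the mass of w beyond
    t. The node 1 - 1/(k+1) is the radius beyond which s^k stays bounded below, and the block
    between successive nodes has length about (k+1)^-2, the factor in the series. Hoelder's
    inequality on the blocks and its equality case thus lead to the same sum, without any
    description of a dual space. The tangent of the angle as parameter makes all derivatives along
    the circle algebraic and reduces polar coordinates to affine substitutions. *)

Section integral_basics.
Context d (T : measurableType d) (R : realType) (mu : {measure set T -> \bar R}).

(** The integral of a nonnegative function is a supremum over the simple functions below it, and a
    simple function below f is also below g; hence no measurability is involved. *)
Lemma ge0_le_integral_nomeas (D : set T) (f g : T -> \bar R) :
  (forall x, D x -> 0 <= f x)%E -> (forall x, D x -> f x <= g x)%E ->
  (\int[mu]_(x in D) f x <= \int[mu]_(x in D) g x)%E.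
Proof.
move=> f0 fg.
have g0 x : D x -> (0 <= g x)%E by move=> Dx; exact: le_trans (f0 _ Dx) (fg _ Dx).
rewrite (integral_mkcond D f) (integral_mkcond D g) !ge0_integralTE.
- apply: ge_ereal_sup => _ /= [h hf <-]; apply: ereal_sup_ubound; exists h => // x.
  apply: le_trans (hf x) _; rewrite !patchE; case: ifPn => // /set_mem; exact: fg.
- by move=> x; rewrite patchE; case: ifPn => // /set_mem; exact: g0.
- by move=> x; rewrite patchE; case: ifPn => // /set_mem; exact: f0.
Qed.

Lemma ge0_integral_le_subset (D E : set T) (f : T -> \bar R) :
  (forall x, E x -> 0 <= f x)%E -> D `<=` E ->
  (\int[mu]_(x in D) f x <= \int[mu]_(x in E) f x)%E.
Proof.
move=> f0 DE; rewrite integral_mkcond (integral_mkcond E).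
apply: ge0_le_integral_nomeas => x _; rewrite !patchE.
  by case: ifPn => // /set_mem /DE; exact: f0.
case: ifPn => [/set_mem/DE xE|_]; first by rewrite mem_set.
by case: ifPn => // /set_mem; exact: f0.
Qed.

End integral_basics.

(** * Polar coordinates *)

Section affine.
Context {R : realType}.
Local Notation mu := (@lebesgue_measure R).

(** By uniqueness of Lebesgue measure it is enough that |a| times the pushforward gives half-open
    intervals their length. For a < 0 the preimage is half-open on the other side, with the same
    length. *)
Lemma lebesgue_measure_affine (a b : R) (A : set R) : a != 0 -> measurable A ->
  pushforward mu (fun x : R => (a * x + b : measurableTypeR R)) A = ((`|a|^-1)%:E * mu A)%E.
Proof.
move=> a0 mA.
have mphi : measurable_fun setT (fun x : R => (a * x + b : measurableTypeR R)).
  by apply: measurable_funD => //.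
have na : 0 < `|a| by rewrite normr_gt0.
pose nu := mscale (NngNum (normr_ge0 a)) (measure_function_pushforward__canonical__measure_function_Measure mu mphi).
have H : mu A = nu A.
  apply: lebesgue_measure_unique => //= _ [[c e]] _ <-.
  rewrite /nu /mscale /= /pushforward.
  have [ce|ec] := ltP c e; last first.
    rewrite set_itv_ge ?measure0 ?preimage_set0 ?measure0 ?mule0//.
    by rewrite bnd_simp -leNgt.
  rewrite lebesgue_measure_itv/= lte_fin ce.
  have [pa|ha] := ltP 0 a.
    rewrite (_ : _ @^-1` _ = `]((c - b) / a), ((e - b) / a)]%classic); last first.
      apply/seteqP; split => x /=; rewrite !in_itv/= ltr_pdivrMr// ler_pdivlMr// => /andP[h1 h2];
        apply/andP; split; lra.
    rewrite lebesgue_measure_itv/= lte_fin ltr_pM2r ?invr_gt0// ltrD2r ce -!EFinB -EFinM.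
    by rewrite gtr0_norm//; congr EFin; field.
  have {}ha : a < 0 by rewrite lt_neqAle a0.
  rewrite (_ : _ @^-1` _ = `[((e - b) / a), ((c - b) / a)[%classic); last first.
    apply/seteqP; split => x /=; rewrite !in_itv/= ltr_ndivlMr// ler_ndivrMr// => /andP[h1 h2];
      apply/andP; split; lra.
  rewrite lebesgue_measure_itv/= lte_fin ltr_nM2r ?invr_lt0// ltrD2r ce -!EFinB -EFinM.
  by rewrite ltr0_norm//; congr EFin; field.
rewrite H /nu /mscale /= muleA -EFinM mulVf ?mul1e// gt_eqF//.
Qed.

Lemma ge0_integral_affine (a b : R) (h : R -> \bar R) : a != 0 ->
  measurable_fun [set: R] h -> (forall x, 0 <= h x)%E ->
  (\int[mu]_x h x = `|a|%:E * \int[mu]_x h (a * (x : R) + b)%R)%E.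
Proof.
move=> a0 mh h0.
have mphi : measurable_fun setT (fun x : R => (a * x + b : measurableTypeR R)).
  by apply: measurable_funD => //.
have na : 0 < `|a| by rewrite normr_gt0.
have := @ge0_integral_pushforward _ _ (measurableTypeR R) (measurableTypeR R) R _ mphi mu setT h measurableT mh (fun x _ => h0 x).
rewrite preimage_setT => <-.
have -> : (\int[pushforward mu (fun x : R => (a * x + b)%R : measurableTypeR R)]_y h y =
    \int[mscale (NngNum (ltW (etrans (invr_gt0 `|a|) na))) mu]_y h y)%E.
  by apply: eq_measure_integral => A mA _; exact: lebesgue_measure_affine.
rewrite ge0_integral_mscale//= muleA -EFinM mulfV ?mul1e// gt_eqF//.
Qed.

Lemma area_tonelli1 (h : R * R -> \bar R) : measurable_fun [set: R * R] h ->
  (forall z, 0 <= h z)%E ->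
  (\int[@area R]_z h z = \int[mu]_x \int[mu]_y h (x, y))%E.
Proof. by move=> mh h0; exact: (@fubini_tonelli1 _ _ _ _ _ mu mu h). Qed.

Lemma area_tonelli2 (h : R * R -> \bar R) : measurable_fun [set: R * R] h ->
  (forall z, 0 <= h z)%E ->
  (\int[@area R]_z h z = \int[mu]_y \int[mu]_x h (x, y))%E.
Proof. by move=> mh h0; exact: (@fubini_tonelli2 _ _ _ _ _ mu mu h). Qed.

Lemma tonelli_swap (h : R * R -> \bar R) : measurable_fun [set: R * R] h ->
  (forall z, 0 <= h z)%E ->
  (\int[mu]_x \int[mu]_y h (x, y) = \int[mu]_y \int[mu]_x h (x, y))%E.
Proof. by move=> mh h0; rewrite -area_tonelli1// area_tonelli2. Qed.

Lemma measurable_inner1 (h : R * R -> \bar R) : measurable_fun [set: R * R] h ->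
  (forall z, 0 <= h z)%E -> measurable_fun [set: R] (fun x => \int[mu]_y h (x, y))%E.
Proof.
move=> mh h0.
exact: (@measurable_fun_fubini_tonelli_F _ _ (measurableTypeR R) (measurableTypeR R) R mu h).
Qed.

Lemma measurable_inner2 (h : R * R -> \bar R) : measurable_fun [set: R * R] h ->
  (forall z, 0 <= h z)%E -> measurable_fun [set: R] (fun y => \int[mu]_x h (x, y))%E.
Proof.
move=> mh h0.
exact: (@measurable_fun_fubini_tonelli_G _ _ (measurableTypeR R) (measurableTypeR R) R mu h).
Qed.

Lemma measurable_slice1 {d} {T : measurableType d} (h : R * R -> T) (x : R) :
  measurable_fun [set: R * R] h -> measurable_fun [set: R] (fun y => h (x, y)).
Proof. by move=> mh; apply: (measurableT_comp mh); exact: measurable_pair1. Qed.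

Lemma measurable_slice2 {d} {T : measurableType d} (h : R * R -> T) (y : R) :
  measurable_fun [set: R * R] h -> measurable_fun [set: R] (fun x => h (x, y)).
Proof. by move=> mh; apply: (measurableT_comp mh); exact: measurable_pair2. Qed.

Lemma tonelli_in (D E : set R) (f : R * R -> \bar R) : measurable D -> measurable E ->
  measurable_fun (D `*` E) f -> (forall x y, D x -> E y -> 0 <= f (x, y))%E ->
  (\int[mu]_(x in D) \int[mu]_(y in E) f (x, y) = \int[mu]_(y in E) \int[mu]_(x in D) f (x, y))%E
  /\ measurable_fun D (fun x => \int[mu]_(y in E) f (x, y))%E.
Proof.
move=> mD mE mf f0.
pose g := f \_ (D `*` E).
have mDE : measurable (D `*` E : set (R * R)) by exact: measurableX.
have mg : measurable_fun [set: R * R] g by apply/(measurable_restrictT f mDE).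
have g0 z : (0 <= g z)%E.
  by rewrite /g patchE; case: ifPn => //; rewrite inE; case: z => x y [/=]; exact: f0.
have e1 x : ((fun x => \int[mu]_(y in E) f (x, y)) \_ D)%E x = (\int[mu]_y g (x, y))%E.
  rewrite patchE; case: ifPn => xD.
    rewrite integral_mkcond; apply: eq_integral => y _; rewrite /g !patchE.
    case: ifPn => yE; first by rewrite mem_set//=; split; apply/set_mem.
    by rewrite memNset//= => -[_ /mem_set]; apply/negP.
  rewrite integral0_eq// => y _; rewrite /g patchE memNset//= => -[/mem_set + _].
  exact/negP.
have e2 y : ((fun y => \int[mu]_(x in D) f (x, y)) \_ E)%E y = (\int[mu]_x g (x, y))%E.
  rewrite patchE; case: ifPn => yE.
    rewrite integral_mkcond; apply: eq_integral => x _; rewrite /g !patchE.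
    case: ifPn => xD; first by rewrite mem_set//=; split; apply/set_mem.
    by rewrite memNset//= => -[/mem_set + _]; apply/negP.
  rewrite integral0_eq// => x _; rewrite /g patchE memNset//= => -[_ /mem_set].
  exact/negP.
split.
  rewrite integral_mkcond [RHS]integral_mkcond.
  under eq_integral do rewrite e1; under [RHS]eq_integral do rewrite e2.
  exact: tonelli_swap.
apply/(measurable_restrictT _ mD); rewrite (funext e1); exact: measurable_inner1.
Qed.

(** Inversion is not continuous at 0. Measurability is inherited from the power function with
    exponent -1 and extended to negative reals by oddness. *)
Lemma measurable_funV_real : measurable_fun [set: R] (fun x : R => x^-1).
Proof.
rewrite (_ : (fun x : R => x^-1) = (fun x => if 0 <= x then x `^ (-1) else - ((- x) `^ (-1)))).
  apply: measurable_fun_ifT; first exact: measurable_fun_ler.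
    exact: measurable_powR.
  apply: measurable_funN; apply: (measurableT_comp (measurable_powR _)) => //.
apply/funext => x; case: leP => x0; first by rewrite powR_inv1.
by rewrite powR_inv1 ?invrN ?opprK// oppr_ge0 ltW.
Qed.

Lemma measurable_funV_in d (T : measurableType d) (D : set T) (f : T -> R) :
  measurable_fun D f -> measurable_fun D (fun x => (f x)^-1).
Proof. by move=> mf; exact: measurableT_comp measurable_funV_real mf. Qed.

End affine.

Section polar.
Context {R : realType}.
Local Notation mu := (@lebesgue_measure R).

Definition quarter (z : R * R) : R * R := (- z.2, z.1).

(* Polar coordinates in the wedge |y| <= x, with the tangent u of the angle as parameter; the plane is
   covered by the wedge and its rotations by [quarter]. *)
Definition arc_pt (u r : R) : R * R :=
  (r / Num.sqrt (1 + u ^+ 2), u * (r / Num.sqrt (1 + u ^+ 2))).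

Definition wedge : set (R * R) := [set z | 0 <= z.1 - `|z.2| ].

Lemma measurable_quarter : measurable_fun [set: R * R] quarter.
Proof.
apply: measurable_fun_pair => //; apply: measurableT_comp => //.
Qed.

Lemma measurable_iter_quarter k : measurable_fun [set: R * R] (iter k quarter).
Proof.
elim: k => [|k IH]; first exact: measurable_id.
exact: measurableT_comp measurable_quarter IH.
Qed.

Lemma measurable_wedge : measurable wedge.
Proof.
have -> : wedge = (fun z : R * R => z.1 - `|z.2|) @^-1` `[0, +oo[%classic.
  by apply/seteqP; split => z /=; rewrite in_itv/= andbT.
rewrite -[X in measurable X]setTI.
have mf : measurable_fun [set: R * R] (fun z : R * R => z.1 - `|z.2|).
  by apply: measurable_funB => //; exact: measurableT_comp.
by apply: mf => //; exact: measurable_itv.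
Qed.

Lemma area_quarter (h : R * R -> \bar R) : measurable_fun [set: R * R] h ->
  (forall z, 0 <= h z)%E ->
  (\int[@area R]_z h (quarter z) = \int[@area R]_z h z)%E.
Proof.
move=> mh h0.
have mq : measurable_fun [set: R * R] (fun z => h (quarter z)).
  by apply: measurableT_comp => //; exact: measurable_quarter.
rewrite (area_tonelli2 _ mq)// area_tonelli1//.
rewrite (@ge0_integral_affine R (-1) 0 (fun x => \int[mu]_y h (x, y))%E) ?oppr_eq0 ?oner_eq0//=; last 2 first.
- exact: measurable_inner1.
- by move=> x; apply: integral_ge0.
rewrite normrN1 mul1e; apply: eq_integral => y _; apply: eq_integral => x _.
by rewrite /quarter /= mulN1r addr0.
Qed.


Lemma area_iter_quarter k (h : R * R -> \bar R) : measurable_fun [set: R * R] h ->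
  (forall z, 0 <= h z)%E ->
  (\int[@area R]_z h (iter k quarter z) = \int[@area R]_z h z)%E.
Proof.
elim: k h => //= k IH h mh h0.
rewrite (IH (h \o quarter)) /=; last 2 first.
- exact: measurableT_comp mh measurable_quarter.
- by move=> z; exact: h0.
exact: area_quarter.
Qed.

Lemma iter4_quarter z : iter 4 quarter z = z.
Proof. by case: z => x y; rewrite /= /quarter /= !opprK. Qed.

Definition polar_int (h : R * R -> \bar R) : \bar R :=
  (\int[mu]_(u in `[(-1)%R, 1%R]) ((1 + u ^+ 2)^-1%:E *
    \int[mu]_(r in `[0%R, +oo[) (r%:E * h (arc_pt u r))))%E.

Lemma measurable_arc_pt : measurable_fun [set: R * R] (fun z => arc_pt z.1 z.2).
Proof.
have mh : measurable_fun [set: R * R] (fun z : R * R => z.2 / Num.sqrt (1 + z.1 ^+ 2)).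
  apply: measurable_funM => //.
  have : measurable_fun [set: R] (fun u : R => (Num.sqrt (1 + u ^+ 2))^-1).
    apply: continuous_measurable_fun => u.
    have h : Num.sqrt (1 + u ^+ 2) != 0 :> R.
      by rewrite gt_eqF// sqrtr_gt0 ltr_wpDr// sqr_ge0.
    apply: (@cvgV _ _ _ _ _ _ h).
    apply: (@continuous_comp _ _ _ (fun u : R => 1 + u ^+ 2) Num.sqrt); last exact: sqrt_continuous.
    by apply: cvgD; [exact: cvg_cst|exact: exprn_continuous].
  move=> h; exact: (measurableT_comp h measurable_fst).
by apply: measurable_fun_pair => //; exact: measurable_funM.
Qed.

(** Two affine substitutions: y = u x on each vertical line, then, after exchanging the integrals, x
    = r / sqrt(1 + u^2) for each slope u. *)
Lemma area_wedge (h : R * R -> \bar R) : measurable_fun [set: R * R] h ->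
  (forall z, 0 <= h z)%E ->
  (\int[@area R]_z (h z * (\1_wedge z)%:E) = polar_int h)%E.
Proof.
move=> mh h0.
have mhw : measurable_fun [set: R * R] (fun z => h z * (\1_wedge z)%:E)%E.
  apply: emeasurable_funM => //; apply/measurable_EFinP.
  exact: measurable_indic measurable_wedge.
have hw0 z : (0 <= h z * (\1_wedge z)%:E)%E by apply: mule_ge0 => //; rewrite lee_fin.
rewrite area_tonelli1//.
have mi (i : interval R) : measurable_fun [set: R] (\1_[set` i] : R -> R) by exact: measurable_indic.
(* The integrand after y = u x, with z.1 = x and z.2 = u. The factor x is the Jacobian; the
   indicators of x >= 0 and |u| <= 1 describe the wedge. *)
pose k (z : R * R) := (h (z.1, z.2 * z.1)%R * (z.1 * (\1_(`[0, +oo[%classic : set R) z.1 * \1_(`[-1, 1]%classic : set R) z.2))%:E)%E.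
have mk : measurable_fun [set: R * R] k.
  apply: emeasurable_funM.
    apply: (measurableT_comp mh); apply: measurable_fun_pair => //.
    exact: measurable_funM.
  apply/measurable_EFinP; apply: measurable_funM => //; apply: measurable_funM.
    exact: (measurableT_comp (mi _) measurable_fst).
  exact: (measurableT_comp (mi _) measurable_snd).
have k0 z : (0 <= k z)%E.
  rewrite /k; apply: mule_ge0 => //; rewrite lee_fin.
  rewrite !indicE; case: (boolP (z.1 \in _)) => [|_]; last by rewrite mul0r mulr0.
  by rewrite inE/= in_itv/= andbT => z1; rewrite mul1r mulr_ge0.
transitivity (\int[mu]_x \int[mu]_u k (x, u))%E.
  apply: eq_integral => x _.
  (* The substitution degenerates on the line x = 0, but this line meets the wedge in the origin
     only, a null set for dy. *)
  have [->|x0] := eqVneq x 0.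
    rewrite [RHS]integral0_eq; last by move=> u _; rewrite /k/= mul0r mule0.
    apply: le_anti; apply/andP; split; last by apply: integral_ge0 => y _; exact: hw0.
    rewrite -(@integral_set1 R (fun y => h (0, y)%R) 0) integral_mkcond.
    rewrite [leRHS]integral_mkcond.
    apply: ge0_le_integral_nomeas => [y _|y _].
      by rewrite patchT ?inE//; exact: hw0.
    rewrite /patch in_setT indicE; case: ifPn => [/set_mem/= ->|/negP yn].
      by rewrite -[leRHS]mule1; apply: lee_wpmul2l; rewrite ?lee_fin ?lern1 ?leq_b1.
    rewrite memNset ?mule0// => hh; apply: yn; rewrite inE /=.
    by move: hh; rewrite /wedge/= sub0r oppr_ge0 normr_le0 => /eqP.
  have [x1|x1] := ltP 0 x; last first.
    rewrite integral0_eq; last first.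
      move=> y _; rewrite indicE memNset ?mule0// /wedge/= => hh.
      have := normr_ge0 y; move: x0 => /eqP x0 ?; apply: x0; lra.
    rewrite integral0_eq// => u _; rewrite /k/= !indicE memNset ?mul0r ?mulr0 ?mule0//=.
    by rewrite in_itv/= andbT => x2; move: x0; rewrite (_ : x = 0) ?eqxx//; apply: le_anti; rewrite x1 x2.
  rewrite (@ge0_integral_affine R x 0 (fun y => h (x, y) * (\1_wedge (x, y))%:E)%E)//; last first.
    exact: (measurable_slice1 (fun z => h z * (\1_wedge z)%:E)%E).
  have mF : measurable_fun [set: R] (fun u : R => h (x, (x * u + 0)%R) * (\1_wedge (x, x * u + 0)%R)%:E)%E.
    apply: (@measurableT_comp _ _ _ _ _ _ (fun y => h (x, y) * (\1_wedge (x, y))%:E)%E).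
      exact: (measurable_slice1 (fun z => h z * (\1_wedge z)%:E)%E).
    by apply: measurable_funD => //.
  rewrite -ge0_integralZl//.
  apply: eq_integral => u _; rewrite /k/= addr0 [(u * x)%R]mulrC muleC -muleA gtr0_norm//.
  congr (_ * _)%E; rewrite -EFinM mulrC; congr (_ * _)%:E.
  rewrite !indicE (mem_set (A := `[0, +oo[%classic)) ?mul1r/= ?in_itv/= ?ltW//.
  suff -> : ((x, x * u)%R \in wedge) = (u \in `[(-1)%R, 1%R]%classic) by [].
  by apply/idP/idP; rewrite !inE /wedge/= in_itv/= normrM gtr0_norm// -ler_norml subr_ge0 ger_pMr.
rewrite tonelli_swap// /polar_int.
rewrite [RHS]integral_mkcond; apply: eq_integral => u _.
rewrite patchE; case: ifPn => uI; last first.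
  transitivity (0%E : \bar R) => //; apply: integral0_eq => x _.
  by rewrite /k/= [\1_`[_, 1] u]indicE (negbTE uI) !mulr0 mule0.
(* With x = r / s the product x dx becomes r dr / s^2, and s^2 = 1 + u^2 is the angular weight of
   [polar_int]. *)
set s := Num.sqrt (1 + u ^+ 2).
have s0 : 0 < s by rewrite sqrtr_gt0 ltr_wpDr// sqr_ge0.
have mku : measurable_fun [set: R] (fun x => k (x, u)) by exact: (measurable_slice2 k).
rewrite (@ge0_integral_affine R s^-1 0 (fun x => k (x, u)))// ?invr_eq0 ?gt_eqF//.
rewrite [X in _ = (_ * X)%E]integral_mkcond.
have mp : measurable_fun [set: R] ((fun r => r%:E * h (arc_pt u r))%E \_ `[0, +oo[%classic).
  apply/(measurable_restrictT _ _).1 => //.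
  apply: measurable_funTS; apply: emeasurable_funM; first exact: EFin_measurable.
  apply: (measurableT_comp mh).
  exact: (measurable_slice1 (fun z => arc_pt z.1 z.2)) measurable_arc_pt.
have mF : measurable_fun [set: R] (fun r : R => k ((s^-1 * r + 0)%R, u)).
  apply: (@measurableT_comp _ _ _ _ _ _ (fun x => k (x, u))) => //.
  by apply: measurable_funD => //.
have p0 r : (0 <= ((fun r => r%:E * h (arc_pt u r))%E \_ `[0%R, +oo[%classic) r)%E.
  rewrite patchE; case: ifPn => //; rewrite inE/= in_itv/= andbT => r0.
  by apply: mule_ge0 => //; rewrite lee_fin.
have u0 : 0 <= (1 + u ^+ 2)^-1 by rewrite invr_ge0 addr_ge0 ?sqr_ge0.
rewrite -ge0_integralZl// -ge0_integralZl//.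
apply: eq_integral => r _; rewrite /k/= addr0 !indicE uI mulr1.
rewrite gtr0_norm ?invr_gt0// patchE.
have -> : (s^-1 * r \in `[0, +oo[%classic) = (r \in `[0, +oo[%classic).
  by apply/idP/idP; rewrite !inE/= !in_itv/= !andbT pmulr_rge0// invr_gt0.
case: ifPn => _; last by rewrite mulr0 !mule0.
rewrite mulr1 /arc_pt -/s [(s^-1 * r)%R]mulrC muleCA -EFinM [RHS]muleA -EFinM muleC.
congr (_ * _)%E; congr EFin; rewrite mulrCA mulrC -invfM -expr2 sqr_sqrtr ?addr_ge0 ?sqr_ge0//.
Qed.

Lemma wedge_cover (z : R * R) : exists k : 'I_4, wedge (iter (4 - k) quarter z).
Proof.
case: z => x y; rewrite /wedge /quarter.
have [h1|h1] := leP `|y| x; first by exists ord0 => /=; rewrite !opprK subr_ge0.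
have [h2|h2] := leP `|y| (- x).
  by exists (inord 2) => /=; rewrite inordK//= normrN subr_ge0.
have [h3|h3] := leP 0 y.
  exists (inord 1) => /=; rewrite inordK//= opprK subr_ge0.
  by move: h1 h2; rewrite ger0_norm// => h1 h2; rewrite ler_norml; apply/andP; split; lra.
exists (inord 3) => /=; rewrite inordK//= subr_ge0.
by move: h1 h2; rewrite ltr0_norm// => h1 h2; rewrite ler_norml; apply/andP; split; lra.
Qed.

(** The change of variables by k quarter turns carries the wedge onto its k-th rotation, since 4 - k
    further turns bring a point back. *)
Let wk (h : R * R -> \bar R) (k : nat) : measurable_fun [set: R * R] h ->
  (forall z, 0 <= h z)%E -> (k < 4)%N ->
  (\int[@area R]_z (h z * (\1_wedge (iter (4 - k) quarter z))%:E) =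
   polar_int (h \o iter k quarter))%E.
Proof.
move=> mh h0 k4.
have mw : measurable_fun [set: R * R] (fun z => h z * (\1_wedge (iter (4 - k) quarter z))%:E)%E.
  apply: emeasurable_funM => //; apply/measurable_EFinP.
  apply: (measurableT_comp _ (measurable_iter_quarter _)).
  exact: measurable_indic measurable_wedge.
rewrite -(area_iter_quarter k _ mw); last first.
  by move=> z; apply: mule_ge0 => //; rewrite lee_fin.
rewrite -area_wedge; [|exact: measurableT_comp mh (measurable_iter_quarter k)|by move=> z; exact: h0].
apply: eq_integral => z _; rewrite -iterD subnK 1?ltnW// iter4_quarter//.
Qed.

Lemma area_polar_le (h : R * R -> \bar R) : measurable_fun [set: R * R] h ->
  (forall z, 0 <= h z)%E ->
  (\int[@area R]_z h z <= \sum_(k < 4) polar_int (h \o iter k quarter))%E.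
Proof.
move=> mh h0.
have mw (k : 'I_4) : measurable_fun [set: R * R] (fun z => h z * (\1_wedge (iter (4 - k) quarter z))%:E)%E.
  apply: emeasurable_funM => //; apply/measurable_EFinP.
  apply: (measurableT_comp _ (measurable_iter_quarter _)).
  exact: measurable_indic measurable_wedge.
have w0 (k : 'I_4) z : (0 <= h z * (\1_wedge (iter (4 - k) quarter z))%:E)%E.
  by apply: mule_ge0 => //; rewrite lee_fin.
under eq_bigr do rewrite -wk//.
rewrite -ge0_integral_sum//.
apply: ge0_le_integral_nomeas => // z _.
have [k hk] := wedge_cover z.
rewrite (bigD1 k)//= indicE mem_set// mule1 leeDl// sume_ge0// => i _.
Qed.

(** Each rotated wedge contributes at most the full integral. The lossy factor 4 avoids any
    discussion of the overlaps of the wedges. *)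
Lemma area_polar_ge (h : R * R -> \bar R) : measurable_fun [set: R * R] h ->
  (forall z, 0 <= h z)%E ->
  (\sum_(k < 4) polar_int (h \o iter k quarter) <= 4%:E * \int[@area R]_z h z)%E.
Proof.
move=> mh h0.
have -> : (4%:E * \int[@area R]_z h z = \sum_(k < 4) \int[@area R]_z h z)%E.
  by rewrite (mule_natl _ 4) sumr_const card_ord.
apply: lee_sum => k _; rewrite -wk//; apply: ge0_le_integral_nomeas => z _.
  by apply: mule_ge0 => //; rewrite lee_fin.
by rewrite -[leRHS]mule1; apply: lee_wpmul2l; rewrite // lee_fin indicE lern1 leq_b1.
Qed.

End polar.

Section rotation.
Context {R : realType}.
Local Notation mu := (@lebesgue_measure R).

(** For c != 0 the rotation is a composition of two substitutions in one variable: with x' = c x - d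
    y the second coordinate becomes y / c + (d / c) x', because c^2 + d^2 = 1. The Jacobians |c| and
    1 / |c| cancel. For c = 0 it is one or three quarter turns. *)
Lemma area_rotation (c d : R) (h : R * R -> \bar R) : c ^+ 2 + d ^+ 2 = 1 ->
  measurable_fun [set: R * R] h -> (forall z, 0 <= h z)%E ->
  (\int[@area R]_z h (c * z.1 - d * z.2, d * z.1 + c * z.2)%R = \int[@area R]_z h z)%E.
Proof.
move=> cd mh h0.
have [c0|c0] := eqVneq c 0.
  have : (d - 1) * (d + 1) = 0 by move: cd; rewrite c0; lra.
  move=> /eqP; rewrite mulf_eq0 => /orP[/eqP d1|/eqP d1].
    have {}d1 : d = 1 by lra.
    rewrite -[RHS]area_quarter//; apply: eq_integral => z _; congr h.
    by rewrite c0 d1 /quarter; congr pair; lra.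
  have {}d1 : d = -1 by lra.
  rewrite -[RHS](area_iter_quarter 3)//; apply: eq_integral => z _; congr h.
  by rewrite c0 d1 /= /quarter/=; congr pair; lra.
have ml (a b : R) : measurable_fun [set: R * R] (fun z : R * R => a * z.1 + b * z.2).
  by apply: measurable_funD; exact: measurable_funM.
have mr : measurable_fun [set: R * R]
    (fun z => h (c * z.1 - d * z.2, d * z.1 + c * z.2)).
  apply: (measurableT_comp mh); apply: measurable_fun_pair => //.
  under eq_fun do rewrite -mulNr; exact: ml.
rewrite area_tonelli2//= area_tonelli1//.
pose k (z : R * R) := h (z.1, c^-1 * z.2 + d / c * z.1).
have mk : measurable_fun [set: R * R] k.
  apply: (measurableT_comp mh); apply: measurable_fun_pair => //.
  under eq_fun do rewrite addrC; exact: ml.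
have k0 z : (0 <= k z)%E by exact: h0.
have nc : `|c| != 0 by rewrite normr_eq0.
transitivity (\int[mu]_y (`|c|^-1%:E * \int[mu]_x k (x, y)))%E.
  apply: eq_integral => y _.
  rewrite (ge0_integral_affine c (- (d * y)) (fun x => k (x, y)))//; last exact: (measurable_slice2 k).
  rewrite muleA -EFinM mulVf// mul1e; apply: eq_integral => x _; congr h => /=; congr pair.
  have e : c * c = 1 - d * d by move: cd; rewrite !expr2; lra.
  have -> : c * y = c^-1 * ((c * c) * y) by field.
  by rewrite e; field.
rewrite ge0_integralZl//; last 2 first.
- exact: measurable_inner2.
- by move=> y _; exact: integral_ge0.
rewrite -tonelli_swap// -ge0_integralZl//; last 2 first.
- exact: measurable_inner1.
- by move=> y _; exact: integral_ge0.
apply: eq_integral => x _.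
rewrite (ge0_integral_affine c^-1 (d / c * x) (fun y => h (x, y)))//; last 2 first.
- by rewrite invr_eq0.
- exact: measurable_slice1.
by rewrite normfV.
Qed.

End rotation.

Section hoelder_integral.
Context d (T : measurableType d) (R : realType) (mu : {measure set T -> \bar R}).

Lemma hoelder_in (D : set T) (f g : T -> R) (p q : R) : measurable D ->
  measurable_fun D f -> measurable_fun D g ->
  (forall x, D x -> 0 <= f x) -> (forall x, D x -> 0 <= g x) ->
  0 < p -> 0 < q -> p^-1 + q^-1 = 1 ->
  (\int[mu]_(x in D) (f x * g x)%:E <=
    (\int[mu]_(x in D) (f x `^ p)%:E) `^ p^-1 * (\int[mu]_(x in D) (g x `^ q)%:E) `^ q^-1)%E.
Proof.
move=> mD mf mg f0 g0 p0 q0 pq.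
have mfD : measurable_fun setT (f \_ D) by exact/(measurable_restrictT f mD).
have mgD : measurable_fun setT (g \_ D) by exact/(measurable_restrictT g mD).
have := hoelder mu mfD mgD p0 q0 pq.
rewrite Lnorm1 !unlock /= => H.
rewrite integral_mkcond (integral_mkcond _ (fun x => (f x `^ p)%:E)).
rewrite (integral_mkcond _ (fun x => (g x `^ q)%:E)).
move: H; congr (_ <= (_ `^ _) * (_ `^ _))%E; apply: eq_integral => x _; rewrite !patchE;
  case: ifPn => xD; rewrite ?mul0r ?normr0 ?poweR_EFin ?powR0 ?gt_eqF//.
- by rewrite ger0_norm// mulr_ge0// ?f0 ?g0// -inE.
- by rewrite ger0_norm// f0// -inE.
- by rewrite ger0_norm// g0// -inE.
Qed.

End hoelder_integral.

(** * Hilbert's inequality *)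

Section powers.
Context {R : realType}.
Local Notation mu := (@lebesgue_measure R).

Lemma ge0_integral_FTC (F f : R -> R) (a b : R) : a <= b ->
  (forall x, a <= x <= b -> is_derive x 1 F (f x)) ->
  (forall x, a <= x <= b -> {for x, continuous f}) ->
  (\int[mu]_(x in `[a, b]) (f x)%:E = (F b - F a)%:E)%E.
Proof.
rewrite le_eqVlt => /predU1P[->|ab] dF cf.
  by rewrite set_itv1 integral_set1 subrr.
have cF x : a <= x <= b -> {for x, continuous F}.
  by move=> xab; apply: differentiable_continuous; apply/derivable1_diffP; case: (dF x xab).
rewrite (@continuous_FTC2 R f F a b)//.
- by apply: continuous_in_subspaceT => x; rewrite inE/= in_itv/=; exact: cf.
- split.
  + by move=> x /[!in_itv]/= /andP[h1 h2]; case: (dF x); rewrite ?ltW.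
  + by apply: cvg_at_right_filter; apply: cF; rewrite lexx ltW.
  + by apply: cvg_at_left_filter; apply: cF; rewrite lexx ltW.
- move=> x /[!in_itv]/= /andP[h1 h2].
  have xab : a <= x <= b by rewrite !ltW.
  have [_ <-] := dF x xab; by rewrite derive1E.
Qed.

Lemma powRDp (x r s : R) : 0 < x -> x `^ (r + s) = x `^ r * x `^ s.
Proof. by move=> x0; rewrite powRD// (gt_eqF x0) implybT. Qed.

Lemma continuous_powR (b x : R) : 0 < x -> {for x, continuous (fun y : R => y `^ b)}.
Proof.
move=> x0; apply: differentiable_continuous; apply/derivable1_diffP.
by apply: derivable_powR; rewrite in_itv/= andbT.
Qed.

Lemma integral_powR (b lo hi : R) : b != 0 -> 0 < lo -> lo <= hi ->
  (\int[mu]_(y in `[lo, hi]) (y `^ (b - 1))%:E = ((hi `^ b - lo `^ b) / b)%:E)%E.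
Proof.
move=> b0 lo0 lohi.
apply: etrans; first apply: (@ge0_integral_FTC (fun y => b^-1 * y `^ b)) => //.
- move=> x /andP[lx _]; have x0 : 0 < x by exact: lt_le_trans lx.
  have h : is_derive x 1 (fun y => b^-1 * y `^ b) (b^-1 * (b * x `^ (b - 1))) :=
    is_deriveZ b^-1 (is_derive1_powR b x0).
  by rewrite mulKf in h.
- by move=> x /andP[lx _]; apply: continuous_powR; exact: lt_le_trans lx.
- by congr EFin; rewrite -mulrBr mulrC.
Qed.

Lemma ge0_integral_bigcup_le d (T : measurableType d) (nu : {measure set T -> \bar R})
    (F : (set T)^nat) (f : T -> \bar R) (M : \bar R) :
  nondecreasing_seq F -> (forall i, measurable (F i)) ->
  (forall i, measurable_fun (F i) f) -> (forall i x, F i x -> 0 <= f x)%E ->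
  (forall i, \int[nu]_(x in F i) f x <= M)%E -> (\int[nu]_(x in \bigcup_i F i) f x <= M)%E.
Proof.
move=> ndF mF mf f0 FM.
have h := @ge0_nondecreasing_set_cvg_integral _ _ _ F f nu ndF mF mf f0.
 rewrite -(cvg_lim _ h)//; apply: lime_le; first by apply/cvg_ex; eexists; exact: h.
exact: nearW.
Qed.

Lemma measurable_powRl (b : R) (D : set R) : measurable_fun D (fun y : R => y `^ b).
Proof. by apply: measurable_funTS; exact: measurable_powR. Qed.

(** The integrand is singular at 0, so ]0, x] is exhausted by the segments [x / (n+1), x], where the
    primitive is differentiable; the value at the lower end is dropped. *)
Lemma integral_powR_near0 (a x : R) : 0 < a < 1 -> 0 < x ->
  (\int[mu]_(y in `]0%R, x]) (y `^ (- a))%:E <= (x `^ (1 - a) / (1 - a))%:E)%E.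
Proof.
move=> /andP[a0 a1] x0.
have -> : `]0%R, x]%classic = \bigcup_n `[(x / n.+1%:R), x]%classic.
  apply/seteqP; split => y /=; rewrite in_itv/=.
    move=> /andP[y0 yx]; exists (Num.trunc (x / y)) => //=; rewrite in_itv/= yx andbT.
    rewrite ler_pdivrMr// mulrC -ler_pdivrMr//.
    by rewrite ltW// truncnS_gt.
  move=> [n _] /=; rewrite in_itv/= => /andP[h1 ->]; rewrite andbT.
  by apply: lt_le_trans h1; rewrite divr_gt0.
apply: ge0_integral_bigcup_le => //.
- apply/nondecreasing_seqP => n; rewrite subsetEset => y /=; rewrite !in_itv/= => /andP[h1 ->].
  rewrite andbT; apply: le_trans h1; rewrite ler_pM2l// lef_pV2 ?posrE// ler_nat//.
- by move=> n; apply/measurable_EFinP; exact: measurable_powRl.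
- by move=> n y _; rewrite lee_fin powR_ge0.
- move=> n; have := @integral_powR (1 - a) (x / n.+1%:R) x.
  rewrite (_ : 1 - a - 1 = - a); last by lra.
  move=> ->; rewrite ?divr_gt0 ?subr_eq0 ?gt_eqF//; last first.
    by rewrite ler_pdivrMr// ler_peMr ?ler1n// ltW.
  rewrite lee_fin ler_pM2r ?invr_gt0 ?subr_gt0// gerBl powR_ge0//.
Qed.

(** Cut at y = x. Below, 1 / (x + y) <= 1 / x gives the constant 1 / (1 - a); above, 1 / (x + y) <=
    1 / y gives 1 / a. *)
Lemma integral_powR_kernel (a x : R) : 0 < a < 1 -> 0 < x <= 1 ->
  (\int[mu]_(y in `]0%R, 1%R]) (y `^ (- a) / (x + y))%:E <=
   (((1 - a)^-1 + a^-1) * x `^ (- a))%:E)%E.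
Proof.
move=> aa /andP[x0 x1]; have /andP[a0 a1] := aa.
have mk (D : set R) : measurable_fun D (fun y => (y `^ (- a) / (x + y))%:E).
  apply/measurable_EFinP; apply: measurable_funM; first exact: measurable_powRl.
  by apply: measurable_funV_in; exact: measurable_funD.
have -> : (`]0%R, 1%R]%classic = `]0%R, x]%classic `|` `]x, 1%R]%classic :> set R).
  apply/seteqP; split => y /=; rewrite !in_itv/=.
    by move=> /andP[-> ->]; rewrite andbT/=; case: (leP y x) => _; [left|right].
  by case=> /andP[h1 h2]; apply/andP; split; lra.
rewrite ge0_integral_setU//=; last 3 first.
- exact: mk.
- move=> y /=; rewrite !in_itv/= => h; rewrite lee_fin divr_ge0 ?powR_ge0//.
  by case: h => /andP[]; lra.
- apply/disj_setPS => y []/=; rewrite !in_itv/= => /andP[_ h1] /andP[h2 _]; lra.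
rewrite mulrDl EFinD; apply: leeD.
- apply: (@le_trans _ _ (\int[mu]_(y in `]0%R, x]) (x^-1%:E * (y `^ (- a))%:E))%E).
    apply: ge0_le_integral_nomeas => y /=; rewrite in_itv/= => /andP[y0 yx].
      by rewrite lee_fin divr_ge0 ?powR_ge0// ltW// addr_gt0.
    rewrite lee_fin mulrC ler_wpM2r ?powR_ge0// lef_pV2 ?posrE ?addr_gt0//; lra.
  rewrite ge0_integralZl//; last 3 first.
  + by apply/measurable_EFinP; exact: measurable_powRl.
  + by move=> y _; rewrite lee_fin powR_ge0.
  + by rewrite lee_fin invr_ge0 ltW.
  apply: (@le_trans _ _ (x^-1%:E * (x `^ (1 - a) / (1 - a))%:E)%E).
    by apply: lee_wpmul2l; [rewrite lee_fin invr_ge0 ltW|exact: integral_powR_near0].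
  have e : x `^ (1 - a) = x * x `^ (- a) by rewrite powRDp// powRr1 ?ltW.
  by rewrite e -EFinM lee_fin mulrA mulKf ?gt_eqF// mulrC.
- have [->|x1'] := eqVneq x 1.
    by rewrite set_itvoc0 integral_set0 powR1 lee_fin mulr_ge0 ?invr_ge0 ?ltW.
  apply: (@le_trans _ _ (\int[mu]_(y in `[x, 1%R]) (y `^ (- a - 1))%:E)%E).
    apply: (@le_trans _ _ (\int[mu]_(y in `]x, 1%R]) (y `^ (- a - 1))%:E)%E).
      apply: ge0_le_integral_nomeas => y /=; rewrite in_itv/= => /andP[y0 y1].
        by rewrite lee_fin divr_ge0 ?powR_ge0// ltW// addr_gt0// (lt_trans x0).
      have yp : 0 < y by exact: lt_trans y0.
      rewrite lee_fin powRDp// powR_inv1 ?(ltW yp)//.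
      by rewrite ler_wpM2l ?powR_ge0// lef_pV2 ?posrE ?addr_gt0//; lra.
    apply: ge0_integral_le_subset => y /=; rewrite ?lee_fin ?powR_ge0//.
    by rewrite !in_itv/= => /andP[h1 ->]; rewrite ltW.
  rewrite integral_powR// ?oppr_eq0 ?gt_eqF// lee_fin powR1 invrN mulrN -mulNr opprB.
  rewrite mulrC ler_pM2l ?invr_gt0// gerBl//.
Qed.

(** Schur's test with the weight y^(-1/(p q)), where q is the conjugate exponent: Hoelder in y for
    fixed x, exchange of the integrals, then [integral_powR_kernel] once more in x. *)
Lemma hilbert_inequality (p : R) : 1 < p -> exists C : R, 0 < C /\
  forall h : R -> R, measurable_fun [set: R] h -> (forall y, 0 <= h y) ->
  (\int[mu]_(x in `]0%R, 1%R]) (\int[mu]_(y in `]0%R, 1%R]) (h y / (x + y))%:E) `^ p <=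
   C%:E * \int[mu]_(y in `]0%R, 1%R]) (h y `^ p)%:E)%E.
Proof.
move=> p1; have p0 : 0 < p by rewrite (lt_trans _ p1).
pose q := p / (p - 1).
have q0 : 0 < q by rewrite divr_gt0// subr_gt0.
have pq : p^-1 + q^-1 = 1.
  by rewrite /q invf_div mulrBl mul1r divff ?gt_eqF// addrC subrK.
have pV : 0 < p^-1 < 1 by rewrite invr_gt0 p0 invf_lt1.
have qV : 0 < q^-1 < 1 by rewrite invr_gt0 q0/=; case/andP: pV; lra.
(* The constant of [integral_powR_kernel] for a = 1/p; it is the same for a = 1/q, because 1 - 1/p =
   1/q merely exchanges the two summands. *)
pose K := (1 - p^-1)^-1 + p^-1^-1.
have KE : (1 - q^-1)^-1 + q^-1^-1 = K.
  rewrite /K (_ : 1 - q^-1 = p^-1); last by lra.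
  by rewrite (_ : 1 - p^-1 = q^-1) 1?addrC//; lra.
have K0 : 0 < K.
  by rewrite addr_gt0// ?invr_gt0 ?subr_gt0//; case/andP: pV.
(* K^(p/q) comes from the second Hoelder factor raised to the power p/q, the other K from the final
   integration in x. *)
pose L := K `^ (p / q) * K.
have L0 : 0 < L by rewrite mulr_gt0// powR_gt0.
exists L; split => // h mh h0.
have mI : measurable (`]0%R, 1%R]%classic : set R) by exact: measurable_itv.
have mhp : measurable_fun [set: R] (fun y => h y `^ p).
  exact: (measurableT_comp (measurable_powR _) mh).
pose k (z : R * R) := (h z.2 `^ p * z.2 `^ q^-1 * z.1 `^ (- q^-1) / (z.1 + z.2))%:E.
have mpw (b : R) : measurable_fun [set: R] (fun y : R => y `^ b) by exact: measurable_powR.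
have mk : measurable_fun [set: R * R] k.
  apply/measurable_EFinP; apply: measurable_funM; last first.
    by apply: measurable_funV_in; exact: measurable_funD.
  apply: measurable_funM; last exact: (measurableT_comp (mpw _) measurable_fst).
  apply: measurable_funM; last exact: (measurableT_comp (mpw _) measurable_snd).
  exact: (measurableT_comp mhp measurable_snd).
have step1 x : x \in `]0%R, 1%R] ->
  ((\int[mu]_(y in `]0%R, 1%R]) (h y / (x + y))%:E) `^ p <=
   (K `^ (p / q))%:E * \int[mu]_(y in `]0%R, 1%R]) k (x, y))%E.
  rewrite in_itv/= => /andP[x0 x1].
  (* The kernel is distributed as (x + y)^(-1/p) and (x + y)^(-1/q); the powers y^(1/(p q)) and
     y^(-1/(p q)) cancel in the product. *)
  pose f1 y := h y * (y `^ q^-1 / (x + y)) `^ p^-1.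
  pose f2 y := (y `^ (- p^-1) / (x + y)) `^ q^-1.
  have mx : measurable_fun [set: R] (fun y => (x + y)^-1).
    by apply: measurable_funV_in; exact: measurable_funD.
  have mf1 : measurable_fun [set: R] f1.
    apply: measurable_funM => //; apply: (measurableT_comp (mpw _)).
    exact: measurable_funM.
  have mf2 : measurable_fun [set: R] f2.
    by apply: (measurableT_comp (mpw _)); exact: measurable_funM.
  have hold := @hoelder_in _ _ _ mu `]0%R, 1%R]%classic f1 f2 p q mI
    (measurable_funTS mf1) (measurable_funTS mf2) _ _ p0 q0 pq.
  have f10 y : 0 <= f1 y by rewrite /f1 mulr_ge0// powR_ge0.
  have f20 y : 0 <= f2 y by rewrite /f2 powR_ge0.
  have {}hold := hold (fun y _ => f10 y) (fun y _ => f20 y).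
  have e1 : (\int[mu]_(y in `]0%R, 1%R]) (h y / (x + y))%:E =
      \int[mu]_(y in `]0%R, 1%R]) (f1 y * f2 y)%:E)%E.
    apply: eq_integral => y; rewrite inE/= in_itv/= => /andP[y0 y1].
    have xy : 0 < x + y by rewrite addr_gt0.
    rewrite /f1 /f2 !powRM ?powR_ge0 ?invr_ge0 ?(ltW xy)//; congr EFin.
    rewrite -mulrA; congr (_ * _).
    rewrite mulrACA -!powRrM -!powRDp ?invr_gt0//.
    by rewrite pq powRr1 ?invr_ge0 ?(ltW xy)// mulNr [p^-1 * _]mulrC subrr powRr0 mul1r.
  have e2 : (\int[mu]_(y in `]0%R, 1%R]) (f2 y `^ q)%:E <= (K * x `^ (- p^-1))%:E)%E.
    have -> : (\int[mu]_(y in `]0%R, 1%R]) (f2 y `^ q)%:E =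
        \int[mu]_(y in `]0%R, 1%R]) (y `^ (- p^-1) / (x + y))%:E)%E.
      apply: eq_integral => y; rewrite inE/= in_itv/= => /andP[y0 y1].
      rewrite /f2 -powRrM mulVf ?gt_eqF// powRr1// divr_ge0 ?powR_ge0//.
      by rewrite addr_ge0// ltW.
    by apply: integral_powR_kernel => //; rewrite x0.
  have A0 : (0 <= \int[mu]_(y in `]0%R, 1%R]) (f1 y `^ p)%:E)%E.
    by apply: integral_ge0 => y _; rewrite lee_fin powR_ge0.
  have I0 : (0 <= \int[mu]_(y in `]0%R, 1%R]) (f1 y * f2 y)%:E)%E.
    by apply: integral_ge0 => y _; rewrite lee_fin mulr_ge0.
  have B0 : (0 <= \int[mu]_(y in `]0%R, 1%R]) (f2 y `^ q)%:E)%E.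
    by apply: integral_ge0 => y _; rewrite lee_fin powR_ge0.
  have Kx0 : 0 <= K * x `^ (- p^-1) by rewrite mulr_ge0 ?powR_ge0// ltW.
  rewrite e1; apply: (le_trans (gt0_ler_poweR _ _ _ hold)).
  - exact: ltW.
  - by rewrite in_itv/= leey andbT.
  - by rewrite in_itv/= leey andbT mule_ge0 ?poweR_ge0.
  rewrite poweRM ?poweR_ge0// -!poweRrM mulVf ?gt_eqF// poweRe1// muleC.
  apply: (@le_trans _ _ (((K * x `^ (- p^-1)) `^ (q^-1 * p))%:E *
     \int[mu]_(y in `]0%R, 1%R]) (f1 y `^ p)%:E)%E).
    apply: lee_wpmul2r => //; rewrite -poweR_EFin; apply: gt0_ler_poweR => //.
    - by rewrite mulr_ge0 ?invr_ge0// ltW.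
    - by rewrite in_itv/= leey andbT.
    - by rewrite in_itv/= leey andbT lee_fin.
  rewrite powRM ?powR_ge0 ?(ltW K0)// EFinM -muleA [(q^-1 * p)%R]mulrC.
  apply: lee_wpmul2l; first by rewrite lee_fin powR_ge0.
  rewrite -ge0_integralZl//; last 3 first.
  - apply/measurable_EFinP; apply: measurable_funTS.
    exact: (measurableT_comp (mpw _) mf1).
  - by move=> y _; rewrite lee_fin powR_ge0.
  - by rewrite lee_fin powR_ge0.
  apply: ge0_le_integral_nomeas => y /=; rewrite in_itv/= => /andP[y0 y1].
    by apply: mule_ge0; rewrite lee_fin powR_ge0.
  have xy : 0 < x + y by rewrite addr_gt0.
  rewrite -EFinM lee_fin /f1 /= powRM ?powR_ge0// -!powRrM.
  rewrite mulVf ?gt_eqF// powRr1 ?divr_ge0 ?powR_ge0 ?(ltW xy)//.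
  rewrite (_ : - p^-1 * (p / q) = - q^-1); last by field; rewrite !gt_eqF.
  by rewrite mulrC !mulrA [X in _ <= X]mulrAC.
apply: (@le_trans _ _ (\int[mu]_(x in `]0%R, 1%R])
   ((K `^ (p / q))%:E * \int[mu]_(y in `]0%R, 1%R]) k (x, y)))%E).
  apply: ge0_le_integral_nomeas => x; first by rewrite poweR_ge0.
  exact: step1.
have k0 x y : x \in `]0%R, 1%R] -> y \in `]0%R, 1%R] -> (0 <= k (x, y))%E.
  rewrite !in_itv/= => /andP[x0 _] /andP[y0 _].
  by rewrite lee_fin/= divr_ge0 ?addr_ge0 ?mulr_ge0 ?powR_ge0// ltW.
have [sw msw] := @tonelli_in R `]0%R, 1%R]%classic `]0%R, 1%R]%classic k mI mI (measurable_funTS mk) k0.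
rewrite ge0_integralZl//; last 2 first.
- by move=> x xI; apply: integral_ge0 => y yI; exact: k0.
- by rewrite lee_fin powR_ge0.
rewrite sw /L EFinM -muleA; apply: lee_wpmul2l; first by rewrite lee_fin powR_ge0.
rewrite -ge0_integralZl//; last 3 first.
- by apply/measurable_EFinP; exact: measurable_funTS.
- by move=> y _; rewrite lee_fin powR_ge0.
- by rewrite lee_fin ltW.
apply: ge0_le_integral_nomeas => y yI.
  by apply: integral_ge0 => x xI; exact: k0.
move: yI => /=; rewrite in_itv/= => /andP[y0 y1].
have -> : (\int[mu]_(x in `]0%R, 1%R]) k (x, y) =
    \int[mu]_(x in `]0%R, 1%R]) ((h y `^ p * y `^ q^-1)%:E * (x `^ (- q^-1) / (y + x))%:E))%E.
  by apply: eq_integral => x _; rewrite /k -EFinM/= mulrA [(y + x)%R]addrC.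
rewrite ge0_integralZl//; last 3 first.
- apply/measurable_EFinP; apply: measurable_funTS; apply: measurable_funM => //.
  by apply: measurable_funV_in; exact: measurable_funD.
- move=> x /=; rewrite in_itv/= => /andP[x0 _].
  by rewrite lee_fin divr_ge0 ?powR_ge0// addr_ge0// ltW.
- by rewrite lee_fin mulr_ge0 ?powR_ge0.
apply: (@le_trans _ _ ((h y `^ p * y `^ q^-1)%:E * (K * y `^ (- q^-1))%:E)%E).
  apply: lee_wpmul2l; first by rewrite lee_fin mulr_ge0 ?powR_ge0.
  by rewrite -KE; apply: integral_powR_kernel => //; rewrite y0.
rewrite -!EFinM lee_fin mulrACA -[_ * _ `^ (- _)]mulrC.
by rewrite -powRDp// addNr powRr0 mulr1 mulrC.
Qed.

End powers.

(** * Cauchy's formula and power series *)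

Section complex_modulus.
Context {R : realType}.
Local Notation C := (CC R).

Definition cofr (x : R) : C := (x%:C)%C.
Definition ii : C := ('i)%C.

Lemma cRe_C (x : R) : complex.Re (cofr x) = x. Proof. by []. Qed.
Lemma cIm_C (x : R) : complex.Im (cofr x) = 0. Proof. by []. Qed.
Lemma cRe_i : complex.Re ii = 0 :> R. Proof. by []. Qed.
Lemma cIm_i : complex.Im ii = 1 :> R. Proof. by []. Qed.
Lemma cReD (z w : C) : complex.Re (z + w) = complex.Re z + complex.Re w.
Proof. by case: z; case: w. Qed.
Lemma cImD (z w : C) : complex.Im (z + w) = complex.Im z + complex.Im w.
Proof. by case: z; case: w. Qed.
Lemma cReN (z : C) : complex.Re (- z) = - complex.Re z.
Proof. by case: z. Qed.
Lemma cImN (z : C) : complex.Im (- z) = - complex.Im z.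
Proof. by case: z. Qed.
Lemma cReM (z w : C) :
  complex.Re (z * w) = complex.Re z * complex.Re w - complex.Im z * complex.Im w.
Proof. by case: z; case: w. Qed.
Lemma cImM (z w : C) :
  complex.Im (z * w) = complex.Re z * complex.Im w + complex.Im z * complex.Re w.
Proof. by case: z; case: w. Qed.
Lemma cRe0 : complex.Re (0 : C) = 0. Proof. by []. Qed.
Lemma cIm0 : complex.Im (0 : C) = 0. Proof. by []. Qed.
Lemma cRe1 : complex.Re (1 : C) = 1. Proof. by []. Qed.
Lemma cIm1 : complex.Im (1 : C) = 0. Proof. by []. Qed.
Definition cE := (cRe_C, cIm_C, cRe_i, cIm_i, cReM, cImM, cReN, cImN, cReD, cImD, cRe0, cIm0, cRe1, cIm1).

Lemma cext (z w : C) : complex.Re z = complex.Re w -> complex.Im z = complex.Im w -> z = w.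
Proof. by case: z => a b; case: w => c d /= -> ->. Qed.

Lemma cofrD (x y : R) : cofr (x + y) = cofr x + cofr y.
Proof. by apply: cext; rewrite !cE ?addr0. Qed.
Lemma cofrN (x : R) : cofr (- x) = - cofr x.
Proof. by apply: cext; rewrite !cE ?oppr0. Qed.
Lemma cofrB (x y : R) : cofr (x - y) = cofr x - cofr y.
Proof. by rewrite cofrD cofrN. Qed.
Lemma cofrM (x y : R) : cofr (x * y) = cofr x * cofr y.
Proof. by apply: cext; rewrite !cE ?mulr0 ?mul0r ?subr0 ?addr0. Qed.
Lemma cofr0 : cofr 0 = 0. Proof. by []. Qed.
Lemma cofr1 : cofr 1 = 1. Proof. by []. Qed.
Lemma cofrX (x : R) n : cofr (x ^+ n) = cofr x ^+ n.
Proof. by elim: n => [|n IH]; rewrite ?cofr1// !exprS cofrM IH. Qed.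
Lemma cofr_nat n : cofr n%:R = n%:R.
Proof. by elim: n => [|n IH]; rewrite // -!natr1 cofrD IH. Qed.
Lemma cofr_inj : injective cofr. Proof. by move=> x y []. Qed.
Lemma cofrV (x : R) : cofr x^-1 = (cofr x)^-1.
Proof.
have [->|x0] := eqVneq x 0; first by rewrite cofr0 !invr0.
have cx : cofr x != 0 by apply: contra_neq x0 => /(congr1 (@complex.Re R)).
by apply: (mulfI cx); rewrite mulfV// -cofrM mulfV.
Qed.

Lemma cnormE (z : C) : `|z| = cofr (cmod z).
Proof. by case: z => a b. Qed.

Lemma cle_real (x y : R) : (cofr x <= cofr y) = (x <= y).
Proof. exact: lecR. Qed.
Lemma clt_real (x y : R) : (cofr x < cofr y) = (x < y).
Proof. exact: ltcR. Qed.

Lemma cpos_real (e : C) : 0 < e -> 0 < complex.Re e /\ e = cofr (complex.Re e).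
Proof.
move=> e0; have er : e = cofr (complex.Re e).
  apply: cext; rewrite !cE//; have : 0 <= e by exact: ltW.
  by case: (e) => a b; rewrite lecE /= => /andP[/eqP ->].
by split => //; rewrite -clt_real -er.
Qed.

Lemma cmod_ge0 (z : C) : 0 <= cmod z. Proof. exact: sqrtr_ge0. Qed.
Lemma cmod0 : cmod (0 : C) = 0.
Proof. by apply: cofr_inj; rewrite -cnormE normr0. Qed.
Lemma cmod1 : cmod (1 : C) = 1.
Proof. by apply: cofr_inj; rewrite -cnormE normr1. Qed.
Lemma cmodN (z : C) : cmod (- z) = cmod z.
Proof. by apply: cofr_inj; rewrite -!cnormE normrN. Qed.
Lemma cmodM (z w : C) : cmod (z * w) = cmod z * cmod w.
Proof. by apply: cofr_inj; rewrite cofrM -!cnormE normrM. Qed.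
Lemma cmodX (z : C) n : cmod (z ^+ n) = cmod z ^+ n.
Proof. by apply: cofr_inj; rewrite cofrX -!cnormE normrX. Qed.
Lemma cmodV (z : C) : cmod z^-1 = (cmod z)^-1.
Proof. by apply: cofr_inj; rewrite cofrV -!cnormE normfV. Qed.
Lemma cmodD (z w : C) : cmod (z + w) <= cmod z + cmod w.
Proof. by rewrite -cle_real cofrD -!cnormE ler_normD. Qed.
Lemma cmodB (z w : C) : cmod (z - w) <= cmod z + cmod w.
Proof. by rewrite -(cmodN w); exact: cmodD. Qed.
Lemma cmodBC (z w : C) : cmod (z - w) = cmod (w - z).
Proof. by rewrite -cmodN opprB. Qed.
Lemma cmodB_ge (z w : C) : cmod z - cmod w <= cmod (z - w).
Proof. by rewrite lerBlDr; apply: le_trans (cmodD _ _); rewrite subrK. Qed.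
Lemma cmod_eq0 (z : C) : (cmod z == 0) = (z == 0).
Proof. by rewrite -(inj_eq cofr_inj) -cnormE cofr0 normr_eq0. Qed.
Lemma cmod_gt0 (z : C) : (0 < cmod z) = (z != 0).
Proof. by rewrite lt_neqAle cmod_ge0 andbT eq_sym cmod_eq0. Qed.
Lemma cmod_real (x : R) : cmod (cofr x) = `|x|.
Proof. by rewrite /cmod !cE expr0n addr0 sqrtr_sqr. Qed.
Lemma cmod_pos (x : R) : 0 <= x -> cmod (cofr x) = x.
Proof. by move=> x0; rewrite cmod_real ger0_norm. Qed.
Lemma cmod_nat n : cmod (n%:R : C) = n%:R.
Proof. by rewrite -cofr_nat cmod_pos. Qed.
Lemma cmod_i : cmod ii = 1.
Proof. by rewrite /cmod !cE expr0n add0r expr1n sqrtr1. Qed.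
Lemma cmod_sqr (z : C) : cmod z ^+ 2 = complex.Re z ^+ 2 + complex.Im z ^+ 2.
Proof. by rewrite sqr_sqrtr// addr_ge0 ?sqr_ge0. Qed.
Lemma cRe_le (z : C) : `|complex.Re z| <= cmod z.
Proof. by rewrite -sqrtr_sqr ler_sqrt ?addr_ge0 ?sqr_ge0// lerDl sqr_ge0. Qed.
Lemma cIm_le (z : C) : `|complex.Im z| <= cmod z.
Proof. by rewrite -sqrtr_sqr ler_sqrt ?addr_ge0 ?sqr_ge0// lerDr sqr_ge0. Qed.
Lemma cmod_le (z : C) : cmod z <= `|complex.Re z| + `|complex.Im z|.
Proof.
rewrite -(@ler_pXn2r _ 2) ?nnegrE ?cmod_ge0 ?addr_ge0// cmod_sqr sqrrD !real_normK ?num_real//.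
by rewrite addrAC lerDl mulrn_wge0// mulr_ge0.
Qed.
Lemma cmod_sum (I : Type) (r : seq I) (P : pred I) (F : I -> C) :
  cmod (\sum_(i <- r | P i) F i) <= \sum_(i <- r | P i) cmod (F i).
Proof.
elim/big_ind2: _ => [|x1 x2 y1 y2 h1 h2|i _] //; first by rewrite cmod0.
by apply: le_trans (cmodD _ _) _; exact: lerD.
Qed.
Lemma cRe_sum (I : Type) (r : seq I) (P : pred I) (F : I -> C) :
  complex.Re (\sum_(i <- r | P i) F i) = \sum_(i <- r | P i) complex.Re (F i).
Proof. by elim/big_ind2: _ => [|x1 x2 y1 y2 h1 h2|i _] //; rewrite cE h1 h2. Qed.
Lemma cIm_sum (I : Type) (r : seq I) (P : pred I) (F : I -> C) :
  complex.Im (\sum_(i <- r | P i) F i) = \sum_(i <- r | P i) complex.Im (F i).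
Proof. by elim/big_ind2: _ => [|x1 x2 y1 y2 h1 h2|i _] //; rewrite cE h1 h2. Qed.

Lemma cge0_real (z : C) : 0 <= z -> z = cofr (complex.Re z) /\ 0 <= complex.Re z.
Proof.
case: z => a b; rewrite lecE /= => /andP[/eqP b0 a0]; split => //.
by rewrite /cofr b0.
Qed.

Lemma cvgCP (T : Type) (F : set_system T) (f : T -> C) (l : C) : Filter F ->
  (f @ F --> l) <->
  ((fun t => complex.Re (f t)) @ F --> complex.Re l) /\ ((fun t => complex.Im (f t)) @ F --> complex.Im l).
Proof.
move=> FF; split.
  move=> /cvgrPdist_lt h; split; apply/cvgrPdist_lt => e e0.
    have ce : 0 < cofr e by rewrite -cofr0 clt_real.
    apply: filterS (h _ ce) => t /=; rewrite cnormE clt_real; apply: le_lt_trans.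
    by rewrite -cReN -cReD; exact: cRe_le.
  have ce : 0 < cofr e by rewrite -cofr0 clt_real.
  apply: filterS (h _ ce) => t /=; rewrite cnormE clt_real; apply: le_lt_trans.
  by rewrite -cImN -cImD; exact: cIm_le.
move=> [/cvgrPdist_lt h1 /cvgrPdist_lt h2]; apply/cvgrPdist_lt => e /cpos_real[e0 ->].
have e2 : 0 < complex.Re e / 2 by rewrite divr_gt0.
near=> t; rewrite cnormE clt_real; apply: le_lt_trans (cmod_le _) _.
rewrite !cE [ltRHS]splitr; apply: ltrD; near: t; [exact: h1|exact: h2].
Unshelve. all: by end_near. Qed.

(* Complex derivability with real epsilons: the radii in the filters of [CC R] are complex numbers. *)
Definition hasd (f : C -> C) (z d : C) := forall e : R, 0 < e ->
  exists2 r : R, 0 < r & forall h : C, cmod h < r ->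
    cmod (f (z + h) - f z - d * h) <= e * cmod h.

Lemma hasd_derivable (f : C -> C) (z d : C) : hasd f z d ->
  derivable f z 1 /\ derive1 f z = d.
Proof.
move=> H.
have K : h^-1 *: ((f \o shift z) h - f z) @[h --> (0 : C)^'] --> d.
  apply/cvgrPdist_le => e /cpos_real[e0 ->].
  have [r r0 Hr] := H _ e0.
  have cr : 0 < cofr r by rewrite -cofr0 clt_real.
  exists (cofr r) => // h /=; rewrite sub0r normrN cnormE clt_real => hr h0.
  rewrite cnormE cle_real.
  have -> : d - h^-1 *: (f (h + z) - f z) = - (h^-1 * (f (z + h) - f z - d * h)).
    by rewrite (addrC h z) mulrBr [h^-1 * (d * h)]mulrCA mulVf// mulr1 opprB.
  rewrite cmodN cmodM cmodV ler_pdivrMl ?cmod_gt0// [cmod h * _]mulrC; exact: Hr.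
have K' : h^-1 *: ((f \o shift z) (h *: (1 : C)) - f z) @[h --> (0 : C)^'] --> d.
  by under eq_fun do rewrite [_ *: 1]mulr1.
by split; [apply/cvg_ex; exists d|rewrite /derive1; apply: cvg_lim].
Qed.

Lemma derivable_hasd (f : C -> C) (z : C) : derivable f z 1 -> hasd f z (derive1 f z).
Proof.
move=> H.
have : h^-1 *: ((f \o shift z) h - f z) @[h --> (0 : C)^'] --> derive1 f z.
  have := H; rewrite /derivable; under eq_fun do rewrite [_ *: 1]mulr1.
  by move=> h; exact: h.
move=> /cvgrPdist_le h e e0.
have ce : 0 < cofr e by rewrite -cofr0 clt_real.
have [rc /= /cpos_real[r0 rE] Hr] := h _ ce.
exists (complex.Re rc) => // k kr.
have [->|k0] := eqVneq k 0; first by rewrite addr0 subrr mulr0 subrr cmod0 mulr0.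
have := Hr k; rewrite /= sub0r normrN cnormE {1}rE clt_real => /(_ kr k0).
rewrite cnormE cle_real.
have -> : derive1 f z - k^-1 *: (f (k + z) - f z) = - (k^-1 * (f (z + k) - f z - derive1 f z * k)).
  by rewrite (addrC k z) mulrBr [k^-1 * (_ * k)]mulrCA mulVf// mulr1 opprB.
by rewrite cmodN cmodM cmodV ler_pdivrMl ?cmod_gt0// [cmod k * _]mulrC.
Qed.

Lemma hasd_near (f : C -> C) (z d : C) : hasd f z d -> forall e : R, 0 < e ->
  exists2 r : R, 0 < r & forall h : C, cmod h < r -> cmod (f (z + h) - f z) < e.
Proof.
move=> H e e0; have [r r0 Hr] := H 1 ltr01.
pose K := 1 + cmod d; have K0 : 0 < K by rewrite ltr_pwDl// cmod_ge0.
exists (Num.min r (e / K)); first by rewrite lt_min r0 divr_gt0.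
move=> h; rewrite lt_min => /andP[w1 w2].
have := Hr h w1; rewrite mul1r => hh.
have -> : f (z + h) - f z = (f (z + h) - f z - d * h) + d * h by rewrite subrK.
apply: le_lt_trans (cmodD _ _) _; rewrite cmodM.
apply: (@le_lt_trans _ _ (K * cmod h)); first by rewrite mulrDl mul1r lerD2r.
by rewrite mulrC -ltr_pdivlMr.
Qed.

Lemma hasd_continuous (f : C -> C) (z d : C) : hasd f z d -> {for z, continuous f}.
Proof.
move=> H; have FF : Filter (nbhs z) := nbhs_filter z.
apply/(@cvgrPdist_lt _ C _ (nbhs z) FF f (f z)) => e /cpos_real[e0 eE].
have [r r0 Hr] := hasd_near _ _ _ H _ e0.
have cr : 0 < cofr r by rewrite -cofr0 clt_real.
exists (cofr r) => // w /=; rewrite cnormE clt_real cmodBC => hw.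
by rewrite eE cnormE clt_real cmodBC; have := Hr _ hw; rewrite [z + _]addrC subrK.
Qed.

End complex_modulus.

(** * Goursat's bisection argument *)

Section bisection.
Context {R : realType}.

Let rect := (R * R * (R * R))%type.

(* Goursat's bisection, to be applied to the modulus of an integral along the boundary of a rectangle. *)
Lemma bisection_le0 (m : R -> R -> R -> R -> R) (a b c d : R) : a <= b -> c <= d ->
  (forall a' b' c' d', a <= a' -> a' <= b' -> b' <= b -> c <= c' -> c' <= d' -> d' <= d ->
    m a' b' c' d' <= m a' ((a' + b') / 2) c' ((c' + d') / 2) +
                     m ((a' + b') / 2) b' c' ((c' + d') / 2) +
                     m a' ((a' + b') / 2) ((c' + d') / 2) d' +
                     m ((a' + b') / 2) b' ((c' + d') / 2) d') ->
  (forall x y, a <= x <= b -> c <= y <= d -> forall e, 0 < e -> exists2 r, 0 < r &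
     forall a' b' c' d', a <= a' -> a' <= x <= b' -> b' <= b ->
       c <= c' -> c' <= y <= d' -> d' <= d ->
       b' - a' < r -> d' - c' < r -> m a' b' c' d' <= e * ((b' - a') + (d' - c')) ^+ 2) ->
  m a b c d <= 0.
Proof.
move=> ab cd sub loc; rewrite leNgt; apply/negP => m0.
pose M (q : rect) := m q.1.1 q.1.2 q.2.1 q.2.2.
pose mid1 (q : rect) := (q.1.1 + q.1.2) / 2.
pose mid2 (q : rect) := (q.2.1 + q.2.2) / 2.
pose q1 (q : rect) : rect := (q.1.1, mid1 q, (q.2.1, mid2 q)).
pose q2 (q : rect) : rect := (mid1 q, q.1.2, (q.2.1, mid2 q)).
pose q3 (q : rect) : rect := (q.1.1, mid1 q, (mid2 q, q.2.2)).
pose q4 (q : rect) : rect := (mid1 q, q.1.2, (mid2 q, q.2.2)).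
(* Keep the first quarter carrying at least a fourth of [m]. If the first three fail, subadditivity
   forces the last one to qualify. *)
pose step (q : rect) := if M q <= 4 * M (q1 q) then q1 q else if M q <= 4 * M (q2 q) then q2 q
  else if M q <= 4 * M (q3 q) then q3 q else q4 q.
pose s n := iter n step (a, b, (c, d)).
pose good (q : rect) := [/\ a <= q.1.1, q.1.1 <= q.1.2, q.1.2 <= b & [/\ c <= q.2.1, q.2.1 <= q.2.2 & q.2.2 <= d]].
have stepP q : good q -> [/\ good (step q), M q <= 4 * M (step q),
    q.1.1 <= (step q).1.1 /\ (step q).1.2 <= q.1.2,
    q.2.1 <= (step q).2.1 /\ (step q).2.2 <= q.2.2 &
    (step q).1.2 - (step q).1.1 = (q.1.2 - q.1.1) / 2 /\
    (step q).2.2 - (step q).2.1 = (q.2.2 - q.2.1) / 2].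
  move=> [g1 g2 g3 [g4 g5 g6]].
  have := sub _ _ _ _ g1 g2 g3 g4 g5 g6.
  rewrite -/(M q) -/(mid1 q) -/(mid2 q) -[m _ _ _ _]/(M (q1 q)).
  rewrite -[m (mid1 q) _ q.2.1 _]/(M (q2 q)) -[m _ (mid1 q) _ _]/(M (q3 q)) -[m (mid1 q) _ _ _]/(M (q4 q)).
  have h1 : q.1.1 <= mid1 q <= q.1.2 by rewrite /mid1; lra.
  have h2 : q.2.1 <= mid2 q <= q.2.2 by rewrite /mid2; lra.
  have /andP[h1a h1b] := h1; have /andP[h2a h2b] := h2.
  have e1 : mid1 q - q.1.1 = (q.1.2 - q.1.1) / 2 by rewrite /mid1; lra.
  have e2 : q.1.2 - mid1 q = (q.1.2 - q.1.1) / 2 by rewrite /mid1; lra.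
  have e3 : mid2 q - q.2.1 = (q.2.2 - q.2.1) / 2 by rewrite /mid2; lra.
  have e4 : q.2.2 - mid2 q = (q.2.2 - q.2.1) / 2 by rewrite /mid2; lra.
  move=> hs; rewrite /step; case: (leP (M q) (4 * M (q1 q))) => k1; first exact: (And5 (And4 g1 h1a (le_trans h1b g3) (And3 g4 h2a (le_trans h2b g6))) k1 (conj (lexx _) h1b) (conj (lexx _) h2b) (conj e1 e3)).
  case: (leP (M q) (4 * M (q2 q))) => k2; first exact: (And5 (And4 (le_trans g1 h1a) h1b g3 (And3 g4 h2a (le_trans h2b g6))) k2 (conj h1a (lexx _)) (conj (lexx _) h2b) (conj e2 e3)).
  case: (leP (M q) (4 * M (q3 q))) => k3; first exact: (And5 (And4 g1 h1a (le_trans h1b g3) (And3 (le_trans g4 h2a) h2b g6)) k3 (conj (lexx _) h1b) (conj h2a (lexx _)) (conj e1 e4)).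
  have k4 : M q <= 4 * M (q4 q) by clear -hs k1 k2 k3; lra.
  exact: (And5 (And4 (le_trans g1 h1a) h1b g3 (And3 (le_trans g4 h2a) h2b g6)) k4 (conj h1a (lexx _)) (conj h2a (lexx _)) (conj e2 e4)).
have gs n : good (s n).
  elim: n => [|n IH]; first by split => //=; split.
  by rewrite /s iterS; case: (stepP _ IH).
have sS n : s n.+1 = step (s n) by [].
have mono n k : (n <= k)%N -> [/\ (s n).1.1 <= (s k).1.1, (s k).1.2 <= (s n).1.2,
    (s n).2.1 <= (s k).2.1 & (s k).2.2 <= (s n).2.2].
  move=> /subnKC <-; elim: (k - n)%N => [|j [i1 i2 i3 i4]]; first by rewrite addn0.
  rewrite addnS sS; have [_ _ [j1 j2] [j3 j4] _] := stepP _ (gs (n + j)%N).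
  by split; [exact: le_trans j1|exact: le_trans i2|exact: le_trans j3|exact: le_trans i4].
have cross n k : (s n).1.1 <= (s k).1.2 /\ (s n).2.1 <= (s k).2.2.
  have [i1 _ i3 _] := mono _ _ (leq_maxl n k).
  have [_ i2 _ i4] := mono _ _ (leq_maxr n k).
  have [_ g1 _ [_ g2 _]] := gs (maxn n k).
  by split; [apply: le_trans i1 (le_trans g1 i2)|apply: le_trans i3 (le_trans g2 i4)].
have Mn n : m a b c d <= 4 ^+ n * M (s n).
  elim: n => [|n IH]; first by rewrite expr0 mul1r.
  apply: le_trans IH _; have [_ h _ _ _] := stepP _ (gs n).
  by rewrite sS exprSr -mulrA ler_pM2l// exprn_gt0.
have wn n : (s n).1.2 - (s n).1.1 = (b - a) / 2 ^+ n /\ (s n).2.2 - (s n).2.1 = (d - c) / 2 ^+ n.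
  elim: n => [|n [IH1 IH2]]; first by rewrite expr0 !divr1.
  rewrite sS; have [_ _ _ _ [-> ->]] := stepP _ (gs n).
  by rewrite IH1 IH2 exprSr invfM !mulrA.
pose x := sup (range (fun n => (s n).1.1)).
pose y := sup (range (fun n => (s n).2.1)).
have hx n : (s n).1.1 <= x <= (s n).1.2.
  apply/andP; split.
    apply: ub_le_sup; last by exists n.
    by exists (s 0).1.2 => _ [k _ <-]; case: (cross k 0).
  apply: ge_sup; first by exists (s 0).1.1, 0.
  by move=> _ [k _ <-]; case: (cross k n).
have hy n : (s n).2.1 <= y <= (s n).2.2.
  apply/andP; split.
    apply: ub_le_sup; last by exists n.
    by exists (s 0).2.2 => _ [k _ <-]; case: (cross k 0).
  apply: ge_sup; first by exists (s 0).2.1, 0.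
  by move=> _ [k _ <-]; case: (cross k n).
(* The added 1 keeps W positive for a degenerate rectangle. *)
pose W := (b - a) + (d - c) + 1.
have W1 : 0 < W by rewrite /W; lra.
(* At generation n the sides have shrunk by 2^n, so the local bound times 4^n is at most this
   tolerance times W^2, that is, half of m: a contradiction. *)
have e0 : 0 < m a b c d / (2 * W ^+ 2) by rewrite divr_gt0// mulr_gt0// exprn_gt0.
have [r r0 Hr] := loc x y (hx 0) (hy 0) _ e0.
have [n hn] : exists n, W / 2 ^+ n < r.
  exists (Num.trunc (W / r)).+1.
  rewrite ltr_pdivrMr ?exprn_gt0// mulrC -ltr_pdivrMr//.
  apply: lt_trans (truncnS_gt _) _; rewrite -natrX ltr_nat; exact: ltn_expl.
have [w1 w2] := wn n; have [g1 g2 g3 [g4 g5 g6]] := gs n.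
have p2 : 0 < (2 : R) ^+ n by rewrite exprn_gt0.
have le1 : (b - a) / 2 ^+ n <= W / 2 ^+ n by rewrite ler_pM2r ?invr_gt0//; rewrite /W; lra.
have le2 : (d - c) / 2 ^+ n <= W / 2 ^+ n by rewrite ler_pM2r ?invr_gt0//; rewrite /W; lra.
have := Hr _ _ _ _ g1 (hx n) g3 g4 (hy n) g6.
rewrite w1 w2 => /(_ (le_lt_trans le1 hn) (le_lt_trans le2 hn)).
rewrite -/(M (s n)) -mulrDl expr_div_n => h.
have := Mn n; apply/negP; rewrite -ltNge.
have p4 : 0 < (4 : R) ^+ n by rewrite exprn_gt0.
apply: le_lt_trans (ler_wpM2l (ltW p4) h) _.
rewrite -exprM mulnC exprM (_ : 2 ^+ 2 = 4 :> R); last by rewrite -natrX.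
set v := (b - a + (d - c)) ^+ 2.
have hv : v <= W ^+ 2 by rewrite lerXn2r ?nnegrE /W//; lra.
have -> : 4 ^+ n * (m a b c d / (2 * W ^+ 2) * (v / 4 ^+ n)) = m a b c d * (v / (2 * W ^+ 2)).
  by field; rewrite !gt_eqF// /W; lra.
rewrite -{2}(mulr1 (m a b c d)) ltr_pM2l// ltr_pdivrMr ?mulr_gt0 ?exprn_gt0// mul1r.
apply: le_lt_trans hv _; rewrite ltr_pMl ?exprn_gt0//; lra.
Qed.

End bisection.

Set Implicit Arguments.
Unset Strict Implicit.

(** * Integrals of complex functions over real segments *)

Section segment_integral.
Context {R : realType}.
Local Notation C := (CC R).
Local Notation mu := (@lebesgue_measure R).

Definition rseg (a b : R) (h : R -> R) : R := Rintegral mu `[a, b] h.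

Definition rcont (a b : R) (h : R -> R) := forall x, a <= x <= b -> {for x, continuous h}.

Lemma rcont_integrable (a b : R) (h : R -> R) : rcont a b h ->
  mu.-integrable `[a, b] (EFin \o h).
Proof.
move=> ch; apply: continuous_compact_integrable; first exact: segment_compact.
by apply: continuous_in_subspaceT => x; rewrite inE/= in_itv/=; exact: ch.
Qed.

Lemma eq_rseg (a b : R) (f g : R -> R) : (forall x, a <= x <= b -> f x = g x) ->
  rseg a b f = rseg a b g.
Proof. by move=> fg; apply: eq_Rintegral => x; rewrite inE/= in_itv/=; exact: fg. Qed.

Lemma rsegD (a b : R) (f g : R -> R) : rcont a b f -> rcont a b g ->
  rseg a b (fun t => f t + g t) = rseg a b f + rseg a b g.
Proof. by move=> /rcont_integrable cf /rcont_integrable cg; exact: RintegralD. Qed.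

Lemma rsegZ (a b k : R) (f : R -> R) : rcont a b f ->
  rseg a b (fun t => k * f t) = k * rseg a b f.
Proof. by move=> /rcont_integrable cf; exact: RintegralZl. Qed.

Lemma rcontZ (a b k : R) (f : R -> R) : rcont a b f -> rcont a b (fun t => k * f t).
Proof. by move=> cf x xab; refine (cvgM _ (cf x xab)); exact: cvg_cst. Qed.

Lemma rsegB (a b : R) (f g : R -> R) : rcont a b f -> rcont a b g ->
  rseg a b (fun t => f t - g t) = rseg a b f - rseg a b g.
Proof. by move=> /rcont_integrable cf /rcont_integrable cg; exact: RintegralB. Qed.

Lemma rseg_cst (a b r : R) : a <= b -> rseg a b (fun=> r) = r * (b - a).
Proof.
move=> ab; rewrite /rseg Rintegral_cst//=; congr (_ * _).
have [ab'|ba] := ltP a b.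
  by rewrite (@lebesgue_measure_itv R `[a, b])/= lte_fin ab'.
have -> : b = a by apply/le_anti; rewrite ab ba.
by rewrite set_itv1 lebesgue_measure_set1 subrr.
Qed.

Lemma rseg_split (a b c : R) (h : R -> R) : a <= b -> b <= c -> rcont a c h ->
  rseg a c h = rseg a b h + rseg b c h.
Proof.
move=> ab bc /rcont_integrable ih; rewrite /rseg.
have ibc : mu.-integrable `]b, c] (EFin \o h).
  apply: (@integrableS _ _ R mu `[a, c]%classic) => //.
  by move=> x /=; rewrite !in_itv/= => /andP[h1 h2]; apply/andP; split; lra.
rewrite -(Rintegral_itv_obnd_cbnd ibc).
have E : (`[a, c]%classic = `[a, b]%classic `|` `]b, c]%classic :> set R).
  apply/seteqP; split => x /=; rewrite !in_itv/=.
    by move=> /andP[-> ->]; rewrite andbT/=; case: (leP x b) => _; [left|right].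
  by case=> /andP[h1 h2]; apply/andP; split; lra.
rewrite E Rintegral_setU -?E//.
by apply/disj_setPS => x []/=; rewrite !in_itv/= => /andP[_ h1] /andP[h2 _]; lra.
Qed.

Lemma rseg_le (a b M : R) (h : R -> R) : a <= b -> rcont a b h ->
  (forall x, a <= x <= b -> `|h x| <= M) -> `|rseg a b h| <= M * (b - a).
Proof.
move=> ab ch hM; rewrite -rseg_cst//; have ih := rcont_integrable ch.
apply: le_trans (le_normr_Rintegral _ ih) _ => //.
apply: le_Rintegral => //.
- exact: integrable_norm ih.
- by apply: rcont_integrable => x _; exact: cvg_cst.
Qed.

Lemma rseg_le_int (a b : R) (h : R -> R) (g : R -> R) : rcont a b h ->
  (forall x, a <= x <= b -> `|h x| <= g x) ->
  (`|rseg a b h|%:E <= \int[mu]_(x in `[a, b]) (g x)%:E)%E.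
Proof.
move=> ch hg; have ih := rcont_integrable ch.
apply: (@le_trans _ _ (\int[mu]_(x in `[a, b]) `|h x|%:E)%E).
  rewrite /rseg EFin_normr_Rintegral//; apply: le_abse_integral => //.
  exact: (measurable_int mu ih).
by apply: ge0_le_integral_nomeas => x //=; rewrite in_itv/= lee_fin; exact: hg.
Qed.

Lemma rseg_FTC (a b : R) (F f : R -> R) : a <= b ->
  (forall x, a <= x <= b -> is_derive x 1 F (f x)) -> rcont a b f ->
  rseg a b f = F b - F a.
Proof. by move=> ab dF cf; rewrite /rseg /Rintegral (ge0_integral_FTC _ _ _ _ ab dF cf). Qed.

Definition cseg (a b : R) (h : R -> C) : C :=
  (rseg a b (fun t => complex.Re (h t)) +i* rseg a b (fun t => complex.Im (h t)))%C.

Lemma cReseg a b h : complex.Re (cseg a b h) = rseg a b (fun t => complex.Re (h t)).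
Proof. by []. Qed.
Lemma cImseg a b h : complex.Im (cseg a b h) = rseg a b (fun t => complex.Im (h t)).
Proof. by []. Qed.

Record ccont (a b : R) (h : R -> C) : Prop := Ccont {
  ccontE : forall x, a <= x <= b -> {for x, continuous h} }.

Lemma ccontP (h : R -> C) (x : R) : {for x, continuous h} <->
  {for x, continuous (fun t => complex.Re (h t))} /\
  {for x, continuous (fun t => complex.Im (h t))}.
Proof. exact: cvgCP. Qed.

Lemma ccont_rcont (a b : R) (h : R -> C) : ccont a b h ->
  rcont a b (fun t => complex.Re (h t)) /\ rcont a b (fun t => complex.Im (h t)).
Proof. by move=> [ch]; split=> x /ch /ccontP[]. Qed.

Lemma ccontD (a b : R) (f g : R -> C) : ccont a b f -> ccont a b g ->
  ccont a b (fun t => f t + g t).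
Proof. by move=> [cf] [cg]; split => x xab; exact: (cvgD (cf x xab) (cg x xab)). Qed.
Lemma ccontN (a b : R) (f : R -> C) : ccont a b f -> ccont a b (fun t => - f t).
Proof. by move=> [cf]; split => x xab; exact: (cvgN (cf x xab)). Qed.
Lemma ccontB (a b : R) (f g : R -> C) : ccont a b f -> ccont a b g ->
  ccont a b (fun t => f t - g t).
Proof. by move=> cf cg; apply: (@ccontD _ _ f (fun t => - g t)) => //; exact: ccontN. Qed.
Lemma ccontM (a b : R) (f g : R -> C) : ccont a b f -> ccont a b g ->
  ccont a b (fun t => f t * g t).
Proof. by move=> [cf] [cg]; split => x xab; exact: (cvgM (cf x xab) (cg x xab)). Qed.
Lemma ccont_cst (a b : R) (k : C) : ccont a b (fun=> k).
Proof. by split => x _; exact: cvg_cst. Qed.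
Lemma ccontX (a b : R) (f : R -> C) n : ccont a b f -> ccont a b (fun t => f t ^+ n).
Proof.
move=> cf; elim: n => [|n IH]; first exact: ccont_cst.
by under eq_fun do rewrite exprS; exact: (@ccontM _ _ f (fun t => f t ^+ n)).
Qed.
Lemma ccontV (a b : R) (f : R -> C) : ccont a b f -> (forall x, a <= x <= b -> f x != 0) ->
  ccont a b (fun t => (f t)^-1).
Proof. by move=> [cf] f0; split => x xab; exact: (cvgV (f0 x xab) (cf x xab)). Qed.
Lemma ccont_cofr (a b : R) (f : R -> R) :
  (forall x, a <= x <= b -> {for x, continuous f}) -> ccont a b (fun t => cofr (f t)).
Proof.
by move=> cf; split => x xab; apply/ccontP; split => /=; [exact: cf|exact: cvg_cst].
Qed.
Lemma ccont_comp (a b : R) (f : R -> C) (F : C -> C) (d : R -> C) : ccont a b f ->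
  (forall x, a <= x <= b -> hasd F (f x) (d x)) -> ccont a b (fun t => F (f t)).
Proof.
move=> [cf] dF; split => x xab; apply: (@continuous_comp _ _ _ f F x); first exact: cf.
exact: hasd_continuous (dF x xab).
Qed.
Lemma ccont_sub (a b a' b' : R) (f : R -> C) : ccont a b f -> a <= a' -> b' <= b ->
  ccont a' b' f.
Proof.
by move=> [cf] aa bb; split => x /andP[h1 h2]; apply: cf; rewrite (le_trans aa)// (le_trans h2).
Qed.

Lemma eq_cseg (a b : R) (f g : R -> C) : (forall x, a <= x <= b -> f x = g x) ->
  cseg a b f = cseg a b g.
Proof.
by move=> fg; apply: cext; rewrite ?cReseg ?cImseg; apply: eq_rseg => x xab; rewrite fg.
Qed.

Lemma csegD (a b : R) (f g : R -> C) : ccont a b f -> ccont a b g ->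
  cseg a b (fun t => f t + g t) = cseg a b f + cseg a b g.
Proof.
move=> /ccont_rcont[f1 f2] /ccont_rcont[g1 g2].
apply: cext; rewrite !cE ?cReseg ?cImseg -rsegD//; apply: eq_rseg => x _; by rewrite !cE.
Qed.

Lemma csegZ (a b : R) (k : C) (f : R -> C) : ccont a b f ->
  cseg a b (fun t => k * f t) = k * cseg a b f.
Proof.
move=> /ccont_rcont[f1 f2].
apply: cext; rewrite !cE ?cReseg ?cImseg -!rsegZ//.
  rewrite -rsegB; [|exact: rcontZ|exact: rcontZ].
  by apply: eq_rseg => x _; rewrite !cE.
rewrite -rsegD; [|exact: rcontZ|exact: rcontZ].
by apply: eq_rseg => x _; rewrite !cE.
Qed.

Lemma csegN (a b : R) (f : R -> C) : ccont a b f -> cseg a b (fun t => - f t) = - cseg a b f.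
Proof.
move=> cf; rewrite -[RHS]mulN1r -csegZ//; apply: eq_cseg => x _; by rewrite mulN1r.
Qed.

Lemma csegB (a b : R) (f g : R -> C) : ccont a b f -> ccont a b g ->
  cseg a b (fun t => f t - g t) = cseg a b f - cseg a b g.
Proof.
by move=> cf cg; rewrite (@csegD _ _ f (fun t => - g t))// ?csegN//; exact: ccontN.
Qed.

Lemma ccont_sum (a b : R) n (f : nat -> R -> C) : (forall k, ccont a b (f k)) ->
  ccont a b (fun t => \sum_(k < n) f k t).
Proof.
move=> cf; elim: n => [|n IH].
  by under eq_fun do rewrite big_ord0; exact: ccont_cst.
under eq_fun do rewrite big_ord_recr/=.
exact: (@ccontD _ _ (fun t => \sum_(k < n) f k t) (f n)).
Qed.

Lemma cseg_cst (a b : R) (k : C) : a <= b -> cseg a b (fun=> k) = k * cofr (b - a).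
Proof.
by move=> ab; apply: cext; [rewrite cReseg|rewrite cImseg]; rewrite rseg_cst// !cE mulr0 ?subr0 ?add0r.
Qed.

Lemma cseg_sum (a b : R) n (f : nat -> R -> C) : a <= b -> (forall k, ccont a b (f k)) ->
  cseg a b (fun t => \sum_(k < n) f k t) = \sum_(k < n) cseg a b (f k).
Proof.
move=> ab cf; elim: n => [|n IH].
  rewrite big_ord0 (@eq_cseg _ _ _ (fun=> 0)); last by move=> x _; rewrite big_ord0.
  by rewrite cseg_cst// mul0r.
rewrite big_ord_recr/= -IH -csegD//; last exact: ccont_sum.
by apply: eq_cseg => x _; rewrite big_ord_recr.
Qed.

Lemma cseg_split (a b c : R) (f : R -> C) : a <= b -> b <= c -> ccont a c f ->
  cseg a c f = cseg a b f + cseg b c f.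
Proof.
move=> ab bc /ccont_rcont[f1 f2].
by apply: cext; rewrite !cE ?cReseg ?cImseg; exact: rseg_split.
Qed.

(** The factor 2 comes from estimating the real and imaginary parts separately; constants are
    immaterial in the comparability to be proved. *)
Lemma cseg_le (a b M : R) (f : R -> C) : a <= b -> ccont a b f ->
  (forall x, a <= x <= b -> cmod (f x) <= M) -> cmod (cseg a b f) <= 2 * M * (b - a).
Proof.
move=> ab /ccont_rcont[f1 f2] fM.
apply: le_trans (cmod_le _) _; rewrite -mulrA mulr_natl mulr2n cReseg cImseg.
apply: lerD; apply: rseg_le => // x xab.
- exact: le_trans (cRe_le _) (fM x xab).
- exact: le_trans (cIm_le _) (fM x xab).
Qed.

Lemma cseg_le_int (a b : R) (f : R -> C) : ccont a b f ->
  ((cmod (cseg a b f))%:E <= 2%:E * \int[mu]_(x in `[a, b]) (cmod (f x))%:E)%E.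
Proof.
move=> /ccont_rcont[f1 f2]; rewrite (mule_natl _ 2) mule2n.
apply: (@le_trans _ _ (`|complex.Re (cseg a b f)| + `|complex.Im (cseg a b f)|)%:E).
  by rewrite lee_fin; exact: cmod_le.
rewrite EFinD cReseg cImseg; apply: leeD; apply: rseg_le_int => // x _.
- exact: cRe_le.
- exact: cIm_le.
Qed.

Record cder (h : R -> C) (x : R) (d : C) : Prop := Cder {
  cder_re : is_derive x 1 (fun t => complex.Re (h t)) (complex.Re d) ;
  cder_im : is_derive x 1 (fun t => complex.Im (h t)) (complex.Im d) }.

Lemma is_deriveMM (f1 f2 g1 g2 : R -> R) (x : R) (a1 a2 b1 b2 : R) :
  is_derive x 1 f1 a1 -> is_derive x 1 f2 a2 -> is_derive x 1 g1 b1 -> is_derive x 1 g2 b2 ->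
  is_derive x 1 (fun t => f1 t * f2 t + g1 t * g2 t) (f1 x * a2 + f2 x * a1 + (g1 x * b2 + g2 x * b1)).
Proof.
move=> h1 h2 h3 h4.
have H := is_deriveD (is_deriveM h1 h2) (is_deriveM h3 h4).
exact: H.
Qed.

Lemma cderM (f g : R -> C) x df dg : cder f x df -> cder g x dg ->
  cder (fun t => f t * g t) x (df * g x + f x * dg).
Proof.
move=> [f1 f2] [g1 g2]; split.
  have f2' : is_derive x 1 (fun t => - complex.Im (f t)) (- complex.Im df) := is_deriveN f2.
  rewrite (_ : (fun t => _) = (fun t => complex.Re (f t) * complex.Re (g t) +
     (- complex.Im (f t)) * complex.Im (g t))); last first.
    by apply/funext => t; rewrite cReM mulNr.
  apply: is_derive_eq (is_deriveMM f1 g1 f2' g2) _.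
  by rewrite !cE; ring.
rewrite (_ : (fun t => _) = (fun t => complex.Re (f t) * complex.Im (g t) +
     complex.Im (f t) * complex.Re (g t))); last first.
  by apply/funext => t; rewrite cImM.
apply: is_derive_eq (is_deriveMM f1 g2 f2 g1) _.
by rewrite !cE; ring.
Qed.

Lemma cder_cst (k : C) x : cder (fun=> k) x 0.
Proof. by split; apply: is_derive_cst. Qed.

Lemma cderZ (k : C) (f : R -> C) x df : cder f x df -> cder (fun t => k * f t) x (k * df).
Proof.
move=> h; have := @cderM (fun=> k) f x 0 df (cder_cst k x) h.
by rewrite mul0r add0r.
Qed.

Lemma cderB (f : R -> C) (k : C) x df : cder f x df -> cder (fun t => f t - k) x df.
Proof.
move=> [f1 f2]; split.
  rewrite (_ : (fun t => _) = (fun t => complex.Re (f t) + cst (- complex.Re k) t)); last first.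
    by apply/funext => t; rewrite cReD cReN.
  by apply: is_derive_eq (is_deriveD f1 (is_derive_cst _ _ _)) _; rewrite addr0.
rewrite (_ : (fun t => _) = (fun t => complex.Im (f t) + cst (- complex.Im k) t)); last first.
  by apply/funext => t; rewrite cImD cImN.
by apply: is_derive_eq (is_deriveD f2 (is_derive_cst _ _ _)) _; rewrite addr0.
Qed.

Lemma cderX (f : R -> C) x df n : cder f x df ->
  cder (fun t => f t ^+ n.+1) x (n.+1%:R * f x ^+ n * df).
Proof.
move=> h; elim: n => [|n IH]; first by rewrite expr0 !mul1r.
have := @cderM f (fun t => f t ^+ n.+1) x _ _ h IH.
have -> : (fun t => f t * f t ^+ n.+1) = (fun t => f t ^+ n.+2).
  by apply/funext => t; rewrite -exprS.
have -> : df * f x ^+ n.+1 + f x * (n.+1%:R * f x ^+ n * df) = n.+2%:R * f x ^+ n.+1 * df.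
  have -> : n.+2%:R = n.+1%:R + 1 :> C by rewrite natr1.
  by rewrite exprS; move: (n.+1%:R : C) (f x ^+ n) (f x) => c d e; ring.
by [].
Qed.

Lemma is_derive_cont (f : R -> R) (x d : R) : is_derive x 1 f d -> {for x, continuous f}.
Proof. by move=> [df _]; apply: differentiable_continuous; apply/derivable1_diffP. Qed.

Lemma cder_cont (a b : R) (f df : R -> C) :
  (forall x, a <= x <= b -> cder f x (df x)) -> ccont a b f.
Proof.
move=> H; split => x /H[f1 f2]; apply/ccontP.
by split; [exact: is_derive_cont f1|exact: is_derive_cont f2].
Qed.

Lemma cseg_FTC (a b : R) (F f : R -> C) : a <= b ->
  (forall x, a <= x <= b -> cder F x (f x)) -> ccont a b f ->
  cseg a b f = F b - F a.
Proof.
move=> ab dF /ccont_rcont[f1 f2]; apply: cext; [rewrite cReseg|rewrite cImseg].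
  by rewrite (rseg_FTC ab (F := fun t => complex.Re (F t)) _ f1)// ?cReD ?cReN// => x /dF[].
by rewrite (rseg_FTC ab (F := fun t => complex.Im (F t)) _ f2)// ?cImD ?cImN// => x /dF[].
Qed.

End segment_integral.

(** * Cauchy's theorem on deformed rectangles *)

Section goursat.
Context {R : realType}.
Local Notation C := (CC R).

(** The four integrals e, f, t, v along the inner sides of the subdivision cancel. *)
Let quad_ring (a b c d e f p q r s t v : C) :
  a + b - (c + d) + (p + q - (r + s)) =
  a - e + (t - r) + (b - f + (p - t)) + (e - c + (v - s)) + (f - d + (q - v)).
Proof. by ring. Qed.

(* Cauchy's theorem for F(w) / (w - a) on the image of [l0, 1] x [u0, u1] under (l, u) |-> a + l psi(u). *)
Lemma goursat_rect (F : C -> C) (a : C) (psi dpsi : R -> C) (l0 u0 u1 P : R) :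
  0 < l0 -> l0 <= 1 -> u0 <= u1 -> 0 < P ->
  (forall u, u0 <= u <= u1 -> cder psi u (dpsi u)) -> ccont u0 u1 dpsi ->
  (forall u, u0 <= u <= u1 -> psi u != 0) ->
  (forall u, u0 <= u <= u1 -> cmod (psi u) <= P) ->
  (forall u, u0 <= u <= u1 -> cmod (dpsi u) <= P) ->
  (forall u, u0 <= u <= u1 -> cmod (dpsi u / psi u) <= P) ->
  (forall l u, l0 <= l <= 1 -> u0 <= u <= u1 -> exists d, hasd F (a + cofr l * psi u) d) ->
  cseg l0 1 (fun l => F (a + cofr l * psi u0) * (cofr l)^-1) -
  cseg l0 1 (fun l => F (a + cofr l * psi u1) * (cofr l)^-1) +
  (cseg u0 u1 (fun u => F (a + cofr 1 * psi u) * (dpsi u / psi u)) -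
   cseg u0 u1 (fun u => F (a + cofr l0 * psi u) * (dpsi u / psi u))) = 0.
Proof.
move=> l00 l01 u01 P0 dps cdpsi psi0 psiP dpsiP kP dF.
have cpsi : ccont u0 u1 psi by exact: cder_cont dps.
pose G (l u : R) := F (a + cofr l * psi u).
pose A l1 l2 u := cseg l1 l2 (fun l => G l u * (cofr l)^-1).
pose B s1 s2 l := cseg s1 s2 (fun u => G l u * (dpsi u / psi u)).
pose circ l1 l2 s1 s2 := A l1 l2 s1 - A l1 l2 s2 + (B s1 s2 l2 - B s1 s2 l1).
have -> : cseg l0 1 (fun l => F (a + cofr l * psi u0) * (cofr l)^-1) -
  cseg l0 1 (fun l => F (a + cofr l * psi u1) * (cofr l)^-1) +
  (cseg u0 u1 (fun u => F (a + cofr 1 * psi u) * (dpsi u / psi u)) -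
   cseg u0 u1 (fun u => F (a + cofr l0 * psi u) * (dpsi u / psi u))) = circ l0 1 u0 u1 by [].
have cid (p q : R) : ccont p q cofr by apply: (@ccont_cofr R p q id) => x _; exact: cvg_id.
have cidV p q : l0 <= p -> ccont p q (fun l => (cofr l)^-1).
  move=> lp; apply: ccontV => // x /andP[px _]; rewrite -cmod_eq0 cmod_real normr_eq0 gt_eqF//.
  exact: lt_le_trans l00 (le_trans lp px).
have ck s1 s2 : u0 <= s1 -> s2 <= u1 -> ccont s1 s2 (fun u => dpsi u / psi u).
  move=> h1 h2; apply: (@ccontM _ _ _ dpsi (fun u => (psi u)^-1)); first exact: ccont_sub cdpsi h1 h2.
  apply: ccontV; first exact: ccont_sub cpsi h1 h2.
  by move=> x /andP[x1 x2]; apply: psi0; rewrite (le_trans h1)// (le_trans x2).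
have cPl p q u : u0 <= u <= u1 -> ccont p q (fun l => a + cofr l * psi u).
  move=> hu; apply: (@ccontD _ _ _ (fun=> a) (fun l => cofr l * psi u)); first exact: ccont_cst.
  by apply: (@ccontM _ _ _ cofr (fun=> psi u)) => //; exact: ccont_cst.
have cPu s1 s2 l : u0 <= s1 -> s2 <= u1 -> ccont s1 s2 (fun u => a + cofr l * psi u).
  move=> h1 h2; apply: (@ccontD _ _ _ (fun=> a) (fun u => cofr l * psi u)); first exact: ccont_cst.
  apply: (@ccontM _ _ _ (fun=> cofr l) psi); first exact: ccont_cst.
  exact: ccont_sub cpsi h1 h2.
(* A derivative chosen for every z at once; off the image of the rectangle the value 0 is a mere
   default. *)
have /choice[D DP] : forall z : C, exists d, (exists l u, [/\ l0 <= l <= 1, u0 <= u <= u1 & z = a + cofr l * psi u]) -> hasd F z d.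
  move=> z; have [[l [u [hl hu zE]]]|nz] := pselect (exists l u, [/\ l0 <= l <= 1, u0 <= u <= u1 & z = a + cofr l * psi u]).
    by have [d hd] := dF l u hl hu; exists d => _; rewrite zE.
  by exists 0.
have dG l u : l0 <= l <= 1 -> u0 <= u <= u1 -> hasd F (a + cofr l * psi u) (D (a + cofr l * psi u)).
  by move=> hl hu; apply: DP; exists l, u.
have cGl p q u : l0 <= p -> q <= 1 -> u0 <= u <= u1 -> ccont p q (fun l => G l u).
  move=> h1 h2 hu; apply: (@ccont_comp _ p q (fun l => a + cofr l * psi u) F (fun l => D (a + cofr l * psi u))).
    exact: cPl.
  by move=> x /andP[x1 x2]; apply: dG => //; rewrite (le_trans h1)// (le_trans x2).
have cGu s1 s2 l : u0 <= s1 -> s2 <= u1 -> l0 <= l <= 1 -> ccont s1 s2 (fun u => G l u).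
  move=> h1 h2 hl; apply: (@ccont_comp _ s1 s2 (fun u => a + cofr l * psi u) F (fun u => D (a + cofr l * psi u))).
    exact: cPu.
  by move=> x /andP[x1 x2]; apply: dG => //; rewrite (le_trans h1)// (le_trans x2).
have cA p q u : l0 <= p -> q <= 1 -> u0 <= u <= u1 -> ccont p q (fun l => G l u * (cofr l)^-1).
  move=> h1 h2 hu; apply: (@ccontM _ _ _ (fun l => G l u) (fun l => (cofr l)^-1)); first exact: cGl.
  exact: cidV.
have cB s1 s2 l : u0 <= s1 -> s2 <= u1 -> l0 <= l <= 1 -> ccont s1 s2 (fun u => G l u * (dpsi u / psi u)).
  move=> h1 h2 hl; apply: (@ccontM _ _ _ (fun u => G l u) (fun u => dpsi u / psi u)); first exact: cGu.
  exact: ck.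
have lip u v : u0 <= u <= u1 -> u0 <= v <= u1 -> cmod (psi u - psi v) <= 2 * P * `|u - v|.
  wlog vu : u v / v <= u => [H hu hv|].
    by case: (leP v u) => h; [exact: H|rewrite cmodBC distrC; apply: H => //; exact: ltW].
  move=> /andP[hu1 hu2] /andP[hv1 hv2].
  rewrite -(@cseg_FTC R v u psi dpsi)//; last 2 first.
  - by move=> x /andP[x1 x2]; apply: dps; rewrite (le_trans hv1)// (le_trans x2).
  - exact: ccont_sub cdpsi hv1 hu2.
  rewrite ger0_norm ?subr_ge0//; apply: cseg_le => //; first exact: ccont_sub cdpsi hv1 hu2.
  by move=> x /andP[x1 x2]; apply: dpsiP; rewrite (le_trans hv1)// (le_trans x2).
apply/eqP; rewrite -cmod_eq0 eq_le cmod_ge0 andbT.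
apply: (@bisection_le0 R (fun l1 l2 s1 s2 => cmod (circ l1 l2 s1 s2)) l0 1 u0 u1 l01 u01).
  move=> l1 l2 s1 s2 hl1 l12 hl2 hs1 s12 hs2.
  set m := (l1 + l2) / 2; set n := (s1 + s2) / 2.
  have [m1 m2] : l1 <= m /\ m <= l2 by rewrite /m; split; lra.
  have [n1 n2] : s1 <= n /\ n <= s2 by rewrite /n; split; lra.
  have hA u : u0 <= u <= u1 -> A l1 l2 u = A l1 m u + A m l2 u.
    by move=> hu; apply: cseg_split => //; exact: cA.
  have hB l : l0 <= l <= 1 -> B s1 s2 l = B s1 n l + B n s2 l.
    by move=> hl; apply: cseg_split => //; exact: cB.
  have -> : circ l1 l2 s1 s2 = circ l1 m s1 n + circ m l2 s1 n + circ l1 m n s2 + circ m l2 n s2.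
    rewrite /circ (hA s1) ?(hA s2) ?(hB l1) ?(hB l2).
    - exact: quad_ring.
    - by rewrite (le_trans hl1 l12).
    - by rewrite hl1 (le_trans l12).
    - by rewrite (le_trans hs1 s12).
    - by rewrite hs1 (le_trans s12).
  apply: le_trans (cmodD _ _) _; rewrite lerD2r.
  apply: le_trans (cmodD _ _) _; rewrite lerD2r.
  exact: cmodD.
move=> l u hl hu e e0.
set z0 := a + cofr l * psi u.
(* The error E is at most (e / Q) * 2 P w. The four sides together multiply this by 4 (1 / l0 + P)
   w, so that this Q leaves e w^2. *)
pose Q := 8 * P * (l0^-1 + P).
have Q0 : 0 < Q by rewrite /Q !mulr_gt0 ?addr_gt0 ?invr_gt0.
have e'0 : 0 < e / Q by rewrite divr_gt0.
have [r0 r00 Hr] := dG l u hl hu _ e'0.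
(* The image of a small rectangle stays within 2 P w of z0, and w is less than twice this radius. *)
exists (r0 / (4 * P)); first by rewrite divr_gt0 ?mulr_gt0.
move=> l1 l2 s1 s2 hl1 /andP[l1l ll2] hl2 hs1 /andP[s1u us2] hs2 w1r w2r.
have l12 : l1 <= l2 by exact: le_trans l1l ll2.
have s12 : s1 <= s2 by exact: le_trans s1u us2.
pose w := (l2 - l1) + (s2 - s1).
have w0 : 0 <= w by rewrite addr_ge0 ?subr_ge0.
pose E l' u' := G l' u' - F z0 - D z0 * (a + cofr l' * psi u' - z0).
(* The affine part of F at z0 is K0 + D z0 * (l psi(u)). Against dw / (w - a) it integrates in
   closed form and cancels along the four sides, so only E contributes to [circ]. *)
pose K0 := F z0 + D z0 * (a - z0).
have GE l' u' : G l' u' = E l' u' + (K0 + D z0 * (cofr l' * psi u')) by rewrite /E /K0; ring.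
have hEle l' u' : l1 <= l' <= l2 -> s1 <= u' <= s2 -> cmod (E l' u') <= e / Q * (2 * P * w).
  move=> /andP[hl'1 hl'2] /andP[hu'1 hu'2].
  have hu' : u0 <= u' <= u1 by rewrite (le_trans hs1)// (le_trans hu'2).
  have h : cmod (a + cofr l' * psi u' - z0) <= 2 * P * w.
    have -> : a + cofr l' * psi u' - z0 = cofr (l' - l) * psi u' + cofr l * (psi u' - psi u).
      by rewrite cofrB /z0; ring.
    apply: le_trans (cmodD _ _) _; rewrite !cmodM !cmod_real.
    have t1 : `|l' - l| * cmod (psi u') <= (l2 - l1) * P.
      apply: ler_pM => //; first exact: cmod_ge0; last exact: psiP.
      by rewrite ler_norml; apply/andP; split; lra.
    have t2 : `|l| * cmod (psi u' - psi u) <= 1 * (2 * P * (s2 - s1)).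
      apply: ler_pM => //; first exact: cmod_ge0.
        by rewrite ler_norml; case/andP: hl => *; apply/andP; split; lra.
      apply: le_trans (lip _ _ hu' hu) _; apply: ler_wpM2l; first by rewrite mulr_ge0// ltW.
      by rewrite ler_norml; apply/andP; split; lra.
    apply: le_trans (lerD t1 t2) _; rewrite mul1r /w.
    have hh : 0 <= (l2 - l1) * P by rewrite mulr_ge0 ?subr_ge0// ltW.
    by clear -hh; lra.
  have hlt : cmod (a + cofr l' * psi u' - z0) < r0.
    apply: le_lt_trans h _.
    apply: (@lt_le_trans _ _ (2 * P * (r0 / (4 * P) + r0 / (4 * P)))).
      by rewrite ltr_pM2l ?mulr_gt0// ltrD.
    by rewrite (_ : 2 * P * (r0 / (4 * P) + r0 / (4 * P)) = r0)//; field; rewrite gt_eqF.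
  have := Hr _ hlt; rewrite [z0 + _]addrC subrK => hh.
  apply: le_trans hh _; apply: ler_wpM2l => //; exact: ltW.
have cEl u' : u0 <= u' <= u1 -> ccont l1 l2 (fun l => E l u').
  move=> hu'; apply: (@ccontB _ _ _ (fun l => G l u' - F z0) (fun l => D z0 * (a + cofr l * psi u' - z0))).
    by apply: (@ccontB _ _ _ (fun l => G l u') (fun=> F z0)); [exact: cGl|exact: ccont_cst].
  apply: (@ccontM _ _ _ (fun=> D z0) (fun l => a + cofr l * psi u' - z0)); first exact: ccont_cst.
  by apply: (@ccontB _ _ _ (fun l => a + cofr l * psi u') (fun=> z0)); [exact: cPl|exact: ccont_cst].
have cEu l' : l0 <= l' <= 1 -> ccont s1 s2 (fun u => E l' u).
  move=> hl'; apply: (@ccontB _ _ _ (fun u => G l' u - F z0) (fun u => D z0 * (a + cofr l' * psi u - z0))).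
    by apply: (@ccontB _ _ _ (fun u => G l' u) (fun=> F z0)); [exact: cGu|exact: ccont_cst].
  apply: (@ccontM _ _ _ (fun=> D z0) (fun u => a + cofr l' * psi u - z0)); first exact: ccont_cst.
  by apply: (@ccontB _ _ _ (fun u => a + cofr l' * psi u) (fun=> z0)); [exact: cPu|exact: ccont_cst].
have cEA u' : u0 <= u' <= u1 -> ccont l1 l2 (fun l => E l u' * (cofr l)^-1).
  move=> hu'; apply: (@ccontM _ _ _ (fun l => E l u') (fun l => (cofr l)^-1)); [exact: cEl|exact: cidV].
have cEB l' : l0 <= l' <= 1 -> ccont s1 s2 (fun u => E l' u * (dpsi u / psi u)).
  move=> hl'; apply: (@ccontM _ _ _ (fun u => E l' u) (fun u => dpsi u / psi u)); [exact: cEu|exact: ck].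
have hA u' : u0 <= u' <= u1 -> A l1 l2 u' = cseg l1 l2 (fun l => E l u' * (cofr l)^-1) +
    (K0 * cseg l1 l2 (fun l => (cofr l)^-1) + D z0 * psi u' * cofr (l2 - l1)).
  move=> hu'; rewrite -csegZ; last exact: cidV.
  rewrite -cseg_cst// -csegD; [|by apply: (@ccontM _ _ _ (fun=> K0)); [exact: ccont_cst|exact: cidV]|exact: ccont_cst].
  rewrite -csegD; [|exact: cEA|].
    apply: eq_cseg => x /andP[x1 x2]; rewrite GE mulrDl; congr (_ + _).
    have x0 : cofr x != 0.
      by rewrite -cmod_eq0 cmod_real normr_eq0 gt_eqF// (lt_le_trans l00)// (le_trans hl1).
    by rewrite mulrDl; congr (_ + _); field.
  apply: (@ccontD _ _ _ (fun t => K0 * (cofr t)^-1) (fun=> D z0 * psi u')); last exact: ccont_cst.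
  by apply: (@ccontM _ _ _ (fun=> K0)); [exact: ccont_cst|exact: cidV].
have cdp : ccont s1 s2 dpsi by exact: ccont_sub cdpsi hs1 hs2.
have hB l' : l0 <= l' <= 1 -> B s1 s2 l' = cseg s1 s2 (fun u => E l' u * (dpsi u / psi u)) +
    (K0 * cseg s1 s2 (fun u => dpsi u / psi u) + D z0 * cofr l' * (psi s2 - psi s1)).
  move=> hl'; rewrite -csegZ; last exact: ck.
  rewrite -(@cseg_FTC R s1 s2 psi dpsi)//; last first.
    by move=> x /andP[x1 x2]; apply: dps; rewrite (le_trans hs1)// (le_trans x2).
  rewrite -csegZ//.
  have c1 : ccont s1 s2 (fun u => K0 * (dpsi u / psi u)).
    by apply: (@ccontM _ _ _ (fun=> K0)); [exact: ccont_cst|exact: ck].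
  have c2 : ccont s1 s2 (fun u => D z0 * cofr l' * dpsi u).
    by apply: (@ccontM _ _ _ (fun=> D z0 * cofr l')); [exact: ccont_cst|].
  rewrite -(csegD c1 c2) -csegD; [|exact: cEB|].
    apply: eq_cseg => x /andP[x1 x2]; rewrite GE mulrDl; congr (_ + _).
    have x0 : psi x != 0 by apply: psi0; rewrite (le_trans hs1)// (le_trans x2).
    by rewrite mulrDl; congr (_ + _); field.
  exact: (@ccontD _ _ _ (fun u => K0 * (dpsi u / psi u)) (fun u => D z0 * cofr l' * dpsi u)).
have hs1' : u0 <= s1 <= u1 by rewrite hs1 (le_trans s12).
have hs2' : u0 <= s2 <= u1 by rewrite (le_trans hs1 s12).
have hl1' : l0 <= l1 <= 1 by rewrite hl1 (le_trans l12).
have hl2' : l0 <= l2 <= 1 by rewrite (le_trans hl1 l12).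
have -> : circ l1 l2 s1 s2 = cseg l1 l2 (fun l => E l s1 * (cofr l)^-1)
   - cseg l1 l2 (fun l => E l s2 * (cofr l)^-1)
   + (cseg s1 s2 (fun u => E l2 u * (dpsi u / psi u)) - cseg s1 s2 (fun u => E l1 u * (dpsi u / psi u))).
  by rewrite /circ (hA s1)// (hA s2)// (hB l1)// (hB l2)// cofrB; ring.
pose M : R := e / Q * (2 * P * w).
have M0 : 0 <= M.
  by apply: mulr_ge0; [exact: ltW|apply: mulr_ge0 => //; rewrite mulr_ge0// ltW].
have bA u' : s1 <= u' <= s2 -> cmod (cseg l1 l2 (fun l => E l u' * (cofr l)^-1)) <= 2 * (M / l0) * (l2 - l1).
  move=> /andP[hu'1 hu'2]; have hu' : u0 <= u' <= u1 by rewrite (le_trans hs1)// (le_trans hu'2).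
  apply: cseg_le => //; first exact: cEA.
  move=> x /andP[x1 x2]; have xp : l0 <= x by exact: le_trans x1.
  rewrite cmodM cmodV cmod_real ger0_norm ?(le_trans (ltW l00))//.
  apply: ler_pM; rewrite ?cmod_ge0 ?invr_ge0 ?(le_trans (ltW l00))//.
    by apply: hEle; rewrite ?x1 ?x2 ?hu'1 ?hu'2.
  by rewrite lef_pV2 ?posrE ?(lt_le_trans l00).
have bB l' : l1 <= l' <= l2 -> cmod (cseg s1 s2 (fun u => E l' u * (dpsi u / psi u))) <= 2 * (M * P) * (s2 - s1).
  move=> /andP[hl'1 hl'2]; have hl' : l0 <= l' <= 1 by rewrite (le_trans hl1)// (le_trans hl'2).
  apply: cseg_le => //; first exact: cEB.
  move=> x /andP[x1 x2]; rewrite cmodM; apply: ler_pM; rewrite ?cmod_ge0//.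
    by apply: hEle; rewrite ?x1 ?x2 ?hl'1 ?hl'2.
  by apply: kP; rewrite (le_trans hs1)// (le_trans x2).
have tri (z1 z2 z3 z4 : C) : cmod (z1 - z2 + (z3 - z4)) <= cmod z1 + cmod z2 + (cmod z3 + cmod z4).
  by apply: le_trans (cmodD _ _) _; apply: lerD; exact: cmodB.
apply: le_trans (tri _ _ _ _) _.
have [lx1 lx2] := (lexx s1, lexx l1).
apply: le_trans (lerD (lerD (bA s1 _) (bA s2 _)) (lerD (bB l2 _) (bB l1 _))) _; rewrite ?lexx ?s12 ?l12//.
have -> : 2 * (M / l0) * (l2 - l1) + 2 * (M / l0) * (l2 - l1) + (2 * (M * P) * (s2 - s1) + 2 * (M * P) * (s2 - s1))
   = 4 * M * (l0^-1 * (l2 - l1) + P * (s2 - s1)) by field; rewrite gt_eqF.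
have -> : e * w ^+ 2 = 4 * M * ((l0^-1 + P) * w).
  have -> : e * w ^+ 2 = e / Q * Q * w ^+ 2 by rewrite divfK// gt_eqF.
  by rewrite /M; move: (e / Q) => x; rewrite /Q; ring.
apply: ler_wpM2l; first by rewrite mulr_ge0.
have lV : 0 <= l0^-1 by rewrite invr_ge0 ltW.
have x1 : 0 <= l2 - l1 by rewrite subr_ge0.
have x2 : 0 <= s2 - s1 by rewrite subr_ge0.
have := mulr_ge0 lV x2; have := mulr_ge0 (ltW P0) x1; rewrite /w; lra.
Qed.

End goursat.

(** * Cauchy's formula on the unit circle *)

Section arcs.
Context {R : realType}.
Local Notation C := (CC R).

(** With u the tangent of the angle, [ct] is its cosine and [wt] the derivative of the angle in
    u. *)
Definition ct (u : R) : R := (Num.sqrt (1 + u ^+ 2))^-1.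
Definition wt (u : R) : R := (1 + u ^+ 2)^-1.
(* The arc of the unit circle with |arg| <= pi / 4, with the tangent u of the argument as parameter. *)
Definition earc (u : R) : C := (ct u +i* (u * ct u))%C.
Definition arc (k : nat) (u : R) : C := ii ^+ k * earc u.

Lemma ct_gt0 u : 0 < ct u.
Proof. by rewrite invr_gt0 sqrtr_gt0 ltr_wpDr// sqr_ge0. Qed.
Lemma wt_gt0 u : 0 < wt u.
Proof. by rewrite invr_gt0 ltr_wpDr// sqr_ge0. Qed.
Lemma ct_sqr u : ct u ^+ 2 = wt u.
Proof. by rewrite /ct /wt exprVn sqr_sqrtr// addr_ge0 ?sqr_ge0. Qed.
Lemma wt_le1 u : wt u <= 1.
Proof. by rewrite invf_le1 ?lerDl ?sqr_ge0// ltr_wpDr// sqr_ge0. Qed.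
Lemma wt_ge2 u : -1 <= u <= 1 -> 2^-1 <= wt u.
Proof.
move=> hu; rewrite lef_pV2 ?posrE ?ltr_wpDr ?sqr_ge0//.
have : u ^+ 2 <= 1 by rewrite -(expr1n _ 2) -real_normK ?num_real// lerXn2r ?nnegrE// ler_norml.
lra.
Qed.
Lemma cmod_earc u : cmod (earc u) = 1.
Proof.
rewrite /cmod /earc /= exprMn -{1}(mul1r (ct u ^+ 2)) -mulrDl ct_sqr /wt mulfV ?sqrtr1//.
by rewrite gt_eqF// ltr_wpDr// sqr_ge0.
Qed.
Lemma cmod_arc k u : cmod (arc k u) = 1.
Proof. by rewrite /arc cmodM cmodX cmod_i expr1n mul1r cmod_earc. Qed.
Lemma arc_neq0 k u : arc k u != 0.
Proof. by rewrite -cmod_eq0 cmod_arc oner_eq0. Qed.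

Lemma cRe_earc u : complex.Re (earc u) = ct u. Proof. by []. Qed.
Lemma cIm_earc u : complex.Im (earc u) = u * ct u. Proof. by []. Qed.

Lemma earc_end : earc 1 = ii * earc (-1).
Proof. have e : ct (-1) = ct 1 by rewrite /ct sqrrN.
apply: cext.
  by rewrite cReM !cRe_earc cIm_earc cRe_i cIm_i e; ring.
by rewrite cImM cRe_earc !cIm_earc cRe_i cIm_i e; ring. Qed.
Lemma arc_end k : arc k 1 = arc k.+1 (-1).
Proof. by rewrite /arc earc_end exprSr mulrA. Qed.
Lemma ii4 : ii ^+ 4 = 1 :> C.
Proof.
have -> : ii ^+ 4 = (ii * ii) * (ii * ii) :> C by rewrite !exprS expr0; ring.
by apply: cext; rewrite !cE; ring.
Qed.
Lemma arc4 u : arc 4 u = arc 0 u.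
Proof. by rewrite /arc ii4 expr0. Qed.

Lemma is_derive_ct (u : R) : is_derive u 1 ct (- (u * ct u) * wt u).
Proof.
have s0 : 0 < 1 + u ^+ 2 by rewrite ltr_wpDr// sqr_ge0.
have q0 : Num.sqrt (1 + u ^+ 2) != 0 by rewrite gt_eqF// sqrtr_gt0.
have d1 : is_derive u 1 (fun v : R => 1 + v ^+ 2) (2 * u).
  have H : is_derive u 1 (fun v : R => 1 + v ^+ 2) (0 + (u * 1 + u * 1)) :=
    is_deriveD (is_derive_cst (1 : R) u 1) (is_deriveM (is_derive_id u 1) (is_derive_id u 1)).
  by apply: is_derive_eq H _; ring.
have d2 : is_derive u 1 (Num.sqrt \o (fun v : R => 1 + v ^+ 2))
    ((2 * Num.sqrt (1 + u ^+ 2))^-1 * (2 * u)).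
  by apply: is_derive1_comp; exact: is_derive1_sqrt.
have d3 := @is_deriveV _ (Num.sqrt \o (fun v : R => 1 + v ^+ 2)) u _ 1 q0 d2.
apply: is_derive_eq d3 _; rewrite /GRing.scale/= /ct /wt.
rewrite -[X in _ / X](sqr_sqrtr (ltW s0)) /=; field; exact: q0.
Qed.

Lemma cder_earc (u : R) : cder earc u (ii * cofr (wt u) * earc u).
Proof.
have dc := is_derive_ct u; split.
  by apply: is_derive_eq dc _; rewrite cReM cReM cImM cRe_earc cIm_earc cRe_i cIm_i cRe_C cIm_C; ring.
have H : is_derive u 1 (fun v => v * ct v) (u * (- (u * ct u) * wt u) + ct u * 1).
  exact: (is_deriveM (is_derive_id u 1) dc).
apply: is_derive_eq H _; rewrite cImM cReM cImM cRe_earc cIm_earc cRe_i cIm_i cRe_C cIm_C.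
have h : wt u * (1 + u ^+ 2) = 1 by rewrite mulVf// gt_eqF// ltr_wpDr// sqr_ge0.
have -> : ct u * 1 = ct u * (wt u * (1 + u ^+ 2)) by rewrite h.
by ring.
Qed.

Lemma cder_arc k (u : R) : cder (arc k) u (ii * cofr (wt u) * arc k u).
Proof.
have := cderZ (ii ^+ k) (cder_earc u).
by rewrite (_ : ii ^+ k * _ = ii * cofr (wt u) * arc k u)// /arc; ring.
Qed.

Lemma is_derive_wt (u : R) : exists d, is_derive u 1 wt d.
Proof.
have s0 : 1 + u ^+ 2 != 0 :> R by rewrite gt_eqF// ltr_wpDr// sqr_ge0.
have d1 : is_derive u 1 (fun v : R => 1 + v ^+ 2) (2 * u).
  have H : is_derive u 1 (fun v : R => 1 + v ^+ 2) (0 + (u * 1 + u * 1)) :=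
    is_deriveD (is_derive_cst (1 : R) u 1) (is_deriveM (is_derive_id u 1) (is_derive_id u 1)).
  by apply: is_derive_eq H _; ring.
have d3 := @is_deriveV _ (fun v : R => 1 + v ^+ 2) u _ 1 s0 d1.
by eexists; exact: d3.
Qed.

Lemma ccont_arc a b k : ccont a b (arc k).
Proof. by apply: cder_cont => u _; exact: cder_arc. Qed.
Lemma ccont_wt a b : ccont a b (fun u => cofr (wt u)).
Proof. by apply: ccont_cofr => u _; have [d hd] := is_derive_wt u; exact: is_derive_cont hd. Qed.
Lemma ccont_iwt a b : ccont a b (fun u => ii * cofr (wt u)).
Proof. by apply: (@ccontM _ _ _ (fun=> ii)); [exact: ccont_cst|exact: ccont_wt]. Qed.

(* Cauchy kernel of the four arcs: [dz / (z - a)] pulled back by [arc k] *)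
Definition ker (a : C) (k : nat) (u : R) : C := ii * cofr (wt u) * arc k u / (arc k u - a).

Lemma arc_sub_ge (a : C) k u : 1 - cmod a <= cmod (arc k u - a).
Proof. by rewrite -(cmod_arc k u); exact: cmodB_ge. Qed.

Lemma arc_sub_neq0 (a : C) k u : cmod a < 1 -> arc k u - a != 0.
Proof.
move=> a1; rewrite -cmod_gt0; apply: lt_le_trans (arc_sub_ge _ _ _); by rewrite subr_gt0.
Qed.

Lemma cmod_ker (a : C) k u : cmod a < 1 -> cmod (ker a k u) <= (cmod (arc k u - a))^-1.
Proof.
move=> a1; rewrite /ker cmodM cmodM cmod_arc cmodM cmod_i cmodV mul1r mulr1 cmod_pos ?(ltW (wt_gt0 _))//.
by rewrite ler_piMl ?wt_le1// invr_ge0 cmod_ge0.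
Qed.

Lemma ccont_ker a b (z : C) k : cmod z < 1 -> ccont a b (ker z k).
Proof.
move=> z1; apply: (@ccontM _ _ _ (fun u => ii * cofr (wt u) * arc k u) (fun u => (arc k u - z)^-1)).
  by apply: (@ccontM _ _ _ (fun u => ii * cofr (wt u)) (arc k)); [exact: ccont_iwt|exact: ccont_arc].
apply: ccontV => [|x _]; last exact: arc_sub_neq0.
by apply: (@ccontB _ _ _ (arc k) (fun=> z)); [exact: ccont_arc|exact: ccont_cst].
Qed.

Let tele_ring (x0 x1 x2 x3 p0 p1 p2 p3 q0 q1 q2 q3 : C) :
  p0 + p1 + p2 + p3 - (q0 + q1 + q2 + q3) =
  (x0 - x1 + (p0 - q0)) + (x1 - x2 + (p1 - q1)) + ((x2 - x3 + (p2 - q2)) + (x3 - x0 + (p3 - q3))).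
Proof. by ring. Qed.

(** The circle is contracted towards a along a + l (arc - a). By [goursat_rect] the integral is the
    same for l = 1 and l = l0: the radial sides cancel because each arc starts where the previous
    one ends. For small l0, F is close to F(a) by continuity. *)
Lemma cauchy_arcs (F : C -> C) (a : C) : cmod a < 1 ->
  (forall z, cmod z <= 1 -> exists d, hasd F z d) ->
  \sum_(k < 4) cseg (-1) 1 (fun u => F (arc k u) * ker a k u) =
  F a * \sum_(k < 4) cseg (-1) 1 (ker a k).
Proof.
move=> a1 dF.
pose psi k u := arc k u - a.
pose P := (1 - cmod a)^-1 + 2.
have a1' : 0 < 1 - cmod a by rewrite subr_gt0.
have P0 : 0 < P by rewrite addr_gt0 ?invr_gt0.
have P2 : 2 <= P by rewrite lerDr invr_ge0 ltW.
have psiP k u : cmod (psi k u) <= P.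
  apply: le_trans (cmodB _ _) _; rewrite cmod_arc; apply: le_trans P2.
  by rewrite -[2]/(1 + 1) lerD2l ltW.
have dpsiP k u : cmod (ii * cofr (wt u) * arc k u) <= P.
  rewrite cmodM cmod_arc cmodM cmod_i mul1r mulr1 cmod_pos ?(ltW (wt_gt0 _))//.
  by apply: le_trans (wt_le1 u) _; apply: le_trans P2; rewrite ler1n.
have kP k u : cmod (ker a k u) <= P.
  apply: le_trans (cmod_ker _ _ a1) _.
  apply: (@le_trans _ _ (1 - cmod a)^-1); last by rewrite lerDl.
  rewrite lef_pV2 ?posrE ?cmod_gt0 ?arc_sub_neq0//; exact: arc_sub_ge.
have seg1 l k u : 0 <= l <= 1 -> cmod (a + cofr l * psi k u) <= 1.
  move=> /andP[l0 l1].
  have -> : a + cofr l * psi k u = cofr (1 - l) * a + cofr l * arc k u.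
    by rewrite /psi cofrB; ring.
  apply: le_trans (cmodD _ _) _; rewrite cmodM [cmod (cofr l * _)]cmodM cmod_arc mulr1 !cmod_pos ?subr_ge0//.
  have : (1 - l) * cmod a <= (1 - l) * 1 by rewrite ler_wpM2l ?subr_ge0// ltW.
  lra.
have dG l k u : 0 <= l <= 1 -> exists d, hasd F (a + cofr l * psi k u) d.
  by move=> hl; apply: dF; exact: seg1.
have ck k : ccont (-1) 1 (ker a k) by exact: ccont_ker.
have cFk l k : 0 <= l <= 1 -> ccont (-1) 1 (fun u => F (a + cofr l * psi k u)).
  move=> hl; have /choice[d hd] := fun u => dG l k u hl.
  apply: (@ccont_comp _ _ _ (fun u => a + cofr l * psi k u) F d) => //.
  apply: (@ccontD _ _ _ (fun=> a)); first exact: ccont_cst.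
  apply: (@ccontM _ _ _ (fun=> cofr l)); first exact: ccont_cst.
  by apply: (@ccontB _ _ _ (arc k) (fun=> a)); [exact: ccont_arc|exact: ccont_cst].
have cFkk l k : 0 <= l <= 1 -> ccont (-1) 1 (fun u => F (a + cofr l * psi k u) * ker a k u).
  by move=> hl; apply: (@ccontM _ _ _ (fun u => F (a + cofr l * psi k u))); [exact: cFk|].
pose S l := \sum_(k < 4) cseg (-1) 1 (fun u => F (a + cofr l * psi k u) * ker a k u).
have SE l0 : 0 < l0 -> l0 <= 1 -> S 1 = S l0.
  move=> l00 l01.
  pose A k u := cseg l0 1 (fun l => F (a + cofr l * psi k u) * (cofr l)^-1).
  have H k : A k (-1) - A k 1 + (cseg (-1) 1 (fun u => F (a + cofr 1 * psi k u) * ker a k u) -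
     cseg (-1) 1 (fun u => F (a + cofr l0 * psi k u) * ker a k u)) = 0.
    apply: (@goursat_rect R F a (psi k) (fun u => ii * cofr (wt u) * arc k u) l0 (-1) 1 P) => //.
    - by move=> u _; apply: cderB; exact: cder_arc.
    - by apply: (@ccontM _ _ _ (fun u => ii * cofr (wt u)) (arc k)); [exact: ccont_iwt|exact: ccont_arc].
    - by move=> u _; exact: arc_sub_neq0.
    - by move=> u _; exact: kP.
    - by move=> l u /andP[h1 h2] _; apply: dG; rewrite (le_trans (ltW l00)).
  have E k : A k 1 = A k.+1 (-1) by rewrite /A /psi arc_end.
  have E4 : A 4%N (-1) = A 0%N (-1) by rewrite /A /psi arc4.
  apply/eqP; rewrite -subr_eq0 /S !big_ord_recr !big_ord0 /= !add0r; apply/eqP.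
  have := congr2 +%R (congr2 +%R (H 0%N) (H 1%N)) (congr2 +%R (H 2%N) (H 3%N)).
  rewrite !addr0 !E E4 => <-.
  exact: tele_ring.
have S1 : S 1 = \sum_(k < 4) cseg (-1) 1 (fun u => F (arc k u) * ker a k u).
  apply: eq_bigr => k _; apply: eq_cseg => u _; congr (F _ * _).
  by rewrite /psi cofr1 mul1r addrC subrK.
rewrite -S1; apply/eqP; rewrite -subr_eq0 -cmod_eq0 eq_le cmod_ge0 andbT.
apply/ler_addgt0Pr => e e0; rewrite add0r.
have [d hd] := dF a (ltW a1).
(* Each arc contributes at most 2 * e' P * 2, twice the bound times the length of [-1, 1]; this is e
   / 4. *)
pose e' := e / (16 * P).
have e'0 : 0 < e' by rewrite divr_gt0 ?mulr_gt0.
have [r r0 Hr] := hasd_near _ _ _ hd _ e'0.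
(* Since |arc - a| <= P, the contracted circle lies within r / 2 of a. *)
pose l0 := Num.min 1 (r / (2 * P)).
have l00 : 0 < l0 by rewrite lt_min ltr01 divr_gt0 ?mulr_gt0.
have l01 : l0 <= 1 by rewrite ge_min lexx.
have l0r : l0 <= r / (2 * P) by rewrite ge_min lexx orbT.
have hl0 : 0 <= l0 <= 1 by rewrite ltW.
rewrite (SE l0 l00 l01) /S mulr_sumr -sumrB.
apply: le_trans (cmod_sum _ _ _ _) _.
have -> : e = \sum_(k < 4) (e / 4).
  by rewrite sumr_const card_ord -mulr_natr; field.
apply: ler_sum => k _.
rewrite -csegZ// -csegB//; last 2 first.
- exact: cFkk.
- by apply: (@ccontM _ _ _ (fun=> F a)); [exact: ccont_cst|].
apply: (@le_trans _ _ (2 * (e' * P) * (1 - -1))); last first.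
  by rewrite (_ : 2 * (e' * P) * (1 - -1) = e / 4)// /e'; field; rewrite gt_eqF.
apply: cseg_le.
- by lra.
- apply: (@ccontB _ _ _ (fun u => F (a + cofr l0 * psi k u) * ker a k u) (fun u => F a * ker a k u)).
    exact: cFkk.
  by apply: (@ccontM _ _ _ (fun=> F a)); [exact: ccont_cst|].
move=> u _; rewrite -mulrBl cmodM; apply: ler_pM; rewrite ?cmod_ge0//.
have h1 : cmod (cofr l0 * psi k u) < r.
  rewrite cmodM cmod_pos ?(ltW l00)//; apply: (@le_lt_trans _ _ (r / (2 * P) * P)).
    by apply: ler_pM; rewrite ?cmod_ge0 ?(ltW l00).
  rewrite (_ : r / (2 * P) * P = r / 2); last by field; rewrite gt_eqF.
  by rewrite ltr_pdivrMr// ltr_pMr// ltr1n.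
exact: ltW (Hr _ h1).
Qed.

End arcs.

(** * Geometric tails *)

Section geometric_tails.
Context {R : realType}.

Lemma expr_small (t e : R) : 0 <= t < 1 -> 0 < e -> exists N, t ^+ N < e.
Proof.
move=> /andP[t0 t1] e0.
have : (fun n => t ^+ n) @ \oo --> (0 : R) by apply: cvg_expr; rewrite ger0_norm.
move=> /cvgrPdist_lt /(_ e e0) [N _ HN]; exists N.
by have := HN N (leqnn N); rewrite /= sub0r normrN ger0_norm ?exprn_ge0.
Qed.

(** This replaces passages to the limit: identities and bounds for infinite series are proved on
    partial sums up to an explicit geometric error. *)
Lemma le_geometric_tail (x B A t : R) : 0 <= t < 1 -> (forall N, x <= B + A * t ^+ N) -> x <= B.
Proof.
move=> ht H; apply/ler_addgt0Pr => e e0.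
have A0 : 0 < `|A| + 1 by rewrite ltr_wpDl.
have [N hN] := expr_small ht (divr_gt0 e0 A0).
apply: le_trans (H N) _; rewrite lerD2l.
have tN : 0 <= t ^+ N by rewrite exprn_ge0//; case/andP: ht.
apply: (@le_trans _ _ ((`|A| + 1) * t ^+ N)).
  by rewrite ler_wpM2r// (le_trans (ler_norm A))// lerDl.
by rewrite mulrC -ler_pdivlMr// ltW.
Qed.

Lemma geometric_sum_le (t : R) N : 0 <= t < 1 -> \sum_(i < N) t ^+ i <= (1 - t)^-1.
Proof.
move=> /andP[t0 t1]; have h : 0 < 1 - t by rewrite subr_gt0.
have -> : \sum_(i < N) t ^+ i = (1 - t ^+ N) / (1 - t).
  apply: (mulIf (lt0r_neq0 h)); rewrite divfK ?lt0r_neq0//.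
  elim: N => [|N IH]; first by rewrite big_ord0 expr0 mul0r subrr.
  by rewrite big_ord_recr/= mulrDl IH exprSr; ring.
by rewrite ler_piMl ?invr_ge0 ?(ltW h)// gerBl exprn_ge0.
Qed.

(** Bernoulli's inequality n x <= (1 + x)^n turns n^2 t^n into x^-2 ((1 + x)^2 t)^n. The choice x =
    (1 - t) / 4 keeps (1 + x)^2 t below 1, because (1 + x)^2 <= 1 + 3 x. *)
Lemma sqr_pow_le (t : R) : 0 < t < 1 -> exists K s : R, [/\ 0 < K, 0 < s < 1 &
  forall n, n%:R ^+ 2 * t ^+ n <= K * s ^+ n].
Proof.
move=> /andP[t0 t1].
pose x := (1 - t) / 4; have x0 : 0 < x by rewrite divr_gt0// subr_gt0.
exists (x ^- 2), ((1 + x) ^+ 2 * t); split.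
- by rewrite invr_gt0 exprn_gt0.
- have x1 : x < 1 by rewrite /x; lra.
  apply/andP; split; first by rewrite mulr_gt0// exprn_gt0// addr_gt0.
  have h1 : (1 + x) ^+ 2 <= 1 + 3 * x.
    have : x * x <= x * 1 by rewrite ler_pM2l// ltW.
    by rewrite expr2; lra.
  apply: le_lt_trans (ler_wpM2r (ltW t0) h1) _.
  have : x * t <= x by rewrite ler_piMr// ltW.
  by rewrite /x; lra.
- move=> n; have -> : x ^- 2 * ((1 + x) ^+ 2 * t) ^+ n = x ^- 2 * ((1 + x) ^+ n) ^+ 2 * t ^+ n.
    by have -> : ((1 + x) ^+ 2 * t) ^+ n = ((1 + x) ^+ n) ^+ 2 * t ^+ n; rewrite ?mulrA// exprMn exprAC.
  rewrite ler_wpM2r ?exprn_ge0 ?(ltW t0)// mulrC ler_pdivlMr ?exprn_gt0//.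
  have p1 : 0 <= (1 + x) ^+ n by rewrite exprn_ge0// addr_ge0// ltW.
  have p2 : 0 <= n%:R * x by rewrite mulr_ge0// ltW.
  rewrite -exprMn; apply: lerXn2r; rewrite ?nnegrE// {p1 p2}.
  elim: n => [|n IH]; first by rewrite mul0r expr0.
  rewrite exprS mulrDl mul1r -natr1 mulrDl mul1r.
  apply: lerD => //; rewrite ler_peMr ?(ltW x0)//.
  by rewrite exprn_ege1// lerDl ltW.
Qed.

End geometric_tails.

(** * Taylor expansion from Cauchy's formula *)

Section cauchy_coefficients.
Context {R : realType}.
Local Notation C := (CC R).

(** The conjugate of [earc], hence its inverse; written in coordinates so that it can be
    differentiated componentwise. *)
Definition iearc (u : R) : C := (ct u +i* (- (u * ct u)))%C.
Definition iarc (k : nat) (u : R) : C := (- ii) ^+ k * iearc u.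

Lemma iarcE k u : iarc k u = (arc k u)^-1.
Proof.
have e : iearc u * earc u = 1.
  have h : wt u * (1 + u ^+ 2) = 1 by rewrite mulVf// gt_eqF// ltr_wpDr// sqr_ge0.
  apply: cext => /=; last by ring.
  by rewrite -h -ct_sqr; ring.
have i2 : (- ii) * ii = 1 :> C by apply: cext; [rewrite cReM cReN cImN cRe_i cIm_i cRe1|rewrite cImM cReN cImN cRe_i cIm_i cIm1]; ring.
have : iarc k u * arc k u = 1.
  by rewrite /iarc /arc mulrACA -exprMn i2 expr1n mul1r e.
by move=> h; apply: (mulIf (arc_neq0 k u)); rewrite h mulVf// arc_neq0.
Qed.

Lemma cmod_iarc k u : cmod (iarc k u) = 1.
Proof. by rewrite iarcE cmodV cmod_arc invr1. Qed.

Lemma iarc_end k : iarc k 1 = iarc k.+1 (-1).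
Proof. by rewrite !iarcE arc_end. Qed.
Lemma iarc4 u : iarc 4 u = iarc 0 u.
Proof. by rewrite !iarcE arc4. Qed.

Lemma cder_iarc k u : cder (iarc k) u (- (ii * cofr (wt u) * iarc k u)).
Proof.
have H : cder iearc u (- (ii * cofr (wt u) * iearc u)).
  have dc := is_derive_ct u; split.
    apply: is_derive_eq dc _; rewrite cReN cReM cReM cImM cRe_i cIm_i cRe_C cIm_C /=.
    by ring.
  have H : is_derive u 1 (fun v => v * ct v) (u * (- (u * ct u) * wt u) + ct u * 1).
    exact: (is_deriveM (is_derive_id u 1) dc).
  apply: is_derive_eq (is_deriveN H) _; rewrite cImN cImM cReM cImM cRe_i cIm_i cRe_C cIm_C /=.
  have h : wt u * (1 + u ^+ 2) = 1 by rewrite mulVf// gt_eqF// ltr_wpDr// sqr_ge0.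
  have -> : ct u * 1 = ct u * (wt u * (1 + u ^+ 2)) by rewrite h.
  by ring.
have := cderZ ((- ii) ^+ k) H.
by rewrite (_ : (- ii) ^+ k * _ = - (ii * cofr (wt u) * iarc k u))// /iarc; ring.
Qed.

Lemma ccont_iarcX a b k n : ccont a b (fun u => iarc k u ^+ n).
Proof. by apply: (@ccontX _ _ _ (iarc k)); apply: cder_cont => u _; exact: cder_iarc. Qed.

(** The integrand has the primitive - iarc^(n+1) / (n+1) on each arc, whose increments telescope
    around the circle. *)
Lemma cseg_iarc_pow n :
  \sum_(k < 4) cseg (-1) 1 (fun u => ii * cofr (wt u) * iarc k u ^+ n.+1) = 0.
Proof.
have cc k : ccont (-1) 1 (fun u => ii * cofr (wt u) * iarc k u ^+ n.+1).
  by apply: (@ccontM _ _ _ (fun u => ii * cofr (wt u))); [exact: ccont_iwt|exact: ccont_iarcX].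
have E k : cseg (-1) 1 (fun u => ii * cofr (wt u) * iarc k u ^+ n.+1) =
    - n.+1%:R^-1 * (iarc k 1 ^+ n.+1 - iarc k (-1) ^+ n.+1).
  have n0 : n.+1%:R != 0 :> C by rewrite pnatr_eq0.
  rewrite -(@cseg_FTC R (-1) 1 (fun u => iarc k u ^+ n.+1)
     (fun u => - n.+1%:R * (ii * cofr (wt u) * iarc k u ^+ n.+1))); last 3 first.
  - by lra.
  - move=> u _; have := cderX n (cder_iarc k u).
    by congr cder; rewrite exprSr; move: (n.+1%:R : C) => c; ring.
  - by apply: (@ccontM _ _ _ (fun=> - n.+1%:R)); [exact: ccont_cst|].
  by rewrite csegZ// mulrA mulrNN mulVf// mul1r.
under eq_bigr do rewrite E.
rewrite -mulr_sumr !big_ord_recr big_ord0 /= !iarc_end iarc4.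
move: (iarc 0 _ ^+ _) (iarc 1 _ ^+ _) (iarc 2 _ ^+ _) (iarc 3 _ ^+ _) (n.+1%:R^-1) => a b c d e.
by ring.
Qed.

(* This is 2 pi i, but only its nonvanishing is needed. *)
Definition arcK : C := \sum_(k < 4) cseg (-1) 1 (fun u => ii * cofr (wt u)).

Lemma cmod_arcK : 4 <= cmod arcK.
Proof.
apply: le_trans (cIm_le _); apply: le_trans (ler_norm _).
rewrite /arcK cIm_sum sumr_const card_ord cImseg.
have cw : rcont (-1) 1 (@wt R).
  by move=> u _; have [d hd] := is_derive_wt u; exact: is_derive_cont hd.
have -> : rseg (-1) 1 (fun t => complex.Im (ii * cofr (wt t))) = rseg (-1) 1 (@wt R).
  by apply: eq_rseg => u _; rewrite cImM cRe_i cIm_i cRe_C cIm_C; ring.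
(* On [-1, 1] the density [wt] is at least 1/2, so every arc contributes at least 1. *)
suff : 1 <= rseg (-1) 1 (@wt R) by rewrite -mulr_natr; lra.
rewrite -[leLHS](_ : rseg (-1) 1 (fun=> 2^-1 : R) = 1); last by rewrite rseg_cst; lra.
apply: le_Rintegral => //.
- by apply: rcont_integrable => x _; exact: cvg_cst.
- exact: rcont_integrable.
- by move=> x /=; rewrite in_itv/=; exact: wt_ge2.
Qed.

Lemma arcK_neq0 : arcK != 0.
Proof. by rewrite -cmod_gt0; apply: lt_le_trans cmod_arcK. Qed.

(** Iteration of arc / (arc - a) = 1 + (a / arc) * arc / (arc - a), a finite geometric series with
    its exact remainder. *)
Lemma ker_geometric (a : C) k u N : cmod a < 1 ->
  ker a k u = \sum_(n < N) a ^+ n * (ii * cofr (wt u) * iarc k u ^+ n) +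
              a ^+ N * (iarc k u ^+ N * ker a k u).
Proof.
move=> a1; elim: N => [|N IH]; first by rewrite big_ord0 !expr0 !mul1r add0r.
rewrite big_ord_recr/= -addrA {1}IH; congr (_ + _).
have kE : ker a k u = ii * cofr (wt u) + a * iarc k u * ker a k u.
  rewrite /ker iarcE; have h1 := arc_neq0 k u; have h2 := arc_sub_neq0 k u a1.
  by field; rewrite h1 h2.
rewrite {1}kE !exprSr; move: (ker a k u) (iarc k u) => x y; ring.
Qed.

(** The n-th Taylor coefficient before division by [arcK]. *)
Definition cauchy_coef (G : C -> C) (n : nat) : C :=
  \sum_(k < 4) cseg (-1) 1 (fun u => G (arc k u) * (ii * cofr (wt u) * iarc k u ^+ n)).

Lemma ccont_on_arc (G : C -> C) a b k : (forall z, cmod z <= 1 -> exists d, hasd G z d) ->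
  ccont a b (fun u => G (arc k u)).
Proof.
move=> dG; have /choice[d hd] : forall u, exists d, hasd G (arc k u) d.
  by move=> u; apply: dG; rewrite cmod_arc.
by apply: (@ccont_comp _ _ _ (arc k) G d) => //; exact: ccont_arc.
Qed.

Lemma ccont_weight_iarc a b k n : ccont a b (fun u => ii * cofr (wt u) * iarc k u ^+ n).
Proof.
by apply: (@ccontM _ _ _ (fun u => ii * cofr (wt u))); [exact: ccont_iwt|exact: ccont_iarcX].
Qed.

Lemma cauchy_coef_le (G : C -> C) (M : R) n : (forall z, cmod z <= 1 -> exists d, hasd G z d) ->
  (forall k u, -1 <= u <= 1 -> cmod (G (arc k u)) <= M) -> cmod (cauchy_coef G n) <= 16 * M.
Proof.
move=> dG GM; have i11 : -1 <= 1 :> R by lra.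
have cmw k u : cmod (ii * cofr (wt u) * iarc k u ^+ n) <= 1.
  rewrite cmodM cmodX cmod_iarc expr1n mulr1 cmodM cmod_i mul1r cmod_pos ?(ltW (wt_gt0 _))//.
  exact: wt_le1.
apply: le_trans (cmod_sum _ _ _ _) _.
apply: (@le_trans _ _ (\sum_(k < 4) (4 * M))); last first.
  by rewrite sumr_const card_ord -mulr_natr; apply/eqP/eqP; lra.
apply: ler_sum => k _; rewrite (_ : 4 * M = 2 * M * (1 - -1)); last by ring.
apply: cseg_le => //.
  by apply: (@ccontM _ _ _ (fun u => G (arc k u))); [exact: ccont_on_arc|exact: ccont_weight_iarc].
by move=> u hu; rewrite cmodM -[leRHS]mulr1; apply: ler_pM; rewrite ?cmod_ge0 ?GM.
Qed.

Lemma cauchy_expansion (G : C -> C) (M : R) a N : (forall z, cmod z <= 1 -> exists d, hasd G z d) ->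
  (forall k u, -1 <= u <= 1 -> cmod (G (arc k u)) <= M) -> cmod a < 1 ->
  cmod (\sum_(k < 4) cseg (-1) 1 (fun u => G (arc k u) * ker a k u) -
    \sum_(n < N) a ^+ n * cauchy_coef G n) <= 16 * M / (1 - cmod a) * cmod a ^+ N.
Proof.
move=> dG GM a1; have a1' : 0 < 1 - cmod a by rewrite subr_gt0.
have i11 : -1 <= 1 :> R by lra.
have cw k n := ccont_weight_iarc (-1) 1 k n.
have cG k := @ccont_on_arc G (-1) 1 k dG.
have ck k : ccont (-1) 1 (ker a k) by exact: ccont_ker.
have cr k : ccont (-1) 1 (fun u => G (arc k u) * (iarc k u ^+ N * ker a k u)).
  apply: (@ccontM _ _ _ (fun u => G (arc k u))) => //.
  by apply: (@ccontM _ _ _ (fun u => iarc k u ^+ N)) => //; exact: ccont_iarcX.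
have E k : cseg (-1) 1 (fun u => G (arc k u) * ker a k u) =
   \sum_(n < N) a ^+ n * cseg (-1) 1 (fun u => G (arc k u) * (ii * cofr (wt u) * iarc k u ^+ n)) +
   a ^+ N * cseg (-1) 1 (fun u => G (arc k u) * (iarc k u ^+ N * ker a k u)).
  have cn n : ccont (-1) 1 (fun u => G (arc k u) * (ii * cofr (wt u) * iarc k u ^+ n)).
    by apply: (@ccontM _ _ _ (fun u => G (arc k u))).
  have can n : ccont (-1) 1 (fun u => a ^+ n * (G (arc k u) * (ii * cofr (wt u) * iarc k u ^+ n))).
    by apply: (@ccontM _ _ _ (fun=> a ^+ n)); [exact: ccont_cst|].
  rewrite -csegZ//.
  have -> : \sum_(n < N) a ^+ n * cseg (-1) 1 (fun u => G (arc k u) * (ii * cofr (wt u) * iarc k u ^+ n)) =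
    cseg (-1) 1 (fun u => \sum_(n < N) a ^+ n * (G (arc k u) * (ii * cofr (wt u) * iarc k u ^+ n))).
    rewrite (@cseg_sum R _ _ N (fun n u => a ^+ n * (G (arc k u) * (ii * cofr (wt u) * iarc k u ^+ n))))//.
    by apply: eq_bigr => n _; rewrite csegZ.
  rewrite -csegD; last 2 first.
  - exact: (@ccont_sum _ _ _ N (fun n u => a ^+ n * (G (arc k u) * (ii * cofr (wt u) * iarc k u ^+ n)))).
  - by apply: (@ccontM _ _ _ (fun=> a ^+ N)); [exact: ccont_cst|].
  apply: eq_cseg => u _; rewrite {1}(ker_geometric k u N a1) mulrDr mulr_sumr mulrCA; congr (_ + _).
  by apply: eq_bigr => n _; rewrite mulrCA.
under eq_bigr do rewrite E.
rewrite big_split/= exchange_big/=.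
under eq_bigr do rewrite -mulr_sumr.
rewrite addrC addrK -mulr_sumr cmodM cmodX mulrC; apply: ler_wpM2r; first by rewrite exprn_ge0 ?cmod_ge0.
apply: le_trans (cmod_sum _ _ _ _) _.
apply: (@le_trans _ _ (\sum_(k < 4) (4 * (M / (1 - cmod a))))); last first.
  by rewrite sumr_const card_ord -mulr_natr; apply/eqP/eqP; lra.
apply: ler_sum => k _; rewrite (_ : 4 * (M / (1 - cmod a)) = 2 * (M / (1 - cmod a)) * (1 - -1)); last by ring.
apply: cseg_le => // u hu; rewrite cmodM [cmod (_ ^+ _ * _)]cmodM cmodX cmod_iarc expr1n mul1r.
apply: ler_pM; rewrite ?cmod_ge0 ?GM//.
apply: le_trans (cmod_ker _ _ a1) _; rewrite lef_pV2 ?posrE ?cmod_gt0 ?arc_sub_neq0//.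
exact: arc_sub_ge.
Qed.

(** The kernel expansion is tested on the constant 1: by [cseg_iarc_pow] only the term of order 0
    survives, so the total does not depend on a. *)
Lemma ker_total (a : C) : cmod a < 1 -> \sum_(k < 4) cseg (-1) 1 (ker a k) = arcK.
Proof.
pose one : C -> C := fun=> 1.
have d1 z : cmod z <= 1 -> exists d, hasd one z d.
  by move=> _; exists 0 => e e0; exists 1 => // h _; rewrite /one subrr mul0r subrr cmod0 mulr_ge0 ?cmod_ge0// ltW.
have one1 k u : -1 <= u <= 1 -> cmod (one (arc k u)) <= 1 by move=> _; rewrite /one cmod1.
have cc1 n : cauchy_coef one n.+1 = 0.
  rewrite -(cseg_iarc_pow n); apply: eq_bigr => k _; apply: eq_cseg => u _; by rewrite /one mul1r.
have cc0 : cauchy_coef one 0%N = arcK.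
  by apply: eq_bigr => k _; apply: eq_cseg => u _; rewrite /one mul1r expr0 mulr1.
move=> a1; apply/eqP; rewrite -subr_eq0 -cmod_eq0 eq_le cmod_ge0 andbT.
apply: (@le_geometric_tail R _ 0 (16 * 1 / (1 - cmod a) * cmod a) (cmod a)); first by rewrite cmod_ge0 a1.
move=> N; have := cauchy_expansion N.+1 d1 one1 a1.
have -> : \sum_(n < N.+1) a ^+ n * cauchy_coef one n = arcK.
  rewrite big_ord_recl expr0 mul1r cc0 big1 ?addr0// => i _.
  by rewrite lift0 cc1 mulr0.
have -> : \sum_(k < 4) cseg (-1) 1 (fun u => one (arc k u) * ker a k u) = \sum_(k < 4) cseg (-1) 1 (ker a k).
  by apply: eq_bigr => k _; apply: eq_cseg => u _; rewrite /one mul1r.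
by rewrite add0r -[_ * cmod a * _]mulrA -exprS.
Qed.

Lemma taylor_arcs (F : C -> C) (M : R) :
  (forall z, cmod z <= 1 -> exists d, hasd F z d) ->
  (forall k u, -1 <= u <= 1 -> cmod (F (arc k u)) <= M) ->
  exists d : nat -> C, (forall n, cmod (d n) <= 4 * M) /\
    forall a, cmod a < 1 -> forall N,
      cmod (F a - \sum_(n < N) d n * a ^+ n) <= 4 * M / (1 - cmod a) * cmod a ^+ N.
Proof.
move=> dF FM.
have M0 : 0 <= M by apply: le_trans (cmod_ge0 _) (FM 0%N 0 _); lra.
have K0 := arcK_neq0.
(* The bound 16 M for the unnormalised coefficient becomes 4 M because |arcK| >= 4. *)
exists (fun n => cauchy_coef F n / arcK); split.
  move=> n; rewrite cmodM cmodV ler_pdivrMr ?cmod_gt0//.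
  apply: le_trans (cauchy_coef_le n dF FM) _.
  have := cmod_arcK; have : 0 <= M * (cmod arcK - 4) by rewrite mulr_ge0// subr_ge0 cmod_arcK.
  lra.
move=> a a1 N; have a1' : 0 < 1 - cmod a by rewrite subr_gt0.
have := cauchy_expansion N dF FM a1; rewrite (cauchy_arcs a1 dF) (ker_total a1) => H.
have -> : F a - \sum_(n < N) cauchy_coef F n / arcK * a ^+ n = (F a * arcK - \sum_(n < N) a ^+ n * cauchy_coef F n) / arcK.
  rewrite mulrBl mulfK//; congr (_ - _); rewrite mulr_suml; apply: eq_bigr => n _.
  by rewrite mulrAC [cauchy_coef F n * _]mulrC.
rewrite cmodM cmodV ler_pdivrMr ?cmod_gt0//; apply: le_trans H _.
rewrite [leRHS]mulrAC; apply: ler_wpM2r; first by rewrite exprn_ge0 ?cmod_ge0.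
rewrite [leRHS]mulrAC; apply: ler_wpM2r; first by rewrite invr_ge0 ltW.
have : 0 <= M * (cmod arcK - 4) by rewrite mulr_ge0// subr_ge0 cmod_arcK.
lra.
Qed.

End cauchy_coefficients.

(** * Power series with explicit remainders *)

Section power_series.
Context {R : realType}.
Local Notation C := (CC R).

Definition cpart (c : nat -> C) (z : C) (N : nat) : C := \sum_(n < N) c n * z ^+ n.

Definition psum (c : nat -> C) (z : C) : C :=
  (limn (fun N => complex.Re (cpart c z N)) +i* limn (fun N => complex.Im (cpart c z N)))%C.

Definition dshift (c : nat -> C) (n : nat) : C := n.+1%:R * c n.+1.

Definition cbound (c : nat -> C) (s M : R) := forall n, cmod (c n) * s ^+ n <= M.

Lemma cbound_ge0 c s M : cbound c s M -> 0 <= M.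
Proof. by move=> h; have := h 0%N; rewrite expr0 mulr1; exact: le_trans (cmod_ge0 _). Qed.

Lemma cpart_diff c z s M N K : cbound c s M -> 0 < s -> cmod z < s -> (N <= K)%N ->
  cmod (cpart c z K - cpart c z N) <= M / (1 - cmod z / s) * (cmod z / s) ^+ N.
Proof.
move=> cM s0 zs NK.
set t := cmod z / s.
have t0 : 0 <= t by rewrite divr_ge0 ?cmod_ge0// ltW.
have t1 : t < 1 by rewrite ltr_pdivrMr// mul1r.
have M0 := cbound_ge0 cM.
have term n : cmod (c n * z ^+ n) <= M * t ^+ n.
  rewrite cmodM cmodX /t expr_div_n mulrA ler_pdivlMr ?exprn_gt0// mulrAC.
  by rewrite ler_wpM2r ?exprn_ge0 ?cmod_ge0.
rewrite -(subnKC NK); move: (K - N)%N => j.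
have -> : cpart c z (N + j) - cpart c z N = \sum_(i < j) c (N + i)%N * z ^+ (N + i).
  by rewrite /cpart big_split_ord/= addrAC subrr add0r.
apply: le_trans (cmod_sum _ _ _ _) _.
apply: (@le_trans _ _ (\sum_(i < j) (M * t ^+ N) * t ^+ i)).
  by apply: ler_sum => i _; rewrite -mulrA -exprD; exact: term.
rewrite -mulr_sumr [leRHS]mulrAC; apply: ler_wpM2l; first by rewrite mulr_ge0 ?exprn_ge0.
by apply: geometric_sum_le; rewrite t0.
Qed.

Lemma psum_tail c z s M N : cbound c s M -> 0 < s -> cmod z < s ->
  cmod (psum c z - cpart c z N) <= M / (1 - cmod z / s) * (cmod z / s) ^+ N.
Proof.
move=> cM s0 zs.
set t := cmod z / s.
have t0 : 0 <= t by rewrite divr_ge0 ?cmod_ge0// ltW.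
have t1 : t < 1 by rewrite ltr_pdivrMr// mul1r.
have t01 : 0 <= t < 1 by rewrite t0.
have M0 := cbound_ge0 cM.
have term n : cmod (c n * z ^+ n) <= M * t ^+ n.
  rewrite cmodM cmodX /t expr_div_n mulrA ler_pdivlMr ?exprn_gt0// mulrAC.
  by rewrite ler_wpM2r ?exprn_ge0 ?cmod_ge0.
have cv (u : nat -> R) : (forall n, `|u n| <= M * t ^+ n) -> cvgn (fun N => \sum_(n < N) u n).
  move=> hu; have : cvgn (series u).
    apply: normed_cvg; apply: (series_le_cvg _ _ hu) => //.
      by move=> n; rewrite mulr_ge0 ?exprn_ge0.
    by apply: is_cvg_geometric_series; rewrite ger0_norm.
  by rewrite /series/=; under eq_fun do rewrite big_mkord.
have /cvgrPdist_lt c1 : cvgn (fun N => complex.Re (cpart c z N)).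
  have -> : (fun N => complex.Re (cpart c z N)) = (fun N => \sum_(n < N) complex.Re (c n * z ^+ n)).
    by apply/funext => K; exact: cRe_sum.
  apply: (cv (fun n => complex.Re (c n * z ^+ n))) => n; exact: le_trans (cRe_le _) (term n).
have /cvgrPdist_lt c2 : cvgn (fun N => complex.Im (cpart c z N)).
  have -> : (fun N => complex.Im (cpart c z N)) = (fun N => \sum_(n < N) complex.Im (c n * z ^+ n)).
    by apply/funext => K; exact: cIm_sum.
  apply: (cv (fun n => complex.Im (c n * z ^+ n))) => n; exact: le_trans (cIm_le _) (term n).
apply/ler_addgt0Pr => e e0.
have e2 : 0 < e / 2 by rewrite divr_gt0.
have [N1 _ H1] := c1 _ e2; have [N2 _ H2] := c2 _ e2.
pose K := maxn N (maxn N1 N2).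
have h1 := H1 K; have h2 := H2 K.
have {}h1 : `|limn (fun N => complex.Re (cpart c z N)) - complex.Re (cpart c z K)| < e / 2.
  by apply: h1; rewrite /= /K !leq_max leqnn !orbT.
have {}h2 : `|limn (fun N => complex.Im (cpart c z N)) - complex.Im (cpart c z K)| < e / 2.
  by apply: h2; rewrite /= /K !leq_max leqnn !orbT.
have -> : psum c z - cpart c z N = (psum c z - cpart c z K) + (cpart c z K - cpart c z N).
  by rewrite addrA subrK.
apply: le_trans (cmodD _ _) _; rewrite addrC; apply: lerD.
  by apply: cpart_diff => //; rewrite /K leq_maxl.
apply: le_trans (cmod_le _) _; rewrite cReD cReN cImD cImN [leRHS]splitr.
by apply: lerD; apply: ltW.
Qed.

Lemma psum_unique (c : nat -> C) (z v : C) (A t : R) : 0 <= t < 1 -> (forall N, cmod (v - cpart c z N) <= A * t ^+ N) ->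
  forall s M, cbound c s M -> 0 < s -> cmod z < s -> v = psum c z.
Proof.
move=> ht hv s M cM s0 zs.
set r := cmod z / s.
have r0 : 0 <= r by rewrite divr_ge0 ?cmod_ge0// ltW.
have r1 : r < 1 by rewrite ltr_pdivrMr// mul1r.
apply/eqP; rewrite -subr_eq0 -cmod_eq0 eq_le cmod_ge0 andbT.
have /andP[t0 t1] := ht.
have hm : 0 <= Num.max r t < 1 by rewrite le_max t0 orbT/= gt_max r1.
apply: (le_geometric_tail hm (A := `|A| + `|M / (1 - r)|)) => N; rewrite add0r.
have -> : v - psum c z = (v - cpart c z N) - (psum c z - cpart c z N) by rewrite opprB addrA subrK.
apply: le_trans (cmodB _ _) _; rewrite mulrDl; apply: lerD.
  apply: le_trans (hv N) _; apply: le_trans (ler_norm _) _.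
  by rewrite normrM ler_wpM2l// ger0_norm ?exprn_ge0// lerXn2r ?nnegrE ?le_max ?lexx ?t0 ?orbT.
apply: le_trans (psum_tail N cM s0 zs) _; apply: le_trans (ler_norm _) _.
by rewrite normrM ler_wpM2l// ger0_norm ?exprn_ge0// lerXn2r ?nnegrE// ?le_max ?lexx ?r0.
Qed.

(** The constant B depends on the two radii only. This uniformity in the series is what the
    convergence of derivatives of a whole family requires. *)
Lemma cbound_dshift (s s' : R) : 0 < s' < s ->
  exists B, forall (c : nat -> C) M, cbound c s M -> cbound (dshift c) s' (B * M).
Proof.
move=> /andP[s'0 s's]; have s0 : 0 < s by exact: lt_trans s's.
have t01 : 0 < s' / s < 1 by rewrite divr_gt0//= ltr_pdivrMr// mul1r.
have [K [q [K0 /andP[q0 q1] H]]] := sqr_pow_le t01.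
exists (K / s') => c M cM n; have M0 := cbound_ge0 cM; rewrite [K / s' * M]mulrC mulrA /dshift cmodM cmod_nat.
rewrite (ler_pdivlMr _ _ s'0) -(mulrA _ (s' ^+ n)) -exprSr.
have h1 : cmod (c n.+1) * s' ^+ n.+1 <= M * (s' / s) ^+ n.+1.
  by rewrite expr_div_n mulrA ler_pdivlMr ?exprn_gt0// mulrAC ler_wpM2r ?exprn_ge0// ltW.
rewrite -mulrA; apply: le_trans (ler_wpM2l _ h1) _ => //.
rewrite mulrCA; apply: ler_wpM2l => //.
have h2 : n.+1%:R * (s' / s) ^+ n.+1 <= n.+1%:R ^+ 2 * (s' / s) ^+ n.+1.
  rewrite ler_wpM2r ?exprn_ge0 ?divr_ge0 ?(ltW s'0) ?(ltW s0)//.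
  by rewrite expr2 ler_peMl// ler1n.
apply: le_trans h2 (le_trans (H _) _).
by rewrite ler_piMr ?(ltW K0)// exprn_ile1 ?(ltW q0) ?(ltW q1).
Qed.

(** The second-order remainder of w^(n+1) is at most (n+1)^2 r^(n-1) |h|^2. Both sides are
    multiplied by r^2 to avoid the exponent n - 1 at n = 0. *)
Lemma pow_taylor2 (z h : C) (r : R) n : cmod z <= r -> cmod (z + h) <= r ->
  cmod ((z + h) ^+ n.+1 - z ^+ n.+1 - n.+1%:R * z ^+ n * h) * r ^+ 2 <=
  n.+1%:R ^+ 2 * r ^+ n.+1 * cmod h ^+ 2.
Proof.
move=> zr zhr; have r0 : 0 <= r by exact: le_trans (cmod_ge0 _) zr.
elim: n => [|n IH].
  rewrite !expr1 expr0 mulr1 mul1r addrAC addrK subrr cmod0 mul0r.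
  by rewrite !mulr_ge0 ?exprn_ge0 ?cmod_ge0.
have -> : (z + h) ^+ n.+2 - z ^+ n.+2 - n.+2%:R * z ^+ n.+1 * h =
   (z + h) * ((z + h) ^+ n.+1 - z ^+ n.+1 - n.+1%:R * z ^+ n * h) + n.+1%:R * z ^+ n * h ^+ 2.
  have -> : n.+2%:R = n.+1%:R + 1 :> C by rewrite natr1.
  rewrite ![_ ^+ n.+2]exprS [z ^+ n.+1]exprS.
  by move: (n.+1%:R : C) ((z + h) ^+ n.+1) (z ^+ n) => a b d; ring.
apply: (@le_trans _ _ (r * (n.+1%:R ^+ 2 * r ^+ n.+1 * cmod h ^+ 2) + n.+1%:R * r ^+ n.+2 * cmod h ^+ 2)).
  apply: (@le_trans _ _ ((cmod (z + h) * cmod ((z + h) ^+ n.+1 - z ^+ n.+1 - n.+1%:R * z ^+ n * h) +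
     n.+1%:R * cmod z ^+ n * cmod h ^+ 2) * r ^+ 2)).
    rewrite ler_wpM2r ?exprn_ge0//; apply: le_trans (cmodD _ _) _.
    by rewrite cmodM lerD2l !cmodM !cmodX cmod_nat.
  rewrite mulrDl; apply: lerD.
    by rewrite -mulrA; apply: ler_pM; rewrite ?cmod_ge0 ?mulr_ge0 ?cmod_ge0 ?exprn_ge0.
  have -> : n.+1%:R * cmod z ^+ n * cmod h ^+ 2 * r ^+ 2 = n.+1%:R * (cmod z ^+ n * r ^+ 2) * cmod h ^+ 2 by ring.
  rewrite -(addn2 n) exprD ler_wpM2r ?exprn_ge0 ?cmod_ge0// ler_wpM2l// ler_wpM2r ?exprn_ge0//.
  by apply: lerXn2r; rewrite ?nnegrE ?cmod_ge0.
have -> : r * (n.+1%:R ^+ 2 * r ^+ n.+1 * cmod h ^+ 2) + n.+1%:R * r ^+ n.+2 * cmod h ^+ 2 =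
  (n.+1%:R ^+ 2 + n.+1%:R) * r ^+ n.+2 * cmod h ^+ 2.
  by rewrite [r ^+ n.+2]exprS; ring.
rewrite ler_wpM2r ?exprn_ge0 ?cmod_ge0// ler_wpM2r ?exprn_ge0//.
have -> : n.+2%:R = n.+1%:R + 1 :> R by rewrite natr1.
have : 0 <= n.+1%:R :> R by [].
by rewrite sqrrD1; lra.
Qed.

(** Termwise differentiation with a quadratic error: the remainders of [pow_taylor2] sum to B |h|^2
    on an intermediate radius r between |z| and s. *)
Lemma psum_hasd c z s M : cbound c s M -> 0 < s -> cmod z < s ->
  hasd (psum c) z (psum (dshift c) z).
Proof.
move=> cM s0 zs.
pose r := (cmod z + s) / 2.
have zr : cmod z < r by rewrite /r; lra.
have rs : r < s by rewrite /r; lra.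
have r0 : 0 < r by rewrite /r; have := cmod_ge0 z; lra.
have M0 := cbound_ge0 cM.
have [Bs HB] := cbound_dshift (introT andP (conj r0 rs)); have cM' := HB _ _ cM; set M' := Bs * M in cM'.
have t01 : 0 < r / s < 1 by rewrite divr_gt0//= ltr_pdivrMr// mul1r.
have [K [q [K0 /andP[q0 q1] HK]]] := sqr_pow_le t01.
pose B := M * K / (1 - q) / r ^+ 2.
have q1' : 0 < 1 - q by rewrite subr_gt0.
have r0' := ltW r0; have K0' := ltW K0; have q1'' := ltW q1'.
have B0 : 0 <= B by apply: divr_ge0; [apply: divr_ge0 => //; apply: mulr_ge0|apply: exprn_ge0].
have key h : cmod h < r - cmod z ->
    cmod (psum c (z + h) - psum c z - psum (dshift c) z * h) <= B * cmod h ^+ 2.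
  move=> hr.
  have zhr : cmod (z + h) < r by apply: le_lt_trans (cmodD _ _) _; lra.
  have zhs : cmod (z + h) < s by exact: lt_trans rs.
  pose th := r / s; have /andP[th0 th1] := t01.
  pose T1 := M / (1 - cmod (z + h) / s); pose T2 := M / (1 - cmod z / s).
  pose T3 := M' / (1 - cmod z / r) * cmod h.
  pose th' := Num.max th (cmod z / r).
  have zr1 : 0 <= cmod z / r < 1.
    by rewrite divr_ge0 ?cmod_ge0 ?(ltW r0)//= ltr_pdivrMr// mul1r.
  have /andP[zr1a zr1b] := zr1.
  have th'01 : 0 <= th' < 1 by rewrite /th' le_max (ltW th0)/= gt_max th1.
  apply: (le_geometric_tail th'01 (A := `|T1| + `|T2| + `|T3|)) => N.
  have A0 : 0 <= M * K / r ^+ 2 * cmod h ^+ 2.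
    apply: mulr_ge0; last by rewrite exprn_ge0 ?cmod_ge0.
    by apply: divr_ge0; [apply: mulr_ge0|apply: exprn_ge0].
  pose E n := (z + h) ^+ n - z ^+ n - n%:R * z ^+ n.-1 * h.
  (* Finitely many second-order remainders plus three tails that decay geometrically in N. The
     derived series stops one term earlier because [dshift] lowers the index. *)
  have -> : psum c (z + h) - psum c z - psum (dshift c) z * h =
     (\sum_(n < N.+1) c n * E n) + ((psum c (z + h) - cpart c (z + h) N.+1) -
       (psum c z - cpart c z N.+1) - (psum (dshift c) z - cpart (dshift c) z N) * h).
    have -> : \sum_(n < N.+1) c n * E n = cpart c (z + h) N.+1 - cpart c z N.+1 - cpart (dshift c) z N * h.
      rewrite /cpart -sumrB mulr_suml.
      have -> : \sum_(i < N) dshift c i * z ^+ i * h = \sum_(i < N.+1) c i * (i%:R * z ^+ i.-1 * h).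
        rewrite big_ord_recl /= !mul0r mulr0 add0r; apply: eq_bigr => i _.
        by rewrite /bump add1n add0n /dshift; ring.
      by rewrite -sumrB; apply: eq_bigr => i _; rewrite /E; ring.
    move: (cpart _ _ _) (cpart _ _ _) (cpart _ _ _) (psum _ _) (psum _ _) (psum _ _) => a1 a2 a3 b1 b2 b3; ring.
  apply: le_trans (cmodD _ _) _; apply: lerD.
    apply: le_trans (cmod_sum _ _ _ _) _.
    apply: (@le_trans _ _ (\sum_(n < N.+1) (M * K / r ^+ 2 * cmod h ^+ 2) * q ^+ n)).
      apply: ler_sum => -[[|n] /= hn] _.
        by rewrite /E !expr0 subrr !mul0r subrr mulr0 cmod0 mulr1.
      have p2 := pow_taylor2 n (ltW zr) (ltW zhr).
      rewrite -[(z + h) ^+ n.+1 - _ - _]/(E n.+1) in p2.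
      rewrite -(ler_pM2r (exprn_gt0 2 r0)) cmodM -[leLHS]mulrA.
      apply: le_trans (ler_wpM2l (cmod_ge0 _) p2) _.
      have h1 : cmod (c n.+1) * r ^+ n.+1 <= M * (r / s) ^+ n.+1.
        by rewrite (expr_div_n r s) [leRHS]mulrA ler_pdivlMr ?exprn_gt0// mulrAC ler_wpM2r ?exprn_ge0// ltW.
      have -> : cmod (c n.+1) * (n.+1%:R ^+ 2 * r ^+ n.+1 * cmod h ^+ 2) =
          n.+1%:R ^+ 2 * (cmod (c n.+1) * r ^+ n.+1) * cmod h ^+ 2 by ring.
      have -> : M * K / r ^+ 2 * cmod h ^+ 2 * q ^+ n.+1 * r ^+ 2 = M * (K * q ^+ n.+1) * cmod h ^+ 2.
        by field; rewrite gt_eqF.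
      rewrite ler_wpM2r ?exprn_ge0 ?cmod_ge0//.
      apply: le_trans (ler_wpM2l _ h1) _; first exact: exprn_ge0.
      by rewrite mulrCA; apply: ler_wpM2l.
    rewrite -mulr_sumr /B [leRHS](_ : _ = M * K / r ^+ 2 * cmod h ^+ 2 * (1 - q)^-1); last by ring.
    by apply: ler_wpM2l => //; apply: geometric_sum_le; rewrite (ltW q0).
  have thN N' : th ^+ N' <= th' ^+ N' by apply: lerXn2r; rewrite ?nnegrE ?le_max ?lexx ?(ltW th0).
  have thS : th' ^+ N.+1 <= th' ^+ N.
    by case/andP: th'01 => a1 a2; rewrite exprS ler_piMl ?exprn_ge0// ltW.
  have gen x y : 0 <= y -> y <= th -> `|x * y ^+ N.+1| <= `|x| * th' ^+ N.
    move=> y0 yt; rewrite normrM ler_wpM2l// ger0_norm ?exprn_ge0//; apply: le_trans _ thS.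
    apply: le_trans _ (thN _); apply: lerXn2r; rewrite ?nnegrE// ltW//.
  apply: le_trans (cmodB _ _) _; rewrite [leRHS]mulrDl [X in _ <= X + _]mulrDl; apply: lerD.
    apply: le_trans (cmodB _ _) _; apply: lerD.
      apply: le_trans (psum_tail N.+1 cM s0 zhs) _; apply: le_trans (ler_norm _) _.
      by apply: gen; rewrite ?divr_ge0 ?cmod_ge0 ?(ltW s0)// ler_pM2r ?invr_gt0// ltW.
    apply: le_trans (psum_tail N.+1 cM s0 zs) _; apply: le_trans (ler_norm _) _.
    by apply: gen; rewrite ?divr_ge0 ?cmod_ge0 ?(ltW s0)// ler_pM2r ?invr_gt0// ltW.
  rewrite cmodM; apply: le_trans (ler_wpM2r (cmod_ge0 _) (psum_tail N cM' r0 zr)) _.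
  rewrite mulrAC -/T3; apply: le_trans (ler_norm _) _; rewrite normrM ler_wpM2l//.
  rewrite ger0_norm ?exprn_ge0//; apply: lerXn2r; rewrite ?nnegrE ?le_max ?lexx ?zr1a ?orbT//.
move=> e e0.
have B1 : 0 < B + 1 by rewrite ltr_wpDl.
exists (Num.min (r - cmod z) (e / (B + 1))).
  by rewrite lt_min subr_gt0 zr divr_gt0.
move=> h; rewrite lt_min => /andP[h1 h2]; apply: le_trans (key h h1) _.
rewrite expr2 mulrA; apply: ler_wpM2r; first exact: cmod_ge0.
move: h2; rewrite ltr_pdivlMr// => h2; apply: le_trans (ltW h2).
by rewrite mulrC ler_wpM2l ?cmod_ge0// lerDl.
Qed.

End power_series.

(** * Holomorphic functions as power series *)

Section holomorphic_functions.
Context {R : realType}.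
Local Notation C := (CC R).

Lemma hasd_eq_near (f h : C -> C) (z d : C) (r : R) : 0 < r ->
  (forall w, cmod (w - z) < r -> f w = h w) -> hasd h z d -> hasd f z d.
Proof.
move=> r0 E H e e0; have [q q0 Hq] := H e e0.
exists (Num.min q r); first by rewrite lt_min q0.
move=> k; rewrite lt_min => /andP[k1 k2].
have k3 : cmod (z + k - z) < r by rewrite addrC addKr.
by rewrite (E _ k3) (E z) ?subrr ?cmod0//; exact: Hq.
Qed.

Lemma holo_hasd (f : C -> C) z : holo f -> cmod z < 1 -> hasd f z (derive1 f z).
Proof. by move=> hf z1; apply: derivable_hasd; exact: hf. Qed.

Lemma hasd_dilate (f : C -> C) (a z d : C) : hasd f (a * z) d -> hasd (fun w => f (a * w)) z (a * d).
Proof.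
move=> H e e0.
have K : 0 < cmod a + 1 by rewrite ltr_wpDl ?cmod_ge0.
have [r r0 Hr] := H (e / (cmod a + 1)) (divr_gt0 e0 K).
exists (r / (cmod a + 1)); first exact: divr_gt0.
move=> h; rewrite ltr_pdivlMr// => hr.
have hle : cmod (a * h) <= cmod h * (cmod a + 1).
  by rewrite cmodM mulrC ler_wpM2l ?cmod_ge0// lerDl.
rewrite mulrDr -[a * d * h]mulrAC [a * h * d]mulrC; apply: le_trans (Hr _ (le_lt_trans hle hr)) _.
apply: le_trans (ler_wpM2l _ hle) _; first by rewrite divr_ge0 ?ltW.
by rewrite [cmod h * _]mulrC mulrA divfK// gt_eqF.
Qed.

Lemma rcont_bounded (a b : R) (h : R -> R) : a <= b -> rcont a b h ->
  exists M, forall x, a <= x <= b -> h x <= M.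
Proof.
move=> ab ch.
have [c _ hc] : exists2 c, c \in `[a, b] & forall t, t \in `[a, b] -> h t <= h c.
  apply: EVT_max => //; apply: continuous_in_subspaceT => x.
  by rewrite inE/= in_itv/=; exact: ch.
by exists (h c) => x hx; apply: hc; rewrite in_itv.
Qed.

Lemma ccont_bounded (a b : R) (h : R -> C) : a <= b -> ccont a b h ->
  exists M, forall x, a <= x <= b -> cmod (h x) <= M.
Proof.
move=> ab ch.
have nc (k : R -> R) : rcont a b k -> rcont a b (fun x => `|k x|).
  by move=> ck x hx; apply: (continuous_comp (ck x hx)); exact: norm_continuous.
have cRI := ccont_rcont ch.
have [M1 H1] := rcont_bounded ab (nc _ cRI.1).
have [M2 H2] := rcont_bounded ab (nc _ cRI.2).
exists (M1 + M2) => x hx; apply: le_trans (cmod_le _) _.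
by apply: lerD; [exact: H1|exact: H2].
Qed.

Lemma ii_mod4 k : (ii : C) ^+ k = ii ^+ (k %% 4).
Proof. by rewrite {1}(divn_eq k 4) mulnC exprD exprM ii4 expr1n mul1r. Qed.

Lemma holo_circle_bounded (f : C -> C) (s : R) : holo f -> 0 < s < 1 ->
  exists M, forall k u, -1 <= u <= 1 -> cmod (f (cofr s * arc k u)) <= M.
Proof.
move=> hf /andP[s0 s1].
have i11 : -1 <= 1 :> R by lra.
have B k : exists M, forall u, -1 <= u <= 1 -> cmod (f (cofr s * arc k u)) <= M.
  apply: (@ccont_bounded _ _ (fun u => f (cofr s * arc k u))) => //.
  apply: (@ccont_comp _ _ _ (fun u => cofr s * arc k u) f (fun u => derive1 f (cofr s * arc k u))).
    by apply: (@ccontM _ _ _ (fun=> cofr s)); [exact: ccont_cst|exact: ccont_arc].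
  by move=> u _; apply: holo_hasd => //; rewrite cmodM cmod_arc mulr1 cmod_pos// ltW.
have /choice[M HM] := B.
exists (\sum_(k < 4) `|M k|) => k u hu.
have -> : arc k u = arc (k %% 4) u by rewrite /arc ii_mod4.
have k4 : (k %% 4 < 4)%N by rewrite ltn_mod.
apply: le_trans (HM _ _ hu) _; apply: le_trans (ler_norm _) _.
rewrite (bigD1 (Ordinal k4))//= lerDl; exact: sumr_ge0.
Qed.

(** [taylor_arcs] wants differentiability on the closed unit disc; it is applied to w -> f(s w),
    which has it since s < 1, and the coefficients are scaled back. *)
Lemma holo_local (f : C -> C) (s M : R) : holo f -> 0 < s < 1 ->
  (forall k u, -1 <= u <= 1 -> cmod (f (cofr s * arc k u)) <= M) ->
  exists e : nat -> C, cbound e s (4 * M) /\ forall z, cmod z < s -> f z = psum e z.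
Proof.
move=> hf /andP[s0 s1] HM.
have cs0 : cofr s != 0 by rewrite -cmod_eq0 cmod_pos ?gt_eqF// ltW.
have dF z : cmod z <= 1 -> exists d, hasd (fun w => f (cofr s * w)) z d.
  move=> z1; exists (cofr s * derive1 f (cofr s * z)); apply: hasd_dilate.
  apply: holo_hasd => //; rewrite cmodM cmod_pos ?(ltW s0)//.
  by apply: le_lt_trans s1; rewrite -[leRHS]mulr1 ler_pM2l.
have [d [d1 d2]] := taylor_arcs dF HM.
have cb : cbound (fun n => d n / cofr s ^+ n) s (4 * M).
  move=> n; rewrite cmodM cmodV cmodX cmod_pos ?(ltW s0)// divfK//.
  by rewrite gt_eqF// exprn_gt0.
exists (fun n => d n / cofr s ^+ n); split=> // z zs.
have z1 : cmod (z / cofr s) < 1 by rewrite cmodM cmodV cmod_pos ?(ltW s0)// ltr_pdivrMr// mul1r.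
have z01 : 0 <= cmod (z / cofr s) < 1 by rewrite cmod_ge0.
apply: (@psum_unique _ _ _ _ (4 * M / (1 - cmod (z / cofr s))) _ z01 _ s _ cb s0 zs) => N.
have -> : cpart (fun n => d n / cofr s ^+ n) z N = \sum_(n < N) d n * (z / cofr s) ^+ n.
  by apply: eq_bigr => n _; rewrite expr_div_n mulrA mulrAC.
by have := d2 _ z1 N; rewrite [cofr s * _]mulrC divfK.
Qed.

(** The radius of convergence is at least s. *)
Definition pbound (c : nat -> C) (s : R) := forall s', 0 < s' < s -> exists M, cbound c s' M.

Lemma pbound_dshift c s : pbound c s -> pbound (dshift c) s.
Proof.
move=> H s' /andP[s'0 s's].
have h : 0 < (s' + s) / 2 < s by apply/andP; split; lra.
have [M HM] := H _ h.
have h' : 0 < s' < (s' + s) / 2 by rewrite s'0/=; lra.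
by have [B HB] := cbound_dshift h'; exists (B * M); exact: HB.
Qed.

Lemma pbound_psum_hasd c s z : pbound c s -> cmod z < s -> hasd (psum c) z (psum (dshift c) z).
Proof.
move=> H zs; have z0 := cmod_ge0 z.
have h : 0 < (cmod z + s) / 2 < s by apply/andP; split; lra.
have [M HM] := H _ h; apply: (psum_hasd HM); lra.
Qed.

Lemma cpart0 (c : nat -> C) N : cpart c 0 N.+1 = c 0%N.
Proof.
rewrite /cpart big_ord_recl/= expr0 mulr1 big1 ?addr0// => i _.
by rewrite /bump add1n expr0n mulr0.
Qed.

Lemma psum0 (c : nat -> C) : psum c 0 = c 0%N.
Proof.
have H (u : nat -> R) x : (forall n, u n.+1 = x) -> limn u = x.
  move=> E; apply: cvg_lim => //; rewrite -(cvg_shiftn 1).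
  by rewrite (_ : (fun n => u (n + 1)%N) = fun=> x);
    [exact: cvg_cst|apply/funext => n; rewrite addn1 E].
by apply: cext; apply: H => n; rewrite cpart0.
Qed.

Lemma iter_dshift (c : nat -> C) n k : iter n dshift c k * k`!%:R = (n + k)`!%:R * c (n + k)%N.
Proof.
elim: n k => [|n IH] k; first by rewrite add0n mulrC.
have e : (k.+1)`!%:R = k.+1%:R * k`!%:R :> C by rewrite factS natrM.
by rewrite iterS addSnnS -IH e /dshift; ring.
Qed.

Lemma derive1n_psum (f : C -> C) c s : 0 < s -> pbound c s -> (forall z, cmod z < s -> f z = psum c z) ->
  forall n z, cmod z < s -> derive1n n f z = psum (iter n dshift c) z.
Proof.
move=> s0 pc fE; elim=> [|n IH] z zs; first exact: fE.
have pn : pbound (iter n dshift c) s by elim: n {IH} => //= n; exact: pbound_dshift.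
rewrite /derive1n !iterS; apply: (proj2 (hasd_derivable _ _ _ _)).
have zs' : 0 < s - cmod z by rewrite subr_gt0.
apply: (hasd_eq_near zs' _ (pbound_psum_hasd pn zs)) => w ws; apply: IH.
rewrite -[w](subrK z); apply: le_lt_trans (cmodD _ _) _; lra.
Qed.

Lemma coef_psum (f : C -> C) c s : 0 < s -> pbound c s -> (forall z, cmod z < s -> f z = psum c z) ->
  coef f = c.
Proof.
move=> s0 pc fE; apply/funext => n.
rewrite /coef (derive1n_psum s0 pc fE) ?cmod0// psum0.
have := iter_dshift c n 0; rewrite fact0 mulr1 addn0 => ->.
by rewrite mulrAC mulfV ?mul1r// pnatr_eq0 -lt0n fact_gt0.
Qed.

Lemma cauchy_estimate (f : C -> C) (s M : R) : holo f -> 0 < s < 1 ->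
  (forall z, cmod z = s -> cmod (f z) <= M) -> cbound (coef f) s (4 * M).
Proof.
move=> hf hs HM; have /andP[s0 s1] := hs.
have [e [ce fe]] : exists e : nat -> C, cbound e s (4 * M) /\ forall z, cmod z < s -> f z = psum e z.
  apply: holo_local => // k u _; apply: HM.
  by rewrite cmodM cmod_arc mulr1 cmod_pos// ltW.
suff -> : coef f = e by [].
apply: (@coef_psum f e s s0) => // s' /andP[s'0 s's].
exists (4 * M) => n; apply: le_trans _ (ce n).
by rewrite ler_wpM2l ?cmod_ge0// lerXn2r ?nnegrE ?ltW.
Qed.

Lemma holo_pbound (f : C -> C) : holo f -> pbound (coef f) 1.
Proof.
move=> hf s hs; have [M HM] := holo_circle_bounded hf hs; have /andP[s0 s1] := hs.
have [e [ce fe]] := holo_local hf hs HM.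
suff -> : coef f = e by exists (4 * M).
apply: (@coef_psum f e s s0) => // s' /andP[s'0 s's].
exists (4 * M) => n; apply: le_trans _ (ce n).
by rewrite ler_wpM2l ?cmod_ge0// lerXn2r ?nnegrE ?ltW.
Qed.

(** Each radius below 1 yields its own expansion, but the coefficients are determined by the
    derivatives at 0, so all these expansions are the same series. *)
Lemma holo_psum (f : C -> C) : holo f -> forall z, cmod z < 1 -> f z = psum (coef f) z.
Proof.
move=> hf z z1; have z0 := cmod_ge0 z.
have hs : 0 < (cmod z + 1) / 2 < 1 by apply/andP; split; lra.
have [M HM] := holo_circle_bounded hf hs; have /andP[s0 s1] := hs.
have [e [ce fe]] := holo_local hf hs HM.
rewrite (@coef_psum f e _ s0) //; first by apply: fe; lra.
move=> s' /andP[s'0 s's].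
exists (4 * M) => n; apply: le_trans _ (ce n).
by rewrite ler_wpM2l ?cmod_ge0// lerXn2r ?nnegrE ?ltW.
Qed.

Lemma psum_holo (f : C -> C) c : pbound c 1 -> (forall z, cmod z < 1 -> f z = psum c z) -> holo f.
Proof.
move=> pc fE z z1; apply: (proj1 (hasd_derivable _ _ (psum (dshift c) z) _)).
have z1' : 0 < 1 - cmod z by rewrite subr_gt0.
apply: (hasd_eq_near z1' _ (pbound_psum_hasd pc z1)) => w ws; apply: fE.
rewrite -[w](subrK z); apply: le_lt_trans (cmodD _ _) _; lra.
Qed.

Lemma derive1_psum (f : C -> C) c : pbound c 1 -> (forall z, cmod z < 1 -> f z = psum c z) ->
  forall z, cmod z < 1 -> derive1 f z = psum (dshift c) z.
Proof. by move=> pc fE z z1; exact: (derive1n_psum ltr01 pc fE 1 z1). Qed.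

Lemma holo_derive1 (f : C -> C) : holo f -> holo (derive1 f).
Proof.
move=> hf; have pf := holo_pbound hf.
apply: (psum_holo (pbound_dshift pf)); exact: derive1_psum pf (holo_psum hf).
Qed.

Lemma coef_derive1 (f : C -> C) : holo f -> coef (derive1 f) = dshift (coef f).
Proof.
move=> hf; have pf := holo_pbound hf.
apply: (@coef_psum _ _ 1) => //; first exact: pbound_dshift.
exact: derive1_psum pf (holo_psum hf).
Qed.

End holomorphic_functions.

(** * Integration along rays and the operator [Tg] *)

Section rays.
Context {R : realType}.
Local Notation C := (CC R).

Lemma is_derive_eps (f : R -> R) (x d : R) :
  (forall e, 0 < e -> exists2 r, 0 < r & forall h, `|h| < r ->
    `|f (x + h) - f x - d * h| <= e * `|h|) -> is_derive x 1 f d.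
Proof.
move=> H.
have K : h^-1 *: ((f \o shift x) h - f x) @[h --> (0 : R)^'] --> d.
  apply/cvgrPdist_le => e e0; have [r r0 Hr] := H _ e0.
  exists r => // h /=; rewrite sub0r normrN => hr h0.
  have -> : d - h^-1 *: (f (h + x) - f x) = - (h^-1 * (f (x + h) - f x - d * h)).
    by rewrite (addrC h x) mulrBr [h^-1 * (d * h)]mulrCA mulVf// mulr1 opprB.
  by rewrite normrN normrM normfV ler_pdivrMl ?normr_gt0// [`|h| * _]mulrC; exact: Hr.
have K' : h^-1 *: ((f \o shift x) (h *: (1 : R)) - f x) @[h --> (0 : R)^'] --> d.
  by under eq_fun do rewrite [_ *: 1]mulr1.
by split; [apply/cvg_ex; exists d|rewrite /derive; apply: cvg_lim].
Qed.

Lemma cder_ray (F : C -> C) (a : C) (t : R) (d : C) : hasd F (cofr t * a) d ->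
  cder (fun s => F (cofr s * a)) t (d * a).
Proof.
move=> H.
have K : 0 < cmod a + 1 by rewrite ltr_wpDl ?cmod_ge0.
have key e : 0 < e -> exists2 r, 0 < r & forall h : R, `|h| < r ->
    cmod (F (cofr (t + h) * a) - F (cofr t * a) - d * a * cofr h) <= e * `|h|.
  move=> e0; have [r r0 Hr] := H (e / (cmod a + 1)) (divr_gt0 e0 K).
  exists (r / (cmod a + 1)); first exact: divr_gt0.
  move=> h; rewrite ltr_pdivlMr// => hr.
  have hle : cmod (cofr h * a) <= `|h| * (cmod a + 1).
    by rewrite cmodM cmod_real ler_wpM2l// lerDl.
  rewrite cofrD mulrDl -[d * a * _]mulrA [a * cofr h]mulrC.
  apply: le_trans (Hr _ (le_lt_trans hle hr)) _.
  apply: le_trans (ler_wpM2l _ hle) _; first by rewrite divr_ge0 ?ltW.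
  by rewrite [`|h| * _]mulrC mulrA divfK// gt_eqF.
split; apply: is_derive_eps => e e0; have [r r0 Hr] := key e e0; exists r => // h hr.
  apply: le_trans _ (Hr h hr); apply: le_trans _ (cRe_le _).
  by rewrite !cReD !cReN [complex.Re (_ * cofr h)]cReM cRe_C cIm_C mulr0 subr0.
apply: le_trans _ (Hr h hr); apply: le_trans _ (cIm_le _).
by rewrite !cImD !cImN [complex.Im (_ * cofr h)]cImM cRe_C cIm_C mulr0 add0r.
Qed.

Lemma cderD (f g : R -> C) x df dg : cder f x df -> cder g x dg ->
  cder (fun t => f t + g t) x (df + dg).
Proof.
move=> [f1 f2] [g1 g2]; split.
  rewrite cReD (_ : (fun t => _) = (fun t => complex.Re (f t)) + (fun t => complex.Re (g t))).
    exact: is_deriveD.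
  by apply/funext => t; rewrite cReD.
rewrite cImD (_ : (fun t => _) = (fun t => complex.Im (f t)) + (fun t => complex.Im (g t))).
  exact: is_deriveD.
by apply/funext => t; rewrite cImD.
Qed.

Lemma holoM (f g : C -> C) : holo f -> holo g -> holo (fun z => f z * g z).
Proof. by move=> hf hg z z1; exact: derivableM (hf z z1) (hg z z1). Qed.

Lemma holoB (f g : C -> C) : holo f -> holo g -> holo (fun z => f z - g z).
Proof. by move=> hf hg z z1; exact: derivableB (hf z z1) (hg z z1). Qed.

Lemma derive1_holoB (f g : C -> C) z : holo f -> holo g -> cmod z < 1 ->
  derive1 (fun z => f z - g z) z = derive1 f z - derive1 g z.
Proof.
move=> hf hg z1; rewrite !derive1E.
exact: deriveB (hf z z1) (hg z z1).
Qed.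

Lemma cmod_ray (t : R) (a : C) : 0 <= t -> cmod (cofr t * a) = t * cmod a.
Proof. by move=> t0; rewrite cmodM cmod_pos. Qed.

Lemma ray_disc (t r : R) (eta : C) : cmod eta <= 1 -> r < 1 -> 0 <= t <= r -> cmod (cofr t * eta) < 1.
Proof.
move=> e1 r1 /andP[t0 tr]; rewrite cmod_ray//; apply: le_lt_trans r1.
by apply: le_trans tr; rewrite -[leRHS]mulr1 ler_wpM2l.
Qed.

Lemma ccont_ray (f : C -> C) (r : R) (eta : C) : holo f -> cmod eta <= 1 -> r < 1 ->
  ccont 0 r (fun t => f (cofr t * eta)).
Proof.
move=> hf e1 r1; apply: (@cder_cont _ _ _ _ (fun t => derive1 f (cofr t * eta) * eta)) => t ht.
by apply: cder_ray; apply: holo_hasd => //; exact: ray_disc ht.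
Qed.

Lemma ccont_ray_derive (f : C -> C) (r : R) (eta : C) : holo f -> cmod eta <= 1 -> r < 1 ->
  ccont 0 r (fun t => derive1 f (cofr t * eta)).
Proof. by move=> hf; exact: (ccont_ray (holo_derive1 hf)). Qed.

Lemma holo_FTC (f : C -> C) (r : R) (eta : C) : holo f -> cmod eta <= 1 -> 0 <= r < 1 ->
  cseg 0 r (fun t => derive1 f (cofr t * eta) * eta) = f (cofr r * eta) - f 0.
Proof.
move=> hf e1 /andP[r0 r1].
rewrite (@cseg_FTC _ 0 r (fun t => f (cofr t * eta)))//; first by rewrite cofr0 mul0r.
  by move=> t ht; apply: cder_ray; apply: holo_hasd => //; exact: ray_disc ht.
exact: (ccontM (ccont_ray_derive hf e1 r1) (ccont_cst 0 r eta)).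
Qed.

Lemma ccont_ray1 (f : C -> C) (z : C) : holo f -> cmod z < 1 -> ccont 0 1 (fun t => f (cofr t * z)).
Proof.
move=> hf z1; apply: (@cder_cont _ _ _ _ (fun t => derive1 f (cofr t * z) * z)) => t /andP[t0 t1].
apply: cder_ray; apply: holo_hasd => //; rewrite cmod_ray//; apply: le_lt_trans z1.
by rewrite -[leRHS]mul1r ler_wpM2r ?cmod_ge0.
Qed.

(** The primitive is obtained by integrating the power series termwise and then identified with the
    segment integral. This makes [Tg] holomorphic without differentiation under the integral
    sign. *)
Lemma holo_primitive (F : C -> C) : holo F -> exists G : C -> C,
  [/\ holo G, G 0 = 0, (forall z, cmod z < 1 -> hasd G z (F z)) &
   forall z, cmod z < 1 -> z * cint01 (fun t => F (cofr t * z)) = G z].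
Proof.
move=> hF; pose c n : C := if n is m.+1 then coef F m / m.+1%:R else 0.
have dc : dshift c = coef F.
  by apply/funext => n; rewrite /dshift /c mulrC divfK// pnatr_eq0.
have pc : pbound c 1.
  move=> s hs; have [M HM] := holo_pbound hF hs; have /andP[s0 s1] := hs; exists M => -[|n].
    by rewrite /c cmod0 mul0r; exact: cbound_ge0 HM.
  rewrite /c cmodM cmodV cmod_nat; apply: le_trans _ (HM n).
  rewrite -mulrA; apply: ler_wpM2l; first exact: cmod_ge0.
  rewrite exprS mulrA ler_piMl ?exprn_ge0 ?(ltW s0)//.
  rewrite mulrC ler_pdivrMr// mul1r; apply: le_trans (ltW s1) _; exact: ler1n.
have hG : holo (psum c) by exact: psum_holo pc _.
have dG z : cmod z < 1 -> hasd (psum c) z (F z).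
  move=> z1; have -> : F z = psum (dshift c) z by rewrite dc; exact: holo_psum.
  exact: (pbound_psum_hasd pc z1).
exists (psum c); split => //; first by rewrite psum0.
move=> z z1.
have cF := ccont_ray1 hF z1.
rewrite -[cint01 _]/(cseg 0 1 (fun t => F (cofr t * z))) -csegZ//.
rewrite (@cseg_FTC _ 0 1 (fun t => psum c (cofr t * z)))//.
- by rewrite cofr0 cofr1 mul0r mul1r psum0 subr0.
- move=> t /andP[t0 t1]; rewrite mulrC; apply: cder_ray; apply: dG.
  by rewrite cmod_ray//; apply: le_lt_trans z1; rewrite -[leRHS]mul1r ler_wpM2r ?cmod_ge0.
- by apply: (@ccontM _ _ _ (fun=> z)) => //; exact: ccont_cst.
Qed.

Lemma hasd_Tg (g f : C -> C) z : holo g -> holo f -> cmod z < 1 ->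
  hasd (Tg g f) z (f z * derive1 g z).
Proof.
move=> hg hf z1.
have [G [hG G0 dG GE]] := holo_primitive (holoM hf (holo_derive1 hg)).
have z1' : 0 < 1 - cmod z by rewrite subr_gt0.
apply: (hasd_eq_near z1' _ (dG z z1)) => w ws; apply: GE.
rewrite -[w](subrK z); apply: le_lt_trans (cmodD _ _) _; lra.
Qed.

Lemma holo_Tg (g f : C -> C) : holo g -> holo f -> holo (Tg g f).
Proof. by move=> hg hf z z1; have [] := hasd_derivable _ _ _ (hasd_Tg hg hf z1). Qed.

Lemma Tg0 (g f : C -> C) : Tg g f 0 = 0.
Proof. by rewrite /Tg mul0r. Qed.

Lemma Tg_FTC (g f : C -> C) (r : R) (eta : C) : holo g -> holo f -> cmod eta <= 1 -> 0 <= r < 1 ->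
  cseg 0 r (fun t => f (cofr t * eta) * derive1 g (cofr t * eta) * eta) = Tg g f (cofr r * eta).
Proof.
move=> hg hf e1 /andP[r0 r1].
rewrite (@cseg_FTC _ 0 r (fun t => Tg g f (cofr t * eta)))//.
- by rewrite cofr0 mul0r Tg0 subr0.
- by move=> t ht; apply: cder_ray; apply: hasd_Tg => //; exact: ray_disc ht.
- exact: (ccontM (ccontM (ccont_ray hf e1 r1) (ccont_ray_derive hg e1 r1)) (ccont_cst 0 r eta)).
Qed.

(* Integration by parts along the ray trades [f g'] for [f' (g(r eta) - g)], so that only moments
   of [g] near the end point enter. *)
Lemma Tg_by_parts (g f : C -> C) (r : R) (eta : C) : holo g -> holo f -> cmod eta <= 1 -> 0 <= r < 1 ->
  Tg g f (cofr r * eta) = f 0 * (g (cofr r * eta) - g 0) +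
    cseg 0 r (fun t => derive1 f (cofr t * eta) * eta * (g (cofr r * eta) - g (cofr t * eta))).
Proof.
move=> hg hf e1 /andP[r0 r1].
set c := g (cofr r * eta).
(* With c the value of g at the end point, H = T_g f + f (c - g) has derivative f g' + f' (c - g) -
   f g' = f' (c - g) along the ray. *)
pose H t := Tg g f (cofr t * eta) + f (cofr t * eta) * (- 1 * (g (cofr t * eta) - c)).
rewrite (@cseg_FTC _ 0 r H)//.
- rewrite /H cofr0 mul0r Tg0 subrr !mulr0 addr0 add0r -/c.
  by rewrite mulN1r opprB addrC subrK.
- move=> t ht; have t1 := ray_disc e1 r1 ht.
  have h1 := cder_ray (hasd_Tg hg hf t1); have h2 := cder_ray (holo_hasd hf t1).
  have h3 := cderZ (- 1) (cderB c (cder_ray (holo_hasd hg t1))).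
  have := cderD h1 (cderM h2 h3); congr cder.
  by move: (derive1 f _) (derive1 g _) (f _) (g (cofr t * eta)) (c) => a b x y k; ring.
- exact: (ccontM (ccontM (ccont_ray_derive hf e1 r1) (ccont_cst 0 r eta))
    (ccontB (ccont_cst 0 r c) (ccont_ray hg e1 r1))).
Qed.

End rays.

(** * Symbols with nonnegative coefficients *)

Section positive_coefficients.
Context {R : realType}.
Local Notation C := (CC R).

Lemma psum_geometric_tail (c : nat -> C) (z : C) : pbound c 1 -> cmod z < 1 ->
  exists A t : R, 0 <= t < 1 /\ forall N, cmod (psum c z - cpart c z N) <= A * t ^+ N.
Proof.
move=> pc z1; have z0 := cmod_ge0 z.
have h : 0 < (cmod z + 1) / 2 < 1 by apply/andP; split; lra.
have [M HM] := pc _ h; set s := (cmod z + 1) / 2 in h HM.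
have /andP[s0 s1] := h; have zs : cmod z < s by rewrite /s; lra.
exists (M / (1 - cmod z / s)), (cmod z / s); split.
  by rewrite divr_ge0 ?(ltW s0)//= ltr_pdivrMr// mul1r.
by move=> N; exact: psum_tail.
Qed.

Lemma coef_ge0_real (g : C -> C) : (forall n, 0 <= coef g n) ->
  forall n, coef g n = cofr (complex.Re (coef g n)) /\ 0 <= complex.Re (coef g n).
Proof. by move=> g0 n; exact: cge0_real. Qed.

Lemma psum_real_ge (c : nat -> C) (s : R) m : pbound c 1 ->
  (forall n, c n = cofr (complex.Re (c n)) /\ 0 <= complex.Re (c n)) -> 0 <= s < 1 ->
  psum c (cofr s) = cofr (complex.Re (psum c (cofr s))) /\
  \sum_(n < m) complex.Re (c n) * s ^+ n <= complex.Re (psum c (cofr s)).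
Proof.
move=> pc c0 /andP[s0 s1].
have z1 : cmod (cofr s) < 1 by rewrite cmod_pos.
have [A [t [ht HA]]] := psum_geometric_tail pc z1.
have A0 : 0 <= A by have := HA 0%N; rewrite expr0 mulr1; exact: le_trans (cmod_ge0 _).
have pE N : cpart c (cofr s) N = cofr (\sum_(n < N) complex.Re (c n) * s ^+ n).
  have term n : c n * cofr s ^+ n = cofr (complex.Re (c n) * s ^+ n).
    by rewrite {1}(c0 n).1 -cofrX -cofrM.
  apply: cext; rewrite /cpart ?cRe_sum ?cIm_sum ?cRe_C ?cIm_C.
    by apply: eq_bigr => n _; rewrite term cRe_C.
  by rewrite big1// => n _; rewrite term cIm_C.
split.
  apply: cext; rewrite ?cRe_C// cIm_C; apply/eqP; rewrite -normr_le0.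
  apply: (le_geometric_tail ht (A := A)) => N; rewrite add0r; apply: le_trans _ (HA N).
  by apply: le_trans _ (cIm_le _); rewrite pE cImD cImN cIm_C subr0.
apply: (le_geometric_tail ht (A := A)) => N.
have h := HA (m + N)%N; rewrite pE in h.
have {}h := le_trans (cRe_le _) h; rewrite cReD cReN cRe_C in h.
have /andP[t0 t1] := ht.
have h2 : A * t ^+ (m + N) <= A * t ^+ N.
  by rewrite ler_wpM2l// exprD ler_piMl ?exprn_ge0// exprn_ile1 ?t0 ?ltW.
have h3 : \sum_(n < m) complex.Re (c n) * s ^+ n <= \sum_(n < m + N) complex.Re (c n) * s ^+ n.
  rewrite big_split_ord/= lerDl; apply: sumr_ge0 => n _.
  by rewrite mulr_ge0 ?exprn_ge0// (c0 _).2.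
move: h; rewrite ler_norml => /andP[h _]; lra.
Qed.

(** The left side is at most 1 and at most (n+1) / (k+1), by Bernoulli and the position of t.
    Multiplying by n + k + 1 = (n+1) + (k+1) - 1 and using one bound for each summand gives 2
    (n+1). *)
Lemma one_sub_pow_le (t : R) (n k : nat) : 0 <= t <= 1 -> 1 - k.+1%:R^-1 <= t ->
  1 - t ^+ n.+1 <= 2 * n.+1%:R / (n + k + 1)%:R.
Proof.
move=> /andP[t0 t1] tk.
have nk : 0 < (n + k + 1)%:R :> R by rewrite ltr0n addn1.
have k0 : 0 < k.+1%:R :> R by [].
have h1 : 1 - t ^+ n.+1 <= n.+1%:R * (1 - t).
  elim: n {nk} => [|n IH]; first by rewrite expr1 mul1r.
  have e : 1 - t ^+ n.+2 = (1 - t) + t * (1 - t ^+ n.+1) by rewrite [t ^+ n.+2]exprS; ring.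
  rewrite e -[n.+2%:R]natr1 mulrDl mul1r [leLHS]addrC lerD2r; apply: le_trans IH.
  by rewrite ler_piMl// subr_ge0 exprn_ile1// t0.
have E : (n + k + 1)%:R = n.+1%:R + k.+1%:R - 1 :> R.
  by rewrite addn1 -!natr1 natrD; ring.
rewrite ler_pdivlMr// E.
have x0 : 0 <= 1 - t ^+ n.+1 by rewrite subr_ge0 exprn_ile1// t0.
have h3 : (1 - t ^+ n.+1) * k.+1%:R <= n.+1%:R.
  apply: le_trans (ler_wpM2r (ltW k0) h1) _; rewrite -mulrA ler_piMr//.
  by rewrite -ler_pdivlMr// mul1r lerBlDr addrC -lerBlDr.
have h4 : (1 - t ^+ n.+1) * n.+1%:R <= n.+1%:R.
  by rewrite ler_piMl// gerBl exprn_ge0.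
rewrite mulrDr mulrDr mulrN1; lra.
Qed.

(** The triangle inequality is applied term by term with r^(n+1) - t^(n+1) <= 1 - t^(n+1). As the
    coefficients are nonnegative, the resulting sum of their moduli is the inner sum itself. *)
Lemma holo_increment_le (g : C -> C) (k : nat) (B t r : R) (eta : C) : holo g ->
  (forall n, 0 <= coef g n) ->
  (forall N, \sum_(n < N) n.+1%:R * complex.Re (coef g n.+1) / (n + k + 1)%:R <= B) ->
  cmod eta <= 1 -> 0 <= t <= r -> r < 1 -> 1 - k.+1%:R^-1 <= t ->
  cmod (g (cofr r * eta) - g (cofr t * eta)) <= 2 * B.
Proof.
move=> hg g0 gB e1 /andP[t0 tr] r1 tk.
have pg := holo_pbound hg; have r0 := le_trans t0 tr.
have z1 : cmod (cofr r * eta) < 1 by apply: (@ray_disc _ r r) => //; rewrite r0 lexx.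
have w1 : cmod (cofr t * eta) < 1 by apply: (@ray_disc _ t r) => //; rewrite t0.
have [A1 [q1 [hq1 H1]]] := psum_geometric_tail pg z1.
have [A2 [q2 [hq2 H2]]] := psum_geometric_tail pg w1.
have A10 : 0 <= A1 by have := H1 0%N; rewrite expr0 mulr1; exact: le_trans (cmod_ge0 _).
have A20 : 0 <= A2 by have := H2 0%N; rewrite expr0 mulr1; exact: le_trans (cmod_ge0 _).
have /andP[q10 q11] := hq1; have /andP[q20 q21] := hq2.
have hq : 0 <= Num.max q1 q2 < 1 by rewrite le_max q10/= gt_max q11.
apply: (le_geometric_tail hq (A := A1 + A2)) => N.
rewrite (holo_psum hg z1) (holo_psum hg w1).
have m1 : q1 ^+ N.+1 <= Num.max q1 q2 ^+ N.
  apply: (@le_trans _ _ (q1 ^+ N)); first by rewrite exprS ler_piMl ?exprn_ge0// ltW.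
  by apply: lerXn2r; rewrite ?nnegrE ?le_max ?q10 ?lexx.
have m2 : q2 ^+ N.+1 <= Num.max q1 q2 ^+ N.
  apply: (@le_trans _ _ (q2 ^+ N)); first by rewrite exprS ler_piMl ?exprn_ge0// ltW.
  by apply: lerXn2r; rewrite ?nnegrE ?le_max ?q10 ?lexx ?orbT.
set c := coef g in H1 H2 pg *.
have -> : psum c (cofr r * eta) - psum c (cofr t * eta) =
  (cpart c (cofr r * eta) N.+1 - cpart c (cofr t * eta) N.+1) +
  ((psum c (cofr r * eta) - cpart c (cofr r * eta) N.+1) - (psum c (cofr t * eta) - cpart c (cofr t * eta) N.+1)).
  move: (psum _ _) (psum _ _) (cpart _ _ _) (cpart _ _ _) => x1 x2 x3 x4; ring.
apply: le_trans (cmodD _ _) _; apply: lerD; last first.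
  apply: le_trans (cmodB _ _) _; rewrite [leRHS]mulrDl; apply: lerD.
    by apply: le_trans (H1 _) _; rewrite ler_wpM2l.
  by apply: le_trans (H2 _) _; rewrite ler_wpM2l.
apply: (@le_trans _ _ (2 * \sum_(n < N) n.+1%:R * complex.Re (c n.+1) / (n + k + 1)%:R)); last first.
  by rewrite ler_wpM2l.
rewrite mulr_sumr /cpart -sumrB big_ord_recl !expr0 subrr add0r.
apply: le_trans (cmod_sum _ _ _ _) _; apply: ler_sum => n _.
rewrite lift0.
have -> : c n.+1 * (cofr r * eta) ^+ n.+1 - c n.+1 * (cofr t * eta) ^+ n.+1 =
    c n.+1 * cofr (r ^+ n.+1 - t ^+ n.+1) * eta ^+ n.+1.
  rewrite cofrD cofrN !cofrX !exprMn.
  by move: (c n.+1) (_ ^+ _) (_ ^+ _) (_ ^+ _) => x1 x2 x3 x4; ring.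
rewrite cmodM cmodX cmodM.
have [cE c0] := coef_ge0_real g0 n.+1; rewrite -/c in cE c0.
rewrite cE cmod_pos// cRe_C cmod_pos; last first.
  by rewrite subr_ge0 lerXn2r ?nnegrE.
have p : 1 - t ^+ n.+1 <= 2 * n.+1%:R / (n + k + 1)%:R.
  by apply: one_sub_pow_le => //; rewrite t0 (le_trans tr (ltW r1)).
have -> : 2 * (n.+1%:R * complex.Re (c n.+1) / (n + k + 1)%:R) =
  complex.Re (c n.+1) * (2 * n.+1%:R / (n + k + 1)%:R) by ring.
rewrite -mulrA; apply: ler_wpM2l => //; apply: le_trans p.
apply: (@le_trans _ _ (r ^+ n.+1 - t ^+ n.+1)).
  rewrite ler_piMr//; first by rewrite subr_ge0 lerXn2r ?nnegrE.
  by rewrite exprn_ile1 ?cmod_ge0.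
by rewrite lerD2r exprn_ile1 ?r0 ?ltW.
Qed.

End positive_coefficients.

(** * Radial weights *)

Section radial_weights.
Context {R : realType}.
Local Notation mu := (@lebesgue_measure R).

(* At x = k (1 - s) this replaces s ^ k: it is analytic in s, with a modulus that decays away from 1. *)
Definition bump (M : nat) (x : R) : R := (1 + x)^-1 ^+ M.

Lemma bump_ge0 M x : 0 <= x -> 0 <= bump M x.
Proof. by move=> x0; rewrite exprn_ge0// invr_ge0 addr_ge0. Qed.

Lemma bump_le1 M x : 0 <= x -> bump M x <= 1.
Proof.
move=> x0; rewrite exprn_ile1 ?invr_ge0 ?addr_ge0// invf_le1 ?lerDl//.
by rewrite ltr_wpDr.
Qed.

Lemma measurable_bump M (a : R) : measurable_fun [set: R] (fun s => bump M (a * (1 - s))).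
Proof.
apply: measurable_funX; apply: measurable_funV_in; apply: measurable_funD => //.
by apply: measurable_funM => //; exact: measurable_funB.
Qed.

(** For x >= 1 the ratio (1 + x/2) / (1 + x) is at most 3/4. This gain, raised to the power M, has
    to absorb the doubling constant. *)
Lemma bump_halve M x : 1 <= x -> bump M x <= (3 / 4) ^+ M * bump M (x / 2).
Proof.
move=> x1; rewrite /bump -exprMn; apply: lerXn2r; rewrite ?nnegrE.
- by rewrite invr_ge0; lra.
- by rewrite mulr_ge0// invr_ge0; lra.
- by rewrite ler_pdivlMr ?ler_pdivrMl//; lra.
Qed.

(** With d = 1 - s and j the integer part of k / M: s^k <= (s^j)^M, and s^j <= 1 / (1 + j d),
    because s (1 + d) <= 1 and 1 + j d <= (1 + d)^j. Finally 1 + k d <= (1 + M) (1 + j d). *)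
Lemma pow_le_bump M k (s : R) : (0 < M)%N -> 0 <= s <= 1 ->
  s ^+ k <= (1 + M%:R) ^+ M * bump M (k%:R * (1 - s)).
Proof.
move=> M0 /andP[s0 s1].
pose d := 1 - s; have d0 : 0 <= d by rewrite subr_ge0.
have d1 : d <= 1 by rewrite /d; lra.
pose j := (k %/ M)%N.
have kd : 0 < 1 + k%:R * d by rewrite ltr_wpDr// mulr_ge0.
have jd : 0 < 1 + j%:R * d by rewrite ltr_wpDr// mulr_ge0.
apply: (@le_trans _ _ ((s ^+ j) ^+ M)).
  rewrite -exprM; apply: ler_wiXn2l; rewrite ?s0//.
  exact: leq_trunc_div.
rewrite /bump -exprMn; apply: lerXn2r; rewrite ?nnegrE ?exprn_ge0//.
  by rewrite mulr_ge0 ?addr_ge0// invr_ge0 ltW.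
apply: (@le_trans _ _ (1 + j%:R * d)^-1).
  rewrite -[leRHS]mul1r ler_pdivlMr//.
  have h : 1 + j%:R * d <= (1 + d) ^+ j.
    elim: j {jd} => [|j IH]; first by rewrite mul0r expr0 addr0.
    rewrite exprS mulrDl mul1r -natr1 mulrDl mul1r addrA; apply: lerD => //.
    by rewrite ler_peMr// exprn_ege1// lerDl.
  apply: le_trans (ler_wpM2l (exprn_ge0 _ s0) h) _.
  rewrite -exprMn exprn_ile1//; first by apply: mulr_ge0 => //; apply: addr_ge0.
  have e : s * (1 + d) = 1 - d * d by rewrite /d; ring.
  by rewrite e gerBl mulr_ge0.
rewrite -/d (ler_pdivlMr _ _ kd) mulrC (ler_pdivrMr _ _ jd).
have hk : k%:R <= (j%:R + 1) * M%:R :> R.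
  by rewrite natr1 -natrM ler_nat ltnW// -ltn_divLR.
have h1 : k%:R * d <= (j%:R + 1) * M%:R * d by rewrite ler_wpM2r.
have h2 : M%:R * d <= M%:R by rewrite ler_piMr.
have h3 : 0 <= j%:R * d by rewrite mulr_ge0.
have e1 : (j%:R + 1) * M%:R * d = j%:R * d * M%:R + M%:R * d by ring.
have e2 : (1 + M%:R) * (1 + j%:R * d) = 1 + M%:R + j%:R * d + j%:R * d * M%:R by ring.
rewrite e2; rewrite e1 in h1; lra.
Qed.

(** For k > 0, e^(1/k) >= 1 + 1/k, which is the inverse of 1 - 1/(k+1). *)
Lemma node_pow (k : nat) (s : R) : 1 - k.+1%:R^-1 <= s -> 1 <= expR 1 * s ^+ k.
Proof.
case: k => [|k] h; first by rewrite expr0 mulr1 -expR0 ler_expR.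
have k0 : 0 < k.+1%:R :> R by [].
have x0 : 0 <= 1 - k.+2%:R^-1 :> R by rewrite subr_ge0 invf_le1 ?ler1n.
have e : expR 1 = expR (k.+1%:R^-1) ^+ k.+1 :> R.
  by rewrite -expRM_natl mulfV// gt_eqF.
rewrite e -exprMn exprn_ege1//.
apply: (@le_trans _ _ ((1 + k.+1%:R^-1) * (1 - k.+2%:R^-1))).
  have -> : (1 + k.+1%:R^-1) * (1 - k.+2%:R^-1) = 1 :> R.
    rewrite -[k.+2%:R]natr1; field.
    have kk : 0 <= k%:R :> R by [].
    by apply/andP; split; apply: lt0r_neq0; lra.
  by [].
by apply: ler_pM => //; exact: expR_ge1Dx.
Qed.

Variable w : R -> R.
Hypothesis rw : radial_weight w.
Variable C0 : R.
Hypothesis C01 : 1 <= C0.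
Hypothesis dw : forall r, 0 <= r < 1 -> (omega_hat w r <= C0%:E * omega_hat w ((1 + r) / 2))%E.

Local Notation I := (`[0%R, 1%R[%classic : set R).

Lemma weight_ge0 r : I r -> 0 <= w r.
Proof. by case: rw => h _ _; rewrite /= in_itv/=; exact: h. Qed.

Lemma measurable_weight : measurable_fun I w.
Proof. by case: rw => _ /measurable_int/measurable_EFinP. Qed.

Lemma omega_hat_mono r s : 0 <= r -> r <= s -> (omega_hat w s <= omega_hat w r)%E.
Proof.
move=> r0 rs; apply: ge0_integral_le_subset => x /=; rewrite !in_itv/=.
  by move=> /andP[h1 h2]; rewrite lee_fin weight_ge0//= in_itv/= h2 (le_trans r0).
by move=> /andP[h1 h2]; rewrite h2 (le_trans rs).
Qed.

Lemma omega_hat_fin r : 0 <= r -> (omega_hat w r < +oo)%E.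
Proof.
move=> r0; apply: le_lt_trans (omega_hat_mono (lexx 0) r0) _.
case: rw => _ iw _; have := integrable_lty _ iw; exact.
Qed.

Definition bumped M (a : R) : \bar R := (\int[mu]_(s in I) (w s * bump M (a * (1 - s)))%:E)%E.

Lemma measurable_bumped M (a : R) : measurable_fun I (fun s => (w s * bump M (a * (1 - s)))%:E).
Proof.
apply/measurable_EFinP; apply: measurable_funM; first exact: measurable_weight.
exact: measurable_funTS (measurable_bump _ _).
Qed.

(** On [1 - d, 1[ the bump is at most 1; further away [bump_halve] applies. The result compares
    scale d with scale 2 d and is meant for iteration. *)
Lemma bumped_halve M d : 0 < d -> d <= 1/2 ->
  (bumped M d^-1 <= omega_hat w (1 - d)%R + ((3 / 4) ^+ M)%:E * bumped M (2 * d)^-1)%E.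
Proof.
move=> d0 d12.
pose J := (`[(1 - d)%R, 1%R[%classic : set R).
have d1 : 0 <= 1 - d by lra.
have JI : J `<=` I.
  by move=> x; rewrite /J /= !in_itv/= => /andP[h1 h2]; rewrite h2 (le_trans d1).
have -> : omega_hat w (1 - d) = (\int[mu]_(s in I) (w s * \1_J s)%:E)%E.
  rewrite /omega_hat -[X in (\int[_]_(_ in X) _)%E](setIidr JI) integral_mkcondr.
  apply: eq_integral => s _; rewrite patchE indicE.
  by case: ifPn => sJ; rewrite ?mulr1 ?mulr0.
have h0 s : I s -> 0 <= 1 - s by rewrite /= in_itv/= => /andP[_ h]; rewrite subr_ge0 ltW.
have q0 : 0 <= (3 / 4 : R) ^+ M by rewrite exprn_ge0.
have d20 : 0 <= (2 * d)^-1 by rewrite invr_ge0; lra.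
rewrite -ge0_integralZl//; last 2 first.
- exact: measurable_bumped.
- by move=> s Is; rewrite lee_fin mulr_ge0 ?weight_ge0 ?bump_ge0 ?mulr_ge0 ?h0.
rewrite -ge0_integralD//; last 4 first.
- by move=> s Is; rewrite lee_fin mulr_ge0 ?weight_ge0// indicE.
- apply/measurable_EFinP; apply: measurable_funM; first exact: measurable_weight.
  by apply: (@measurable_indic _ _ R I J); exact: measurable_itv.
- by move=> s Is; rewrite -EFinM lee_fin !mulr_ge0 ?weight_ge0 ?bump_ge0 ?mulr_ge0 ?h0.
- by apply: measurable_funeM; exact: measurable_bumped.
apply: ge0_le_integral_nomeas => s Is.
  by rewrite lee_fin mulr_ge0 ?weight_ge0 ?bump_ge0 ?mulr_ge0 ?h0 ?invr_ge0 ?(ltW d0).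
rewrite -EFinM -EFinD lee_fin.
have w0 := weight_ge0 Is.
have -> : w s * \1_J s + (3 / 4) ^+ M * (w s * bump M ((2 * d)^-1 * (1 - s))) =
  w s * (\1_J s + (3 / 4) ^+ M * bump M ((2 * d)^-1 * (1 - s))) by ring.
apply: ler_wpM2l => //.
rewrite indicE; have [sJ|sJ] := boolP (s \in J).
  apply: ler_wpDr; first by rewrite mulr_ge0 ?bump_ge0 ?mulr_ge0 ?h0.
  by rewrite bump_le1// mulr_ge0 ?h0 ?invr_ge0 ?(ltW d0).
rewrite add0r.
have -> : (2 * d)^-1 * (1 - s) = d^-1 * (1 - s) / 2 by rewrite invfM; ring.
apply: bump_halve.
have sd : s < 1 - d.
  rewrite ltNge; apply: contra sJ => h; rewrite inE /J /= in_itv/= h/=.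
  by move: Is; rewrite /= in_itv/= => /andP[].
by rewrite ler_pdivlMl// mulr1; lra.
Qed.

Lemma bumped_le_total M a : 0 <= a -> (bumped M a <= omega_hat w 0)%E.
Proof.
move=> a0; apply: ge0_le_integral_nomeas => s Is.
  have h : 0 <= 1 - s by move: Is; rewrite /= in_itv/= => /andP[_ h]; rewrite subr_ge0 ltW.
  by rewrite lee_fin mulr_ge0 ?weight_ge0 ?bump_ge0 ?mulr_ge0.
have h : 0 <= 1 - s by move: Is; rewrite /= in_itv/= => /andP[_ h]; rewrite subr_ge0 ltW.
by rewrite lee_fin ler_piMr ?weight_ge0// bump_le1// mulr_ge0.
Qed.

(** Dyadic induction on the scale. The constant 2 C0 reproduces itself: 1 + (3/4)^M * 2 C0 * C0 <= 1
    + C0 <= 2 C0, where one factor C0 is the doubling from scale 2 d to d. *)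
Lemma bumped_le M d : (3 / 4) ^+ M * C0 <= 2^-1 -> 0 < d <= 1 ->
  (bumped M d^-1 <= (2 * C0)%:E * omega_hat w (1 - d))%E.
Proof.
move=> hM.
have C00 : 0 <= C0 by exact: le_trans C01.
(* The induction climbs from scale d to 2 d, so it counts the doublings needed to reach 1; it is
   vacuous at j = 0. *)
suff H j : forall d, 2^-1 ^+ j < d -> d <= 1 -> (bumped M d^-1 <= (2 * C0)%:E * omega_hat w (1 - d))%E.
  move=> /andP[d0 d1].
  have h12 : 0 <= (2^-1 : R) < 1 by apply/andP; split; lra.
  have [j hj] := expr_small h12 d0.
  by apply: H hj d1.
elim: j => [|j IH] {}d hd d1; first by move: hd; rewrite expr0 ltNge d1.
have d0 : 0 < d by apply: lt_trans hd; rewrite exprn_gt0.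
have wh0 : (0 <= omega_hat w (1 - d))%E.
  case: (ltgtP d 1) d1 => // h _; last by rewrite h subrr; case: rw => _ _ H; apply/ltW/H; rewrite lexx ltr01.
  by case: rw => _ _ H; apply/ltW/H; lra.
have [h|h] := leP d (1/2); last first.
  apply: le_trans (bumped_le_total _ _) _; first by rewrite invr_ge0 ltW.
  apply: (@le_trans _ _ (C0%:E * omega_hat w (1 - d))%E).
    apply: le_trans (dw _) _; first by rewrite lexx ltr01.
    apply: lee_wpmul2l => //; apply: omega_hat_mono; lra.
  by apply: lee_wpmul2r => //; rewrite lee_fin; lra.
apply: le_trans (bumped_halve _ d0 h) _.
have h2 : (bumped M (2 * d)^-1 <= (2 * C0)%:E * omega_hat w (1 - 2 * d))%E.
  by apply: IH; [move: hd; rewrite exprS; lra|lra].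
have h3 : (omega_hat w (1 - 2 * d) <= C0%:E * omega_hat w (1 - d))%E.
  have -> : 1 - d = (1 + (1 - 2 * d)) / 2 by lra.
  by apply: dw; apply/andP; split; lra.
apply: (@le_trans _ _ (omega_hat w (1 - d) + ((3 / 4) ^+ M * (2 * C0) * C0)%:E * omega_hat w (1 - d))%E).
  rewrite leeD2l// !EFinM -!muleA lee_wpmul2l ?lee_fin ?exprn_ge0//.
  apply: le_trans h2 _; rewrite EFinM -muleA.
  by do 2!(apply: lee_wpmul2l; first by rewrite lee_fin).
rewrite -[X in (X + _)%E]mul1e -ge0_muleDl ?lee_fin ?mulr_ge0 ?exprn_ge0//.
apply: lee_wpmul2r => //; rewrite -EFinD lee_fin.
have -> : (3 / 4) ^+ M * (2 * C0) * C0 = (3 / 4) ^+ M * C0 * (2 * C0) by ring.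
apply: (@le_trans _ _ (1 + 2^-1 * (2 * C0))); first by rewrite lerD2l ler_wpM2r// mulr_ge0.
by rewrite mulrA mulVf// mul1r mulr_natl mulr2n lerD2r.
Qed.

Lemma moment_ge_hat k : (omega_hat w (1 - k.+1%:R^-1) <= (expR 1)%:E * moment w k)%E.
Proof.
have x0 : 0 <= 1 - k.+1%:R^-1 :> R by rewrite subr_ge0 invf_le1 ?ler1n.
have p s : I s -> 0 <= s ^+ k * w s.
  by move=> Is; rewrite mulr_ge0 ?weight_ge0 ?exprn_ge0//; move: Is; rewrite /= in_itv/= => /andP[].
rewrite /moment -ge0_integralZl ?lee_fin ?expR_ge0//; last first.
  apply/measurable_EFinP; apply: measurable_funM; last exact: measurable_weight.
  exact: measurable_funX.
apply: (@le_trans _ _ (\int[mu]_(s in `[(1 - k.+1%:R^-1)%R, 1%R[) ((expR 1)%:E * (s ^+ k * w s)%:E))%E).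
  apply: ge0_le_integral_nomeas => s; rewrite /= in_itv/= => /andP[h1 h2].
    by rewrite lee_fin weight_ge0//= in_itv/= h2 (le_trans x0).
  rewrite -EFinM lee_fin mulrA ler_peMl ?weight_ge0 ?node_pow//=.
  by rewrite in_itv/= h2 (le_trans x0).
apply: ge0_integral_le_subset.
  by move=> s Is; rewrite -EFinM lee_fin mulr_ge0 ?expR_ge0 ?p.
by move=> s /=; rewrite !in_itv/= => /andP[h1 ->]; rewrite (le_trans x0).
Qed.

(** The scale belonging to the node is 1/(k+1); the factor 2^M pays for replacing k + 1 by k in the
    bump. *)
Lemma bumped_node_le M k : (3 / 4) ^+ M * C0 <= 2^-1 ->
  (bumped M k%:R <= (2 ^+ M * (2 * C0))%:E * omega_hat w (1 - k.+1%:R^-1))%E.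
Proof.
move=> hM.
have k1 : 0 < (k.+1%:R^-1 : R) <= 1 by rewrite invr_gt0 ltr0n invf_le1 ?ler1n.
have := bumped_le hM k1; rewrite invrK => h.
rewrite EFinM -muleA; apply: (@le_trans _ _ ((2 ^+ M)%:E * bumped M k.+1%:R)%E); last first.
  by apply: lee_wpmul2l => //; rewrite lee_fin exprn_ge0.
have p s (n : nat) : I s -> 0 <= n%:R * (1 - s).
  by rewrite /= in_itv/= => /andP[_ hs]; rewrite mulr_ge0// subr_ge0 ltW.
rewrite /bumped -ge0_integralZl ?lee_fin ?exprn_ge0//; last 2 first.
- exact: measurable_bumped.
- by move=> s Is; rewrite lee_fin mulr_ge0 ?weight_ge0// bump_ge0// p.
apply: ge0_le_integral_nomeas => s Is.
  by rewrite lee_fin mulr_ge0 ?weight_ge0 ?bump_ge0 ?p.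
rewrite -EFinM lee_fin mulrCA ler_wpM2l ?weight_ge0// /bump -exprMn.
have pk := p s k Is; have pk1 := p s k.+1 Is.
apply: lerXn2r; rewrite ?nnegrE ?mulr_ge0 ?invr_ge0 ?addr_ge0//.
rewrite ler_pdivlMr ?ltr_wpDr// ler_pdivrMl ?ltr_wpDr//.
have hs : 0 <= s by move: Is; rewrite /= in_itv/= => /andP[].
by move: pk pk1; rewrite -natr1 mulrDl mul1r; lra.
Qed.

Lemma moment_fin k : (moment w k < +oo)%E.
Proof.
apply: le_lt_trans (omega_hat_fin (lexx 0)).
apply: ge0_le_integral_nomeas => s Is; have w0 := weight_ge0 Is.
  by rewrite lee_fin mulr_ge0// exprn_ge0//; move: Is; rewrite /= in_itv/= => /andP[].
move: Is; rewrite /= in_itv/= => /andP[s0 s1].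
by rewrite lee_fin ler_piMl// exprn_ile1 ?s0 ?ltW.
Qed.

Lemma moment_gt0 k : (0 < moment w k)%E.
Proof.
have h := moment_ge_hat k; have e0 : 0 < expR 1 :> R by rewrite expR_gt0.
have : (0 < omega_hat w (1 - k.+1%:R^-1))%E.
  case: rw => _ _; apply; rewrite subr_ge0 invf_le1 ?ler1n//= gtrBl invr_gt0//.
move=> /lt_le_trans/(_ h); apply: contraTT; rewrite -!leNgt => m.
by apply: mule_ge0_le0 => //; rewrite lee_fin ltW.
Qed.

Lemma moment_le_bumped M k : (0 < M)%N ->
  (moment w k <= ((1 + M%:R) ^+ M)%:E * bumped M k%:R)%E.
Proof.
move=> M0.
have p s : I s -> 0 <= k%:R * (1 - s).
  by rewrite /= in_itv/= => /andP[_ hs]; rewrite mulr_ge0// subr_ge0 ltW.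
rewrite /bumped -ge0_integralZl ?lee_fin ?exprn_ge0 ?addr_ge0//; last 2 first.
- exact: measurable_bumped.
- by move=> s Is; rewrite lee_fin mulr_ge0 ?weight_ge0 ?bump_ge0 ?p.
apply: ge0_le_integral_nomeas => s Is; have w0 := weight_ge0 Is.
  by rewrite lee_fin mulr_ge0// exprn_ge0//; move: Is; rewrite /= in_itv/= => /andP[].
rewrite -EFinM lee_fin mulrCA mulrC ler_wpM2l// pow_le_bump//.
by move: Is; rewrite /= in_itv/= => /andP[-> /ltW ->].
Qed.

End radial_weights.

Lemma weight_facts {R : realType} (w : R -> R) : radial_weight w -> Dhat w ->
  exists (M : nat) (C : R), [/\ (0 < M)%N, 0 < C,
    (forall k, bumped w M k%:R <= C%:E * moment w k)%E &
    forall k (t : R), 0 <= t <= 1 - k.+2%:R^-1 -> (moment w k <= C%:E * omega_hat w t)%E].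
Proof.
move=> rw [C0 [C01 dw]].
have C00 : 0 < C0 by exact: lt_le_trans C01.
(* M is the exponent for which (3/4)^M C0 <= 1/2, the condition of [bumped_le]. *)
have [N hN] := @expr_small R (3 / 4) (2 * C0)^-1 ltac:(apply/andP; split; lra) ltac:(by rewrite invr_gt0 mulr_gt0).
pose M := N.+1.
have hM : (3 / 4) ^+ M * C0 <= 2^-1.
  have h : (3 / 4) ^+ M <= (2 * C0)^-1 :> R.
    apply: le_trans (ltW hN); rewrite exprS ler_piMl ?exprn_ge0//; lra.
  apply: le_trans (ler_wpM2r (ltW C00) h) _.
  by rewrite invfM -mulrA mulVf ?mulr1// gt_eqF.
pose A := 2 ^+ M * (2 * C0); have A0 : 0 < A by rewrite !mulr_gt0 ?exprn_gt0.
pose B : R := (1 + M%:R) ^+ M; have B0 : 0 < B by rewrite exprn_gt0// ltr_wpDr.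
have e0 : 0 < expR 1 :> R by rewrite expR_gt0.
exists M, (A * expR 1 + B * (A * C0)); split => //.
- by rewrite addr_gt0 ?mulr_gt0.
- move=> k; have m0 := ltW (moment_gt0 rw k).
  apply: le_trans (bumped_node_le rw C01 dw k hM) _.
  apply: (@le_trans _ _ ((A * expR 1)%:E * moment w k)%E).
    by rewrite (EFinM A) -muleA; apply: lee_wpmul2l; [rewrite lee_fin ltW|exact: moment_ge_hat].
  by apply: lee_wpmul2r => //; rewrite lee_fin lerDl !mulr_ge0// ltW.
- move=> k t /andP[t0 tk].
  have k2 : 0 < k.+2%:R^-1 :> R by rewrite invr_gt0.
  have t1 : t < 1 by apply: le_lt_trans tk _; rewrite gtrBl.
  have w0 : (0 <= omega_hat w t)%E by case: rw => _ _ H; apply/ltW/H; rewrite t0.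
  have k1 : 0 < (k.+1%:R^-1 : R) <= 1 by rewrite invr_gt0 ltr0n invf_le1 ?ler1n.
  (* One doubling step leads from 1 - 1/(k+1) to 1 - 1/(2(k+1)), which lies beyond 1 - 1/(k+2) since
     2 (k+1) >= k + 2. Hence t may range over the whole block up to the next node. *)
  have h : (omega_hat w (1 - k.+1%:R^-1) <= C0%:E * omega_hat w t)%E.
    apply: le_trans (dw _ _) _; first by move: k1; move: (k.+1%:R^-1) => x /andP[x0 x1]; apply/andP; split; lra.
    apply: lee_wpmul2l; first by rewrite lee_fin ltW.
    apply: omega_hat_mono => //; apply: le_trans tk _.
    have : k.+1%:R^-1 / 2 <= k.+2%:R^-1 :> R.
      by rewrite -invfM lef_pV2 ?posrE// -natrM ler_nat muln2 doubleS !ltnS -addnn leq_addr.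
    by move: (k.+1%:R^-1) (k.+2%:R^-1) => x y; lra.
  apply: le_trans (moment_le_bumped rw k (ltn0Sn N)) _.
  apply: (@le_trans _ _ ((B * (A * C0))%:E * omega_hat w t)%E).
    rewrite (EFinM B) -muleA; apply: lee_wpmul2l; first by rewrite lee_fin ltW.
    apply: le_trans (bumped_node_le rw C01 dw k hM) _.
    rewrite (EFinM A) -muleA; apply: lee_wpmul2l => //; by rewrite lee_fin ltW.
  by apply: lee_wpmul2r => //; rewrite lee_fin lerDr mulr_ge0// ltW.
Qed.

(** * Measurability on the disc *)

Section disc_measurability.
Context {R : realType}.
Local Notation C := (CC R).
Local Notation mu := (@lebesgue_measure R).

Definition in_disc (z : R * R) : bool := z.1 ^+ 2 + z.2 ^+ 2 < 1.

Definition pt (z : R * R) : C := (z.1 +i* z.2)%C.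

(** Cut off outside the disc, where F is arbitrary, so that it is measurable on the whole plane and
    the change of variables applies without restrictions. *)
Definition disc_mod (F : C -> C) (z : R * R) : R := if in_disc z then cmod (F (pt z)) else 0.

Definition weight_ext (w : R -> R) (s : R) : R := if 0 <= s < 1 then w s else 0.

Lemma cmod_pt z : cmod (pt z) = Num.sqrt (z.1 ^+ 2 + z.2 ^+ 2).
Proof. by []. Qed.

Lemma in_discE z : in_disc z = (cmod (pt z) < 1).
Proof.
rewrite cmod_pt /in_disc -[in RHS](sqrtr1 R) ltr_sqrt//.
Qed.

Lemma measurable_in_disc : measurable_fun [set: R * R] in_disc.
Proof.
apply: measurable_fun_ltr => //; apply: measurable_funD; apply: measurable_funX => //.
Qed.

Lemma measurable_cpow n : measurable_fun [set: R * R] (fun z => complex.Re (pt z ^+ n)) /\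
  measurable_fun [set: R * R] (fun z => complex.Im (pt z ^+ n)).
Proof.
elim: n => [|n [IH1 IH2]]; first by split; under eq_fun do rewrite expr0; exact: measurable_cst.
have m1 : measurable_fun [set: R * R] (fun z : R * R => complex.Re (pt z)) by exact: measurable_fst.
have m2 : measurable_fun [set: R * R] (fun z : R * R => complex.Im (pt z)) by exact: measurable_snd.
split.
  under eq_fun do rewrite exprS cReM.
  by apply: measurable_funB; apply: measurable_funM.
under eq_fun do rewrite exprS cImM.
by apply: measurable_funD; apply: measurable_funM.
Qed.

Lemma measurable_sqrt_real : measurable_fun [set: R] (@Num.sqrt R).
Proof. by apply: continuous_measurable_fun; exact: sqrt_continuous. Qed.

Lemma measurable_cmod d (T : measurableType d) (D : set T) (h : T -> C) :
  measurable_fun D (fun z => complex.Re (h z)) -> measurable_fun D (fun z => complex.Im (h z)) ->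
  measurable_fun D (fun z => cmod (h z)).
Proof.
move=> m1 m2; apply: (measurableT_comp measurable_sqrt_real).
by apply: measurable_funD; apply: measurable_funX.
Qed.

Lemma measurable_cpart (c : nat -> C) N :
  measurable_fun [set: R * R] (fun z => cmod (cpart c (pt z) N)).
Proof.
have m n : measurable_fun [set: R * R] (fun z => complex.Re (c n * pt z ^+ n)) /\
    measurable_fun [set: R * R] (fun z => complex.Im (c n * pt z ^+ n)).
  have [m1 m2] := measurable_cpow n; split.
    under eq_fun do rewrite cReM.
    by apply: measurable_funB; apply: measurable_funM => //; exact: measurable_cst.
  under eq_fun do rewrite cImM.
  by apply: measurable_funD; apply: measurable_funM => //; exact: measurable_cst.
apply: measurable_cmod; rewrite /cpart.
  by under eq_fun do rewrite cRe_sum; apply: measurable_sum => n; exact: (m n).1.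
by under eq_fun do rewrite cIm_sum; apply: measurable_sum => n; exact: (m n).2.
Qed.

(** In the disc the function is the pointwise limit of the moduli of its Taylor polynomials. *)
Lemma measurable_disc_mod (F : C -> C) : holo F -> measurable_fun [set: R * R] (disc_mod F).
Proof.
move=> hF; apply: measurable_fun_if => //; first exact: measurable_in_disc.
apply: (@measurable_fun_cvg _ _ _ _ (fun N z => cmod (cpart (coef F) (pt z) N))).
  by move=> N; apply: measurable_funTS; exact: measurable_cpart.
move=> z [_ /=]; rewrite in_discE => z1.
rewrite (holo_psum hF z1).
have [A [t [ht HA]]] := psum_geometric_tail (holo_pbound hF) z1.
apply/cvgrPdist_lt => e e0.
have A0 : 0 < `|A| + 1 by rewrite ltr_wpDl.
have [N hN] := expr_small ht (divr_gt0 e0 A0).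
have /andP[t0 t1] := ht.
exists N => // n /= Nn.
apply: (@le_lt_trans _ _ (cmod (psum (coef F) (pt z) - cpart (coef F) (pt z) n))).
  rewrite ler_norml; apply/andP; split; last exact: cmodB_ge.
  by rewrite lerNl opprB cmodBC cmodB_ge.
apply: le_lt_trans (HA n) _.
have h1 : t ^+ n <= t ^+ N by apply: ler_wiXn2l => //; rewrite ?t0 ?ltW.
apply: (@le_lt_trans _ _ ((`|A| + 1) * t ^+ N)); last by rewrite mulrC -ltr_pdivlMr.
apply: (@le_trans _ _ ((`|A| + 1) * t ^+ n)); last by rewrite ler_wpM2l// ltW.
by rewrite ler_wpM2r ?exprn_ge0// (le_trans (ler_norm A))// lerDl.
Qed.

Lemma measurable_weight_ext (w : R -> R) : radial_weight w -> measurable_fun [set: R] (weight_ext w).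
Proof.
move=> rw.
have -> : weight_ext w = w \_ `[0, 1[.
  by apply/funext => s; rewrite patchE /weight_ext mem_setE in_itv.
by apply/(measurable_restrictT _ (measurable_itv `[0, 1[)); exact: measurable_weight.
Qed.

Lemma weight_ext_ge0 (w : R -> R) s : radial_weight w -> 0 <= weight_ext w s.
Proof. by case=> w0 _ _; rewrite /weight_ext; case: ifP => // /w0. Qed.

Definition dp_density (p : R) (w : R -> R) (f : C -> C) (z : R * R) : \bar R :=
  (disc_mod (derive1 f) z `^ p * weight_ext w (Num.sqrt (z.1 ^+ 2 + z.2 ^+ 2)))%:E.

Lemma dp_density_ge0 p w f z : radial_weight w -> (0 <= dp_density p w f z)%E.
Proof. by move=> rw; rewrite lee_fin mulr_ge0 ?powR_ge0 ?weight_ext_ge0. Qed.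

Lemma measurable_dp_density p w f : radial_weight w -> holo f ->
  measurable_fun [set: R * R] (dp_density p w f).
Proof.
move=> rw hf; apply/measurable_EFinP; apply: measurable_funM.
  by apply: (measurableT_comp (measurable_powR p)); apply: measurable_disc_mod; exact: holo_derive1.
apply: (measurableT_comp (measurable_weight_ext rw)).
apply: (measurableT_comp measurable_sqrt_real).
by apply: measurable_funD; apply: measurable_funX.
Qed.

Lemma Dnorm_p_density p w f : 0 < p ->
  Dnorm_p p w f = ((pi^-1)%:E * \int[@area R]_z dp_density p w f z + ((cmod (f 0)) `^ p)%:E)%E.
Proof.
move=> p0; congr (_ * _ + _)%E; rewrite integral_mkcond; apply: eq_integral => z _.
rewrite patchE /dp_density /disc_mod /area_integrand.
have -> : (z \in @unit_disc2 R) = in_disc z.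
  by apply/idP/idP => [/set_mem//|h]; apply/mem_set.
case: ifPn => zD; last by rewrite powR0 ?gt_eqF// mul0r.
rewrite /weight_ext sqrtr_ge0 /=.
by move: zD; rewrite in_discE cmod_pt => ->.
Qed.

End disc_measurability.

(** * The Fejer-Riesz inequality *)

Section fejer_riesz.
Context {R : realType}.
Local Notation C := (CC R).
Local Notation mu := (@lebesgue_measure R).

Lemma poweR_le (x y : \bar R) (p : R) : 0 <= p -> (0 <= x)%E -> (x <= y)%E -> (x `^ p <= y `^ p)%E.
Proof.
move=> p0 x0 xy; apply: (gt0_ler_poweR p0) => //; rewrite in_itv/= leey andbT//.
exact: le_trans xy.
Qed.

Lemma ct_ge2 (u : R) : -1 <= u <= 1 -> 2^-1 <= ct u.
Proof.
move=> hu; have h := wt_ge2 hu; rewrite -ct_sqr in h.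
rewrite leNgt; apply/negP => c.
have c0 := ct_gt0 u.
have : ct u * ct u <= 2^-1 * ct u by rewrite ler_wpM2r// ltW.
by rewrite -expr2; lra.
Qed.

Lemma arc_im_ge k (u : R) : -1 <= u <= 1 -> `|u| / 2 <= `|complex.Im (arc k u)|.
Proof.
move=> hu; have c2 := ct_ge2 hu; have c0 := ct_gt0 u.
have hu' : `|u| <= 1 by rewrite ler_norml.
have E0 : `|u| / 2 <= `|u * ct u| by rewrite normrM (gtr0_norm c0) ler_wpM2l.
have E1 : `|u| / 2 <= `|ct u| by rewrite (gtr0_norm c0); lra.
rewrite /arc ii_mod4; have : (k %% 4 < 4)%N by rewrite ltn_mod.
case: (k %% 4)%N => [|[|[|[|//]]]] _.
- by rewrite expr0 mul1r cIm_earc.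
- by rewrite expr1 cImM cRe_earc cIm_earc cRe_i cIm_i mul0r add0r mul1r.
- rewrite expr2 -mulrA cImM cReM cImM cRe_earc cIm_earc cRe_i cIm_i.
  by rewrite (_ : _ + _ = - (u * ct u)) ?normrN//; ring.
- rewrite !exprS expr0 mulr1 -!mulrA !(cImM, cReM) cRe_earc cIm_earc cRe_i cIm_i.
  by rewrite (_ : _ + _ = - ct u) ?normrN//; ring.
Qed.

(** The distance is at least 1 - r and at least the imaginary part, which is u [ct] or [ct] up to
    sign and so at least |u| / 2. Crude on the arcs away from 1, but it treats all four alike. *)
Lemma arc_dist k (u r : R) : -1 <= u <= 1 -> 0 <= r <= 1 ->
  ((1 - r) + `|u|) / 4 <= cmod (arc k u - cofr r).
Proof.
move=> hu /andP[r0 r1].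
have h1 : 1 - r <= cmod (arc k u - cofr r).
  by have := arc_sub_ge (cofr r) k u; rewrite cmod_pos.
have h2 : `|u| / 2 <= cmod (arc k u - cofr r).
  apply: le_trans (arc_im_ge k hu) _; apply: le_trans _ (cIm_le _).
  by rewrite cImD cImN cIm_C subr0.
by move: h1 h2; move: (cmod _) (`|u|) => x v; lra.
Qed.

Lemma rcont_cmod_arc (G : C -> C) k : (forall z, cmod z <= 1 -> exists d, hasd G z d) ->
  continuous (fun u : R => cmod (G (arc k u))).
Proof.
move=> dG u.
have [c] := @ccont_on_arc _ G u u k dG.
have cu : {for u, continuous (fun v => G (arc k v))} by apply: c; rewrite lexx.
have [c1 c2] := (ccontP (fun v => G (arc k v)) u).1 cu.
apply: (@continuous_comp _ _ _ (fun v => complex.Re (G (arc k v)) ^+ 2 + complex.Im (G (arc k v)) ^+ 2) Num.sqrt).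
  by apply: cvgD; [exact: (cvgM c1 c1)|exact: (cvgM c2 c2)].
exact: sqrt_continuous.
Qed.

(** By [arc_dist] the kernel is at most 4 / ((1 - r) + |u|). With the factor 2 of [cseg_le_int] this
    makes 8, and division by |arcK| >= 4 leaves 2. *)
Lemma cauchy_arcs_le (G : C -> C) (r : R) : (forall z, cmod z <= 1 -> exists d, hasd G z d) ->
  0 <= r < 1 ->
  ((cmod (G (cofr r)))%:E <= 2%:E * \sum_(k < 4)
    \int[mu]_(u in `[(-1)%R, 1%R]) (cmod (G (arc k u)) / ((1 - r) + `|u|))%:E)%E.
Proof.
move=> dG /andP[r0 r1].
have zr : cmod (cofr r) < 1 by rewrite cmod_pos.
have mG k (D : set R) : measurable_fun D (fun u => cmod (G (arc k u))).
  by apply: measurable_funTS; apply: continuous_measurable_fun; exact: rcont_cmod_arc.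
have mq k (D : set R) : measurable_fun D (fun u : R => (cmod (G (arc k u)) / ((1 - r) + `|u|))%:E).
  apply: measurable_funTS; apply/measurable_EFinP; apply: measurable_funM; first exact: mG.
  by apply: measurable_funV_in; apply: measurable_funD => //; exact: measurableT_comp.
have q0 k u : 0 <= cmod (G (arc k u)) / ((1 - r) + `|u|).
  by rewrite divr_ge0 ?cmod_ge0// addr_ge0// subr_ge0 ltW.
have term k : ((cmod (cseg (-1) 1 (fun u => G (arc k u) * ker (cofr r) k u)))%:E <=
    8%:E * \int[mu]_(u in `[(-1)%R, 1%R]) (cmod (G (arc k u)) / ((1 - r) + `|u|))%:E)%E.
  have cc : ccont (-1) 1 (fun u => G (arc k u) * ker (cofr r) k u).
    by apply: (@ccontM _ _ _ (fun u => G (arc k u))); [exact: ccont_on_arc|exact: ccont_ker].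
  apply: le_trans (cseg_le_int cc) _.
  have -> : 8%:E = (2%:E * 4%:E)%E :> \bar R by rewrite -EFinM; congr EFin; lra.
  rewrite -muleA; apply: lee_wpmul2l => //.
  have m1 := mq k `[(-1), 1]%classic.
  have m0 (u : R) : `[(-1), 1]%classic u -> (0 <= (cmod (G (arc k u)) / ((1 - r) + `|u|))%:E)%E.
    by move=> _; rewrite lee_fin.
  rewrite -ge0_integralZl//.
  apply: ge0_le_integral_nomeas => u; rewrite /= in_itv/= => hu; first by rewrite lee_fin cmod_ge0.
  rewrite -EFinM lee_fin cmodM mulrCA; apply: ler_wpM2l; first exact: cmod_ge0.
  apply: le_trans (cmod_ker _ _ zr) _.
  have d0 : 0 < (1 - r) + `|u| by rewrite ltr_wpDr// subr_gt0.
  rewrite -[4 in leRHS]invrK -invfM lef_pV2 ?posrE ?mulr_gt0 ?invr_gt0 ?cmod_gt0 ?arc_sub_neq0//.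
  by rewrite mulrC; apply: arc_dist => //; rewrite r0 ltW.
have E := cauchy_arcs zr dG; rewrite (ker_total zr) in E.
have h : (4%:E * (cmod (G (cofr r)))%:E <= \sum_(k < 4)
   8%:E * \int[mu]_(u in `[(-1)%R, 1%R]) (cmod (G (arc k u)) / ((1 - r) + `|u|))%:E)%E.
  apply: (@le_trans _ _ (\sum_(k < 4) (cmod (cseg (-1) 1 (fun u => G (arc k u) * ker (cofr r) k u)))%:E)%E).
    rewrite sumEFin -EFinM lee_fin.
    apply: le_trans _ (cmod_sum _ _ _ _); rewrite E cmodM mulrC.
    by apply: ler_wpM2l; [exact: cmod_ge0|exact: cmod_arcK].
  by apply: lee_sum => k _; exact: term.
rewrite -ge0_sume_distrr in h; last by move=> k _; apply: integral_ge0 => u _; rewrite lee_fin.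
rewrite -(@lee_pmul2l _ 4%:E)//; apply: le_trans h _.
by rewrite muleA -EFinM (_ : 4 * 2 = 8 :> R)//; lra.
Qed.

Lemma integral_fold (phi : R -> \bar R) : measurable_fun [set: R] phi -> (forall u, 0 <= phi u)%E ->
  (\int[mu]_(u in `[(-1)%R, 1%R]) phi u =
   \int[mu]_(u in `]0%R, 1%R]) (phi u + phi (- u)%R))%E.
Proof.
move=> mphi phi0.
have mN : measurable_fun [set: R] (fun u => phi (- u)) by apply: measurableT_comp.
have -> : `[(-1)%R, 1%R]%classic = `[(-1)%R, 0%R] `|` `]0%R, 1%R] :> set R.
  apply/seteqP; split => x /=; rewrite !in_itv/=.
    by move=> /andP[-> ->]; rewrite andbT/=; case: (leP x 0) => _; [left|right].
  by case=> /andP[h1 h2]; apply/andP; split; lra.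
rewrite ge0_integral_setU//; last 2 first.
- exact: measurable_funTS.
- by apply/disj_setPS => x []/=; rewrite !in_itv/= => /andP[_ h1] /andP[h2 _]; lra.
rewrite ge0_integralD//; try exact: measurable_funTS.
rewrite addeC; congr (_ + _)%E.
rewrite (@integral_itv_obnd_cbnd _ 0 (BRight 1) (fun u => phi (- u))); last exact: measurable_funTS.
rewrite integral_mkcond [RHS]integral_mkcond.
rewrite (@ge0_integral_affine _ (-1) 0)//; last 2 first.
- by apply/(measurable_restrictT _ (measurable_itv `[(-1), 0])); exact: measurable_funTS.
- by move=> x; rewrite patchE; case: ifP.
rewrite normrN1 mul1e; apply: eq_integral => x _.
rewrite !patchE mulN1r addr0 !mem_setE !in_itv/= lerN2 oppr_le0.
by rewrite andbC.
Qed.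

(** Each a_i is at most the l^p norm; summing n such bounds gives a constant worse than convexity
    would, but enough here. *)
Lemma powR_sum_le (p : R) n (a : 'I_n -> R) : 0 < p -> (forall i, 0 <= a i) ->
  (\sum_i a i) `^ p <= n%:R `^ p * \sum_i a i `^ p.
Proof.
move=> p0 a0; set S := \sum_i a i `^ p.
have S0 : 0 <= S by apply: sumr_ge0 => i _; exact: powR_ge0.
have le1 i : a i <= S `^ p^-1.
  rewrite -[leLHS](@powRr1 _ (a i))// -(mulfV (lt0r_neq0 p0)) powRrM.
  apply: ge0_ler_powR; rewrite ?nnegrE ?powR_ge0 ?invr_ge0 ?(ltW p0)//.
  by rewrite /S (bigD1 i)//= lerDl; apply: sumr_ge0 => j _; exact: powR_ge0.
have le2 : \sum_i a i <= n%:R * S `^ p^-1.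
  apply: le_trans (ler_sum _ (fun i _ => le1 i)) _.
  by rewrite sumr_const card_ord mulr_natl.
apply: (@le_trans _ _ ((n%:R * S `^ p^-1) `^ p)).
  by apply: ge0_ler_powR; rewrite ?nnegrE ?mulr_ge0 ?powR_ge0 ?(ltW p0)//; exact: sumr_ge0.
by rewrite powRM ?powR_ge0// -powRrM mulVf ?gt_eqF// powRr1.
Qed.

Lemma powR_add_le (p x y : R) : 0 < p -> 0 <= x -> 0 <= y ->
  (x + y) `^ p <= 2 `^ p * (x `^ p + y `^ p).
Proof.
move=> p0 x0 y0; pose a (i : 'I_2) := if i == ord0 then x else y.
have a0 i : 0 <= a i by rewrite /a; case: ifP.
by have := powR_sum_le p0 a0; rewrite !big_ord_recl !big_ord0 /a /= !addr0.
Qed.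

(** At distance x from 1, Cauchy's formula bounds |G| by integrals over the arcs against 1 / (x +
    |u|). Folding u and -u together leaves the Hilbert kernel on ]0, 1]. *)
Lemma fejer_riesz (p : R) : 1 < p -> exists K : R, 0 < K /\ forall G : C -> C,
  (forall z, cmod z <= 1 -> exists d, hasd G z d) ->
  (\int[mu]_(x in `]0%R, 1%R]) (cmod (G (cofr (1 - x))) `^ p)%:E <=
   K%:E * \sum_(k < 4) \int[mu]_(u in `[(-1)%R, 1%R]) (cmod (G (arc k u)) `^ p)%:E)%E.
Proof.
move=> p1; have p0 : 0 < p by apply: lt_trans p1.
have [H [H0 hilb]] := hilbert_inequality p p1.
(* 4^p for adding four arcs, one 2^p for the factor 2 of [cauchy_arcs_le], the other for adding the
   values at u and -u. *)
pose A : R := 4 `^ p * (2 `^ p * 2 `^ p).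
have A0 : 0 < A by rewrite !mulr_gt0 ?powR_gt0.
exists (H * A); split; first exact: mulr_gt0.
move=> G dG.
have mG k : measurable_fun [set: R] (fun u => cmod (G (arc k u))).
  by apply: continuous_measurable_fun; exact: rcont_cmod_arc.
have mGN k : measurable_fun [set: R] (fun u => cmod (G (arc k (- u)))).
  by apply: (measurableT_comp (mG k)).
pose b (k : 'I_4) (u : R) := 2 * (cmod (G (arc k u)) + cmod (G (arc k (- u)))).
pose h u := \sum_(k < 4) b k u.
have b0 k u : 0 <= b k u by rewrite mulr_ge0 ?addr_ge0 ?cmod_ge0.
have h0 u : 0 <= h u by apply: sumr_ge0 => k _.
have mb k : measurable_fun [set: R] (b k).
  by apply: measurable_funM => //; exact: measurable_funD.
have mh : measurable_fun [set: R] h by exact: measurable_sum.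
have step x : `]0%R, 1%R]%classic x ->
    ((cmod (G (cofr (1 - x))))%:E <= \int[mu]_(y in `]0%R, 1%R]) (h y / (x + y))%:E)%E.
  rewrite /= in_itv/= => /andP[x0 x1].
  have hr : 0 <= 1 - x < 1 by apply/andP; split; lra.
  apply: le_trans (cauchy_arcs_le dG hr) _.
  have e : 1 - (1 - x) = x by lra.
  have mq k : measurable_fun [set: R] (fun u : R => (cmod (G (arc k u)) / (x + `|u|))%:E).
    apply/measurable_EFinP; apply: measurable_funM => //.
    by apply: measurable_funV_in; apply: measurable_funD => //; exact: measurableT_comp.
  have q0 k u : 0 <= cmod (G (arc k u)) / (x + `|u|) by rewrite divr_ge0 ?cmod_ge0// addr_ge0// ltW.
  have q0e k u : (0 <= (cmod (G (arc k u)) / (x + `|u|))%:E)%E by rewrite lee_fin.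
  rewrite e; under eq_bigr => k _ do rewrite (integral_fold (mq k) (q0e k)).
  rewrite -ge0_integral_sum//; last 2 first.
  - move=> k; apply: measurable_funTS.
    by apply: emeasurable_funD; [exact: mq|exact: (measurableT_comp (mq k))].
  - by move=> k u _; rewrite adde_ge0// lee_fin.
  rewrite -ge0_integralZl//; last 2 first.
  - apply: measurable_funTS; apply: emeasurable_sum => k.
    by apply: emeasurable_funD; [exact: mq|exact: (measurableT_comp (mq k))].
  - by move=> u _; apply: sume_ge0 => k _; rewrite adde_ge0// lee_fin.
  rewrite le_eqVlt; apply/orP; left; apply/eqP; apply: eq_integral => u.
  rewrite inE /= in_itv/= => /andP[u0 _].
  under eq_bigr do rewrite -EFinD.
  rewrite sumEFin -EFinM; congr EFin; rewrite mulr_sumr /h mulr_suml; apply: eq_bigr => k _.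
  by rewrite normrN (gtr0_norm u0) /b; ring.
apply: (@le_trans _ _ (\int[mu]_(x in `]0%R, 1%R]) (\int[mu]_(y in `]0%R, 1%R]) (h y / (x + y))%:E) `^ p)%E).
  apply: ge0_le_integral_nomeas => x hx; first by rewrite lee_fin powR_ge0.
  by rewrite -poweR_EFin; apply: poweR_le; [exact: ltW|rewrite lee_fin cmod_ge0|exact: step].
apply: le_trans (hilb h mh h0) _.
rewrite EFinM -muleA; apply: lee_wpmul2l; first by rewrite lee_fin ltW.
have mp k : measurable_fun [set: R] (fun u => (cmod (G (arc k u)) `^ p)%:E).
  by apply/measurable_EFinP; apply: (measurableT_comp (measurable_powR p)).
have p0e k u : (0 <= (cmod (G (arc k u)) `^ p)%:E)%E by rewrite lee_fin powR_ge0.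
under eq_bigr => k _ do rewrite (integral_fold (mp k) (p0e k)).
have mpN (k : 'I_4) : measurable_fun (`]0%R, 1%R]%classic : set R) (fun u => ((cmod (G (arc k u)) `^ p)%:E + (cmod (G (arc k (- u))) `^ p)%:E)%E).
  apply: measurable_funTS.
  by apply: emeasurable_funD; [exact: mp|exact: (measurableT_comp (mp k))].
rewrite -ge0_integral_sum//; last by move=> k u _; rewrite adde_ge0// lee_fin powR_ge0.
rewrite -ge0_integralZl//; last 3 first.
- exact: emeasurable_sum.
- by move=> u _; apply: sume_ge0 => k _; rewrite adde_ge0// lee_fin powR_ge0.
- by rewrite lee_fin ltW.
apply: ge0_le_integral_nomeas => u _; first by rewrite lee_fin powR_ge0.
under eq_bigr do rewrite -EFinD.
rewrite sumEFin -EFinM lee_fin.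
apply: le_trans (powR_sum_le p0 (fun k => b0 k u)) _.
rewrite /A -mulrA; apply: ler_wpM2l; first exact: powR_ge0.
rewrite mulr_sumr; apply: ler_sum => k _.
rewrite /b powRM ?addr_ge0 ?cmod_ge0// -mulrA; apply: ler_wpM2l; first exact: powR_ge0.
by apply: powR_add_le; rewrite ?cmod_ge0.
Qed.

End fejer_riesz.

(** * Radial integrals against the tail of the weight *)

Section radial_bound.
Context {R : realType}.
Local Notation C := (CC R).
Local Notation mu := (@lebesgue_measure R).
Local Notation I := (`[0%R, 1%R[%classic : set R).

Definition rot (c d : R) (z : R * R) : R * R := (c * z.1 - d * z.2, d * z.1 + c * z.2).

Lemma measurable_rot c d : measurable_fun [set: R * R] (rot c d).
Proof.
apply: measurable_fun_pair.
  by apply: measurable_funB; apply: measurable_funM => //; exact: measurable_cst.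
by apply: measurable_funD; apply: measurable_funM => //; exact: measurable_cst.
Qed.

Lemma pt_rot (eta : C) z : pt (rot (complex.Re eta) (complex.Im eta) z) = eta * pt z.
Proof. by apply: cext; rewrite ?cReM ?cImM /=; ring. Qed.

Lemma pt_iter_quarter k z : pt (iter k (@quarter R) z) = ii ^+ k * pt z.
Proof.
elim: k => [|k IH]; first by rewrite expr0 mul1r.
rewrite iterS exprS -mulrA -IH; move: (iter _ _ _) => v.
by apply: cext; rewrite ?cReM ?cImM ?cRe_i ?cIm_i /=; ring.
Qed.

Lemma pt_arc_pt u r : pt (arc_pt u r) = cofr r * (earc u : C).
Proof.
apply: cext.
  by rewrite cReM cRe_C cIm_C cRe_earc mul0r subr0.
by rewrite cImM cRe_C cIm_C cIm_earc mul0r addr0 mulrCA.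
Qed.

Lemma disc_mod_pt (F : C -> C) z : disc_mod F z = if cmod (pt z) < 1 then cmod (F (pt z)) else 0.
Proof. by rewrite /disc_mod in_discE. Qed.

Lemma mule_integral (D : set R) (k : R) (f : R -> R) : measurable D -> measurable_fun D f ->
  (forall x, D x -> 0 <= f x) -> 0 <= k ->
  (k%:E * \int[mu]_(x in D) (f x)%:E = \int[mu]_(x in D) (k * f x)%:E)%E.
Proof.
move=> mD mf f0 k0.
rewrite (_ : (fun x => (k * f x)%:E) = fun x => (k%:E * (EFin \o f) x)%E); last by apply/funext.
rewrite ge0_integralZl//; exact/measurable_EFinP.
Qed.

Lemma hat_fubini (w q : R -> R) : radial_weight w -> measurable_fun [set: R] q -> (forall t, 0 <= q t) ->
  (\int[mu]_(t in I) ((q t)%:E * omega_hat w t) <=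
   \int[mu]_(s in I) ((w s)%:E * \int[mu]_(t in `[0%R, s]) (q t)%:E))%E.
Proof.
move=> rw mq q0.
have mI : measurable I by exact: measurable_itv.
pose f (z : R * R) : \bar R := (if z.1 <= z.2 then q z.1 * weight_ext w z.2 else 0)%:E.
have mf : measurable_fun [set: R * R] f.
  apply/measurable_EFinP; apply: measurable_fun_ifT => //; first exact: measurable_fun_ler.
  apply: measurable_funM; first exact: measurableT_comp.
  by apply: measurableT_comp => //; exact: measurable_weight_ext.
have f0 z : (0 <= f z)%E.
  by rewrite /f lee_fin; case: ifP => // _; rewrite mulr_ge0// weight_ext_ge0.
have wE s : I s -> weight_ext w s = w s by rewrite /= in_itv/= /weight_ext => ->.
have [sw _] := @tonelli_in R I I f mI mI (measurable_funTS mf) (fun x y _ _ => f0 (x, y)).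
have -> : (\int[mu]_(t in I) ((q t)%:E * omega_hat w t) = \int[mu]_(t in I) \int[mu]_(s in I) f (t, s))%E.
  apply: eq_integral => t /set_mem It.
  have ts : `[t, 1%R[%classic `<=` I.
    move=> s; move: It; rewrite /= !in_itv/= => /andP[t0 _] /andP[h1 h2].
    by rewrite h2 (le_trans t0).
  have mw : measurable_fun `[t, 1%R[ w by apply: (measurable_funS mI ts); exact: measurable_weight.
  rewrite /omega_hat (mule_integral (measurable_itv _) mw _ (q0 t)); last first.
    by move=> s /ts; exact: weight_ge0.
  rewrite -{1}(setIidr ts) integral_mkcondr; apply: eq_integral => s /set_mem Is.
  rewrite patchE mem_setE in_itv/= /f /=; move: (Is); rewrite /= in_itv/= => /andP[_ s1].
  by rewrite s1 andbT; case: ifP => // _; rewrite wE.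
rewrite sw; apply: ge0_le_integral_nomeas => s Is; first exact: integral_ge0.
have st : `[0%R, s]%classic `<=` I.
  move=> t; move: Is; rewrite /= !in_itv/= => /andP[_ s1] /andP[-> h2].
  exact: le_lt_trans s1.
rewrite (mule_integral (measurable_itv _) (measurable_funTS mq) (fun t _ => q0 t) (weight_ge0 rw Is)).
rewrite -{1}(setIidr st) integral_mkcondr; apply: ge0_le_integral_nomeas => t It //.
rewrite patchE mem_setE in_itv/= /f /=; move: (It); rewrite /= in_itv/= => /andP[-> _] /=.
by case: ifP => // _; rewrite wE// mulrC.
Qed.

Variables (p : R) (p1 : 1 < p).

(** |F|^p at the point s eta i^k earc(u), expressed by planar rotations so that it matches the
    integrand of [polar_int]. *)
Definition circle_density (F : C -> C) (eta : C) (k : nat) (s u : R) : R :=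
  disc_mod F (rot (complex.Re eta) (complex.Im eta) (iter k (@quarter R) (arc_pt u s))) `^ p.

(** Apply Fejer-Riesz to z -> F(s eta z), which is differentiable up to the unit circle. The factor
    s is the Jacobian of t = s (1 - x). *)
Lemma fejer_riesz_circle (K : R) : 0 < K -> (forall G : C -> C,
    (forall z, cmod z <= 1 -> exists d, hasd G z d) ->
    (\int[mu]_(x in `]0%R, 1%R]) (cmod (G (cofr (1 - x))) `^ p)%:E <=
     K%:E * \sum_(k < 4) \int[mu]_(u in `[(-1)%R, 1%R]) (cmod (G (arc k u)) `^ p)%:E)%E) ->
  forall (F : C -> C) (eta : C) s, holo F -> cmod eta = 1 -> I s ->
  (\int[mu]_(t in `[0%R, s]) (disc_mod F (rot (complex.Re eta) (complex.Im eta) (t, 0)) `^ p)%:E <=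
   s%:E * (K%:E * \sum_(k < 4) \int[mu]_(u in `[(-1)%R, 1%R]) (circle_density F eta k s u)%:E))%E.
Proof.
move=> K0 FR F eta s hF e1; rewrite /= in_itv/= => /andP[s0 s1].
have p0 : 0 < p by apply: lt_trans p1.
set q := fun t : R => (disc_mod F (rot (complex.Re eta) (complex.Im eta) (t, 0)) `^ p)%:E.
have mq : measurable_fun [set: R] q.
  apply/measurable_EFinP; apply: (measurableT_comp (measurable_powR p)).
  apply: (measurableT_comp (measurable_disc_mod hF)).
  apply: (measurableT_comp (measurable_rot _ _)).
  by apply: measurable_fun_pair => //; exact: measurable_cst.
have q0 t : (0 <= q t)%E by rewrite lee_fin powR_ge0.
have [->|sn0] := eqVneq s 0.
  by rewrite set_itv1 integral_set1 mul0e.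
have {}s0 : 0 < s by rewrite lt_def sn0.
rewrite integral_mkcond (@ge0_integral_affine _ (- s) s); last 3 first.
- by rewrite oppr_eq0.
- by apply/(measurable_restrictT _ (measurable_itv `[0, s])); exact: measurable_funTS.
- by move=> x; rewrite patchE; case: ifP => // _; exact: q0.
rewrite normrN gtr0_norm//; apply: lee_wpmul2l; first by rewrite lee_fin ltW.
pose G z := F (cofr s * eta * z).
have se : cmod (cofr s * eta) = s by rewrite cmod_ray ?e1 ?mulr1// ltW.
have dG z : cmod z <= 1 -> exists d, hasd G z d.
  move=> z1; exists (cofr s * eta * derive1 F (cofr s * eta * z)); apply: hasd_dilate.
  apply: holo_hasd => //; rewrite cmodM se; apply: le_lt_trans s1.
  by rewrite -[leRHS]mulr1 ler_pM2l.
have -> : (\int[mu]_x (q \_ `[0%R, s]) (- s * x + s)%R =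
    \int[mu]_(x in `]0%R, 1%R]) (cmod (G (cofr (1 - x))) `^ p)%:E)%E.
  transitivity (\int[mu]_(x in `[0%R, 1%R]) q (- s * x + s)%R)%E.
    rewrite [RHS]integral_mkcond; apply: eq_integral => x _.
    rewrite !patchE !mem_setE !in_itv/=.
    suff -> : (0 <= - s * x + s <= s) = (0 <= x <= 1) by [].
    have -> : - s * x + s = s * (1 - x) by ring.
    by rewrite pmulr_rge0// subr_ge0 ger_pMr// gerBl andbC.
  rewrite -(@integral_itv_obnd_cbnd _ 0 (BRight 1) (fun x => q (- s * x + s))); last first.
    apply: measurable_funTS; apply: (measurableT_comp mq).
    by apply: measurable_funD => //; exact: measurable_funM.
  apply: eq_integral => x /set_mem; rewrite /= in_itv/= => /andP[x0 x1].
  congr (_ `^ p)%:E; rewrite disc_mod_pt pt_rot.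
  have -> : pt (- s * x + s, 0) = cofr (s * (1 - x)).
    by apply: cext; rewrite ?cRe_C ?cIm_C /=; ring.
  have -> : eta * cofr (s * (1 - x)) = cofr s * eta * cofr (1 - x) by rewrite cofrM; ring.
  rewrite cmodM se cmod_pos ?subr_ge0// /G.
  suff -> : s * (1 - x) < 1 by [].
  by apply: le_lt_trans s1; rewrite -[leRHS]mulr1 ler_pM2l// gerBl ltW.
have -> : (\sum_(k < 4) \int[mu]_(u in `[(-1)%R, 1%R]) (circle_density F eta k s u)%:E =
    \sum_(k < 4) \int[mu]_(u in `[(-1)%R, 1%R]) (cmod (G (arc k u)) `^ p)%:E)%E.
  apply: eq_bigr => k _; apply: eq_integral => u _; congr (_ `^ p)%:E.
  rewrite disc_mod_pt pt_rot pt_iter_quarter pt_arc_pt.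
  have -> : eta * (ii ^+ k * (cofr s * earc u)) = cofr s * eta * arc k u by rewrite /arc; ring.
  by rewrite cmodM se cmod_arc mulr1 s1.
exact: FR G dG.
Qed.

Lemma dp_density_polar (w : R -> R) (f : C -> C) (eta : C) k r u : cmod eta = 1 -> 0 <= r ->
  dp_density p w f (rot (complex.Re eta) (complex.Im eta) (iter k (@quarter R) (arc_pt u r))) =
  (circle_density (derive1 f) eta k r u * weight_ext w r)%:E.
Proof.
move=> e1 r0; rewrite /dp_density -cmod_pt pt_rot pt_iter_quarter pt_arc_pt.
by rewrite cmodM e1 cmodM cmodX cmod_i expr1n cmodM cmod_pos// cmod_earc mulr1 !mul1r.
Qed.

(** The factor s that [fejer_riesz_circle] produces is precisely the radial Jacobian of the area, so
    integrating over s against w gives the area integral in polar coordinates. *)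
Lemma radial_bound (w : R -> R) : radial_weight w -> exists K : R, 0 < K /\ forall (f : C -> C) (eta : C), holo f -> cmod eta = 1 ->
  (\int[mu]_(t in I) ((cmod (derive1 f (cofr t * eta)) `^ p)%:E * omega_hat w t) <=
   K%:E * Dnorm_p p w f)%E.
Proof.
move=> rw; have [K [K0 FR]] := fejer_riesz p1.
have p0 : 0 < p by apply: lt_trans p1.
(* 8 = 2 * 4: the factor 2 because 1 / (1 + u^2) >= 1/2 on the arcs, the factor 4 from
   [area_polar_ge]; pi undoes the normalisation of the area. *)
exists (K * (8 * pi)); split; first by rewrite !mulr_gt0// pi_gt0.
move=> f eta hf e1.
have hF := holo_derive1 hf; set F := derive1 f in hF *.
pose q t := disc_mod F (rot (complex.Re eta) (complex.Im eta) (t, 0)) `^ p.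
pose D k (z : R * R) := circle_density F eta k z.1 z.2.
have mrot := measurable_rot (complex.Re eta) (complex.Im eta).
have mq : measurable_fun [set: R] q.
  apply: (measurableT_comp (measurable_powR p)).
  apply: (measurableT_comp (measurable_disc_mod hF)).
  apply: (measurableT_comp mrot).
  by apply: measurable_fun_pair => //; exact: measurable_cst.
have mD k : measurable_fun [set: R * R] (D k).
  apply: (measurableT_comp (measurable_powR p)).
  apply: (measurableT_comp (measurable_disc_mod hF)).
  apply: (measurableT_comp mrot).
  apply: (measurableT_comp (measurable_iter_quarter k)).
  have ms : measurable_fun [set: R * R] (fun z : R * R => (z.2, z.1)) by exact: measurable_swap.
  exact: (measurableT_comp (@measurable_arc_pt R) ms).
have D0 k z : 0 <= D k z by exact: powR_ge0.
have mI : measurable I by exact: measurable_itv.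
pose J := (`[(-1)%R, 1%R]%classic : set R).
have mJ : measurable J by exact: measurable_itv.
have -> : (\int[mu]_(t in I) ((cmod (F (cofr t * eta)) `^ p)%:E * omega_hat w t) =
   \int[mu]_(t in I) ((q t)%:E * omega_hat w t))%E.
  apply: eq_integral => t /set_mem; rewrite /= in_itv/= => /andP[t0 t1].
  congr (_%:E * _)%E; rewrite /q disc_mod_pt pt_rot.
  have -> : pt (t, 0) = cofr t by [].
  by rewrite [cofr t * eta]mulrC cmodM e1 mul1r cmod_pos// t1.
have q0 t : 0 <= q t by exact: powR_ge0.
apply: le_trans (hat_fubini rw mq q0) _.
(* The 2^-1 prepares the comparison with the angular weight 1 / (1 + u^2) of [polar_int], and the K
   * 2 below compensates it. *)
pose W k (z : R * R) : \bar R := (2^-1 * (z.1 * weight_ext w z.1) * D k z)%:E.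
have mW k : measurable_fun [set: R * R] (W k).
  have mzw : measurable_fun [set: R * R] (fun z : R * R => weight_ext w z.1).
    by apply: measurableT_comp => //; exact: measurable_weight_ext.
  apply/measurable_EFinP.
  exact: (measurable_funM (measurable_funM (measurable_cst _) (measurable_funM measurable_fst mzw)) (mD k)).
have W0 k x y : I x -> (0 <= W k (x, y))%E.
  rewrite /= in_itv/= => /andP[x0 _].
  by rewrite lee_fin !mulr_ge0//; exact: weight_ext_ge0.
have wE s : I s -> weight_ext w s = w s by rewrite /= in_itv/= /weight_ext => ->.
have sw k := @tonelli_in R I J (W k) mI mJ (measurable_funTS (mW k)) (fun x y Ix _ => W0 k x y Ix).
have i0 k s : I s -> (0 <= \int[mu]_(u in J) W k (s, u))%E.
  by move=> Is; apply: integral_ge0 => u _; exact: W0.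
have K2 : 0 <= K * 2 by rewrite mulr_ge0// ltW.
apply: (@le_trans _ _ (\int[mu]_(s in I) ((K * 2)%:E * \sum_(k < 4) \int[mu]_(u in J) W k (s, u)))%E).
  apply: ge0_le_integral_nomeas => s Is.
    by rewrite mule_ge0// ?lee_fin ?weight_ge0//; apply: integral_ge0 => t _; rewrite lee_fin.
  have ws := weight_ge0 rw Is.
  have s0 : 0 <= s by move: Is; rewrite /= in_itv/= => /andP[].
  have wsE : (0 <= (w s)%:E)%E by rewrite lee_fin.
  apply: le_trans (lee_wpmul2l wsE (fejer_riesz_circle K0 FR hF e1 Is)) _.
  have mDs k : measurable_fun J (fun u => circle_density F eta k s u).
    by apply: measurable_funTS; exact: (measurable_slice1 _ s (mD k)).
  have -> : (\sum_(k < 4) \int[mu]_(u in J) W k (s, u) =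
      (2^-1 * (s * w s))%:E * \sum_(k < 4) \int[mu]_(u in J) (circle_density F eta k s u)%:E)%E.
    rewrite ge0_sume_distrr; last by move=> k _; apply: integral_ge0 => u _; rewrite lee_fin powR_ge0.
    apply: eq_bigr => k _.
    rewrite (mule_integral mJ (mDs k)); last 2 first.
    - by move=> u _; exact: powR_ge0.
    - by rewrite mulr_ge0// mulr_ge0.
    by apply: eq_integral => u _; rewrite /W /= wE.
  rewrite 3!muleA -!EFinM.
  by have -> : K * 2 * (2^-1 * (s * w s)) = w s * s * K by field.
rewrite ge0_integralZl ?lee_fin//; last 2 first.
- by apply: emeasurable_sum => k; exact: (sw k).2.
- by move=> s Is; apply: sume_ge0 => k _; exact: i0.
rewrite ge0_integral_sum//; last 2 first.
- by move=> k; exact: (sw k).2.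
- by move=> k s Is; exact: i0.
pose h z := dp_density p w f (rot (complex.Re eta) (complex.Im eta) z).
have mh : measurable_fun [set: R * R] h.
  by apply: measurableT_comp mrot; exact: measurable_dp_density.
have h0 z : (0 <= h z)%E by exact: dp_density_ge0.
have bound (k : 'I_4) : (\int[mu]_(s in I) \int[mu]_(u in J) W k (s, u) <= polar_int (h \o iter k (@quarter R)))%E.
  rewrite (sw k).1; apply: ge0_le_integral_nomeas => u.
    by move=> _; apply: integral_ge0 => s Is; exact: W0.
  rewrite /J /= in_itv/= => hu.
  have wu := wt_ge2 hu; rewrite /wt in wu.
  apply: (@le_trans _ _ (2^-1%:E * \int[mu]_(r in I) (r%:E * h (iter k (@quarter R) (arc_pt u r))))%E).
    have mg : measurable_fun I (fun r => r * weight_ext w r * D k (r, u)).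
      apply: measurable_funTS; apply: measurable_funM; last exact: (measurable_slice2 _ u (mD k)).
      by apply: measurable_funM => //; exact: measurable_weight_ext.
    have -> : (\int[mu]_(r in I) (r%:E * h (iter k (@quarter R) (arc_pt u r))) =
       \int[mu]_(r in I) (r * weight_ext w r * D k (r, u))%:E)%E.
      apply: eq_integral => r /set_mem; rewrite /= in_itv/= => /andP[r0 _].
      by rewrite /h dp_density_polar// -EFinM /D /=; congr EFin; ring.
    rewrite (mule_integral mI mg) ?invr_ge0//; last first.
      move=> r; rewrite /= in_itv/= => /andP[r0 _].
      by rewrite !mulr_ge0//; exact: weight_ext_ge0.
    rewrite le_eqVlt; apply/orP; left; apply/eqP; apply: eq_integral => r _.
    by rewrite /W /=; congr EFin; ring.
  apply: lee_pmul => //; first by apply: integral_ge0 => r; rewrite /= in_itv/= => /andP[r0 _]; rewrite mule_ge0.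
  apply: ge0_integral_le_subset => r; rewrite /= !in_itv/= ?andbT.
    by move=> r0; rewrite mule_ge0.
  by case/andP.
apply: (@le_trans _ _ ((K * 2)%:E * (4%:E * \int[@area R]_z dp_density p w f z))%E).
  apply: lee_wpmul2l; first by rewrite lee_fin.
  apply: le_trans (lee_sum _ (fun k _ => bound k)) _.
  apply: le_trans (area_polar_ge _ mh h0) _.
  have hE : (\int[@area R]_z h z = \int[@area R]_z dp_density p w f z)%E.
    apply: (@area_rotation R (complex.Re eta) (complex.Im eta) (dp_density p w f)).
    - by rewrite -cmod_sqr e1 expr1n.
    - exact: measurable_dp_density.
    - by move=> z; exact: dp_density_ge0.
  by rewrite hE.
rewrite Dnorm_p_density//.
have : (0 <= \int[@area R]_z dp_density p w f z)%E.
  by apply: integral_ge0 => z _; exact: dp_density_ge0.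
move: (\int[_]_z _)%E => X X0.
have pi0 : 0 <= pi^-1 :> R by rewrite invr_ge0 pi_ge0.
rewrite ge0_muleDr ?lee_fin ?powR_ge0//; last by rewrite mule_ge0.
rewrite -[leLHS]adde0; apply: leeD; last first.
  by rewrite mule_ge0 ?lee_fin ?powR_ge0// !mulr_ge0 ?pi_ge0// ltW.
rewrite !muleA -!EFinM.
have -> : K * (8 * pi) / pi = K * 2 * 4.
  have pn : (pi : R) != 0 by rewrite gt_eqF// pi_gt0.
  by rewrite mulrA mulfK//; ring.
by [].
Qed.

End radial_bound.

(** * The upper bound *)

Section step_functions.
Context {R : realType}.
Local Notation mu := (@lebesgue_measure R).

Definition node (k : nat) : R := 1 - k.+1%:R^-1.

Definition block (k : nat) : set R := `[node k, node k.+1[%classic.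

Definition step (K N : nat) (a : nat -> R) (t : R) : R := \sum_(K <= k < N) a k * \1_(block k) t.

Lemma node_ge0 k : 0 <= node k.
Proof. by rewrite subr_ge0 invf_le1 ?ler1n. Qed.

Lemma node_lt1 k : node k < 1.
Proof. by rewrite gtrBl. Qed.

Lemma node_le k l : (k <= l)%N -> node k <= node l.
Proof. by move=> kl; rewrite lerD2l lerN2 lef_pV2 ?posrE// ler_nat. Qed.

Lemma node0 : node 0 = 0.
Proof. by rewrite /node invr1 subrr. Qed.

Lemma block_uniq k l t : block k t -> block l t -> k = l.
Proof.
rewrite /block /= !in_itv/= => /andP[k1 k2] /andP[l1 l2].
apply/eqP; rewrite eqn_leq; apply/andP; split; rewrite leqNgt; apply/negP => h.
  by have := le_lt_trans (le_trans (node_le h) k1) l2; rewrite ltxx.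
by have := le_lt_trans (le_trans (node_le h) l1) k2; rewrite ltxx.
Qed.

Lemma block_ex t n : 0 <= t -> t < node n -> exists2 k, (k < n)%N & block k t.
Proof.
move=> t0; elim: n => [|n IH] tn; first by move: tn; rewrite node0 ltNge t0.
have [h|h] := ltP t (node n).
  by have [k kn kt] := IH h; exists k => //; exact: ltnW.
by exists n => //; rewrite /block /= in_itv/= h.
Qed.

Lemma stepE K N a t k : (K <= k < N)%N -> block k t -> step K N a t = a k.
Proof.
move=> kN kt; rewrite /step (bigD1_seq k)/= ?mem_index_iota ?iota_uniq//.
rewrite indicE mem_set// mulr1 big1 ?addr0// => i ik; rewrite indicE.
case: (boolP (t \in block i)); last by rewrite mulr0.
by move=> /set_mem it; move: ik; rewrite (block_uniq it kt) eqxx.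
Qed.

Lemma stepP K N t : (exists2 k, (K <= k < N)%N & block k t) \/ (forall a, step K N a t = 0).
Proof.
have [[k kN kt]|h] := pselect (exists2 k, (K <= k < N)%N & block k t); first by left; exists k.
right => a; rewrite /step big_nat big1// => k kN; rewrite indicE.
case: (boolP (t \in block k)); last by rewrite mulr0.
by move=> /set_mem kt; case: h; exists k.
Qed.

Lemma measurable_step K N a : measurable_fun [set: R] (step K N a).
Proof.
apply: measurable_sum => k; apply: measurable_funM => //.
apply: (@measurable_indic _ _ R [set: R] (block k)); exact: measurable_itv.
Qed.

Lemma step_ge0 K N a t : (forall k, 0 <= a k) -> 0 <= step K N a t.
Proof. by move=> a0; apply: sumr_ge0 => k _; rewrite mulr_ge0// indicE. Qed.

(** This length is the source of the factor (k+1)^-2 in the series. *)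
Lemma block_measure k : (mu (block k) <= (k.+1%:R ^- 2)%:E)%E.
Proof.
rewrite lebesgue_measure_itv/= lte_fin; case: ifP => _; last by rewrite lee_fin invr_ge0 exprn_ge0.
rewrite -EFinB lee_fin /node.
have -> : 1 - k.+2%:R^-1 - (1 - k.+1%:R^-1) = (k.+1%:R * k.+2%:R)^-1 :> R.
  have h : k.+2%:R = k.+1%:R + 1 :> R by rewrite natr1.
  have k1 : k.+1%:R != 0 :> R by rewrite pnatr_eq0.
  have k2 : k.+1%:R + 1 != 0 :> R by rewrite natr1 pnatr_eq0.
  by rewrite h; move: (k.+1%:R : R) k1 k2 => x x0 x1; field; rewrite x0 x1.
rewrite -exprVn expr2 -invfM lef_pV2 ?posrE ?mulr_gt0//.
by rewrite ler_pM2l// ler_nat.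
Qed.

Lemma integral_step_le K N a (D : set R) : measurable D -> (forall k, 0 <= a k) ->
  (\int[mu]_(t in D) (step K N a t)%:E <= (\sum_(K <= k < N) a k * k.+1%:R ^- 2)%:E)%E.
Proof.
move=> mD a0.
have mb k : measurable (block k) by exact: measurable_itv.
have mi k : measurable_fun [set: R] (\1_(block k) : R -> R).
  exact: (@measurable_indic _ _ R [set: R] (block k)).
apply: (@le_trans _ _ (\int[mu]_t (step K N a t)%:E)%E).
  by apply: ge0_integral_le_subset => // t _; rewrite lee_fin step_ge0.
have -> : (\int[mu]_t (step K N a t)%:E = \int[mu]_t \sum_(K <= k < N) (a k * \1_(block k) t)%:E)%E.
  by apply: eq_integral => t _; rewrite /step -sumEFin.
rewrite ge0_integral_sum//; last 2 first.
- by move=> k; apply/measurable_EFinP; apply: measurable_funM => //; exact: mi.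
- by move=> k t _; rewrite lee_fin mulr_ge0// indicE.
rewrite -sumEFin; apply: lee_sum => k _.
rewrite -(mule_integral measurableT (mi k))//.
rewrite EFinM; apply: lee_wpmul2l; first by rewrite lee_fin.
have E : (\int[mu]_t (\1_(block k) t)%:E = mu (block k `&` [set: R]))%E.
  rewrite (@integral_indic _ (measurableTypeR R) R mu [set: R] measurableT (block k) _)//.
  exact: measurable_itv.
by rewrite E setIT; exact: block_measure.
Qed.

End step_functions.

Lemma powR_div {R : realType} (x y a : R) : 0 <= x -> 0 < y -> (x / y) `^ a = x `^ a / y `^ a.
Proof.
move=> x0 y0; have ya : y `^ a != 0 by rewrite gt_eqF// powR_gt0.
apply: (mulIf ya); rewrite divfK// -powRM ?divfK ?gt_eqF//; last exact: ltW.
by rewrite divr_ge0// ltW.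
Qed.

Section upper_bound.
Context {R : realType}.
Local Notation C := (CC R).
Local Notation mu := (@lebesgue_measure R).
Local Notation I := (`[0%R, 1%R[%classic : set R).
Variables (p : R) (p1 : 1 < p) (w : R -> R) (rw : radial_weight w).
Local Notation p' := (p / (p - 1)).
Local Notation mo k := (fine (moment w k)).

(** J stays a parameter: finite upper bounds of the inner sums in the upper estimate, truncated
    inner sums in the lower one. *)
Definition Sg_term (J : nat -> R) (k : nat) : R := k.+1%:R ^- 2 / mo k `^ (p' - 1) * J k `^ p'.

Lemma Sg_term_ge0 J k : 0 <= Sg_term J k.
Proof. by rewrite mulr_ge0 ?powR_ge0// divr_ge0 ?powR_ge0// invr_ge0 exprn_ge0. Qed.

Lemma fine_momentK k : ((mo k)%:E = moment w k)%E.
Proof. by rewrite fineK// ge0_fin_numE ?moment_fin// ltW// moment_gt0. Qed.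

Lemma fine_moment_gt0 k : 0 < mo k.
Proof. by rewrite -lte_fin fine_momentK moment_gt0. Qed.

(* The radius is split at node K: K = 0 gives boundedness, large K compactness. *)
Lemma Tg_upper (Cw : R) : 0 < Cw ->
  (forall k (t : R), 0 <= t <= 1 - k.+2%:R^-1 -> (moment w k <= Cw%:E * omega_hat w t)%E) ->
  exists A : R, 0 < A /\ forall (g f : C -> C) (J : nat -> R) (K : nat) (S T D : R),
  holo g -> (forall n, 0 <= coef g n) -> holo f ->
  (forall k N, \sum_(n < N) n.+1%:R * complex.Re (coef g n.+1) / (n + k + 1)%:R <= J k) ->
  (forall N, \sum_(K <= k < N) Sg_term J k <= T) ->
  (forall z, cmod z <= node K -> cmod (derive1 f z) <= S) ->
  (Dnorm_p p w f <= D%:E)%E ->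
  forall z, cmod z < 1 ->
    cmod (Tg g f z) <= 2 * J 0%N * (cmod (f 0) + 2 * S * node K) + A * T `^ p'^-1 * D `^ p^-1.
Proof.
move=> Cw0 hC.
have p0 : 0 < p by apply: lt_trans p1.
have p10 : 0 < p - 1 by rewrite subr_gt0.
have q0 : 0 < p' by rewrite divr_gt0.
have pq : p^-1 + p'^-1 = 1.
  by rewrite invf_div; field; rewrite gt_eqF.
have q1 : p' - 1 = p' / p.
  by rewrite -[X in _ - X](mulfV (lt0r_neq0 p10)) -mulrBl; field; rewrite !gt_eqF.
have [KR [KR0 rad]] := radial_bound p1 rw.
(* 4 = 2 * 2, from [cseg_le_int] and from [holo_increment_le]. The power of [Cw] comes from the
   second Hoelder factor, that of [KR] from [radial_bound] in the first. *)
exists (4 * Cw `^ ((p' - 1) / p') * KR `^ p^-1); split; first by rewrite !mulr_gt0 ?powR_gt0.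
move=> g f J K S T D hg g0 hf hJ hT hS hD z z1.
have J0 k : 0 <= J k by have := hJ k 0%N; rewrite big_ord0.
have T0 : 0 <= T by have := hT K; rewrite big_geq.
have D0 : 0 <= D.
  rewrite -lee_fin; apply: le_trans hD; rewrite Dnorm_p_density//.
  rewrite adde_ge0 ?lee_fin ?powR_ge0// mule_ge0 ?lee_fin ?invr_ge0 ?pi_ge0//.
  by apply: integral_ge0 => v _; exact: dp_density_ge0.
have S0 : 0 <= S by apply: le_trans (cmod_ge0 _) (hS 0 _); rewrite cmod0 node_ge0.
pose r := cmod z; have r0 : 0 <= r by exact: cmod_ge0.
have [eta [e1 zE]] : exists eta, cmod eta = 1 /\ z = cofr r * eta.
  have [z0|z0] := eqVneq z 0; first by exists 1; rewrite /r z0 cmod0 cofr0 mul0r cmod1.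
  have rn : cofr r != 0 by rewrite -cmod_eq0 cmod_pos// /r cmod_eq0.
  exists (z / cofr r); rewrite cmodM cmodV cmod_pos// mulfV ?cmod_eq0//.
  by rewrite mulrC divfK.
have e1' : cmod eta <= 1 by rewrite e1.
have r1 : r < 1 by [].
have r01 : 0 <= r < 1 by rewrite r0.
rewrite zE (Tg_by_parts hg hf e1' r01).
set c := fun t => g (cofr r * eta) - g (cofr t * eta).
pose psi t := derive1 f (cofr t * eta) * eta * c t.
have c_le k t : node k <= t <= r -> cmod (c t) <= 2 * J k.
  move=> /andP[kt tr]; apply: (holo_increment_le hg g0 (hJ k)) => //.
  by rewrite tr (le_trans (node_ge0 k)).
have cpsi : ccont 0 r psi.
  exact: (ccontM (ccontM (ccont_ray_derive hf e1' r1) (ccont_cst 0 r eta))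
    (ccontB (ccont_cst 0 r (g (cofr r * eta))) (ccont_ray hg e1' r1))).
have psi_le t : cmod (psi t) = cmod (derive1 f (cofr t * eta)) * cmod (c t).
  by rewrite /psi cmodM [cmod (_ * eta)]cmodM e1 mulr1.
rewrite -[cseg 0 r _]/(cseg 0 r psi) [2 * J 0%N * (_ + _)]mulrDr -[leRHS]addrA.
have h0 : cmod (f 0 * (g (cofr r * eta) - g 0)) <= 2 * J 0%N * cmod (f 0).
  rewrite cmodM mulrC ler_wpM2r ?cmod_ge0//.
  by have := @c_le 0%N 0; rewrite /c cofr0 mul0r; apply; rewrite node0 lexx.
apply: le_trans (cmodD _ _) _; apply: lerD => //.
set E := 4 * _ * _ * _ * _.
have E0 : 0 <= E by rewrite /E !mulr_ge0 ?powR_ge0.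
(* Below node K the derivative is at most S and every increment of g at most 2 J 0, since node 0 is
   the origin. *)
have low rho : 0 <= rho -> rho <= r -> rho <= node K ->
    cmod (cseg 0 rho psi) <= 2 * J 0%N * (2 * S * node K).
  move=> rho0 rhor rhoK.
  have cp : ccont 0 rho psi by exact: ccont_sub cpsi _ _.
  apply: le_trans (@cseg_le _ 0 rho (S * (2 * J 0%N)) psi rho0 cp _) _.
    move=> x /andP[x0 xrho]; rewrite psi_le; apply: ler_pM; rewrite ?cmod_ge0//.
      apply: hS; rewrite cmod_ray// e1 mulr1; exact: le_trans rhoK.
    by apply: c_le; rewrite node0 x0 (le_trans xrho).
  rewrite subr0 (_ : 2 * J 0%N * (2 * S * node K) = 2 * (S * (2 * J 0%N)) * node K); last by ring.
  by rewrite ler_wpM2l// !mulr_ge0.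
have [rK|Kr] := leP r (node K).
  by apply: le_trans (low r r0 (lexx r) rK) _; rewrite lerDl.
rewrite (@cseg_split _ 0 (node K) r psi (node_ge0 K) (ltW Kr) cpsi).
apply: le_trans (cmodD _ _) _; apply: lerD; first by apply: low; rewrite ?node_ge0// ltW.
(* Only finitely many blocks meet [0, r], so step functions with finitely many values suffice. *)
have [N rN] : exists N, r < node N.
  exists (Num.trunc (1 - r)^-1); rewrite /node ltrBrDl addrC -ltrBrDl.
  rewrite invf_plt ?posrE ?subr_gt0//; exact: truncnS_gt.
pose phi t := disc_mod (derive1 f) (rot (complex.Re eta) (complex.Im eta) (t, 0)).
have mphi : measurable_fun [set: R] phi.
  apply: (measurableT_comp (measurable_disc_mod (holo_derive1 hf))).
  apply: (measurableT_comp (measurable_rot _ _)).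
  by apply: measurable_fun_pair => //; exact: measurable_cst.
have phiE t : I t -> phi t = cmod (derive1 f (cofr t * eta)).
  rewrite /= in_itv/= => /andP[t0 t1]; rewrite /phi disc_mod_pt pt_rot.
  have -> : pt (t, 0) = cofr t by [].
  by rewrite [cofr t * eta]mulrC cmodM e1 mul1r cmod_pos// t1.
have phi0 t : 0 <= phi t by rewrite /phi disc_mod_pt; case: ifP => // _; exact: cmod_ge0.
(* A lower bound for hat w on block k. On that block [su] is its power 1/p, so that (phi su)^p <=
   phi^p hat w, and su sv = 2 J k bounds the increment of g. *)
pose x k := mo k / Cw; have x0 k : 0 < x k by rewrite divr_gt0// fine_moment_gt0.
pose su := step K N (fun k => x k `^ p^-1).
pose sv := step K N (fun k => 2 * J k * x k `^ (- p^-1)).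
have su0 t : 0 <= su t by apply: step_ge0 => k; exact: powR_ge0.
have sv0 t : 0 <= sv t by apply: step_ge0 => k; rewrite !mulr_ge0 ?powR_ge0.
have mu_ : measurable_fun I (fun t => phi t * su t).
  by apply: measurable_funTS; apply: measurable_funM => //; exact: measurable_step.
have mv : measurable_fun I sv by apply: measurable_funTS; exact: measurable_step.
have mI : measurable I by exact: measurable_itv.
have cp : ccont (node K) r psi by apply: ccont_sub cpsi _ _ => //; exact: node_ge0.
rewrite -lee_fin; apply: le_trans (cseg_le_int cp) _.
have main : (\int[mu]_(t in `[node K, r]) (cmod (psi t))%:E <= \int[mu]_(t in I) (phi t * su t * sv t)%:E)%E.
  apply: (@le_trans _ _ (\int[mu]_(t in `[node K, r]) (phi t * su t * sv t)%:E)%E); last first.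
    apply: ge0_integral_le_subset; first by move=> t _; rewrite lee_fin !mulr_ge0.
    move=> t; rewrite /= !in_itv/= => /andP[Kt tr].
    by rewrite (le_trans (node_ge0 K) Kt) (le_lt_trans tr).
  apply: ge0_le_integral_nomeas => t; first by rewrite lee_fin cmod_ge0.
  rewrite /= in_itv/= => /andP[Kt tr]; have t0 := le_trans (node_ge0 K) Kt.
  have [k kN kt] := block_ex t0 (le_lt_trans tr rN).
  have Kk : (K <= k)%N.
    rewrite leqNgt; apply/negP => kK; move: kt; rewrite /block /= in_itv/= => /andP[_].
    by rewrite ltNge (le_trans (node_le kK)).
  have KkN : (K <= k < N)%N by rewrite Kk.
  rewrite lee_fin psi_le phiE; last by rewrite /= in_itv/= t0 (le_lt_trans tr).
  rewrite -mulrA; apply: ler_wpM2l; first exact: cmod_ge0.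
  rewrite /su /sv !(stepE _ KkN kt) mulrCA powRN mulfV ?gt_eqF ?powR_gt0// mulr1.
  by apply: c_le; move: kt; rewrite /block /= in_itv/= => /andP[-> _].
have U : (\int[mu]_(t in I) ((phi t * su t) `^ p)%:E <= (KR * D)%:E)%E.
  apply: (@le_trans _ _ (KR%:E * Dnorm_p p w f)%E); last first.
    by rewrite EFinM; apply: lee_wpmul2l => //; rewrite lee_fin ltW.
  apply: le_trans (rad f eta hf e1).
  apply: ge0_le_integral_nomeas => t It; first by rewrite lee_fin powR_ge0.
  have whh : (0 <= omega_hat w t)%E by move: It; rewrite /= in_itv/= => ht; case: rw => _ _ H; exact/ltW/H.
  rewrite powRM// EFinM phiE//; apply: lee_wpmul2l; first by rewrite lee_fin powR_ge0.
  case: (stepP K N t) => [[k kN kt]|z0]; last by rewrite /su z0 powR0 ?gt_eqF.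
  rewrite /su (stepE _ kN kt) -powRrM mulVf ?gt_eqF// (powRr1 (ltW (x0 k))) /x mulrC EFinM.
  rewrite lee_pdivrMl// fine_momentK; apply: hC.
  move: kt; rewrite /block /= in_itv/= => /andP[h1 h2].
  by rewrite (le_trans (node_ge0 k) h1) ltW.
(* Since p' / p = p' - 1, on block k the power p' of [sv] is 2^p' J_k^p' (Cw / mo k)^(p' - 1); times
   the block length this is at most a constant multiple of the term of the series. *)
have V : (\int[mu]_(t in I) (sv t `^ p')%:E <= (2 `^ p' * Cw `^ (p' - 1) * T)%:E)%E.
  pose b k := (2 * J k * x k `^ (- p^-1)) `^ p'.
  have -> : (\int[mu]_(t in I) (sv t `^ p')%:E = \int[mu]_(t in I) (step K N b t)%:E)%E.
    apply: eq_integral => t _; congr EFin.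
    case: (stepP K N t) => [[k kN kt]|z0]; last by rewrite /sv !z0 powR0 ?gt_eqF.
    by rewrite /sv !(stepE _ kN kt).
  have b0 k : 0 <= b k by exact: powR_ge0.
  apply: le_trans (integral_step_le K N mI b0) _; rewrite lee_fin.
  have -> : \sum_(K <= k < N) b k * k.+1%:R ^- 2 = 2 `^ p' * Cw `^ (p' - 1) * \sum_(K <= k < N) Sg_term J k.
    rewrite mulr_sumr; apply: eq_bigr => k _.
    rewrite /b /Sg_term powRM ?mulr_ge0 ?powR_ge0// powRM// -powRrM.
    have -> : - p^-1 * p' = - (p' - 1) by rewrite q1 mulNr mulrC.
    rewrite powRN /x powR_div//; last by rewrite ltW// fine_moment_gt0.
    by rewrite invf_div; ring.
  by rewrite ler_wpM2l ?mulr_ge0 ?powR_ge0.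
have HH := @hoelder_in _ _ _ mu I (fun t => phi t * su t) sv p p' mI mu_ mv (fun t _ => mulr_ge0 (phi0 t) (su0 t)) (fun t _ => sv0 t) p0 q0 pq.
have fin : (\int[mu]_(t in `[node K, r]) (cmod (psi t))%:E <=
   ((KR * D) `^ p^-1 * (2 `^ p' * Cw `^ (p' - 1) * T) `^ p'^-1)%:E)%E.
  apply: le_trans main _; apply: le_trans HH _.
  rewrite EFinM -!poweR_EFin; apply: lee_pmul; rewrite ?poweR_ge0//.
    apply: poweR_le => //; first by rewrite invr_ge0 ltW.
    by apply: integral_ge0 => t _; rewrite lee_fin powR_ge0.
  apply: poweR_le => //; first by rewrite invr_ge0 ltW.
  by apply: integral_ge0 => t _; rewrite lee_fin powR_ge0.
apply: (@le_trans _ _ (2%:E * ((KR * D) `^ p^-1 * (2 `^ p' * Cw `^ (p' - 1) * T) `^ p'^-1)%:E)%E).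
  exact: lee_wpmul2l.
rewrite -EFinM lee_fin.
rewrite !powRM ?powR_ge0 ?mulr_ge0 ?powR_ge0// ?(ltW KR0)//.
rewrite -!powRrM mulfV ?gt_eqF// powRr1// /E.
rewrite le_eqVlt; apply/orP; left; apply/eqP; ring.
Qed.

End upper_bound.

(** * The lower bound *)

Section step_kernel.
Context {R : realType}.
Local Notation mu := (@lebesgue_measure R).

Lemma block_measureE k : (mu (block k) = ((k.+1%:R * k.+2%:R)^-1)%:E)%E.
Proof.
have k1 : 0 < k.+1%:R :> R by [].
have k2 : k.+2%:R = k.+1%:R + 1 :> R by rewrite natr1.
have h : @node R k.+1 - node k = (k.+1%:R * k.+2%:R)^-1.
  rewrite /node k2; move: (k.+1%:R : R) k1 => x x0.
  by field; apply/andP; split; apply: lt0r_neq0; lra.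
rewrite lebesgue_measure_itv/= lte_fin -subr_gt0 h invr_gt0 mulr_gt0//.
by rewrite -EFinB h.
Qed.

Lemma integral_stepE N a : (forall k, 0 <= a k) ->
  (\int[mu]_t (step 0 N a t)%:E = (\sum_(0 <= k < N) a k / (k.+1%:R * k.+2%:R))%:E)%E.
Proof.
move=> a0.
have mi k : measurable_fun [set: R] (\1_(block k) : R -> R).
  by apply: (@measurable_indic _ _ R [set: R] (block k)); exact: measurable_itv.
have -> : (\int[mu]_t (step 0 N a t)%:E = \int[mu]_t \sum_(0 <= k < N) (a k * \1_(block k) t)%:E)%E.
  by apply: eq_integral => t _; rewrite /step -sumEFin.
rewrite ge0_integral_sum//; last 2 first.
- by move=> k; apply/measurable_EFinP; apply: measurable_funM => //; exact: mi.
- by move=> k t _; rewrite lee_fin mulr_ge0// indicE.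
rewrite -sumEFin; apply: eq_bigr => k _.
rewrite -(mule_integral measurableT (mi k))// EFinM; congr (_ * _)%E.
rewrite (@integral_indic _ (measurableTypeR R) R mu [set: R] measurableT (block k) _)//.
  by rewrite setIT; exact: block_measureE.
exact: measurable_itv.
Qed.

Lemma step_out N (a : nat -> R) t : ~~ (0 <= t < 1) -> step 0 N a t = 0.
Proof.
move=> h; case: (stepP 0 N t) => [[k _]|->//].
rewrite /block /= in_itv/= => /andP[h1 h2]; move: h.
by rewrite (le_trans (node_ge0 k) h1) (lt_trans h2 (node_lt1 _)).
Qed.

Lemma measurable_step_rev N (a : nat -> R) : measurable_fun [set: R] (fun v => step 0 N a (1 - v)).
Proof.
apply: (measurableT_comp (measurable_step 0 N a)); exact: measurable_funB.
Qed.

Lemma integral_step_rev N a : (forall k, 0 <= a k) ->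
  (\int[mu]_(v in `]0%R, 1%R]) (step 0 N a (1 - v))%:E =
   (\sum_(0 <= k < N) a k / (k.+1%:R * k.+2%:R))%:E)%E.
Proof.
move=> a0; rewrite -integral_stepE//.
rewrite (@ge0_integral_affine _ (-1) 1); last 3 first.
- by rewrite oppr_eq0 oner_eq0.
- by apply/measurable_EFinP; exact: measurable_step.
- by move=> t; rewrite lee_fin step_ge0.
rewrite normrN1 mul1e integral_mkcond; apply: eq_integral => v _.
rewrite patchE mem_setE in_itv/= mulN1r addrC.
case: ifPn => // h; rewrite step_out//; apply: contra h => /andP[h1 h2].
by apply/andP; split; lra.
Qed.

(** On block k one has v = 1 - t <= 1/(k+1), hence 1 / (v + y) >= (k+1) / (1 + (k+1) y); integrating
    over the block multiplies this by 1 / ((k+1)(k+2)). *)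
Lemma step_kernel_ge N (c : nat -> R) (y : R) : 0 <= y -> (forall k, 0 <= c k) ->
  (\sum_(0 <= k < N) (c k / (k.+2%:R * (1 + k.+1%:R * y)))%:E <=
   \int[mu]_(v in `]0%R, 1%R]) (step 0 N c (1 - v) / (v + y))%:E)%E.
Proof.
move=> y0 c0.
have d0 k : 0 < k.+1%:R^-1 + y by rewrite ltr_wpDr// invr_gt0.
pose a k := c k * (k.+1%:R^-1 + y)^-1.
have a0 k : 0 <= a k by rewrite mulr_ge0// invr_ge0 ltW.
have -> : (\sum_(0 <= k < N) (c k / (k.+2%:R * (1 + k.+1%:R * y)))%:E)%E =
    (\sum_(0 <= k < N) a k / (k.+1%:R * k.+2%:R))%:E.
  rewrite -sumEFin; apply: eq_bigr => k _; congr EFin; rewrite /a -!mulrA; congr (_ * _).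
  rewrite -invfM; congr (_^-1).
  have n0 : k.+1%:R != 0 :> R by rewrite pnatr_eq0.
  by move: n0; move: (k.+1%:R : R) (k.+2%:R : R) => n m n0; field.
rewrite -integral_step_rev//; apply: ge0_le_integral_nomeas => v; first by rewrite lee_fin step_ge0.
rewrite /= in_itv/= => /andP[v0 v1]; rewrite lee_fin.
case: (stepP 0 N (1 - v)) => [[k kN kt]|z0]; last by rewrite !z0 mul0r.
rewrite !(stepE _ kN kt) /a; apply: ler_wpM2l => //.
have vy : 0 < v + y by rewrite ltr_wpDr.
rewrite lef_pV2 ?posrE// lerD2r.
by move: kt; rewrite /block /= in_itv/= /node => /andP[h _]; rewrite lerD2l lerN2 in h.
Qed.

End step_kernel.

(** * Test functions *)

Section test_functions.
Context {R : realType}.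
Local Notation C := (CC R).
Local Notation mu := (@lebesgue_measure R).
Local Notation I := (`[0%R, 1%R[%classic : set R).

Definition qden (k : nat) (z : C) : C := 1 + k%:R * (1 - z).

Definition testB (M k : nat) (z : C) : C := (qden k z)^-1 ^+ M.

Lemma qden_ge k z : cmod z <= 1 -> 1 + k%:R * (1 - cmod z) <= cmod (qden k z).
Proof.
move=> z1; apply: le_trans _ (le_trans (ler_norm _) (cRe_le _)).
have kE : k%:R = cofr k%:R :> C by rewrite cofr_nat.
rewrite /qden kE cReD cReM cRe_C cIm_C mul0r subr0 cReD cReN cRe1 lerD2l.
apply: ler_wpM2l => //; rewrite lerD2l lerN2.
exact: le_trans (ler_norm _) (cRe_le _).
Qed.

Lemma qden_neq0 k z : cmod z < 1 -> qden k z != 0.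
Proof.
move=> z1; rewrite -cmod_gt0; apply: lt_le_trans (qden_ge k (ltW z1)).
by rewrite ltr_wpDr// mulr_ge0// subr_ge0 ltW.
Qed.

(** |1 + v| >= |v| because v = k (1 - z) has nonnegative real part. *)
Lemma qden_ge2 k z : cmod z <= 1 -> k%:R * cmod (1 - z) <= cmod (qden k z).
Proof.
move=> z1.
have kE : k%:R = cofr k%:R :> C by rewrite cofr_nat.
rewrite -(cmod_nat k) -cmodM /qden; set v := k%:R * (1 - z).
have v0 : 0 <= complex.Re v.
  rewrite /v kE cReM cRe_C cIm_C mul0r subr0 mulr_ge0// cReD cReN cRe1 subr_ge0.
  by apply: le_trans z1; exact: le_trans (ler_norm _) (cRe_le _).
rewrite -(@ler_pXn2r _ 2)// ?nnegrE ?cmod_ge0// !cmod_sqr cReD cImD cRe1 cIm1 add0r lerD2r.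
by rewrite lerXn2r ?nnegrE ?addr_ge0// lerDr.
Qed.

Lemma cmod_one_sub k (s u : R) : cmod (1 - cofr s * arc k u) = cmod (arc k u - cofr s).
Proof.
apply/eqP; rewrite -(@eqrXn2 _ 2)// ?cmod_ge0//.
have a1 : complex.Re (arc k u) ^+ 2 + complex.Im (arc k u) ^+ 2 = 1.
  by rewrite -cmod_sqr cmod_arc expr1n.
rewrite !cmod_sqr !cReD !cReN !cImD !cImN [complex.Re (cofr s * _)]cReM [complex.Im (cofr s * _)]cImM.
rewrite cRe1 cIm1 cRe_C cIm_C.
move: (complex.Re _) (complex.Im _) a1 => x y a1; apply/eqP.
have -> : (1 - (s * x - 0 * y)) ^+ 2 + (0 - (s * y + 0 * x)) ^+ 2 = 1 - 2 * s * x + s ^+ 2 * (x ^+ 2 + y ^+ 2) by ring.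
have -> : (x - s) ^+ 2 + (y - 0) ^+ 2 = (x ^+ 2 + y ^+ 2) - 2 * s * x + s ^+ 2 by ring.
by rewrite a1; ring.
Qed.

(** 5 = 1 + 4: the modulus is at least 1 and, by [arc_dist], at least k |u| / 4. *)
Lemma qden_arc_ge k j (s u : R) : 0 <= s < 1 -> -1 <= u <= 1 ->
  1 + k%:R * `|u| <= 5 * cmod (qden k (cofr s * arc j u)).
Proof.
move=> /andP[s0 s1] hu.
have z1 : cmod (cofr s * arc j u) <= 1 by rewrite cmodM cmod_arc mulr1 cmod_pos// ltW.
have h1 := qden_ge k z1; have h2 := qden_ge2 k z1.
rewrite cmod_one_sub in h2.
have s01 : 0 <= s <= 1 by rewrite s0 ltW.
have h3 : k%:R * (`|u| / 4) <= cmod (qden k (cofr s * arc j u)).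
  apply: le_trans h2; apply: ler_wpM2l => //; apply: le_trans (arc_dist j hu s01).
  by rewrite ler_pM2r ?invr_gt0// lerDr subr_ge0 ltW.
have h4 : 1 <= cmod (qden k (cofr s * arc j u)).
  by apply: le_trans h1; rewrite lerDl mulr_ge0// subr_ge0.
rewrite mulrA ler_pdivrMr// in h3.
by move: h3 h4; move: (cmod _) (k%:R * `|u|) => x y; lra.
Qed.

Lemma testB_hasd M k z : cmod z < 1 ->
  hasd (testB M.+1 k) z (M.+1%:R * (qden k z)^-1 ^+ M * (k%:R * (qden k z)^-1 ^+ 2)).
Proof.
move=> z1; have q0 := qden_neq0 k z1.
have dq : is_derive z (1 : C) (qden k) (- k%:R).
  have h := is_deriveD (is_derive_cst (1 : C) z 1)
     (is_deriveM (is_derive_cst (k%:R : C) z 1) (is_deriveB (is_derive_cst (1 : C) z 1) (is_derive_id z (1 : C)))).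
  apply: is_derive_eq h _.
  by rewrite /GRing.scale/= !add0r mulr0 addr0 mulrN mulr1.
have q_ex : derivable (qden k) z 1 by case: dq.
have dv := derivableP (derivableV q0 q_ex).
have dx := is_deriveX M.+1 dv.
have tE : testB M.+1 k = (fun y => (qden k y)^-1) ^+ M.+1.
  by apply/funext => y; rewrite exprfctE.
have h : derivable (testB M.+1 k) z 1 by rewrite tE; case: dx.
have -> : M.+1%:R * (qden k z)^-1 ^+ M * (k%:R * (qden k z)^-1 ^+ 2) = derive1 (testB M.+1 k) z.
  rewrite derive1E tE; case: dx => _ ->.
  have vq : 'D_1 (qden k) z = - k%:R by case: dq.
  rewrite (deriveV q0 q_ex) vq.
  by rewrite /GRing.scale/= mulrNN -(exprVn _ 2) [_ ^+ 2 * _]mulrC.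
exact: derivable_hasd.
Qed.

(** The derivative contains M + 2 inverse powers of [qden]. M + 1 of them give the radial bump, the
    last one the angular decay that leads to the Hilbert kernel. *)
Lemma testB_derive_le M k j (s u : R) : 0 <= s < 1 -> -1 <= u <= 1 ->
  cmod (derive1 (testB M.+1 k) (cofr s * arc j u)) <=
  (M.+1%:R * 5) * bump M.+1 (k%:R * (1 - s)) * (k.+1%:R / (1 + k.+1%:R * `|u|)).
Proof.
move=> hs hu; have /andP[s0 s1] := hs.
set z := cofr s * arc j u.
have zs : cmod z = s by rewrite cmodM cmod_arc mulr1 cmod_pos.
have z1 : cmod z < 1 by rewrite zs.
rewrite (proj2 (hasd_derivable _ _ _ (testB_hasd M k z1))).
have q0 : 0 < cmod (qden k z) by rewrite cmod_gt0 qden_neq0.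
have x0 : 0 <= k%:R * (1 - s) by rewrite mulr_ge0// subr_ge0 ltW.
have h1 : (cmod (qden k z))^-1 <= (1 + k%:R * (1 - s))^-1.
  rewrite lef_pV2 ?posrE// ?ltr_wpDr//.
  by have := qden_ge k (ltW z1); rewrite zs.
have h2 : (cmod (qden k z))^-1 <= 5 / (1 + k%:R * `|u|).
  rewrite -[leLHS]mul1r ler_pdivrMr// mulrAC ler_pdivlMr ?ltr_wpDr ?mulr_ge0// mul1r.
  exact: qden_arc_ge.
have h3 : k%:R / (1 + k%:R * `|u|) <= k.+1%:R / (1 + k.+1%:R * `|u|).
  rewrite ler_pdivrMr ?ltr_wpDr ?mulr_ge0// mulrAC ler_pdivlMr ?ltr_wpDr ?mulr_ge0//.
  rewrite -natr1; have : 0 <= `|u| by []. move: (`|u|) => v v0.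
  by move: (k%:R : R) => n; lra.
have -> : cmod (M.+1%:R * (qden k z)^-1 ^+ M * (k%:R * (qden k z)^-1 ^+ 2)) =
    M.+1%:R * ((cmod (qden k z))^-1 ^+ M.+1 * (k%:R * (cmod (qden k z))^-1)).
  rewrite cmodM [cmod (_ * _ ^+ M)]cmodM [cmod (k%:R * _)]cmodM !cmod_nat !cmodX cmodV expr2 exprS.
  by move: (_ ^-1) (k%:R : R) (M.+1%:R : R) => a b c; ring.
have -> : M.+1%:R * 5 * bump M.+1 (k%:R * (1 - s)) * (k.+1%:R / (1 + k.+1%:R * `|u|)) =
    M.+1%:R * (bump M.+1 (k%:R * (1 - s)) * (5 * (k.+1%:R / (1 + k.+1%:R * `|u|)))) by rewrite !mulrA; ring.
apply: ler_wpM2l => //; apply: ler_pM.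
- by rewrite exprn_ge0// invr_ge0 ltW.
- by rewrite mulr_ge0// invr_ge0 ltW.
- by apply: lerXn2r; rewrite ?nnegrE ?invr_ge0 ?(ltW q0)// addr_ge0.
apply: le_trans (ler_wpM2l _ h2) _ => //.
by rewrite mulrCA; apply: ler_wpM2l.
Qed.

Lemma holo_testB M k : holo (testB M.+1 k).
Proof. by move=> z z1; case: (hasd_derivable _ _ _ (testB_hasd M k z1)). Qed.

Definition testf (M N : nat) (a : nat -> R) (z : C) : C :=
  \sum_(0 <= k < N) cofr (a k) * testB M k z.

Lemma hasd_testf M N a z : cmod z < 1 ->
  hasd (testf M.+1 N a) z (\sum_(0 <= k < N) cofr (a k) * derive1 (testB M.+1 k) z).
Proof.
move=> z1.
have dt k : derivable (testB M.+1 k) z 1 by exact: holo_testB.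
have H : is_derive z (1 : C) (testf M.+1 N a) (\sum_(0 <= k < N) cofr (a k) * derive1 (testB M.+1 k) z).
  elim: N => [|N IH].
    rewrite big_geq// (_ : testf _ _ _ = cst 0); first exact: is_derive_cst.
    by apply/funext => y; rewrite /testf big_geq.
  rewrite big_nat_recr//= (_ : testf _ _ _ = testf M.+1 N a + (cofr (a N) \*: testB M.+1 N)).
    apply: is_deriveD; rewrite derive1E.
    exact: (is_deriveZ (cofr (a N)) (derivableP (dt N))).
  by apply/funext => y; rewrite /testf big_nat_recr.
case: H => H1 H2; rewrite -H2 -derive1E; exact: derivable_hasd.
Qed.

Lemma holo_testf M N a : holo (testf M.+1 N a).
Proof. by move=> z z1; case: (hasd_derivable _ _ _ (hasd_testf M N a z1)). Qed.

Lemma testf_real M N a s : 0 <= s <= 1 ->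
  testf M N a (cofr s) = cofr (\sum_(0 <= k < N) a k * bump M (k%:R * (1 - s))).
Proof.
move=> hs; rewrite /testf.
have E k : cofr (a k) * testB M k (cofr s) = cofr (a k * bump M (k%:R * (1 - s))).
  rewrite cofrM /testB /bump cofrX cofrV /qden cofrD cofrM cofrB cofr1 cofr_nat//.
elim: N => [|N IH]; first by rewrite !big_geq// cofr0.
by rewrite !big_nat_recr//= IH E cofrD.
Qed.

End test_functions.

Lemma ray_integral_le {R : realType} (E W : R -> \bar R) :
  (forall r, 0 <= r -> (0 <= E r)%E) -> (forall r, 0 <= r < 1 -> (E r <= W r)%E) ->
  (forall r, 1 <= r -> E r = 0%E) ->
  (\int[@lebesgue_measure R]_(r in `[0%R, +oo[) E r <= \int[@lebesgue_measure R]_(r in `[0%R, 1%R[) W r)%E.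
Proof.
move=> E0 EW E1; rewrite integral_mkcond [leRHS]integral_mkcond.
apply: ge0_le_integral_nomeas => r _; rewrite !patchE !mem_setE !in_itv/= andbT.
  by case: (boolP (0 <= r)) => // /E0.
case: (boolP (0 <= r)) => //= r0; case: (ltP r 1) => r1; first by apply: EW; rewrite r0.
by rewrite E1.
Qed.

(** * The norm of the test functions *)

Section test_norm.
Context {R : realType}.
Local Notation C := (CC R).
Local Notation mu := (@lebesgue_measure R).
Local Notation I := (`[0%R, 1%R[%classic : set R).
Local Notation J := (`[(-1)%R, 1%R]%classic : set R).
Local Notation U := (`]0%R, 1%R]%classic : set R).
Variables (p : R) (p1 : 1 < p) (w : R -> R) (rw : radial_weight w).
Variables (M : nat) (x : nat -> R) (N : nat).
Hypothesis x0 : forall k, 0 <= x k.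
Local Notation mo k := (fine (moment w k)).

(** The factor (k+1)^-2 stands for the length of block k, so that [x] gives the heights of a step
    function. *)
Definition test_coef (k : nat) : R := k.+1%:R ^- 2 * x k.
Local Notation f := (testf M.+1 N test_coef).
Local Notation b k s := (bump M.+1 (k%:R * (1 - s))).

(* The modulus of f' on the circle of radius s is dominated by the Hilbert transform of this function. *)
Definition majorant (s v : R) : R :=
  step 0 N (fun k => 10 * M.+1%:R * x k * b k s) (1 - v).

(** Discretised p-th power of the norm of the step function; [y] is the bump at a fixed radius or,
    after integration against w, the moment. *)
Definition weighted_sum (y : nat -> R) : R := \sum_(0 <= k < N) k.+1%:R ^- 2 * x k `^ p * y k.

Lemma bump_node_ge0 k (s : R) : 0 <= s < 1 -> 0 <= b k s.
Proof. by move=> /andP[s0 s1]; rewrite bump_ge0// mulr_ge0// subr_ge0 ltW. Qed.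

Lemma majorant_coef_ge0 s k : 0 <= s < 1 -> 0 <= 10 * M.+1%:R * x k * b k s.
Proof. by move=> hs; rewrite !mulr_ge0// bump_node_ge0. Qed.

Lemma test_coef_ge0 k : 0 <= test_coef k.
Proof. by rewrite mulr_ge0// invr_ge0 exprn_ge0. Qed.

Lemma succ_ratio k : k.+1%:R^-1 <= 2 / k.+2%:R :> R.
Proof.
rewrite -[leLHS]mul1r ler_pdivrMr// mulrAC ler_pdivlMr// mul1r -natrM ler_nat.
by rewrite mul2n doubleS !ltnS -addnn leq_addr.
Qed.

(** The constant 10 in [majorant] is 5 from [qden_arc_ge] times 2 from comparing 1/(k+1) with
    1/(k+2). *)
Lemma testf_derive_le j s u : 0 <= s < 1 -> -1 <= u <= 1 ->
  ((cmod (derive1 f (cofr s * arc j u)))%:E <= \int[mu]_(v in U) (majorant s v / (v + `|u|))%:E)%E.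
Proof.
move=> hs hu; have /andP[s0 s1] := hs.
have z1 : cmod (cofr s * arc j u) < 1 by rewrite cmodM cmod_arc mulr1 cmod_pos.
have c0 k := majorant_coef_ge0 k hs.
apply: le_trans _ (step_kernel_ge N (normr_ge0 u) c0).
rewrite sumEFin lee_fin (proj2 (hasd_derivable _ _ _ (hasd_testf M N test_coef z1))).
rewrite big_seq_cond; apply: le_trans (cmod_sum _ _ _ _) _; rewrite -big_seq_cond.
apply: ler_sum => k _; rewrite cmodM (cmod_pos _ (test_coef_ge0 k)).
apply: le_trans (ler_wpM2l (test_coef_ge0 k) (testB_derive_le M k j hs hu)) _.
have d0 : 0 < 1 + k.+1%:R * `|u| by rewrite ltr_wpDr// mulr_ge0.
have k1 : k.+1%:R != 0 :> R by rewrite pnatr_eq0.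
have -> : test_coef k * (M.+1%:R * 5 * b k s * (k.+1%:R / (1 + k.+1%:R * `|u|))) =
    (5 * M.+1%:R * x k * b k s / (1 + k.+1%:R * `|u|)) * k.+1%:R^-1.
  rewrite /test_coef; move: (1 + k.+1%:R * `|u|) d0 => d d0; move: (k.+1%:R : R) k1 => e e0.
  by field; rewrite e0 gt_eqF.
have -> : 10 * M.+1%:R * x k * b k s / (k.+2%:R * (1 + k.+1%:R * `|u|)) =
    (5 * M.+1%:R * x k * b k s / (1 + k.+1%:R * `|u|)) * (2 / k.+2%:R).
  have k2 : k.+2%:R != 0 :> R by rewrite pnatr_eq0.
  move: (1 + k.+1%:R * `|u|) d0 (k.+2%:R : R) k2 => d d0 e e0.
  by field; rewrite e0 gt_eqF.
apply: ler_wpM2l; last exact: succ_ratio.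
by rewrite !mulr_ge0 ?bump_node_ge0// invr_ge0 ltW.
Qed.

(** The same Hilbert transform also dominates |f(0)| for all y in ]0, 1]. As |f(0)| does not depend
    on y, integration over y controls it with the same inequality as f'. *)
Lemma testf0_le s y : 0 <= s < 1 -> 0 < y <= 1 ->
  ((cmod (f 0))%:E <= \int[mu]_(v in U) (majorant s v / (v + y))%:E)%E.
Proof.
move=> hs /andP[y0 y1]; have /andP[s0 s1] := hs.
have c0 k := majorant_coef_ge0 k hs.
apply: le_trans _ (step_kernel_ge N (ltW y0) c0).
have h01 : 0 <= (0 : R) <= 1 by rewrite lexx ler01.
rewrite sumEFin lee_fin -cofr0 (testf_real _ _ _ h01) cmod_real ger0_norm; last first.
  by apply: sumr_ge0 => k _; rewrite mulr_ge0 ?test_coef_ge0// bump_ge0// subr0 mulr1.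
apply: ler_sum => k _.
have b01 : bump M.+1 (k%:R * (1 - 0)) <= b k s.
  have h1 : 0 < 1 + k%:R * (1 - s) by rewrite ltr_wpDr// mulr_ge0// subr_ge0 ltW.
  have h2 : 0 < 1 + k%:R :> R by rewrite ltr_wpDr.
  rewrite subr0 mulr1 /bump; apply: lerXn2r; rewrite ?nnegrE ?invr_ge0 ?(ltW h1) ?(ltW h2)//.
  by rewrite lef_pV2 ?posrE// lerD2l ler_piMr//; lra.
apply: le_trans (ler_wpM2l (test_coef_ge0 k) b01) _.
have xb : 0 <= x k * b k s by rewrite mulr_ge0// bump_node_ge0.
have d0 : 0 < 1 + k.+1%:R * y by rewrite ltr_wpDr// mulr_ge0// ltW.
have -> : 10 * M.+1%:R * x k * b k s / (k.+2%:R * (1 + k.+1%:R * y)) =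
   (10 * M.+1%:R / (k.+2%:R * (1 + k.+1%:R * y))) * (x k * b k s) by ring.
have -> : test_coef k * b k s = k.+1%:R ^- 2 * (x k * b k s) by rewrite /test_coef mulrA.
apply: ler_wpM2r => //.
apply: (@le_trans _ _ (4 / (k.+2%:R * k.+2%:R))).
  have h := succ_ratio k.
  have -> : 4 / (k.+2%:R * k.+2%:R) = (2 / k.+2%:R) ^+ 2 :> R.
    by rewrite expr2 invfM; ring.
  by rewrite -exprVn; apply: lerXn2r; rewrite ?nnegrE ?invr_ge0.
apply: ler_pM; rewrite ?invr_ge0 ?mulr_ge0//.
  have : 1 <= M.+1%:R :> R by rewrite ler1n.
  lra.
rewrite lef_pV2 ?posrE ?mulr_gt0// ler_pM2l//.
have -> : k.+2%:R = 1 + k.+1%:R :> R by rewrite addrC natr1.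
by rewrite lerD2l ler_piMr.
Qed.

Variables (H : R) (H0 : 0 < H).
Hypothesis hilb : forall h : R -> R, measurable_fun [set: R] h -> (forall y, 0 <= h y) ->
  (\int[mu]_(x in U) (\int[mu]_(y in U) (h y / (x + y))%:E) `^ p <=
   H%:E * \int[mu]_(y in U) (h y `^ p)%:E)%E.

Local Notation A := (H * (10 * M.+1%:R) `^ p).

Lemma majorant_hilbert s : 0 <= s < 1 ->
  (\int[mu]_(y in U) (\int[mu]_(v in U) (majorant s v / (v + y))%:E) `^ p <=
   (A * weighted_sum (fun k => b k s))%:E)%E.
Proof.
move=> hs; have p0 : 0 < p by exact: lt_trans p1.
have c0 k := majorant_coef_ge0 k hs.
have m0 v : 0 <= majorant s v by exact: step_ge0.
have mm : measurable_fun [set: R] (majorant s) by exact: measurable_step_rev.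
have := hilb mm m0.
under eq_integral => y _ do under eq_integral => v _ do rewrite [y + v]addrC.
move=> h; apply: le_trans h _; rewrite -mulrA [leRHS]EFinM; apply: lee_wpmul2l; first by rewrite lee_fin ltW.
have -> : (\int[mu]_(y in U) (majorant s y `^ p)%:E =
   \int[mu]_(y in U) (step 0 N (fun k => (10 * M.+1%:R * x k * b k s) `^ p) (1 - y))%:E)%E.
  apply: eq_integral => y _; congr EFin; rewrite /majorant.
  case: (stepP 0 N (1 - y)) => [[k kN kt]|z0]; last by rewrite !z0 powR0 ?gt_eqF.
  by rewrite !(stepE _ kN kt).
rewrite integral_step_rev; last by move=> k; exact: powR_ge0.
rewrite lee_fin /weighted_sum mulr_sumr; apply: ler_sum => k _.
have bk := bump_node_ge0 k hs.
(* The bump is at most 1, so its power p may be replaced by the bump itself, whose integral against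
   w is comparable with the moment. *)
have b1 : b k s `^ p <= b k s.
  have /andP[s0 s1] := hs.
  have bl : b k s <= 1 by rewrite bump_le1// mulr_ge0// subr_ge0 ltW.
  have bg : 0 < b k s by rewrite exprn_gt0// invr_gt0 ltr_wpDr// mulr_ge0// subr_ge0 ltW.
  by apply: ge1r_powR; [rewrite bg|exact: ltW].
have -> : (10 * M.+1%:R * x k * b k s) `^ p = (10 * M.+1%:R) `^ p * x k `^ p * b k s `^ p.
  by rewrite powRM ?mulr_ge0// powRM ?mulr_ge0.
have -> : (10 * M.+1%:R) `^ p * (k.+1%:R ^- 2 * x k `^ p * b k s) =
  (10 * M.+1%:R) `^ p * x k `^ p * b k s * k.+1%:R ^- 2 by ring.
apply: ler_pM; rewrite ?mulr_ge0 ?powR_ge0 ?invr_ge0 ?mulr_ge0//.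
  by apply: ler_wpM2l; rewrite ?mulr_ge0 ?powR_ge0.
by rewrite -exprVn expr2 -invfM lef_pV2 ?posrE ?mulr_gt0// ler_pM2l// ler_nat.
Qed.

Lemma testf_circle_le j s : 0 <= s < 1 ->
  (\int[mu]_(u in J) (cmod (derive1 f (cofr s * arc j u)) `^ p)%:E <=
   (2 * A * weighted_sum (fun k => b k s))%:E)%E.
Proof.
move=> hs; have p0 : 0 < p by exact: lt_trans p1.
have /andP[s0 s1] := hs.
pose F := derive1 f; have hF : holo F by apply: holo_derive1; exact: holo_testf.
have dG z : cmod z <= 1 -> exists d, hasd (fun z => F (cofr s * z)) z d.
  move=> z1; exists (cofr s * derive1 F (cofr s * z)); apply: hasd_dilate.
  apply: holo_hasd => //; rewrite cmod_ray//; apply: le_lt_trans s1.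
  by rewrite -[leRHS]mulr1 ler_wpM2l.
pose phi u := (cmod (F (cofr s * arc j u)) `^ p)%:E.
have mphi : measurable_fun [set: R] phi.
  apply/measurable_EFinP; apply: (measurableT_comp (measurable_powR p)).
  by apply: continuous_measurable_fun; exact: (@rcont_cmod_arc _ (fun z => F (cofr s * z)) j dG).
have phi0 u : (0 <= phi u)%E by rewrite lee_fin powR_ge0.
have mphiN : measurable_fun [set: R] (fun u => phi (- u)) by exact: measurableT_comp.
rewrite -[X in (X <= _)%E]/(\int[mu]_(u in J) phi u)%E integral_fold//.
have mU : measurable U by exact: measurable_itv.
rewrite (@ge0_integralD _ _ _ mu U mU phi (fun u => phi (- u)) (fun u _ => phi0 u)
  (measurable_funTS mphi) (fun u _ => phi0 (- u)) (measurable_funTS mphiN)).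
have -> : 2 * A * weighted_sum (fun k => b k s) = A * weighted_sum (fun k => b k s) + A * weighted_sum (fun k => b k s) by ring.
have bnd u y : U y -> -1 <= u <= 1 -> `|u| = y ->
    (phi u <= (\int[mu]_(v in U) (majorant s v / (v + y))%:E) `^ p)%E.
  move=> Uy hu uy; rewrite /phi -poweR_EFin; apply: poweR_le; first exact: ltW.
    by rewrite lee_fin cmod_ge0.
  by rewrite -uy; exact: testf_derive_le.
rewrite EFinD; apply: leeD; apply: le_trans _ (majorant_hilbert hs);
  apply: ge0_le_integral_nomeas => // u Uu; apply: bnd => //; move: Uu; rewrite /= in_itv/= => /andP[u0 u1].
- by apply/andP; split; lra.
- by rewrite gtr0_norm.
- by apply/andP; split; lra.
- by rewrite normrN gtr0_norm.
Qed.

Lemma testf0_pow_le s : 0 <= s < 1 -> cmod (f 0) `^ p <= A * weighted_sum (fun k => b k s).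
Proof.
move=> hs; have p0 : 0 < p by exact: lt_trans p1.
rewrite -lee_fin; apply: le_trans _ (majorant_hilbert hs).
have -> : ((cmod (f 0) `^ p)%:E = \int[mu]_(y in U) (cmod (f 0) `^ p)%:E)%E.
  rewrite (@integral_cst _ (measurableTypeR R) R mu U); last exact: measurable_itv.
  rewrite -[X in (_ = _ * X)%E]/(mu U).
  by rewrite (@lebesgue_measure_itv R `]0, 1]%R)/= lte_fin ltr01 sube0 mule1.
apply: ge0_le_integral_nomeas => y Uy; first by rewrite lee_fin powR_ge0.
rewrite -poweR_EFin; apply: poweR_le; first exact: ltW.
  by rewrite lee_fin cmod_ge0.
by apply: testf0_le => //; move: Uy; rewrite /= in_itv.
Qed.

Variables (Cb : R) (Cb0 : 0 < Cb).
Hypothesis hb : forall k, (bumped w M.+1 k%:R <= Cb%:E * moment w k)%E.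
Local Notation S := (weighted_sum (fun k => mo k)).

Lemma weighted_bump_le K : 0 <= K ->
  (\int[mu]_(s in I) (w s * (K * weighted_sum (fun k => b k s)))%:E <= (K * Cb * S)%:E)%E.
Proof.
move=> K0.
have mw := measurable_weight rw; have mI : measurable I by exact: measurable_itv.
pose q k s := K * (k.+1%:R ^- 2 * x k `^ p) * (w s * b k s).
have c0 k : 0 <= K * (k.+1%:R ^- 2 * x k `^ p) by rewrite !mulr_ge0 ?powR_ge0// invr_ge0 exprn_ge0.
have wb0 k s : I s -> 0 <= w s * b k s.
  move=> Is; apply: mulr_ge0; first exact: weight_ge0.
  by apply: bump_node_ge0; move: Is; rewrite /= in_itv.
have mwb k : measurable_fun I (fun s => w s * b k s).
  by apply/measurable_EFinP; exact: measurable_bumped.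
have -> : (\int[mu]_(s in I) (w s * (K * weighted_sum (fun k => b k s)))%:E =
    \int[mu]_(s in I) \sum_(0 <= k < N) (q k s)%:E)%E.
  apply: eq_integral => s _; rewrite sumEFin; congr EFin.
  rewrite /weighted_sum !mulr_sumr; apply: eq_bigr => k _; rewrite /q; ring.
rewrite ge0_integral_sum//; last 2 first.
- by move=> k; apply/measurable_EFinP; exact: (measurable_funM (measurable_cst _) (mwb k)).
- by move=> k s Is; rewrite lee_fin mulr_ge0// wb0.
rewrite /weighted_sum mulr_sumr -sumEFin; apply: lee_sum => k _.
rewrite -(mule_integral mI (mwb k) (wb0 k) (c0 k)).
apply: (@le_trans _ _ ((K * (k.+1%:R ^- 2 * x k `^ p))%:E * (Cb%:E * moment w k))%E).
  by apply: lee_wpmul2l; [rewrite lee_fin|exact: hb].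
rewrite -(fine_momentK rw) -!EFinM lee_fin le_eqVlt; apply/orP; left; apply/eqP; ring.
Qed.

(** Inside the disc the Jacobian factors r and 1 / (1 + u^2) are at most 1 and are dropped;
    [testf_circle_le] is then integrated over the radius against w. *)
Lemma testf_polar_le j :
  (polar_int (dp_density p w f \o iter j (@quarter R)) <= (2 * A * Cb * S)%:E)%E.
Proof.
have A0 : 0 <= 2 * A by rewrite !mulr_ge0 ?powR_ge0// ltW.
have mI : measurable I by exact: measurable_itv.
have mJ : measurable J by exact: measurable_itv.
have hf := @holo_testf R M N test_coef; have hF := holo_derive1 hf.
pose D (z : R * R) := circle_density p (derive1 f) 1 j z.1 z.2.
have c1 : cmod (1 : C) = 1 by exact: cmod1.
have rdp (r : R) z : 0 <= r -> (0 <= r%:E * dp_density p w f z)%E.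
  by move=> r0; apply: mule_ge0; [rewrite lee_fin|exact: dp_density_ge0].
have rot1 (z : R * R) : rot (complex.Re (1 : C)) (complex.Im (1 : C)) z = z.
  by rewrite /rot cRe1 cIm1 !mul1r !mul0r subr0 add0r; case: z.
have mD : measurable_fun [set: R * R] D.
  apply: (measurableT_comp (measurable_powR p)).
  apply: (measurableT_comp (measurable_disc_mod hF)).
  apply: (measurableT_comp (measurable_rot _ _)).
  apply: (measurableT_comp (measurable_iter_quarter j)).
  have ms : measurable_fun [set: R * R] (fun z : R * R => (z.2, z.1)) by exact: measurable_swap.
  exact: (measurableT_comp (@measurable_arc_pt R) ms).
have D0 z : 0 <= D z by exact: powR_ge0.
pose W (z : R * R) : \bar R := (weight_ext w z.1 * D z)%:E.
have mW : measurable_fun [set: R * R] W.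
  have mzw : measurable_fun [set: R * R] (fun z : R * R => weight_ext w z.1).
    by apply: measurableT_comp => //; exact: measurable_weight_ext.
  by apply/measurable_EFinP; exact: (measurable_funM mzw mD).
have W0 z : (0 <= W z)%E by rewrite lee_fin mulr_ge0// weight_ext_ge0.
have [sw _] := @tonelli_in R I J W mI mJ (measurable_funTS mW) (fun y z _ _ => W0 (y, z)).
apply: (@le_trans _ _ (\int[mu]_(u in J) \int[mu]_(r in I) W (r, u))%E).
  apply: ge0_le_integral_nomeas => u _.
    apply: mule_ge0; first by rewrite lee_fin invr_ge0 addr_ge0 ?sqr_ge0.
    apply: integral_ge0 => r; rewrite /= in_itv/= andbT => r0.
    exact: rdp.
  rewrite -[leRHS]mul1e; apply: lee_pmul.
  - by rewrite lee_fin invr_ge0 addr_ge0 ?sqr_ge0.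
  - apply: integral_ge0 => r; rewrite /= in_itv/= andbT => r0.
    exact: rdp.
  - by rewrite lee_fin; exact: wt_le1.
  apply: ray_integral_le => r r0; first exact: rdp.
    have /andP[r00 r1] := r0.
    have := dp_density_polar p w f j u c1 r00; rewrite rot1 => E.
    rewrite [X in (_ * X)%E]E -EFinM lee_fin /W /D /=.
    rewrite [leRHS]mulrC; apply: ler_piMl; last exact: ltW.
    by apply: mulr_ge0; [exact: powR_ge0|exact: weight_ext_ge0].
  have r00 : 0 <= r by exact: le_trans r0.
  have := dp_density_polar p w f j u c1 r00; rewrite rot1 => E.
  by rewrite [X in (_ * X)%E]E -EFinM /weight_ext r00 ltNge r0 /= !mulr0.
rewrite -sw.
apply: (@le_trans _ _ (\int[mu]_(r in I) (w r * (2 * A * weighted_sum (fun k => b k r)))%:E)%E); last first.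
  exact: weighted_bump_le.
apply: ge0_le_integral_nomeas => r Ir; first by apply: integral_ge0 => u _.
have hr : 0 <= r < 1 by move: Ir; rewrite /= in_itv.
have mDr : measurable_fun J (fun u => D (r, u)).
  by apply: measurable_funTS; exact: (measurable_slice1 _ r mD).
have -> : (\int[mu]_(u in J) W (r, u) = (w r)%:E * \int[mu]_(u in J) (D (r, u))%:E)%E.
  rewrite (mule_integral mJ mDr (fun u _ => D0 (r, u)) (weight_ge0 rw Ir)).
  by apply: eq_integral => u _; rewrite /W /= /weight_ext hr.
rewrite EFinM; apply: lee_wpmul2l; first by rewrite lee_fin; exact: weight_ge0.
apply: le_trans _ (testf_circle_le j hr).
rewrite le_eqVlt; apply/orP; left; apply/eqP; apply: eq_integral => u _; congr (_ `^ p)%:E.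
rewrite /= rot1 disc_mod_pt pt_iter_quarter pt_arc_pt.
have -> : ii ^+ j * (cofr r * earc u) = cofr r * arc j u by rewrite /arc mulrCA.
have /andP[r0 r1] := hr.
have -> : cmod (cofr r * arc j u) < 1 by rewrite cmodM cmod_arc mulr1 cmod_pos.
by [].
Qed.

Lemma test_norm : (Dnorm_p p w f <= ((pi^-1 * (4 * (2 * A * Cb)) + A * Cb / mo 0) * S)%:E)%E.
Proof.
have p0 : 0 < p by exact: lt_trans p1.
have hf := @holo_testf R M N test_coef.
rewrite Dnorm_p_density// mulrDl EFinD; apply: leeD.
  rewrite -mulrA EFinM; apply: lee_wpmul2l; first by rewrite lee_fin invr_ge0 pi_ge0.
  apply: le_trans (area_polar_le _ (measurable_dp_density p rw hf) (fun z => dp_density_ge0 p f z rw)) _.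
  apply: (@le_trans _ _ (\sum_(j < 4) (2 * A * Cb * S)%:E)%E).
    by apply: lee_sum => j _; exact: testf_polar_le.
  rewrite sumEFin sumr_const card_ord -mulr_natl lee_fin.
  by rewrite -mulr_natl le_eqVlt; apply/orP; left; apply/eqP; ring.
(* [testf0_pow_le] holds at every radius. Integrating it against w puts the moment of order 0 on the
   left, hence the division by it. *)
have m0 : 0 < mo 0 by exact: fine_moment_gt0.
have A0 : 0 <= A by rewrite mulr_ge0 ?powR_ge0// ltW.
rewrite lee_fin mulrAC ler_pdivlMr// mulrC.
rewrite -lee_fin EFinM fine_momentK//; apply: le_trans _ (weighted_bump_le A0).
have mI : measurable I by exact: measurable_itv.
rewrite muleC /moment (mule_integral mI)//; last 3 first.
- by apply: measurable_funM; [exact: measurable_funX|exact: measurable_weight].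
- by move=> r Ir; rewrite expr0 mul1r; exact: weight_ge0.
- exact: powR_ge0.
apply: ge0_le_integral_nomeas => r Ir; have wr := weight_ge0 rw Ir; rewrite expr0 mul1r lee_fin.
  by rewrite mulr_ge0 ?powR_ge0.
rewrite mulrC; apply: ler_wpM2l => //; apply: testf0_pow_le.
by move: Ir; rewrite /= in_itv.
Qed.

End test_norm.

(** * [Tg] of a test function on the real axis *)

Section lower_integral.
Context {R : realType}.
Local Notation C := (CC R).

Lemma rseg_mono (a b : R) (f g : R -> R) : rcont a b f -> rcont a b g ->
  (forall x, a <= x <= b -> f x <= g x) -> rseg a b f <= rseg a b g.
Proof.
move=> /rcont_integrable cf /rcont_integrable cg fg; apply: le_Rintegral => //.
Qed.

Lemma rcont_sum (T : Type) (s : seq T) (a b : R) (f : T -> R -> R) :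
  (forall i, rcont a b (f i)) -> rcont a b (fun t => \sum_(i <- s) f i t).
Proof.
move=> cf; elim: s => [|i s IH].
  by under eq_fun do rewrite big_nil; move=> x _; exact: cvg_cst.
by under eq_fun do rewrite big_cons; move=> x xab; exact: (cvgD (cf i x xab) (IH x xab)).
Qed.

Lemma rseg_sum (T : Type) (s : seq T) (a b : R) (f : T -> R -> R) : a <= b ->
  (forall i, rcont a b (f i)) ->
  rseg a b (fun t => \sum_(i <- s) f i t) = \sum_(i <- s) rseg a b (f i).
Proof.
move=> ab cf; elim: s => [|i s IH].
  have -> : \sum_(i <- [::]) rseg a b (f i) = rseg a b (fun=> 0).
    by rewrite big_nil rseg_cst// mul0r.
  by apply: eq_rseg => x _; rewrite big_nil.
rewrite big_cons -IH -rsegD//; last exact: rcont_sum.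
by apply: eq_rseg => x _; rewrite big_cons.
Qed.

Lemma rcont_pow (a b : R) n : rcont a b (fun t => t ^+ n).
Proof. by move=> x _; exact: exprn_continuous. Qed.

Lemma rseg_pow (r : R) n : 0 <= r -> rseg 0 r (fun t => t ^+ n) = r ^+ n.+1 / n.+1%:R.
Proof.
move=> r0.
have dF (x : R) : 0 <= x <= r -> is_derive x 1 (fun t : R => n.+1%:R^-1 * t ^+ n.+1) (x ^+ n).
  move=> _; have h : is_derive x 1 (fun t : R => t ^+ n.+1) (n.+1%:R * x ^+ n).
    have := @is_deriveX R R id n.+1 x 1 1 (is_derive_id x 1).
    by rewrite /GRing.scale/= mulr1 (_ : id ^+ n.+1 = fun t : R => t ^+ n.+1)// exprfctE.
  have := is_deriveZ (n.+1%:R^-1 : R) h.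
  by rewrite /GRing.scale/= mulrA mulVf ?mul1r// pnatr_eq0.
have := rseg_FTC r0 dF (@rcont_pow 0 r n) => ->.
by rewrite expr0n/= mulr0 subr0 mulrC.
Qed.

(** On [0, r] both f and g' are real and nonnegative: f dominates a multiple of the sum of a_k t^k
    by [pow_le_bump], and g' its partial sums. Integrating t^(n+k) creates the denominator n + k +
    1. *)
Lemma Tg_testf_ge (g : C -> C) (M N m : nat) (a : nat -> R) (r : R) : holo g ->
  (forall n, 0 <= coef g n) -> (forall k, 0 <= a k) -> 0 <= r < 1 ->
  \sum_(0 <= k < N) \sum_(n < m)
    (a k * (n.+1%:R * complex.Re (coef g n.+1))) * (r ^+ (n + k + 1) / (n + k + 1)%:R) <=
  (1 + M.+1%:R) ^+ M.+1 * cmod (Tg g (testf M.+1 N a) (cofr r)).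
Proof.
move=> hg g0 a0 hr; have /andP[r0 r1] := hr.
set B := (1 + M.+1%:R) ^+ M.+1.
have B0 : 0 <= B by rewrite exprn_ge0.
set f := testf M.+1 N a; have hf : holo f by exact: holo_testf.
have e1 : cmod (1 : C) <= 1 by rewrite cmod1.
have hg' := holo_derive1 hg.
have pg' := holo_pbound hg'.
pose psi t := f (cofr t * 1) * derive1 g (cofr t * 1) * 1.
have cpsi : ccont 0 r psi.
  exact: (ccontM (ccontM (ccont_ray hf e1 r1) (ccont_ray hg' e1 r1)) (ccont_cst 0 r 1)).
have := Tg_FTC hg hf e1 hr; rewrite -[cseg 0 r _]/(cseg 0 r psi) mulr1 => <-.
apply: (@le_trans _ _ (B * complex.Re (cseg 0 r psi))); last first.
  by rewrite ler_wpM2l// (le_trans (ler_norm _) (cRe_le _)).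
have [cR _] := ccont_rcont cpsi.
rewrite cReseg -rsegZ//.
pose q k (n : 'I_m) t := (a k * (n.+1%:R * complex.Re (coef g n.+1))) * t ^+ (n + k).
have cq k n : rcont 0 r (q k n) by apply: rcontZ; exact: rcont_pow.
have -> : \sum_(0 <= k < N) \sum_(n < m)
    (a k * (n.+1%:R * complex.Re (coef g n.+1))) * (r ^+ (n + k + 1) / (n + k + 1)%:R) =
  rseg 0 r (fun t => \sum_(0 <= k < N) \sum_(n < m) q k n t).
  rewrite rseg_sum//; last by move=> k; exact: rcont_sum.
  apply: eq_bigr => k _; rewrite rseg_sum//; apply: eq_bigr => n _.
  by rewrite rsegZ ?rseg_pow ?addn1//; exact: rcont_pow.
apply: rseg_mono.
- by apply: rcont_sum => k; exact: rcont_sum.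
- exact: rcontZ.
move=> t /andP[t0 tr].
have ht : 0 <= t <= 1 by rewrite t0 (le_trans tr (ltW r1)).
have ht' : 0 <= t < 1 by rewrite t0 (le_lt_trans tr).
have c0 n : coef (derive1 g) n = cofr (complex.Re (coef (derive1 g) n)) /\ 0 <= complex.Re (coef (derive1 g) n).
  have [cE cp] := coef_ge0_real g0 n.+1.
  by rewrite coef_derive1// /dshift cE -cofr_nat -cofrM cRe_C; split=> //; rewrite mulr_ge0.
have [dE dge] := psum_real_ge m pg' c0 ht'.
rewrite /psi !mulr1 (holo_psum hg') ?cmod_pos//; last by case/andP: ht'.
rewrite dE -/f /f testf_real// -cofrM cRe_C mulrA mulr_sumr.
apply: (@le_trans _ _ ((\sum_(0 <= k < N) a k * t ^+ k) * (\sum_(n < m) complex.Re (coef (derive1 g) n) * t ^+ n))).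
  rewrite mulr_suml; apply: ler_sum => k _; rewrite mulr_sumr; apply: ler_sum => n _.
  rewrite /q coef_derive1// /dshift (coef_ge0_real g0 n.+1).1 -cofr_nat -cofrM !cRe_C.
  by rewrite exprD le_eqVlt; apply/orP; left; apply/eqP; ring.
apply: ler_pM => //.
- by apply: sumr_ge0 => k _; rewrite mulr_ge0// exprn_ge0.
- by apply: sumr_ge0 => n _; rewrite mulr_ge0 ?exprn_ge0// (c0 n).2.
apply: ler_sum => k _; rewrite mulrCA; apply: ler_wpM2l => //; exact: pow_le_bump.
Qed.

End lower_integral.

Section lower_bound.
Context {R : realType}.
Local Notation C := (CC R).

(* The lower bound is proved for truncated inner sums: the full ones are not yet known to be finite. *)
Definition psum_inner (g : C -> C) (m k : nat) : R :=
  \sum_(n < m) n.+1%:R * complex.Re (coef g n.+1) / (n + k + 1)%:R.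

Lemma psum_inner_ge0 g m k : (forall n, 0 <= coef g n) -> 0 <= psum_inner g m k.
Proof.
by move=> g0; apply: sumr_ge0 => n _; rewrite divr_ge0 ?mulr_ge0// (coef_ge0_real g0 _).2.
Qed.

Lemma expr_dec (r : R) e : 0 <= r <= 1 -> 1 - e%:R * (1 - r) <= r ^+ e.
Proof.
move=> /andP[r0 r1]; elim: e => [|e IH]; first by rewrite mul0r subr0 expr0.
have h1 : r ^+ e <= 1 by rewrite exprn_ile1 ?r0.
have : r * (1 - e%:R * (1 - r)) <= r * r ^+ e by rewrite ler_wpM2l.
have : 0 <= e%:R * (1 - r) * (1 - r) :> R by rewrite !mulr_ge0// subr_ge0.
rewrite exprS -natr1; move: (r ^+ e) (e%:R : R) => x y; nra.
Qed.

(** All sums are finite, so the limit r -> 1 is taken by hand: r^(m+N) is a lower bound for every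
    power of r that occurs. *)
Lemma test_lower (g : C -> C) (M N m : nat) (a : nat -> R) (T : R) : holo g ->
  (forall n, 0 <= coef g n) -> (forall k, 0 <= a k) ->
  (forall z, cmod z < 1 -> cmod (Tg g (testf M.+1 N a) z) <= T) ->
  \sum_(0 <= k < N) a k * psum_inner g m k <= (1 + M.+1%:R) ^+ M.+1 * T.
Proof.
move=> hg g0 a0 hT; set B := (1 + M.+1%:R) ^+ M.+1.
have B0 : 0 <= B by rewrite exprn_ge0.
set L := \sum_(0 <= k < N) _; have L0 : 0 <= L.
  by apply: sumr_ge0 => k _; rewrite mulr_ge0// psum_inner_ge0.
pose e := (m + N)%N.
have main (r : R) : 0 <= r < 1 -> r ^+ e * L <= B * T.
  move=> hr; have /andP[r0 r1] := hr.
  have z1 : cmod (cofr r) < 1 by rewrite cmod_pos.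
  apply: le_trans (ler_wpM2l B0 (hT _ z1)).
  have h0 := Tg_testf_ge M N m hg g0 a0 hr.
  apply: (le_trans _ h0).
  rewrite /L mulr_sumr big_nat [leRHS]big_nat; apply: ler_sum => k /andP[_ kN].
  rewrite /psum_inner !mulr_sumr; apply: ler_sum => n _.
  have h : r ^+ e <= r ^+ (n + k + 1).
    apply: ler_wiXn2l => //; first exact: ltW.
    by rewrite addn1 -addnS /e leq_add// ltnW.
  have c0 : 0 <= a k * (n.+1%:R * complex.Re (coef g n.+1)) / (n + k + 1)%:R.
    by rewrite divr_ge0// !mulr_ge0// (coef_ge0_real g0 _).2.
  have := ler_wpM2r c0 h.
  move: (r ^+ e) (r ^+ (n + k + 1)) => x y h'; apply: le_trans (le_trans h' _);
    by rewrite le_eqVlt; apply/orP; left; apply/eqP; ring.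
apply/ler_addgt0Pr => d d0.
have c0 : 0 < e%:R * L + d + 1 by rewrite ltr_wpDl// addr_ge0 ?mulr_ge0// ltW.
(* Chosen so that e (1 - r) L <= d; by [expr_dec] the factor r^e then costs at most d. *)
pose r := 1 - d / (e%:R * L + d + 1).
have hr : 0 <= r < 1.
  rewrite /r subr_ge0 ler_pdivrMr// mul1r gtrBl divr_gt0// andbT.
  have : 0 <= e%:R * L by rewrite mulr_ge0.
  lra.
have hr' : 0 <= r <= 1 by case/andP: hr => -> /ltW.
have h1 := main r hr; have h2 := ler_wpM2r L0 (expr_dec e hr').
have h3 : e%:R * (1 - r) * L <= d.
  rewrite /r opprB addrCA subrr addr0.
  have -> : e%:R * (d / (e%:R * L + d + 1)) * L = d * (e%:R * L / (e%:R * L + d + 1)) by ring.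
  apply: ler_piMr; first exact: ltW.
  by rewrite ler_pdivrMr// mul1r; lra.
move: h2; rewrite mulrBl mul1r; lra.
Qed.

End lower_bound.

(** * From truncated to full sums *)

Section truncated_sums.
Context {R : realType}.
Local Notation C := (CC R).
Variables (p : R) (p1 : 1 < p) (w : R -> R) (rw : radial_weight w).
Local Notation p' := (p / (p - 1)).
Local Notation mo k := (fine (moment w k)).

Lemma conj_gt1 : 1 < p'.
Proof. by rewrite ltr_pdivlMr ?subr_gt0// mul1r gtrBl. Qed.

Lemma conj_subr1 : (p' - 1) * p = p'.
Proof. by have : 0 < p - 1 by [rewrite subr_gt0]; move=> h; field; rewrite gt_eqF. Qed.

Lemma conj_inv : p^-1 + p'^-1 = 1.
Proof.
have p10 : 0 < p - 1 by rewrite subr_gt0.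
have p0 : 0 < p by exact: lt_trans p1.
by rewrite invf_div; field; rewrite gt_eqF.
Qed.

Lemma powR_cvg (u : nat -> R) (l a : R) : 0 < a -> (forall n, 0 <= u n <= l) ->
  u @ \oo --> l -> (fun n => u n `^ a) @ \oo --> l `^ a.
Proof.
move=> a0 ul cu; have /andP[u0 u1] := ul 0%N; have l0 := le_trans u0 u1.
have [lz|lp] := eqVneq l 0.
  rewrite lz in ul *; have uE n : u n = 0 by apply/eqP; rewrite eq_le andbC ul.
  by under eq_fun do rewrite uE; exact: cvg_cst.
have {}lp : 0 < l by rewrite lt_def lp.
have cl : {for l, continuous (fun x : R => x `^ a)}.
  by apply: differentiable_continuous; apply/derivable1_diffP; case: (is_derive1_powR a lp).
exact: (cvg_comp u (fun x : R => x `^ a) cu cl).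
Qed.

Section coefficients.
Variables (g : C -> C) (g0 : forall n, 0 <= coef g n).
Local Notation J := (psum_inner g).

Lemma psum_inner_partial m k :
  ((J m k)%:E = \sum_(0 <= n < m) (n.+1%:R * complex.Re (coef g n.+1) / (n + k + 1)%:R)%:E)%E.
Proof. by rewrite sumEFin big_mkord. Qed.

Lemma inner_term_ge0 k n : (0 <= (n.+1%:R * complex.Re (coef g n.+1) / (n + k + 1)%:R)%:E)%E.
Proof. by rewrite lee_fin divr_ge0 ?mulr_ge0// (coef_ge0_real g0 _).2. Qed.

Lemma inner_sum_ge0 k : (0 <= inner_sum g k)%E.
Proof. by apply: nneseries_ge0 => n _ _; exact: inner_term_ge0. Qed.

Lemma inner_sum_cvg k : (fun m => (J m k)%:E) @ \oo --> inner_sum g k.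
Proof.
under eq_fun do rewrite psum_inner_partial.
by apply: is_cvg_nneseries => n _ _; exact: inner_term_ge0.
Qed.

Lemma inner_sum_le k (b : R) : (forall m, J m k <= b) -> (inner_sum g k <= b%:E)%E.
Proof.
move=> h; have c := @inner_sum_cvg k; rewrite -(cvg_lim _ c)//; apply: lime_le; first exact: cvgP c.
by apply: nearW => m; rewrite lee_fin.
Qed.

Lemma psum_inner_le k m : ((J m k)%:E <= inner_sum g k)%E.
Proof. by rewrite psum_inner_partial; apply: nneseries_lim_ge => n _ _; exact: inner_term_ge0. Qed.

Lemma inner_sum_fin k : (inner_sum g k < +oo)%E -> exists I : R,
  [/\ inner_sum g k = I%:E, (forall m, 0 <= J m k <= I) & (fun m => J m k) @ \oo --> I].
Proof.
move=> fI; exists (fine (inner_sum g k)).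
have E : (inner_sum g k = (fine (inner_sum g k))%:E)%E by rewrite fineK// ge0_fin_numE// inner_sum_ge0.
split => //.
  by move=> m; rewrite psum_inner_ge0//= -lee_fin -E psum_inner_le.
by have := @inner_sum_cvg k; rewrite {1}E => /fine_cvg.
Qed.

Lemma Sg_coef_gt0 k : 0 < k.+1%:R ^- 2 / mo k `^ (p' - 1).
Proof. by rewrite divr_gt0 ?powR_gt0 ?fine_moment_gt0// invr_gt0 exprn_gt0. Qed.

Lemma Sg_summand_ge0 k : (0 <= (k.+1%:R ^- 2 / mo k `^ (p' - 1))%:E * inner_sum g k `^ p')%E.
Proof. by apply: mule_ge0; [rewrite lee_fin ltW// Sg_coef_gt0|exact: poweR_ge0]. Qed.

Lemma Sg_ge0 : (0 <= Sg p w g)%E.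
Proof. by apply: nneseries_ge0 => k _ _; exact: Sg_summand_ge0. Qed.

Lemma Sg_summandE (I : nat -> R) k : inner_sum g k = (I k)%:E ->
  ((k.+1%:R ^- 2 / mo k `^ (p' - 1))%:E * inner_sum g k `^ p' = (Sg_term p w I k)%:E)%E.
Proof. by move=> ->; rewrite poweR_EFin -EFinM. Qed.

(** A single infinite inner sum would make its term infinite, because the coefficients of the series
    are positive. *)
Lemma Sg_fin : (Sg p w g < +oo)%E -> exists (I : nat -> R) (T : R),
  [/\ (forall k m, J m k <= I k), Sg p w g = T%:E, 0 <= T &
      forall N, \sum_(0 <= k < N) Sg_term p w I k <= T].
Proof.
move=> fS; have h N := @nneseries_lim_ge R _ xpredT 0 N (fun k _ _ => Sg_summand_ge0 k).
have fI k : (inner_sum g k < +oo)%E.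
  have p'0 : p' != 0 by rewrite gt_eqF// (lt_trans _ conj_gt1).
  have := le_lt_trans (h k.+1) fS; rewrite big_nat_recr//= => h1.
  have h2 : ((k.+1%:R ^- 2 / mo k `^ (p' - 1))%:E * inner_sum g k `^ p' < +oo)%E.
    by apply: le_lt_trans h1; apply: leeDr; apply: sume_ge0 => i _; exact: Sg_summand_ge0.
  rewrite ltNge leye_eq; apply/eqP => E; move: h2; rewrite E poweRyr//.
  by rewrite gt0_muley ?lte_fin ?Sg_coef_gt0// ltxx.
have [I HI] := choice (fun k => inner_sum_fin (fI k)).
exists I, (fine (Sg p w g)).
have E : (Sg p w g = (fine (Sg p w g))%:E)%E by rewrite fineK// ge0_fin_numE// Sg_ge0.
split => //; first by move=> k m; case: (HI k) => _ /(_ m)/andP[].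
  by rewrite -lee_fin -E Sg_ge0.
move=> N; rewrite -lee_fin -E; apply: le_trans (h N).
rewrite -sumEFin le_eqVlt; apply/orP; left; apply/eqP; apply: eq_bigr => k _.
by rewrite (@Sg_summandE I)//; case: (HI k).
Qed.

(** The bound on the k-th term alone makes the k-th inner sum finite. Then m tends to infinity at
    fixed N, and N afterwards. *)
Lemma Sg_le (V : R) : (forall N m, \sum_(0 <= k < N) Sg_term p w (J m) k <= V) ->
  (Sg p w g <= V%:E)%E.
Proof.
move=> HV; have p'0 : 0 < p' by exact: lt_trans conj_gt1.
have V0 : 0 <= V by have := HV 0%N 0%N; rewrite big_geq.
have fI k : (inner_sum g k < +oo)%E.
  have c0 := Sg_coef_gt0 k; set c := _ / _ in c0.
  apply: le_lt_trans (ltry ((V / c) `^ p'^-1)); apply: inner_sum_le => m.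
  have J0 := psum_inner_ge0 m k g0.
  have h : J m k `^ p' <= V / c.
    rewrite ler_pdivlMr// mulrC; apply: le_trans (HV k.+1 m).
    rewrite big_nat_recr//= lerDr; apply: sumr_ge0 => i _; exact: Sg_term_ge0.
  have := @ge0_ler_powR R p'^-1 _ (J m k `^ p') (V / c) _ _ h.
  rewrite -powRrM mulfV ?gt_eqF// powRr1//; apply; rewrite ?nnegrE ?powR_ge0 ?invr_ge0//.
    exact: ltW.
  by rewrite divr_ge0// ltW.
have [I HI] := choice (fun k => inner_sum_fin (fI k)).
have part N : \sum_(0 <= k < N) Sg_term p w I k <= V.
  have c : (fun m => \sum_(0 <= k < N) Sg_term p w (J m) k) @ \oo --> \sum_(0 <= k < N) Sg_term p w I k.
    elim: N => [|N IH].
      by under eq_fun do rewrite big_geq//; rewrite big_geq//; exact: cvg_cst.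
    under eq_fun do rewrite big_nat_recr//=; rewrite big_nat_recr//=.
    apply: (cvgD IH); apply: cvgM; first exact: cvg_cst.
    by case: (HI N) => _ h1 h2; exact: powR_cvg.
  rewrite -(cvg_lim _ c)//; apply: limr_le; first exact: cvgP c.
  by apply: nearW => m.
rewrite /Sg; apply: lime_le.
  by apply: is_cvg_nneseries => k _ _; exact: Sg_summand_ge0.
apply: nearW => N; have := part N; rewrite -lee_fin -sumEFin; apply: le_trans.
rewrite le_eqVlt; apply/orP; left; apply/eqP; apply: eq_bigr => k _.
by rewrite (@Sg_summandE I)//; case: (HI k).
Qed.

End coefficients.

Lemma supnorm_le (h : C -> C) (T : R) : (supnorm h <= T%:E)%E <-> forall z, cmod z < 1 -> cmod (h z) <= T.
Proof.
split => [H z z1|H].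
  by rewrite -lee_fin; apply: le_trans H; apply: ereal_sup_ubound; exists z.
by apply: ge_ereal_sup => _ [z z1 <-]; rewrite lee_fin; exact: H.
Qed.

Lemma Dnorm_p_ge0 (f : C -> C) : holo f -> (0 <= Dnorm_p p w f)%E.
Proof.
move=> hf; rewrite Dnorm_p_density//.
  rewrite adde_ge0 ?lee_fin ?powR_ge0// mule_ge0 ?lee_fin ?invr_ge0 ?pi_ge0//.
  by apply: integral_ge0 => v _; exact: dp_density_ge0.
exact: lt_trans p1.
Qed.

Lemma truncated_lower : Dhat w -> exists A : R, 0 < A /\
  forall (g : C -> C) (T : R), holo g -> (forall n, 0 <= coef g n) -> 0 <= T ->
  (forall f, Dp p w f -> (Dnorm_p p w f <= 1)%E -> forall z, cmod z < 1 -> cmod (Tg g f z) <= T) ->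
  forall N m, \sum_(0 <= k < N) Sg_term p w (psum_inner g m) k <= A * T `^ p'.
Proof.
move=> dw; have p0 : 0 < p by exact: lt_trans p1.
have p'1 := conj_gt1; have p'0 : 0 < p' by exact: lt_trans p'1.
have [H [H0 hilb]] := hilbert_inequality p p1.
have [M0 [Cb [M0p Cb0 hb _]]] := weight_facts rw dw.
case: M0 M0p hb => // M _ hb.
pose Cn := pi^-1 * (4 * (2 * (H * (10 * M.+1%:R) `^ p) * Cb)) + H * (10 * M.+1%:R) `^ p * Cb / mo 0.
have Cn0 : 0 < Cn.
  have h : 0 < (10 * M.+1%:R : R) `^ p by rewrite powR_gt0// mulr_gt0.
  rewrite /Cn addr_gt0 ?divr_gt0 ?mulr_gt0 ?invr_gt0 ?pi_gt0//; exact: fine_moment_gt0.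
pose B : R := (1 + M.+1%:R) ^+ M.+1.
have B0 : 0 < B by rewrite exprn_gt0// ltr_wpDr.
pose E := B * Cn `^ p^-1; have E0 : 0 < E by rewrite mulr_gt0// powR_gt0.
exists (E `^ p'); split; first by rewrite powR_gt0.
move=> g T hg g0 T0 hT N m; pose J := psum_inner g m.
have J0 k : 0 <= J k by exact: psum_inner_ge0.
set S := \sum_(0 <= k < N) _.
have S0 : 0 <= S by apply: sumr_ge0 => k _; exact: Sg_term_ge0.
have [->|SN] := eqVneq S 0; first by rewrite mulr_ge0 ?powR_ge0.
have {SN}Sp : 0 < S by rewrite lt_def SN.
(* Normalisation: the p-th power of the norm is at most Cn c^p S, which is 1. *)
pose c := (Cn * S) `^ (- p^-1); have c0 : 0 < c by rewrite powR_gt0// mulr_gt0.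
have cp : c `^ p = (Cn * S)^-1.
  by rewrite /c -powRrM mulNr mulVf ?gt_eqF// powR_inv1// mulr_ge0// ltW.
(* The equality case of Hoelder's inequality for the pairing of x with the inner sums. *)
pose x k := c * (mo k `^ (- (p' - 1)) * J k `^ (p' - 1)).
have x0 k : 0 <= x k by rewrite !mulr_ge0 ?powR_ge0// ltW.
have mg k : 0 < mo k by exact: fine_moment_gt0.
have xp : weighted_sum p x N (fun k => mo k) = c `^ p * S.
  rewrite /weighted_sum /S mulr_sumr; apply: eq_bigr => k _.
  rewrite /x powRM ?mulr_ge0 ?powR_ge0 ?(ltW c0)// powRM ?powR_ge0//.
  rewrite -(powRrM (mo k)) -(powRrM (J k)) mulNr conj_subr1 /Sg_term -/(J k) powRN.
  have -> : mo k `^ p' = mo k `^ (p' - 1) * mo k.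
    by rewrite -[X in _ = _ * X](powRr1 (ltW (mg k))) -powRD ?subrK// gt_eqF ?implybT.
  have m1 : mo k != 0 by rewrite gt_eqF.
  have m2 : mo k `^ (p' - 1) != 0 by rewrite gt_eqF// powR_gt0.
  move: (mo k `^ _) (J k `^ _) (c `^ p) m1 m2; move: (mo k) => x1 x2 x3 x4 x10 x20.
  move: (k.+1%:R : R) (pnatr_eq0 R k.+1) => e /negbT e0.
  by field; rewrite e0 x10 x20.
pose f := testf M.+1 N (test_coef x).
have hf : holo f by exact: holo_testf.
have nf : (Dnorm_p p w f <= 1)%E.
  apply: le_trans (test_norm p1 rw N x0 H0 hilb hb) _; rewrite -/Cn xp cp.
  by rewrite mulrCA mulVf ?gt_eqF ?mulr_gt0// lexx.
have df : Dp p w f by split => //; apply: le_lt_trans nf _; exact: ltry.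
have := test_lower m hg g0 (test_coef_ge0 x0) (hT f df nf).
have -> : \sum_(0 <= k < N) test_coef x k * psum_inner g m k = c * S.
  rewrite /S mulr_sumr; apply: eq_bigr => k _; rewrite /test_coef /x /Sg_term -/J powRN.
  have -> : J k `^ p' = J k `^ (p' - 1) * J k.
    have [j0|j0] := eqVneq (J k) 0; first by rewrite j0 mulr0 powR0// gt_eqF.
    by rewrite -[X in _ = _ * X](powRr1 (J0 k)) -powRD ?subrK// j0 implybT.
  by ring.
rewrite -/B => h.
(* The pairing equals c S = Cn^(-1/p) S^(1 - 1/p), and 1 - 1/p = 1/p'. Dividing by a power of S is
   legitimate because S is finite and positive. *)
have h2 : S `^ p'^-1 <= E * T.
  have -> : S `^ p'^-1 = Cn `^ p^-1 * (c * S).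
    rewrite /c powRM ?(ltW Cn0)// powRN mulrA mulrA mulfV ?gt_eqF ?powR_gt0// mul1r powRN.
    have -> : p'^-1 = 1 - p^-1 by apply/eqP; rewrite eq_sym subr_eq [_ + p^-1]addrC conj_inv.
    by rewrite powRD ?(gt_eqF Sp) ?implybT// powRr1// powRN mulrC.
  have -> : E * T = Cn `^ p^-1 * (B * T) by rewrite /E; ring.
  by apply: ler_wpM2l => //; exact: powR_ge0.
have h3 := @ge0_ler_powR R p' (ltW p'0) _ _ _ _ h2.
have : (S `^ p'^-1) `^ p' <= (E * T) `^ p'.
  by apply: h3; rewrite nnegrE ?powR_ge0// mulr_ge0// ltW.
by rewrite -powRrM mulVf ?gt_eqF// powRr1// powRM// ltW.
Qed.

End truncated_sums.

(** * Compactness *)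

Section coefficient_convergence.
Context {R : realType}.
Local Notation C := (CC R).

Lemma psumB (c d : nat -> C) z : pbound c 1 -> pbound d 1 -> cmod z < 1 ->
  psum c z - psum d z = psum (fun n => c n - d n) z.
Proof.
move=> pc pd z1; have z0 := cmod_ge0 z.
have h : 0 < (cmod z + 1) / 2 < 1 by apply/andP; split; lra.
have [M HM] := pc _ h; have [M' HM'] := pd _ h; set s := (cmod z + 1) / 2 in h HM HM'.
have /andP[s0 s1] := h; have zs : cmod z < s by rewrite /s; lra.
have cM : cbound (fun n => c n - d n) s (M + M').
  move=> n; apply: le_trans (ler_wpM2r (exprn_ge0 _ (ltW s0)) (cmodB _ _)) _.
  by rewrite mulrDl; exact: lerD.
have ht : 0 <= cmod z / s < 1 by rewrite divr_ge0 ?(ltW s0)//= ltr_pdivrMr// mul1r.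
apply: (psum_unique ht _ cM s0 zs (A := M / (1 - cmod z / s) + M' / (1 - cmod z / s))) => N.
have -> : cpart (fun n => c n - d n) z N = cpart c z N - cpart d z N.
  by rewrite /cpart -sumrB; apply: eq_bigr => n _; rewrite mulrBl.
have -> : psum c z - psum d z - (cpart c z N - cpart d z N) =
    (psum c z - cpart c z N) - (psum d z - cpart d z N).
  by move: (psum _ _) (psum _ _) (cpart _ _ _) (cpart _ _ _) => x1 x2 x3 x4; ring.
apply: le_trans (cmodB _ _) _; rewrite mulrDl; apply: lerD; exact: psum_tail.
Qed.

(** Finitely many small coefficients and a common coefficient bound make a series small; L and d do
    not depend on the series. *)
Lemma psum_small (s M rho e : R) : s <= 1 -> 0 <= rho < s -> 0 < e ->
  exists (L : nat) (d : R), 0 < d /\ forall c : nat -> C, cbound c s M ->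
    (forall k, (k < L)%N -> cmod (c k) <= d) -> forall z, cmod z <= rho -> cmod (psum c z) <= e.
Proof.
move=> s1 /andP[rho0 rhos] e0; have s0 : 0 < s by exact: le_lt_trans rhos.
pose t := rho / s; have ht : 0 <= t < 1 by rewrite divr_ge0 ?(ltW s0)//= ltr_pdivrMr// mul1r.
have /andP[t0 t1] := ht; have t1' : 0 < 1 - t by rewrite subr_gt0.
pose A := `|M| / (1 - t) + 1; have A0 : 0 < A by rewrite ltr_wpDl// divr_ge0// ltW.
have e2 : 0 < e / 2 / A by rewrite !divr_gt0.
have [L HL] := expr_small ht e2.
exists L, (e / 2 / L.+1%:R); split; first by rewrite !divr_gt0.
move=> c cM cs z zr; have z0 := cmod_ge0 z.
have zs : cmod z < s by exact: le_lt_trans rhos.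
have -> : psum c z = (psum c z - cpart c z L) + cpart c z L by rewrite subrK.
apply: le_trans (cmodD _ _) _; rewrite [leRHS]splitr; apply: lerD.
  apply: le_trans (psum_tail L cM s0 zs) _.
  have zt : cmod z / s <= t by rewrite ler_wpM2r ?invr_ge0 ?(ltW s0).
  have zp : 0 <= cmod z / s by rewrite divr_ge0// ltW.
  apply: (@le_trans _ _ (A * t ^+ L)); last first.
    by rewrite mulrC -ler_pdivlMr// ltW.
  apply: ler_pM.
  - by rewrite divr_ge0 ?(cbound_ge0 cM)// subr_ge0 (le_trans zt)// ltW.
  - exact: exprn_ge0.
  - apply: (@le_trans _ _ (`|M| / (1 - t))); last by rewrite lerDl.
    rewrite ger0_norm ?(cbound_ge0 cM)//; apply: ler_wpM2l; first exact: cbound_ge0 cM.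
    rewrite lef_pV2 ?posrE//; first by rewrite lerD2l lerN2.
    by rewrite subr_gt0 (le_lt_trans zt).
  - by apply: lerXn2r; rewrite ?nnegrE.
apply: le_trans (cmod_sum _ _ _ _) _.
apply: (@le_trans _ _ (\sum_(k < L) (e / 2 / L.+1%:R))).
  apply: ler_sum => k _; rewrite cmodM cmodX; apply: le_trans (cs k _) => //.
  by rewrite ler_piMr ?cmod_ge0// exprn_ile1// (le_trans (ltW zs)).
rewrite sumr_const card_ord -[_ *+ L]mulr_natl mulrCA; apply: ler_piMr; first by lra.
by rewrite ler_pdivrMr// mul1r ler_nat.
Qed.

(** The difference series is controlled by [psum_small] on the disc of radius rho, and its derived
    series likewise, with a slightly smaller radius s' to make room for [dshift]. *)
Lemma holo_coef_cvg (v : nat -> C -> C) (f : C -> C) : holo f -> (forall n, holo (v n)) ->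
  (forall s, 0 < s < 1 -> exists M, cbound (coef f) s M /\ forall n, cbound (coef (v n)) s M) ->
  (forall k e, 0 < e -> exists N, forall n, (N <= n)%N -> cmod (coef (v n) k - coef f k) <= e) ->
  forall rho e, 0 <= rho < 1 -> 0 < e -> exists N, forall n, (N <= n)%N -> forall z, cmod z <= rho ->
    cmod (v n z - f z) <= e /\ cmod (derive1 (v n) z - derive1 f z) <= e.
Proof.
move=> hf hv cM cv rho e /andP[rho0 rho1] e0.
pose s := (rho + 1) / 2; pose s' := (rho + s) / 2.
have hs : 0 < s < 1 by rewrite /s; apply/andP; split; lra.
have hs' : 0 < s' < s by rewrite /s' /s; apply/andP; split; lra.
have /andP[s0 s1] := hs; have /andP[s'0 s's] := hs'.
have rs : 0 <= rho < s by rewrite rho0 /s; lra.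
have rs' : 0 <= rho < s' by rewrite rho0 /s' /s; lra.
have [M [Mf Mv]] := cM _ hs.
pose d n k := coef (v n) k - coef f k.
have dM n : cbound (d n) s (M + M).
  move=> k; apply: le_trans (ler_wpM2r (exprn_ge0 _ (ltW s0)) (cmodB _ _)) _.
  by rewrite mulrDl; apply: lerD; [exact: Mv|exact: Mf].
have [B HB] := cbound_dshift hs'.
have [L1 [d1 [d10 H1]]] := psum_small (M + M) (ltW s1) rs e0.
have [L2 [d2 [d20 H2]]] := psum_small (B * (M + M)) (ltW (lt_trans s's s1)) rs' e0.
pose L := maxn L1 L2.
pose dd := Num.min d1 (d2 / L.+1%:R).
have dd0 : 0 < dd by rewrite lt_min d10 divr_gt0.
have [N HN] : exists N, forall n, (N <= n)%N -> forall k, (k <= L)%N -> cmod (d n k) <= dd.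
  elim: (L) => [|l [N HN]].
    by have [N HN] := cv 0%N dd dd0; exists N => n nN k; rewrite leqn0 => /eqP ->; exact: HN.
  have [N' HN'] := cv l.+1 dd dd0; exists (maxn N N') => n; rewrite geq_max => /andP[h1 h2] k.
  by rewrite leq_eqVlt => /orP[/eqP ->|kl]; [exact: HN'|exact: HN].
exists N => n nN z zr; have z1 : cmod z < 1 by exact: le_lt_trans rho1.
split.
  rewrite (holo_psum (hv n) z1) (holo_psum hf z1).
  have -> := psumB (holo_pbound (hv n)) (holo_pbound hf) z1.
  apply: (H1 (d n)) => // k kL; apply: le_trans (HN n nN k _) _; last by rewrite ge_min lexx.
  by rewrite /L leq_max (ltnW kL).
have hv' := holo_derive1 (hv n); have hf' := holo_derive1 hf.
rewrite (holo_psum hv' z1) (holo_psum hf' z1).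
have -> := psumB (holo_pbound hv') (holo_pbound hf') z1.
have -> : (fun k => coef (derive1 (v n)) k - coef (derive1 f) k) = dshift (d n).
  apply/funext => k; have e1 := congr1 (@^~ k) (coef_derive1 (hv n)).
  have e2 := congr1 (@^~ k) (coef_derive1 hf).
  by apply: etrans (congr2 (fun a b => a - b) e1 e2) _; rewrite /dshift /d mulrBr.
apply: H2 => //; first exact: HB.
move=> k kL; rewrite /dshift cmodM cmod_nat.
have h := HN n nN k.+1; have {}h : cmod (d n k.+1) <= d2 / L.+1%:R.
  by apply: le_trans (h _) _; rewrite ?ge_min ?lexx ?orbT// /L leq_max kL orbT.
apply: le_trans (ler_wpM2l _ h) _ => //.
rewrite mulrCA ler_piMr ?(ltW d20)// ler_pdivrMr// mul1r ler_nat ltnS.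
by rewrite /L leq_max (ltnW kL) orbT.
Qed.

End coefficient_convergence.

(** * Extraction of a subsequence *)

Section extraction.
Context {R : realType}.
Local Notation C := (CC R).

Lemma ultra_fmap {S T : Type} (F : set_system S) (f : S -> T) : UltraFilter F ->
  UltraFilter (f @ F).
Proof.
move=> FU; split; first exact: fmap_proper_filter.
move=> G GF fG; rewrite predeqE => A; split; last exact: fG.
move=> GA; have [//|nA] := in_ultra_setVsetC (f @^-1` A) FU.
have GnA : G (~` A) by exact: fG.
by have /filter_ex [? []] : G (A `&` ~` A) by exact: filterI.
Qed.

(* Along an ultrafilter all coefficients converge at once, which replaces the diagonal argument. *)
Lemma bounded_ultra_cvg (F : set_system nat) (a : nat -> R) (B : R) : UltraFilter F ->
  (forall n, `|a n| <= B) -> exists l : R, forall e, 0 < e -> F [set n | `|a n - l| < e].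
Proof.
move=> FU aB.
have := @segment_compact R (- B) B; rewrite compact_ultra => H.
have [] := H (a @ F) (ultra_fmap a FU).
  by apply: (@filterS _ F _ [set: nat]); [move=> n _ /=; rewrite in_itv/= -ler_norml|exact: filterT].
move=> l [_ /cvgrPdist_lt cl]; exists l => e e0; apply: filterS (cl e e0) => n /=.
by rewrite distrC.
Qed.

Lemma diagonal_extraction (c : nat -> nat -> C) (B : nat -> R) :
  (forall n k, cmod (c n k) <= B k) ->
  exists (phi : nat -> nat) (l : nat -> C), (forall n, (phi n < phi n.+1)%N) /\
    forall n k, (k <= n)%N -> cmod (c (phi n) k - l k) <= n.+1%:R^-1.
Proof.
move=> cB.
have [F [FU FF]] := ultraFilterLemma (eventually_filter : ProperFilter \oo).
have HR k : exists l : R, forall e, 0 < e -> F [set n | `|complex.Re (c n k) - l| < e].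
  by apply: (bounded_ultra_cvg (B := B k)) => n; exact: le_trans (cRe_le _) _.
have HI k : exists l : R, forall e, 0 < e -> F [set n | `|complex.Im (c n k) - l| < e].
  by apply: (bounded_ultra_cvg (B := B k)) => n; exact: le_trans (cIm_le _) _.
have [lr Hr] := choice HR; have [li Hi] := choice HI.
pose l k : C := (lr k +i* li k)%C.
have near_l m e : 0 < e -> F [set n | forall k, (k <= m)%N -> cmod (c n k - l k) <= e].
  move=> e0; have one k : F [set n | cmod (c n k - l k) <= e].
    have e2 : 0 < e / 2 by rewrite divr_gt0.
    apply: filterS (filterI (Hr k _ e2) (Hi k _ e2)) => n [/ltW h1 /ltW h2] /=.
    apply: le_trans (cmod_le _) _; rewrite cReD cReN cImD cImN [leRHS]splitr.
    by apply: lerD.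
  elim: m => [|m IH].
    by apply: filterS (one 0%N) => n h k; rewrite leqn0 => /eqP ->.
  apply: filterS (filterI IH (one m.+1)) => n [h1 h2] k.
  by rewrite leq_eqVlt => /orP[/eqP ->|] //; exact: h1.
(* The ultrafilter refines convergence to infinity, so it contains every tail: the next index can be
   taken beyond the previous one and good for the first m + 1 coefficients at once. *)
have pick (N m : nat) : exists n, (N < n)%N /\ forall k, (k <= m)%N -> cmod (c n k - l k) <= m.+1%:R^-1.
  have m0 : 0 < m.+1%:R^-1 :> R by rewrite invr_gt0.
  have FN : F [set n | (N < n)%N] by apply: FF; exists N.+1.
  by have [n [h1 h2]] := @filter_ex _ F _ _ (filterI FN (near_l m _ m0)); exists n.
have [s Hs] := choice (fun Nm : nat * nat => pick Nm.1 Nm.2).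
pose phi := fix phi n := if n is n'.+1 then s (phi n', n) else s (0%N, 0%N).
exists phi, l; split; first by move=> n; have [] := Hs (phi n, n.+1).
case=> [|n] k kn; first by have [_ /(_ k kn)] := Hs (0%N, 0%N).
by have [_ /(_ k kn)] := Hs (phi n, n.+1).
Qed.

End extraction.

(** * Estimates on the unit ball *)

Section sufficiency.
Context {R : realType}.
Local Notation C := (CC R).
Local Notation mu := (@lebesgue_measure R).
Local Notation I01 := (`[0%R, 1%R[%classic : set R).

Lemma polar_form (z : C) : exists eta, cmod eta = 1 /\ z = cofr (cmod z) * eta.
Proof.
have [->|z0] := eqVneq z 0; first by exists 1; rewrite cmod0 cofr0 mul0r cmod1.
have rn : cofr (cmod z) != 0 by rewrite -cmod_eq0 cmod_pos ?cmod_ge0// cmod_eq0.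
exists (z / cofr (cmod z)); rewrite cmodM cmodV cmod_pos ?cmod_ge0// mulfV ?cmod_eq0//.
by rewrite mulrC divfK.
Qed.

Lemma ge0_integral_le_sum (d : measure_display)
    (T : measurableType d) (m : {measure set T -> \bar R}) (h a b : T -> \bar R) (c : R) : 0 <= c ->
  measurable_fun [set: T] a -> measurable_fun [set: T] b ->
  (forall x, 0 <= h x)%E -> (forall x, 0 <= a x)%E -> (forall x, 0 <= b x)%E ->
  (forall x, h x <= c%:E * (a x + b x))%E ->
  (\int[m]_x h x <= c%:E * (\int[m]_x a x + \int[m]_x b x))%E.
Proof.
move=> c0 ma mb h0 a0 b0 hab.
rewrite -(@ge0_integralD _ _ _ m setT measurableT a b (fun x _ => a0 x) ma (fun x _ => b0 x) mb).
have mab : measurable_fun [set: T] (fun x => a x + b x)%E by exact: emeasurable_funD.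
rewrite -(@ge0_integralZl_EFin _ _ _ m setT measurableT _ (fun x _ => adde_ge0 (a0 x) (b0 x)) mab c c0).
by apply: ge0_le_integral_nomeas => x _; [exact: h0|exact: hab].
Qed.

Lemma tail_small (t : nat -> R) (T e : R) : (forall k, 0 <= t k) ->
  (forall N, \sum_(0 <= k < N) t k <= T) -> 0 < e ->
  exists K, forall N, \sum_(K <= k < N) t k <= e.
Proof.
move=> t0 hT e0; pose s N := \sum_(0 <= k < N) t k.
have nd : nondecreasing_seq s.
  by apply/nondecreasing_seqP => n; rewrite /s big_nat_recr//= lerDl.
have cs : cvgn s.
  by apply: nondecreasing_is_cvgn => //; exists T => _ [n _ <-]; exact: hT.
have /cvgrPdist_lt/(_ _ e0)[K _ HK] := cs.
exists K => N; have [NK|KN] := leqP N K; first by rewrite big_geq// ltW.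
have h := HK K (leqnn K); have h2 := nondecreasing_cvgn_le nd cs N.
have E : s N = s K + \sum_(K <= k < N) t k by rewrite /s (big_cat_nat _ (n := K))// ltnW.
move: h => /=; rewrite ger0_norm ?subr_ge0; last exact: nondecreasing_cvgn_le.
by rewrite -/(s K) => h; move: h2 E h; move: (limn s) (s N) (s K) => x y z; lra.
Qed.

Lemma cvge0_of_le (u : nat -> \bar R) : (forall n, 0 <= u n)%E ->
  (forall e : R, 0 < e -> exists N, forall n, (N <= n)%N -> (u n <= e%:E)%E) -> u @ \oo --> 0%E.
Proof.
move=> u0 hu; apply/fine_cvgP; split.
  have [N HN] := hu 1 ltr01; exists N => // n /HN h.
  by rewrite ge0_fin_numE//; apply: le_lt_trans h _; exact: ltry.
apply/cvgrPdist_le => e e0; have [N HN] := hu e e0; exists N => // n /HN h /=.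
rewrite sub0r normrN ger0_norm ?fine_ge0// -lee_fin fineK//.
by rewrite ge0_fin_numE//; apply: le_lt_trans h _; exact: ltry.
Qed.

Lemma combine_le (q P x y z : R) (a b c : \bar R) : 0 <= q -> 0 <= P -> 0 <= x -> 0 <= y ->
  (0 <= a)%E -> (0 <= b)%E -> z <= P * (x + y) -> (c <= P%:E * (a + b))%E ->
  (q%:E * a + x%:E <= 1)%E -> (q%:E * b + y%:E <= 1)%E -> (q%:E * c + z%:E <= (P * 2)%:E)%E.
Proof.
move=> q0 P0 x0 y0 a0 b0 h0 hh ha hb.
apply: (@le_trans _ _ (P%:E * ((q%:E * a + x%:E) + (q%:E * b + y%:E)))%E).
  rewrite addeACA.
  have <- : (q%:E * (a + b) = q%:E * a + q%:E * b)%E by exact: ge0_muleDr.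
  have -> : (P%:E * (q%:E * (a + b) + (x%:E + y%:E)) =
      P%:E * (q%:E * (a + b)) + P%:E * (x%:E + y%:E))%E.
    by apply: ge0_muleDr; rewrite ?mule_ge0 ?adde_ge0 ?lee_fin.
  apply: leeD; last by rewrite -EFinD -EFinM lee_fin.
  by rewrite muleCA; apply: lee_wpmul2l; rewrite ?lee_fin.
rewrite EFinM; apply: lee_wpmul2l; first by rewrite lee_fin.
by rewrite (_ : 2%:E = 1 + 1)%E//; exact: leeD.
Qed.

Variables (p : R) (p1 : 1 < p) (w : R -> R) (rw : radial_weight w).
Local Notation p' := (p / (p - 1)).
Local Notation mo k := (fine (moment w k)).

Lemma value0_le (f : C -> C) (D : R) : holo f -> (Dnorm_p p w f <= D%:E)%E -> cmod (f 0) `^ p <= D.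
Proof.
move=> hf hD; rewrite -lee_fin; apply: le_trans hD.
rewrite Dnorm_p_density; last exact: lt_trans p1.
rewrite leeDr// mule_ge0 ?lee_fin ?invr_ge0 ?pi_ge0//.
by apply: integral_ge0 => v _; exact: dp_density_ge0.
Qed.

Lemma value0_root (f : C -> C) (D : R) : holo f -> (Dnorm_p p w f <= D%:E)%E ->
  cmod (f 0) <= D `^ p^-1.
Proof.
move=> hf hD; have p0 : 0 < p by exact: lt_trans p1.
have h := value0_le hf hD.
have -> : cmod (f 0) = (cmod (f 0) `^ p) `^ p^-1.
  by rewrite -powRrM mulfV ?gt_eqF// powRr1// cmod_ge0.
apply: ge0_ler_powR => //; rewrite ?nnegrE ?powR_ge0//; first by rewrite invr_ge0 ltW.
exact: le_trans (powR_ge0 _ _) h.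
Qed.

Lemma disc_mod_sub (f g : C -> C) (z : R * R) : holo f -> holo g ->
  disc_mod (derive1 (fun z => f z - g z)) z <= disc_mod (derive1 f) z + disc_mod (derive1 g) z.
Proof.
move=> hf hg; rewrite /disc_mod; have := in_discE z; case: (in_disc z) => z1; last by rewrite addr0.
have -> : derive1 (fun z => f z - g z) (pt z) = derive1 f (pt z) - derive1 g (pt z).
  by apply: derive1_holoB => //; rewrite -z1.
exact: cmodB.
Qed.

Lemma Dnorm_p_sub (f g : C -> C) : holo f -> holo g ->
  (Dnorm_p p w f <= 1)%E -> (Dnorm_p p w g <= 1)%E ->
  (Dnorm_p p w (fun z => (f z - g z)%R) <= (2 `^ p * 2)%:E)%E.
Proof.
move=> hf hg; have p0 : 0 < p by exact: lt_trans p1.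
have P0 : 0 <= 2 `^ p :> R by exact: powR_ge0.
have q0 : 0 <= (pi^-1 : R) by rewrite invr_ge0 pi_ge0.
rewrite !Dnorm_p_density//.
have hh : (\int[@area R]_z dp_density p w (fun z => f z - g z)%R z <=
   (2 `^ p)%:E * (\int[@area R]_z dp_density p w f z + \int[@area R]_z dp_density p w g z))%E.
  apply: ge0_integral_le_sum => //; try exact: measurable_dp_density;
    try by move=> z; exact: dp_density_ge0.
  move=> z; rewrite -EFinD -EFinM lee_fin -mulrDl mulrA.
  apply: ler_wpM2r; first exact: weight_ext_ge0.
  have dm0 F : 0 <= disc_mod (R := R) F z by rewrite /disc_mod; case: ifP => // _; exact: cmod_ge0.
  apply: le_trans (powR_add_le p0 (dm0 _) (dm0 _)).
  apply: ge0_ler_powR; rewrite ?nnegrE ?addr_ge0 ?dm0//; first exact: ltW.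
  exact: disc_mod_sub.
have h0 : cmod (f 0 - g 0) `^ p <= 2 `^ p * (cmod (f 0) `^ p + cmod (g 0) `^ p).
  apply: le_trans (powR_add_le p0 (cmod_ge0 _) (cmod_ge0 _)).
  by apply: ge0_ler_powR; rewrite ?nnegrE ?addr_ge0 ?cmod_ge0 ?cmodB// ltW.
have a0 : (0 <= \int[@area R]_z dp_density p w f z)%E.
  by apply: integral_ge0 => v _; exact: dp_density_ge0.
have b0 : (0 <= \int[@area R]_z dp_density p w g z)%E.
  by apply: integral_ge0 => v _; exact: dp_density_ge0.
move=> ha hb.
exact: (combine_le q0 P0 (powR_ge0 (cmod (f 0)) p) (powR_ge0 (cmod (g 0)) p) a0 b0 h0 hh ha hb).
Qed.

(** Write f(z) as f(0) plus an integral of f' along the ray and use |f'| <= 1 + |f'|^p. On [0, s]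
    the tail hat w is at least hat w(s) > 0, so [radial_bound] controls the second summand. *)
Lemma local_bound (s : R) : 0 < s < 1 -> exists M : R, forall f : C -> C, holo f ->
  (Dnorm_p p w f <= 1)%E -> forall z, cmod z <= s -> cmod (f z) <= M.
Proof.
move=> /andP[s0 s1]; have p0 : 0 < p by exact: lt_trans p1.
have [K [K0 rad]] := radial_bound p1 rw.
pose ws := fine (omega_hat w s).
have wsE : (omega_hat w s = ws%:E)%E.
  rewrite fineK// ge0_fin_numE ?(omega_hat_fin rw (ltW s0))//.
  by case: rw => _ _ H; apply/ltW/H; rewrite (ltW s0).
have ws0 : 0 < ws by rewrite -lte_fin -wsE; case: rw => _ _; apply; rewrite (ltW s0).
exists (1 + 2 * (1 + K / ws)) => f hf fD z zs.
have [eta [e1 zE]] := polar_form z.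
pose r := cmod z; have r0 : 0 <= r by exact: cmod_ge0.
have rs : r <= s by []; have r1 : r < 1 by exact: le_lt_trans s1.
have e1' : cmod eta <= 1 by rewrite e1.
have hr : 0 <= r < 1 by rewrite r0.
pose psi t := derive1 f (cofr t * eta) * eta.
have cpsi : ccont 0 r psi.
  exact: (ccontM (ccont_ray_derive hf e1' r1) (ccont_cst 0 r eta)).
have FE : f z = f 0 + cseg 0 r psi by rewrite (holo_FTC hf e1' hr) zE addrC subrK.
rewrite FE; apply: le_trans (cmodD _ _) _; apply: lerD.
  by have := value0_root hf fD; rewrite powR1.
rewrite -lee_fin; apply: le_trans (cseg_le_int cpsi) _.
rewrite [leRHS]EFinM; apply: lee_wpmul2l => //.
pose phi t := disc_mod (derive1 f) (rot (complex.Re eta) (complex.Im eta) (t, 0)).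
have mphi : measurable_fun [set: R] phi.
  apply: (measurableT_comp (measurable_disc_mod (holo_derive1 hf))).
  apply: (measurableT_comp (measurable_rot _ _)).
  by apply: measurable_fun_pair => //; exact: measurable_cst.
have phiE t : I01 t -> phi t = cmod (derive1 f (cofr t * eta)).
  rewrite /= in_itv/= => /andP[t0 t1]; rewrite /phi disc_mod_pt pt_rot.
  have -> : pt (t, 0) = cofr t by [].
  by rewrite [cofr t * eta]mulrC cmodM e1 mul1r cmod_pos// t1.
have phi0 t : 0 <= phi t by rewrite /phi disc_mod_pt; case: ifP => // _; exact: cmod_ge0.
have mphip : measurable_fun [set: R] (fun t => phi t `^ p).
  exact: (measurableT_comp (measurable_powR p)).
have mD : measurable (`[0, r]%classic : set R) by exact: measurable_itv.
have sub t : (`[0, r]%classic : set R) t -> I01 t.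
  by rewrite /= !in_itv/= => /andP[-> tr]; exact: le_lt_trans r1.
apply: (@le_trans _ _ (\int[mu]_(t in `[0%R, r]) (1 + phi t `^ p)%:E)%E).
  apply: ge0_le_integral_nomeas => t ht; first by rewrite lee_fin cmod_ge0.
  rewrite lee_fin /psi cmodM e1 mulr1 -phiE; last exact: sub.
  have [h|h] := leP (phi t) 1; first by rewrite ler_wpDr ?powR_ge0.
  rewrite ler_wpDl//; apply: (@le_trans _ _ (phi t `^ 1)); first by rewrite powRr1.
  by apply: ler_powR; [exact: ltW|exact: ltW].
under eq_integral do rewrite EFinD.
rewrite (@ge0_integralD _ _ _ mu `[0, r] mD (cst 1%:E) (fun t => (phi t `^ p)%:E)); last 4 first.
- by move=> t _; rewrite lee_fin.
- exact: measurable_cst.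
- by move=> t _; rewrite lee_fin powR_ge0.
- by apply/measurable_EFinP; exact: measurable_funTS.
rewrite EFinD; apply: leeD.
  rewrite (@integral_cst _ (measurableTypeR R) R mu `[0, r])//.
  rewrite -[X in (_ * X)%E]/(mu `[0, r]) mul1e.
  rewrite (@lebesgue_measure_itv R `[0, r])/=; case: ifP => _; last by rewrite lee_fin.
  by rewrite sube0 lee_fin ltW.
rewrite mulrC EFinM lee_pdivlMl//.
rewrite (mule_integral mD (measurable_funTS mphip) (fun t _ => powR_ge0 (phi t) p) (ltW ws0)).
apply: (@le_trans _ _ (K%:E * Dnorm_p p w f)%E); last first.
  by rewrite -[leRHS]mule1; apply: lee_wpmul2l => //; rewrite lee_fin ltW.
apply: le_trans (rad f eta hf e1).
apply: (@le_trans _ _ (\int[mu]_(t in `[0%R, r]) ((cmod (derive1 f (cofr t * eta)) `^ p)%:E * omega_hat w t))%E).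
  apply: ge0_le_integral_nomeas => t ht; first by rewrite lee_fin mulr_ge0 ?powR_ge0// ltW.
  rewrite phiE; last exact: sub.
  rewrite mulrC EFinM; apply: lee_wpmul2l; first by rewrite lee_fin powR_ge0.
  rewrite -wsE; move: ht; rewrite /= in_itv/= => /andP[t0 tr].
  by apply: omega_hat_mono => //; exact: le_trans rs.
apply: ge0_integral_le_subset => // t ht; apply: mule_ge0; first by rewrite lee_fin powR_ge0.
by case: rw => _ _ H; apply/ltW/H; move: ht; rewrite /= in_itv.
Qed.

Lemma TgB (g f1 f2 : C -> C) z : holo g -> holo f1 -> holo f2 -> cmod z < 1 ->
  Tg g (fun z => f1 z - f2 z) z = Tg g f1 z - Tg g f2 z.
Proof.
move=> hg h1 h2 z1; have [eta [e1 ->]] := polar_form z.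
have e1' : cmod eta <= 1 by rewrite e1.
have hr : 0 <= cmod z < 1 by rewrite cmod_ge0.
rewrite -(Tg_FTC hg (holoB h1 h2) e1' hr) -(Tg_FTC hg h1 e1' hr) -(Tg_FTC hg h2 e1' hr).
have cg : ccont 0 (cmod z) (fun t => derive1 g (cofr t * eta)) by exact: ccont_ray_derive hg e1' z1.
have ce : ccont 0 (cmod z) (fun=> eta) by exact: ccont_cst.
have c1 := ccontM (ccontM (ccont_ray h1 e1' z1) cg) ce.
have c2 := ccontM (ccontM (ccont_ray h2 e1' z1) cg) ce.
rewrite -(csegB c1 c2); apply: eq_cseg => t _.
by move: (f1 _) (f2 _) (derive1 g _) => x y u; ring.
Qed.

(** Continuity of f -> T_g f(z) at a fixed point z, with G depending on z. It only identifies a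
    limit; uniformity comes from [Tg_uniform_cauchy]. *)
Lemma Tg_small (g : C -> C) z : holo g -> cmod z < 1 -> exists G : R, 0 < G /\
  forall (f : C -> C) (e : R), holo f -> (forall y, cmod y <= cmod z -> cmod (f y) <= e) ->
  cmod (Tg g f z) <= e * G.
Proof.
move=> hg z1; have [eta [e1 zE]] := polar_form z.
have e1' : cmod eta <= 1 by rewrite e1.
have z0 := cmod_ge0 z; have hr : 0 <= cmod z < 1 by rewrite z0.
have cg : ccont 0 (cmod z) (fun t => derive1 g (cofr t * eta)) by exact: ccont_ray_derive hg e1' z1.
have [G HG] := ccont_bounded z0 cg.
exists (2 * (`|G| + 1)); split; first by rewrite mulr_gt0// ltr_wpDl.
move=> f e hf he.
have e0 : 0 <= e by apply: le_trans (cmod_ge0 _) (he z (lexx _)).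
rewrite zE -(Tg_FTC hg hf e1' hr).
have c1 := ccontM (ccontM (ccont_ray hf e1' z1) cg) (ccont_cst 0 (cmod z) eta).
apply: le_trans (@cseg_le _ 0 (cmod z) (e * (`|G| + 1)) _ z0 c1 _) _; last first.
  rewrite subr0 [leRHS]mulrCA; apply: ler_piMr; last exact: ltW.
  by rewrite !mulr_ge0// addr_ge0.
move=> t /andP[t0 tz]; rewrite cmodM e1 mulr1 cmodM.
have yz : cmod (cofr t * eta) <= cmod z by rewrite cmod_ray// e1 mulr1.
apply: ler_pM; rewrite ?cmod_ge0 ?he//.
by apply: le_trans (HG t _) _; rewrite ?t0// ler_wpDr// ler_norm.
Qed.

End sufficiency.

(** * Boundedness and compactness from the finite series *)

Section equivalence.
Context {R : realType}.
Local Notation C := (CC R).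
Variables (p : R) (p1 : 1 < p) (w : R -> R) (rw : radial_weight w).
Local Notation p' := (p / (p - 1)).
Local Notation mo k := (fine (moment w k)).

Variables (A : R) (A0 : 0 < A).
Hypothesis upper : forall (g f : C -> C) (J : nat -> R) (K : nat) (S T D : R),
  holo g -> (forall n, 0 <= coef g n) -> holo f ->
  (forall k N, \sum_(n < N) n.+1%:R * complex.Re (coef g n.+1) / (n + k + 1)%:R <= J k) ->
  (forall N, \sum_(K <= k < N) Sg_term p w J k <= T) ->
  (forall z, cmod z <= node K -> cmod (derive1 f z) <= S) ->
  (Dnorm_p p w f <= D%:E)%E ->
  forall z, cmod z < 1 ->
    cmod (Tg g f z) <= 2 * J 0%N * (cmod (f 0) + 2 * S * node K) + A * T `^ p'^-1 * D `^ p^-1.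

(** The first summand pays for the contribution of f(0): the term k = 0 of the series alone bounds
    the inner sum of index 0. *)
Definition upper_const : R := 2 * (mo 0 `^ (p' - 1)) `^ p'^-1 + A.

Lemma upper_const_gt0 : 0 < upper_const.
Proof. by rewrite /upper_const ltr_wpDl// mulr_ge0// powR_ge0. Qed.

Section symbol.
Variables (g : C -> C) (hg : holo g) (g0 : forall n, 0 <= coef g n).
Variables (I : nat -> R) (T : R).
Hypothesis gI : forall k m, psum_inner g m k <= I k.
Hypothesis IT : forall N, \sum_(0 <= k < N) Sg_term p w I k <= T.

Lemma inner_bound_ge0 k : 0 <= I k.
Proof. by apply: le_trans (gI k 0%N); exact: psum_inner_ge0. Qed.

Lemma Sg_bound_ge0 : 0 <= T.
Proof. by have := IT 0%N; rewrite big_geq. Qed.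

Lemma inner_bound0_le : I 0%N <= (mo 0 `^ (p' - 1)) `^ p'^-1 * T `^ p'^-1.
Proof.
have p'0 : 0 < p' by apply: lt_trans (conj_gt1 p1).
have T0 := Sg_bound_ge0; have I0 := inner_bound_ge0 0.
have m0 : 0 < mo 0 `^ (p' - 1) by rewrite powR_gt0// fine_moment_gt0.
have h : I 0%N `^ p' <= mo 0 `^ (p' - 1) * T.
  have := IT 1; rewrite big_nat1 /Sg_term expr1n invr1 mul1r => h.
  by rewrite -ler_pdivrMl.
rewrite -powRM//; last exact: ltW.
have -> : I 0%N = (I 0%N `^ p') `^ p'^-1 by rewrite -powRrM mulfV ?gt_eqF// powRr1.
apply: ge0_ler_powR => //; rewrite ?nnegrE ?powR_ge0//; first by rewrite invr_ge0 ltW.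
by rewrite mulr_ge0// ltW.
Qed.

Lemma Tg_le (f : C -> C) (D : R) : holo f -> (Dnorm_p p w f <= D%:E)%E ->
  forall z, cmod z < 1 -> cmod (Tg g f z) <= upper_const * T `^ p'^-1 * D `^ p^-1.
Proof.
move=> hf hD z z1.
(* [node 0] is 0, so the bound on f' concerns the origin only and its contribution is multiplied by
   0. *)
have S0 y : cmod y <= node 0 -> cmod (derive1 f y) <= cmod (derive1 f 0).
  rewrite node0 => y0; have : cmod y == 0 by rewrite eq_le y0 cmod_ge0.
  by rewrite cmod_eq0 => /eqP ->.
apply: le_trans (upper hg g0 hf gI IT S0 hD z1) _.
rewrite node0 mulr0 addr0.
have -> : upper_const * T `^ p'^-1 * D `^ p^-1 =
    2 * ((mo 0 `^ (p' - 1)) `^ p'^-1 * T `^ p'^-1) * D `^ p^-1 + A * T `^ p'^-1 * D `^ p^-1.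
  by rewrite /upper_const; ring.
rewrite lerD2r; apply: ler_pM.
- by rewrite mulr_ge0// inner_bound_ge0.
- exact: cmod_ge0.
- by apply: ler_wpM2l => //; exact: inner_bound0_le.
- exact: (value0_root p1 rw hf hD).
Qed.

(** The upper bound is applied to differences. K is fixed first, making the tail of the series
    small; then m and n are taken large for the value at 0 and the derivative on the disc of radius
    node K. *)
Lemma Tg_uniform_cauchy (v : nat -> C -> C) (f : C -> C) : (forall n, holo (v n)) -> holo f ->
  (forall n, (Dnorm_p p w (v n) <= 1)%E) ->
  (forall rho e, 0 <= rho < 1 -> 0 < e -> exists N, forall n, (N <= n)%N -> forall z, cmod z <= rho ->
    cmod (v n z - f z) <= e /\ cmod (derive1 (v n) z - derive1 f z) <= e) ->
  forall e, 0 < e -> exists N, forall m n, (N <= m)%N -> (N <= n)%N ->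
    forall z, cmod z < 1 -> cmod (Tg g (v m) z - Tg g (v n) z) <= e.
Proof.
move=> hv hf vD vf e e0; have p0 : 0 < p by exact: lt_trans p1.
have p'0 : 0 < p' by apply: lt_trans (conj_gt1 p1).
have I0 := inner_bound_ge0 0.
pose D : R := 2 `^ p * 2; have D0 : 0 < D `^ p^-1 by rewrite powR_gt0// mulr_gt0// powR_gt0.
(* The tail is required to be at most x^p', so that its contribution A x D^(1/p) is exactly e /
   2. *)
pose x := e / 2 / (A * D `^ p^-1); have x0 : 0 < x by rewrite !divr_gt0// mulr_gt0.
have [K HK] := tail_small (fun k => Sg_term_ge0 p w I k) IT (powR_gt0 p' x0).
(* The compact part is at most 2 I_0 (2 d + 4 d) = 12 I_0 d, which is below e / 2; the 1 added to
   I_0 avoids a zero denominator. *)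
pose d := e / (24 * (I 0%N + 1)).
have d0 : 0 < d by rewrite divr_gt0// mulr_gt0// ltr_wpDl.
have hK : 0 <= (node K : R) < 1 by rewrite node_ge0 node_lt1.
have [N HN] := vf _ _ hK d0; exists N => m n mN nN z z1.
rewrite -(TgB hg (hv m) (hv n) z1); set F := fun z => v m z - v n z.
have hF : holo F by exact: (holoB (hv m) (hv n)).
have FD : (Dnorm_p p w F <= D%:E)%E by exact: (Dnorm_p_sub p1 rw (hv m) (hv n) (vD m) (vD n)).
have c0 : cmod (0 : C) <= node K by rewrite cmod0 node_ge0.
have F0 : cmod (F 0) <= 2 * d.
  have -> : F 0 = (v m 0 - f 0) - (v n 0 - f 0) by rewrite /F opprB addrA subrK.
  apply: le_trans (cmodB _ _) _; rewrite mulr_natl mulr2n.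
  by apply: lerD; [have [] := HN m mN 0 c0|have [] := HN n nN 0 c0].
have F' y : cmod y <= node K -> cmod (derive1 F y) <= 2 * d.
  move=> yK; have y1 : cmod y < 1 by apply: le_lt_trans yK _; exact: node_lt1.
  have -> : derive1 F y = (derive1 (v m) y - derive1 f y) - (derive1 (v n) y - derive1 f y).
    have -> : derive1 F y = derive1 (v m) y - derive1 (v n) y by exact: (derive1_holoB (hv m) (hv n) y1).
    by move: (derive1 _ _) (derive1 _ _) (derive1 _ _) => a b c; ring.
  apply: le_trans (cmodB _ _) _; rewrite mulr_natl mulr2n.
  by apply: lerD; [have [] := HN m mN y yK|have [] := HN n nN y yK].
apply: le_trans (upper hg g0 hF gI HK F' FD z1) _; rewrite [leRHS]splitr; apply: lerD.
  have k1 : node K <= 1 :> R by apply: ltW; exact: node_lt1.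
  apply: (@le_trans _ _ (2 * I 0%N * (2 * d + 2 * (2 * d) * 1))).
    apply: ler_wpM2l; first by rewrite mulr_ge0.
    apply: lerD; first exact: F0.
    apply: ler_wpM2l; last exact: k1.
    by apply: mulr_ge0 => //; apply: mulr_ge0 => //; exact: (ltW d0).
  have -> : 2 * I 0%N * (2 * d + 2 * (2 * d) * 1) = e / 2 * (I 0%N / (I 0%N + 1)).
    by rewrite /d; field; rewrite gt_eqF// ltr_wpDl.
  apply: ler_piMr; first by rewrite divr_ge0// ltW.
  by rewrite ler_pdivrMr ?ltr_wpDl// mul1r lerDl.
rewrite -powRrM mulfV ?gt_eqF// powRr1; last exact: ltW.
rewrite /x le_eqVlt; apply/orP; left; apply/eqP; field.
by rewrite !gt_eqF.
Qed.

(** The coefficient limits define f, and T_g f is the limit function. The norm of f is never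
    estimated: the images are uniformly Cauchy and converge pointwise to T_g f, which is enough. *)
Lemma compact_extraction (u : nat -> C -> C) : (forall n, holo (u n)) ->
  (forall n, (Dnorm_p p w (u n) <= 1)%E) ->
  exists (phi : nat -> nat) (h : C -> C),
    [/\ (forall n, (phi n < phi n.+1)%N), Hinf h &
     (fun n => supnorm (fun z => Tg g (u (phi n)) z - h z)) @ \oo --> 0%E].
Proof.
move=> hu uD.
have cb s : 0 < s < 1 -> exists M, forall n, cbound (coef (u n)) s M.
  move=> hs; have [M HM] := local_bound p1 rw hs; exists (4 * M) => n.
  have hz z : cmod z = s -> cmod (u n z) <= M.
    by move=> zs; apply: (HM _ (hu n) (uD n)); rewrite zs.
  exact: (cauchy_estimate (hu n) hs hz).
(* Any fixed radius would do here; it only supplies a bound for each coefficient before the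
   extraction. *)
have h12 : 0 < (2^-1 : R) < 1 by apply/andP; split; lra.
have [M0 HM0] := cb _ h12.
have cB n k : cmod (coef (u n) k) <= M0 / 2^-1 ^+ k.
  by rewrite ler_pdivlMr ?exprn_gt0//; exact: HM0.
have [phi [l [phi_lt phil]]] := diagonal_extraction cB.
have inv_small (e : R) : 0 < e -> exists N, forall n, (N <= n)%N -> n.+1%:R^-1 <= e.
  move=> e0; exists (Num.trunc e^-1) => n nN.
  rewrite invf_ple ?posrE//; apply: ltW; apply: lt_le_trans (truncnS_gt e^-1) _.
  by rewrite ler_nat.
have lM s M : 0 < s < 1 -> (forall n, cbound (coef (u n)) s M) -> cbound l s M.
  move=> /andP[s0 s1] HM k; apply/ler_addgt0Pr => e e0.
  have [N HN] := inv_small e e0; pose n := maxn N k.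
  have h := phil n k (leq_maxr N k).
  have h2 := le_trans h (HN n (leq_maxl N k)).
  have -> : l k = coef (u (phi n)) k - (coef (u (phi n)) k - l k) by rewrite subKr.
  apply: le_trans (ler_wpM2r (exprn_ge0 _ (ltW s0)) (cmodB _ _)) _.
  rewrite mulrDl; apply: lerD; first exact: HM.
  by apply: le_trans h2; rewrite ler_piMr ?cmod_ge0// exprn_ile1 ?(ltW s0) ?(ltW s1).
have pl : pbound l 1 by move=> s hs; have [M HM] := cb s hs; exists M; exact: lM.
pose f := psum l; have hf : holo f by exact: psum_holo pl _.
have fl : coef f = l by exact: (coef_psum ltr01 pl).
pose v n := u (phi n).
have vf rho e : 0 <= rho < 1 -> 0 < e -> exists N, forall n, (N <= n)%N -> forall z, cmod z <= rho ->
    cmod (v n z - f z) <= e /\ cmod (derive1 (v n) z - derive1 f z) <= e.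
  move=> hrho e0.
  have c1 s : 0 < s < 1 -> exists M, cbound (coef f) s M /\ forall n, cbound (coef (v n)) s M.
    move=> hs; have [M HM] := cb s hs; exists M; split; last by move=> n; exact: (HM (phi n)).
    by rewrite fl; exact: (lM s M hs HM).
  have c2 k d : 0 < d -> exists N, forall n, (N <= n)%N -> cmod (coef (v n) k - coef f k) <= d.
    move=> d0; have [N HN] := inv_small d d0; exists (maxn N k) => n; rewrite geq_max => /andP[nN nk].
    by rewrite fl; exact: (le_trans (phil n k nk) (HN n nN)).
  exact: (holo_coef_cvg hf (fun n => hu (phi n)) c1 c2 hrho e0).
have hv n : holo (v n) by exact: hu.
have cau := Tg_uniform_cauchy hv hf (fun n => uD (phi n)) vf.
have pointwise z e : cmod z < 1 -> 0 < e -> exists N, forall n, (N <= n)%N -> cmod (Tg g (v n) z - Tg g f z) <= e.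
  move=> z1 e0.
  have [G [G0 HG]] := Tg_small hg z1.
  have d0 : 0 < e / G by rewrite divr_gt0.
  have hz : 0 <= cmod z < 1 by rewrite cmod_ge0.
  have [N HN] := vf _ _ hz d0; exists N => n nN.
  rewrite -(TgB hg (hv n) hf z1).
  apply: le_trans (HG _ _ (holoB (hv n) hf) (fun y yz => proj1 (HN n nN y yz))) _.
  by rewrite divfK ?gt_eqF.
have unif e : 0 < e -> exists N, forall n, (N <= n)%N -> forall z, cmod z < 1 -> cmod (Tg g (v n) z - Tg g f z) <= e.
  move=> e0; have e2 : 0 < e / 2 by rewrite divr_gt0.
  have [N HN] := cau _ e2; exists N => n nN z z1.
  have [N' HN'] := pointwise z _ z1 e2; pose m := maxn N N'.
  have -> : Tg g (v n) z - Tg g f z = (Tg g (v n) z - Tg g (v m) z) + (Tg g (v m) z - Tg g f z).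
    by rewrite addrA subrK.
  apply: le_trans (cmodD _ _) _; rewrite [leRHS]splitr; apply: lerD.
    by apply: HN; rewrite // leq_maxl.
  by apply: HN'; rewrite leq_maxr.
exists phi, (Tg g f); split; first exact: phi_lt.
  split; first exact: (holo_Tg hg hf).
  have [N HN] := unif 1 ltr01.
  apply: (@le_lt_trans _ _ (upper_const * T `^ p'^-1 * 1 `^ p^-1 + 1)%:E); last exact: ltry.
  apply/supnorm_le => z z1.
  have -> : Tg g f z = Tg g (v N) z - (Tg g (v N) z - Tg g f z) by rewrite subKr.
  apply: le_trans (cmodB _ _) _; apply: lerD; last exact: HN.
  exact: (Tg_le (hv N) (uD (phi N)) z1).
apply: cvge0_of_le => [n|e e0].
  apply: (@le_trans _ _ (cmod (Tg g (u (phi n)) 0 - Tg g f 0))%:E); first by rewrite lee_fin cmod_ge0.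
  by apply: ereal_sup_ubound; exists 0 => //; rewrite /disc /= cmod0.
have [N HN] := unif e e0; exists N => n nN; apply/supnorm_le => z z1; exact: HN.
Qed.

End symbol.
End equivalence.

(** * Norms and uniform bounds *)

Section norms.
Context {R : realType}.
Local Notation C := (CC R).
Variables (p : R) (p1 : 1 < p) (w : R -> R) (rw : radial_weight w).
Local Notation p' := (p / (p - 1)).

Lemma Dnorm_fin (f : C -> C) : Dp p w f -> exists D : R,
  [/\ 0 <= D, Dnorm_p p w f = D%:E & Dnorm p w f = (D `^ p^-1)%:E].
Proof.
move=> [hf fD]; have D0 := Dnorm_p_ge0 p1 rw hf.
have E : (Dnorm_p p w f = (fine (Dnorm_p p w f))%:E)%E by rewrite fineK// ge0_fin_numE.
exists (fine (Dnorm_p p w f)); split => //; first exact: fine_ge0.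
by rewrite /Dnorm [in LHS]E poweR_EFin.
Qed.

Lemma Dnorm_le1 (f : C -> C) : Dp p w f -> (Dnorm p w f <= 1)%E <-> (Dnorm_p p w f <= 1)%E.
Proof.
have p0 : 0 < p by exact: lt_trans p1.
move=> /Dnorm_fin[D [D0 -> ->]]; rewrite !lee_fin; split => h.
  have := @ge0_ler_powR R p (ltW p0) _ _ _ _ h.
  by rewrite -powRrM mulVf ?gt_eqF// powRr1// powR1; apply; rewrite nnegrE ?powR_ge0.
have pi0 : 0 <= p^-1 by rewrite invr_ge0 ltW.
by have := @ge0_ler_powR R _ pi0 _ _ _ _ h; rewrite powR1; apply; rewrite nnegrE.
Qed.

Lemma Dp0 : Dp p w (fun=> 0) /\ (Dnorm p w (fun=> 0%R) <= 1)%E.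
Proof.
have p0 : 0 < p by exact: lt_trans p1.
have h0 : holo (fun=> 0 : C) by move=> z _; exact: derivable_cst.
have D0 : Dnorm_p p w (fun=> 0) = 0%E.
  rewrite Dnorm_p_density// cmod0 powR0 ?gt_eqF// adde0 integral0_eq ?mule0// => z _.
  rewrite /dp_density /disc_mod derive1_cst cmod0; case: ifP => _;
    by rewrite powR0 ?gt_eqF// mul0r.
have d0 : Dp p w (fun=> 0) by split; rewrite ?D0.
by split => //; apply/(Dnorm_le1 d0); rewrite D0.
Qed.

Lemma Tg_norm_ge0 (g : C -> C) : (0 <= Tg_norm p w g)%E.
Proof.
apply: (@le_trans _ _ (supnorm (Tg g (fun=> 0)))).
  apply: (@le_trans _ _ (cmod (Tg g (fun=> 0) 0))%:E); first by rewrite lee_fin cmod_ge0.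
  by apply: ereal_sup_ubound; exists 0 => //; rewrite /disc /= cmod0.
by apply: ereal_sup_ubound; exists (fun=> 0) => //; exact: Dp0.
Qed.

Lemma bounded_uniform (g : C -> C) : Tg_bounded p w g -> exists T : R, 0 <= T /\
  forall f, Dp p w f -> (Dnorm_p p w f <= 1)%E -> forall z, cmod z < 1 -> cmod (Tg g f z) <= T.
Proof.
move=> [_ [K HK]]; exists `|K|; split => // f df /(Dnorm_le1 df) f1; apply/supnorm_le.
apply: le_trans (HK f df) _; have [D [_ _ E]] := Dnorm_fin df; move: f1; rewrite E !lee_fin => f1.
apply: (@le_trans _ _ (`|K| * D `^ p^-1)); first by rewrite ler_wpM2r ?powR_ge0// ler_norm.
by rewrite ler_piMr.
Qed.

(** Otherwise the unit ball contains functions u_n whose images exceed n somewhere. Along a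
    convergent subsequence the images stay within 1 of a bounded function, a contradiction. *)
Lemma compact_uniform (g : C -> C) : Tg_compact p w g -> exists T : R, 0 <= T /\
  forall f, Dp p w f -> (Dnorm_p p w f <= 1)%E -> forall z, cmod z < 1 -> cmod (Tg g f z) <= T.
Proof.
move=> [_ cg]; apply: contrapT => nT.
have H (n : nat) : exists f : C -> C, (Dp p w f /\ (Dnorm p w f <= 1)%E) /\
    exists z, cmod z < 1 /\ n%:R < cmod (Tg g f z).
  apply: contrapT => nf; apply: nT; exists n%:R; split => // f df f1 z z1.
  rewrite leNgt; apply/negP => h; apply: nf; exists f; split; last by exists z.
  by split => //; apply/(Dnorm_le1 df).
have [u Hu] := choice H.
have [phi [h [phi_lt [[hh hfin] cv]]]] := cg u (fun n => (Hu n).1).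
have phi_ge n : (n <= phi n)%N by elim: n => // n IH; exact: leq_ltn_trans (phi_lt n).
have h0 : (0 <= supnorm h)%E.
  apply: (@le_trans _ _ (cmod (h 0))%:E); first by rewrite lee_fin cmod_ge0.
  by apply: ereal_sup_ubound; exists 0 => //; rewrite /disc /= cmod0.
have hE : (supnorm h <= (fine (supnorm h))%:E)%E by rewrite fineK// ge0_fin_numE.
have /fine_cvgP[[N1 _ fin] /cvgrPdist_lt/(_ 1 ltr01)[N2 _ HN]] := cv.
set b := fine (supnorm h) in hE.
pose n := maxn (maxn N1 N2) (Num.trunc (b + 1)).+1.
have n1 : (N1 <= n)%N by rewrite /n !leq_max leqnn.
have n2 : (N2 <= n)%N by rewrite /n !leq_max leqnn orbT.
have n3 : b + 1 < n%:R by apply: lt_le_trans (truncnS_gt _) _; rewrite ler_nat /n leq_maxr.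
have [z [z1 hz]] := (Hu (phi n)).2.
have e1 : cmod (Tg g (u (phi n)) z - h z) <= 1.
  have F := fin n n1; have := HN n n2; rewrite /= sub0r normrN => /ltW h1.
  have h2 : (supnorm (fun z => Tg g (u (phi n)) z - h z)%R <= 1%:E)%E.
    by rewrite -(fineK F) lee_fin; apply: le_trans h1; exact: ler_norm.
  by move/supnorm_le: h2; apply.
have e2 : cmod (h z) <= b by move/supnorm_le: hE; apply.
have : cmod (Tg g (u (phi n)) z) <= b + 1.
  have -> : Tg g (u (phi n)) z = h z + (Tg g (u (phi n)) z - h z) by rewrite addrC subrK.
  by apply: le_trans (cmodD _ _) _; exact: lerD.
move=> h3; have : n%:R <= (phi n)%:R :> R by rewrite ler_nat.
by move: n3 h3 hz; move: (n%:R : R) ((phi n)%:R : R) (cmod _) => x y t; lra.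
Qed.

End norms.

Theorem mainTheorem8 (R : realType) (p : R) (w : R -> R) :
  1 < p -> radial_weight w -> Dhat w ->
  (forall g : CC R -> CC R, Hinf g -> (forall n, 0 <= coef g n) ->
     (Tg_bounded p w g <-> Tg_compact p w g) /\
     (Tg_bounded p w g <-> (Sg p w g < +oo)%E)) /\
  (exists K : R, 0 < K /\
     forall g : CC R -> CC R, Hinf g -> (forall n, 0 <= coef g n) ->
       (Tg_norm p w g `^ (p / (p - 1)) <= K%:E * Sg p w g)%E /\
       (Sg p w g <= K%:E * Tg_norm p w g `^ (p / (p - 1)))%E).
Proof.
move=> p1 rw dw; have p0 : 0 < p by exact: lt_trans p1.
have p'0 : 0 < p / (p - 1) by exact: (lt_trans ltr01 (conj_gt1 p1)).
have pinv0 : 0 <= (p / (p - 1))^-1 by rewrite invr_ge0 ltW.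
have [M [Cw [_ Cw0 _ hC]]] := weight_facts rw dw.
have [A [A0 upper]] := Tg_upper p1 rw Cw0 hC.
have [B [B0 lower]] := truncated_lower p1 rw dw.
pose c := upper_const p w A; have c0 : 0 < c by exact: upper_const_gt0.
have Sg_of_uniform (g : CC R -> CC R) (T : R) : holo g -> (forall n, 0 <= coef g n) -> 0 <= T ->
    (forall f, Dp p w f -> (Dnorm_p p w f <= 1)%E -> forall z, cmod z < 1 -> cmod (Tg g f z) <= T) ->
    (Sg p w g <= (B * T `^ (p / (p - 1)))%:E)%E.
  by move=> hg g0 T0 hT; apply: (Sg_le p1 rw g0); exact: (lower g T hg g0 T0 hT).
split=> [g [hg _] g0|].
  have toS : (exists T : R, 0 <= T /\ forall f, Dp p w f -> (Dnorm_p p w f <= 1)%E ->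
      forall z, cmod z < 1 -> cmod (Tg g f z) <= T) -> (Sg p w g < +oo)%E.
    by move=> [T [T0 hT]]; apply: le_lt_trans (Sg_of_uniform g T hg g0 T0 hT) _; exact: ltry.
  have ofS : (Sg p w g < +oo)%E -> Tg_bounded p w g /\ Tg_compact p w g.
    move=> /(Sg_fin p1 rw g0)[I [T [gI _ T0 IT]]].
    have bd f : Dp p w f -> (supnorm (Tg g f) <= (c * T `^ (p / (p - 1))^-1)%:E * Dnorm p w f)%E.
      move=> df; have [D [D0 DE ->]] := Dnorm_fin p1 rw df.
      rewrite -EFinM; apply/supnorm_le => z z1.
      have hD : (Dnorm_p p w f <= D%:E)%E by rewrite DE.
      exact: (Tg_le p1 rw upper hg g0 gI IT (proj1 df) hD z1).
    have hinf f : Dp p w f -> Hinf (Tg g f).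
      move=> df; split; first exact: (holo_Tg hg (proj1 df)).
      apply: le_lt_trans (bd f df) _; have [D [_ _ ->]] := Dnorm_fin p1 rw df.
      by rewrite -EFinM; exact: ltry.
    split; first by split => //; exists (c * T `^ (p / (p - 1))^-1).
    split => // u hu.
    have uD n : (Dnorm_p p w (u n) <= 1)%E by case: (hu n) => du; move/(Dnorm_le1 p1 rw du).
    have [phi [h [h1 h2 h3]]] := compact_extraction p1 rw A0 upper hg g0 gI IT (fun n => proj1 (proj1 (hu n))) uD.
    by exists phi, h.
  split; split.
  - by move=> /(bounded_uniform p1 rw)/toS/ofS[].
  - by move=> /(compact_uniform p1 rw)/toS/ofS[].
  - by move=> /(bounded_uniform p1 rw)/toS.
  - by move=> /ofS[].
(* One constant for both inequalities: the first summand serves the upper bound for the norm, B the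
   lower one. It is positive, so each inequality is trivial when its right side is infinite. *)
exists (c `^ (p / (p - 1)) + B); split; first by rewrite addr_gt0// powR_gt0.
have K0 : 0 < c `^ (p / (p - 1)) + B by rewrite addr_gt0// powR_gt0.
move=> g [hg _] g0; have N0 := Tg_norm_ge0 p1 rw g.
split.
  have [fS|iS] := boolP (Sg p w g < +oo)%E; last first.
    have -> : Sg p w g = +oo%E by apply/eqP; rewrite -leye_eq leNgt.
    by rewrite gt0_muley ?lte_fin// leey.
  have [I [T [gI ST T0 IT]]] := Sg_fin p1 rw g0 fS.
  have nT : (Tg_norm p w g <= (c * T `^ (p / (p - 1))^-1)%:E)%E.
    apply: ge_ereal_sup => _ [f [df /(Dnorm_le1 p1 rw df) f1] <-].
    apply/supnorm_le => z z1; have := Tg_le p1 rw upper hg g0 gI IT (proj1 df) f1 z1.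
    by rewrite powR1 mulr1.
  apply: le_trans (poweR_le (ltW p'0) N0 nT) _.
  rewrite poweR_EFin ST -EFinM lee_fin powRM ?powR_ge0 ?(ltW c0)//.
  rewrite -powRrM mulVf ?gt_eqF// powRr1//.
  by rewrite ler_wpM2r// lerDl ltW.
have [fN|iN] := boolP (Tg_norm p w g < +oo)%E; last first.
  have -> : Tg_norm p w g = +oo%E by apply/eqP; rewrite -leye_eq leNgt.
  by rewrite poweRyr ?gt_eqF// gt0_muley ?lte_fin// leey.
have NE : (Tg_norm p w g = (fine (Tg_norm p w g))%:E)%E by rewrite fineK// ge0_fin_numE.
have T0 : 0 <= fine (Tg_norm p w g) by exact: fine_ge0.
apply: le_trans (Sg_of_uniform g _ hg g0 T0 _) _; last first.
  rewrite [in leRHS]NE poweR_EFin -EFinM lee_fin ler_wpM2r ?powR_ge0// lerDr.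
  exact: powR_ge0.
move=> f df f1; apply/supnorm_le; rewrite -NE; apply: ereal_sup_ubound.
by exists f => //; split => //; apply/(Dnorm_le1 p1 rw df).
Qed.
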